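(* Let $T>0$ and let $K\subset H^{-1}(\mathcal{O}_1)\times H^{-1}(\mathcal{O}_2)$ be a closed set such that $\hat{\mathbb{K}}_{t,s}=\mathbb{K}_s$ for all $0\le t\le s\le T$ (notation of the context). Under the assumptions on $\mathcal{O}_i,b_i,\beta_i,f_i,U$ listed in the context, the following are equivalent: (a) $K$ is nearly viable on $[0,T]$ with respect to the random-deterministic control system (S) of the context, i.e. for every $t\in[0,T)$ and every $(\xi,\eta)\in\mathbb{K}_t$, $$\inf_{u\in\mathcal{U}}\ \sup_{s\in[t,T]} d\big((x^{t,\xi,\eta,u}(s),y^{t,\xi,\eta,u}(s)),\mathbb{K}_s\big)=0;$$ (b) $K$ satisfies the quasi-tangency condition for every $t\in[0,T)$ and every $(\xi,\eta)\in\mathbb{K}_t$, i.e. for all such $t,\xi,\eta$, $$\liminf_{\varepsilon\to0+}\ \inf\Big\{\frac1{\varepsilon^2}\mathbb{E}\Big[\|\hat x^{t,\xi,\eta,u}(t+\varepsilon)-\theta_1\|_{H^{-1}(\mathcal{O}_1)}^2+\|\hat y^{t,\xi,\eta,u}(t+\varepsilon)-\theta_2\|_{H^{-1}(\mathcal{O}_2)}^2\Big]:\ u\in\mathcal{U},\ (\theta_1,\theta_2)\in\mathbb{K}_{t+\varepsilon}\Big\}=0 .$$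
   Context: Setting, for $i\in\{1,2\}$. $\mathcal{O}_i\subset\mathbb{R}^d$, $d\ge2$, is a bounded open domain with smooth boundary. $-\Delta$ denotes the Dirichlet Laplacian. $H^1_0(\mathcal{O}_i)$ has norm $\|\phi\|_{H^1_0(\mathcal{O}_i)}=\|(-\Delta)^{1/2}\phi\|_{L^2(\mathcal{O}_i)}$; $H^{-1}(\mathcal{O}_i)$ is its dual with pivot space $L^2(\mathcal{O}_i)$ and scalar product $\langle\phi,\psi\rangle_{H^{-1}(\mathcal{O}_i)}=\langle(-\Delta)^{-1}\phi,\psi\rangle_{L^2(\mathcal{O}_i)}$. $W$ is a one-dimensional Brownian motion on a filtered probability space $(\Omega,\mathcal{F},\{\mathcal{F}_t\}_{t\ge0},\mathbb{P})$ satisfying the usual conditions. $U$ is a compact metric space and $\mathcal{U}$ is the set of progressively measurable $U$-valued processes. The coefficient field $b_i=(b_i^1,\dots,b_i^d)$ satisfies $b_i^j\in C^2(\overline{\mathcal{O}_i})$, $\operatorname{div}b_i=0$, and $b_i$ is tangent to $\partial\mathcal{O}_i$. Set $B_i\phi=b_i\cdot\nabla(-\Delta)^{-1}\phi$; $B_i\in\mathcal{L}(H^{-1}(\mathcal{O}_i);L^2(\mathcal{O}_i))$ is skew-symmetric in $H^{-1}(\mathcal{O}_i)$ and generates a $C_0$-group of contractions $\{e^{sB_i}\}_{s\in\mathbb{R}}$ on $H^{-1}(\mathcal{O}_i)$ leaving $L^2(\mathcal{O}_i)$ invariant. Set $\Gamma_i(t,s)=e^{[W(s)-W(t)]B_i}$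 for $s,t\ge 0$. Assumptions on the nonlinearities: (i) $\beta_i:\mathbb{R}\to\mathbb{R}$ is Lipschitz continuous; (ii) there is $\alpha_i>0$ with $(\beta_i(r)-\beta_i(s))(r-s)\ge\alpha_i(r-s)^2$ for all $r,s\in\mathbb{R}$; (iii) $f_i:H^{-1}(\mathcal{O}_1)\times H^{-1}(\mathcal{O}_2)\times U\to H^{-1}(\mathcal{O}_i)$ and there is $[f_i]_1>0$ such that $\|f_i(x,y,u)-f_i(x',y',u)\|_{H^{-1}(\mathcal{O}_i)}\le[f_i]_1(\|x-x'\|_{H^{-1}(\mathcal{O}_1)}+\|y-y'\|_{H^{-1}(\mathcal{O}_2)})$ for all $x,x',y,y',u$, and $\sup_{u\in U}\|f_i(0,0,u)\|_{H^{-1}(\mathcal{O}_i)}<\infty$; (iv) $f_i$ restricts to a map $L^2(\mathcal{O}_1)\times L^2(\mathcal{O}_2)\times U\to L^2(\mathcal{O}_i)$ with the same properties in the $L^2$ norms. System (S): given $t\ge0$, $(\xi,\eta)\in L^2(\Omega,\mathcal{F}_t,\mathbb{P};H^{-1}(\mathcal{O}_1)\times H^{-1}(\mathcal{O}_2))$ and $u\in\mathcal{U}$, the pair $(x,y)=(x^{t,\xi,\eta,u},y^{t,\xi,\eta,u})$ is the solution (in the usual $H^{-1}$ sense, $\omega$ by $\omega$) of $$\partial_sx(s)=\Gamma_1(s,t)\Delta\beta_1(\Gamma_1(t,s)x(s))+\Gamma_1(s,t)f_1(\Gamma_1(t,s)x(s),\Gamma_2(t,s)y(s),u(s)),$$ $$\partial_sy(s)=\Gamma_2(s,t)\Delta\beta_2(\Gamma_2(t,s)y(s))+\Gamma_2(s,t)f_2(\Gamma_1(t,s)x(s),\Gamma_2(t,s)y(s),u(s)),$$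 for $s>t$, with zero Dirichlet boundary conditions and $x(t)=\xi$, $y(t)=\eta$. Fundamental (Euler-type) scheme: $(\hat x,\hat y)=(\hat x^{t,\xi,\eta,u},\hat y^{t,\xi,\eta,u})$ is the solution of $$\partial_s\hat x(s)=\Gamma_1(s,t)\Delta\beta_1(\Gamma_1(t,s)\hat x(s))+f_1(\xi,\eta,u(s)),\qquad \partial_s\hat y(s)=\Gamma_2(s,t)\Delta\beta_2(\Gamma_2(t,s)\hat y(s))+f_2(\xi,\eta,u(s)),$$ for $s>t$, with zero Dirichlet boundary conditions and $\hat x(t)=\xi$, $\hat y(t)=\eta$. Notation: $\mathbb{K}_s:=L^2(\Omega,\mathcal{F}_s,\mathbb{P};K)$; $d$ is the distance in $L^2(\Omega,\mathcal{F},\mathbb{P};H^{-1}(\mathcal{O}_1)\times H^{-1}(\mathcal{O}_2))$; $\hat{\mathbb{K}}_{t,s}:=\{(\Gamma_1(s,t)\theta_1,\Gamma_2(s,t)\theta_2):(\theta_1,\theta_2)\in\mathbb{K}_s\}$. *)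

(* Defs.v *)
From HB Require Import structures.
From mathcomp Require Import all_boot all_order all_algebra.
From mathcomp Require Import all_classical all_reals all_analysis.
Set Implicit Arguments.
Unset Strict Implicit.
Unset Printing Implicit Defensive.

Import Order.TTheory GRing.Theory Num.Theory.
Import numFieldNormedType.Exports.

Local Open Scope classical_set_scope.
Local Open Scope ring_scope.

(* Lebesgue measure on R^n, as the iterated product of [lebesgue_measure] *)
Section lebesgue_tuple.
Context {R : realType}.
Local Notation mR := (measurableTypeR R).

Section step.
Variables (n : nat) (m : {sigma_finite_measure set (n.-tuple mR) -> \bar R}).

Definition tuple_cons (p : mR * n.-tuple mR) : n.+1.-tuple mR :=
  [tuple of p.1 :: p.2].

Lemma measurable_tuple_cons : measurable_fun setT tuple_cons.
Proof. exact: (measurable_cons measurable_fst measurable_snd). Qed.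

Definition lebesgue_step : set (n.+1.-tuple mR) -> \bar R :=
  pushforward (lebesgue_measure \x m)%E tuple_cons.

Let leb0 : lebesgue_step set0 = 0%E.
Proof. by rewrite /lebesgue_step /pushforward preimage_set0 measure0. Qed.

Let leb_ge0 A : (0 <= lebesgue_step A)%E.
Proof. by rewrite /lebesgue_step /pushforward; exact: measure_ge0. Qed.

Let leb_sigma_additive : semi_sigma_additive lebesgue_step.
Proof.
move=> F mF tF mUF; rewrite /lebesgue_step /pushforward preimage_bigcup.
apply: measure_semi_sigma_additive.
- by move=> n'; rewrite -[X in measurable X]setTI; exact: measurable_tuple_cons.
- apply/trivIsetP => /= i j _ _ ij; rewrite -preimage_setI.
  by move/trivIsetP : tF => /(_ _ _ _ _ ij) ->//; rewrite preimage_set0.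
- by rewrite -preimage_bigcup -[X in measurable X]setTI;
  exact: measurable_tuple_cons.
Qed.

HB.instance Definition _ := isMeasure.Build _ _ _ lebesgue_step
  leb0 leb_ge0 leb_sigma_additive.

Definition uncons (t : n.+1.-tuple mR) := (thead t, [tuple of behead t]).

Lemma measurable_uncons : measurable_fun setT uncons.
Proof.
apply/measurable_fun_pairP; split.
  exact: measurable_tnth.
exact: measurable_behead.
Qed.

Let leb_sigma_finite : sigma_finite setT lebesgue_step.
Proof.
have /sigma_finiteP[F [TF ndF Foo]] :=
  sigma_finiteT (lebesgue_measure : {sigma_finite_measure set mR -> \bar R}).
have /sigma_finiteP[G [TG ndG Goo]] := sigma_finiteT m.
exists (fun k => uncons @^-1` (F k `*` G k)).
  rewrite predeqE => t; split=> // _.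
  have : [set: mR] (uncons t).1 by [].
  have : [set: n.-tuple mR] (uncons t).2 by [].
  rewrite TF TG => -[i _ Gi] [j _ Fj]; exists (maxn i j) => //; split.
    by move: Fj; exact/subsetPset/ndF/leq_maxr.
  by move: Gi; exact/subsetPset/ndG/leq_maxl.
move=> k; have [mF Fk] := Foo k; have [mG Gk] := Goo k; split.
  rewrite -[X in measurable X]setTI; apply: measurable_uncons => //.
  exact: measurableX.
rewrite /lebesgue_step /pushforward -comp_preimage.
rewrite (_ : uncons \o tuple_cons = id); last first.
  apply/funext => -[x y]; rewrite /uncons /tuple_cons /= theadE; congr pair.
  exact: val_inj.
by rewrite product_measure1E// lte_mul_pinfty// ge0_fin_numE.
Qed.

HB.instance Definition _ := Measure_isSigmaFinite.Build _ _ _ lebesgue_step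
  leb_sigma_finite.

End step.

Fixpoint lebesgue_tuple n :
    {sigma_finite_measure set (n.-tuple mR) -> \bar R} :=
  if n is k.+1 then lebesgue_step (lebesgue_tuple k)
  else @dirac _ _ [tuple] R.
End lebesgue_tuple.

Section euclidean.
Context {R : realType} {d : nat}.
Local Notation Rd := 'rV[R]_d.
Implicit Types (O V : set Rd) (f g u v : Rd -> R).

Definition partial (j : 'I_d) f (x : Rd) : R := 'D_(delta_mx 0 j) f x.

(* f in C^k(closure O), O open: f and its partial derivatives on O up to order
   k extend continuously to the closure *)
Fixpoint C_closure (k : nat) O f : Prop :=
  {within closure O, continuous f} /\
  if k is l.+1 then
    forall j : 'I_d, exists2 g,
      (forall x, O x -> derivable f x (delta_mx 0 j) /\ partial j f x = g x)
      & C_closure l O g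
  else True.

Definition smooth f := forall k, C_closure k setT f.

Definition boundary O : set Rd := closure O `\` interior O.

Definition local_defining O (p : Rd) V rho :=
  [/\ open V, V p, smooth rho, exists j, partial j rho p != 0
    & O `&` V = [set x | rho x < 0] `&` V].

Definition smooth_boundary O :=
  forall p, boundary O p -> exists V rho, local_defining O p V rho.

Definition bounded_smooth_domain O :=
  [/\ open O, O !=set0, connected O, bounded_set O & smooth_boundary O].

(* b in C^2(closure O), div b = 0, b tangent to the boundary: the outer normal
   at p is positively collinear to the gradient of a local defining function *)
Definition admissible_field O (b : Rd -> Rd) :=
  [/\ forall j, C_closure 2 O (fun x => b x 0 j),
      forall x, O x -> \sum_(j < d) partial j (fun y => b y 0 j) x = 0
    & forall p V rho, boundary O p -> local_defining O p V rho ->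
        \sum_(j < d) b p 0 j * partial j rho p = 0].

(* [lebesgue_tuple] lives on tuples, the topology on row vectors *)
Definition pt (t : d.-tuple (measurableTypeR R)) : Rd := \row_j tnth t j.

Definition intO O f : R :=
  \int[lebesgue_tuple d]_(t in pt @^-1` O) f (pt t).

Definition L2 O f :=
  measurable_fun (pt @^-1` O) (f \o pt) /\
  (\int[lebesgue_tuple d]_(t in pt @^-1` O) ((f (pt t)) ^+ 2)%:E < +oo)%E.

Definition normL2 O f : R := Num.sqrt (intO O (fun x => f x ^+ 2)).

Definition is_test O v :=
  smooth v /\ exists C, [/\ compact C, C `<=` O & forall x, ~ C x -> v x = 0].

Definition testfun O := {v : Rd -> R | is_test O v}.

(* |(-Delta)^(1/2) v|_L2 = |nabla v|_L2 *)
Definition H10norm O v : R :=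
  Num.sqrt (intO O (fun x => \sum_(j < d) partial j v x ^+ 2)).

(* u in H^1_0(O), with weak gradient gu *)
Definition H10 O u (gu : 'I_d -> Rd -> R) :=
  [/\ L2 O u, forall j, L2 O (gu j) &
    exists v : nat -> testfun O,
      normL2 O (fun x => u x - sval (v n) x) @[n --> \oo] --> 0 /\
      forall j, normL2 O (fun x => gu j x - partial j (sval (v n)) x)
        @[n --> \oo] --> 0].
End euclidean.

(* H^-1(O), the dual of H^1_0(O): H^1_0(O) being the completion of the test
   functions for [H10norm], an element is a linear form on the test functions
   that is bounded for [H10norm], i.e. a distribution on O; the norm is the
   dual norm (a quotient by 0 is 0). *)
Section Hm1.
Context {R : realType} {d : nat}.
Variable O : set 'rV[R]_d.

Definition is_Hm1 : {pred (testfun O -> R)} := fun phi => `[<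
  (forall (a : R) (u v w : testfun O),
     sval w = (fun x => a * sval u x + sval v x) ->
     phi w = a * phi u + phi v) /\
  exists C : R, forall v, `|phi v| <= C * H10norm O (sval v) >].

Record Hm1 := MkHm1 { hm1_fun :> testfun O -> R ; hm1P : hm1_fun \in is_Hm1 }.

HB.instance Definition _ := [isSub for hm1_fun].
HB.instance Definition _ := [Choice of Hm1 by <:].

Lemma is_Hm1_submod : submod_closed is_Hm1.
Proof.
split.
  apply/asboolP; split=> [a u v w _|]; first by rewrite [RHS]addr0 mulr0.
  by exists 0 => v; rewrite normr0 mul0r.
move=> c phi psi /asboolP[lphi [C hC]] /asboolP[lpsi [D hD]].
apply/asboolP; split=> [a u v w uvw|].
  rewrite !fctE (lphi _ _ _ _ uvw) (lpsi _ _ _ _ uvw) /GRing.scale/=.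
  by rewrite !mulrDr !mulrA [c * a]mulrC addrACA.
exists (`|c| * C + D) => v; rewrite mulrDl; apply: (le_trans (ler_normD _ _)).
by apply: lerD => //; rewrite normrM -mulrA ler_wpM2l.
Qed.

HB.instance Definition _ :=
  GRing.isSubmodClosed.Build R (testfun O -> R) is_Hm1 is_Hm1_submod.
HB.instance Definition _ := [SubChoice_isSubLmodule of Hm1 by <:].

Definition Hm1norm (phi : Hm1) : R :=
  sup [set `|phi v| / H10norm O (sval v) | v in [set: testfun O]].


Implicit Types (phi psi : Hm1) (v : testfun O).

Lemma Hm1norm_ge0 phi : 0 <= Hm1norm phi.
Proof.
rewrite /Hm1norm; set E := [set _ | _ in _].
have [[[x [v _ vx]] ubE]|noE] := pselect (has_sup E); last by rewrite sup_out.
apply: (@le_trans _ _ (`|phi v| / H10norm O (sval v))).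
  by rewrite divr_ge0// sqrtr_ge0.
by apply: ub_le_sup => //; exists v.
Qed.

Lemma Hm1_bound phi v : `|phi v| <= Hm1norm phi * H10norm O (sval v).
Proof.
have [_ [C hC]] := asboolP _ (hm1P phi).
have [v0|v0] := eqVneq (H10norm O (sval v)) 0.
  by have := hC v; rewrite v0 !mulr0.
rewrite -ler_pdivrMr ?lt0r ?v0 ?sqrtr_ge0//.
apply: ub_le_sup; last by exists v.
exists `|C| => _ [w _ <-].
have [w0|w0] := eqVneq (H10norm O (sval w)) 0; first by rewrite w0 invr0 mulr0.
rewrite ler_pdivrMr ?lt0r ?w0 ?sqrtr_ge0//.
by apply: (le_trans (hC w)); rewrite ler_wpM2r ?sqrtr_ge0 ?ler_norm.
Qed.

Lemma Hm1norm_le phi C : 0 <= C ->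
  (forall v, `|phi v| <= C * H10norm O (sval v)) -> Hm1norm phi <= C.
Proof.
move=> C0 hC; rewrite /Hm1norm; set E := [set _ | _ in _].
have [[neE _]|noE] := pselect (has_sup E); last by rewrite sup_out.
apply: ge_sup => //.
move=> _ [v _ <-]; have [v0|v0] := eqVneq (H10norm O (sval v)) 0.
  by rewrite v0 invr0 mulr0.
by rewrite ler_pdivrMr ?lt0r ?v0 ?sqrtr_ge0.
Qed.

Let normD phi psi : Hm1norm (phi + psi) <= Hm1norm phi + Hm1norm psi.
Proof.
apply: Hm1norm_le => [|v]; first by rewrite addr_ge0// Hm1norm_ge0.
rewrite mulrDl; apply: (le_trans (ler_normD _ _)).
by apply: lerD; exact: Hm1_bound.
Qed.

Let normZ_le (a : R) phi : Hm1norm (a *: phi) <= `|a| * Hm1norm phi.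
Proof.
apply: Hm1norm_le => [|v]; first by rewrite mulr_ge0// Hm1norm_ge0.
by rewrite [X in X <= _]normrM -mulrA ler_wpM2l// Hm1_bound.
Qed.

Let normZ (a : R) phi : Hm1norm (a *: phi) = `|a| * Hm1norm phi.
Proof.
apply/eqP; rewrite eq_le normZ_le/=.
have [->|a0] := eqVneq a 0; first by rewrite normr0 mul0r Hm1norm_ge0.
rewrite -ler_pdivlMl ?normr_gt0// -normfV.
by apply: le_trans (normZ_le _ _); rewrite scalerA mulVf// scale1r.
Qed.

Let norm_eq0 phi : Hm1norm phi = 0 -> phi = 0.
Proof.
move=> phi0; apply/val_inj/funext => v; apply/eqP; rewrite -normr_le0.
by have := Hm1_bound phi v; rewrite phi0 mul0r.
Qed.

HB.instance Definition _ :=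
  Lmodule_isNormed.Build R Hm1 normD normZ norm_eq0.

End Hm1.

Section pivot.
Context {R : realType} {d : nat} {O : set 'rV[R]_d}.
Implicit Types (phi psi chi : Hm1 O) (u g : 'rV[R]_d -> R).

(* the embedding of L^2(O) in H^-1(O): phi is the distribution g *)
Definition is_density phi g :=
  L2 O g /\ forall v : testfun O, phi v = intO O (fun x => g x * sval v x).

Definition in_L2 phi := exists g, is_density phi g.

Definition density phi : 'rV[R]_d -> R := xget (fun=> 0) (is_density phi).

(* +oo outside L^2(O) *)
Definition L2norm phi : \bar R :=
  ereal_inf [set (normL2 O g)%:E | g in is_density phi].

(* the Dirichlet problem -Delta u = phi, u in H^1_0(O) *)
Definition is_inv_laplacian phi (p : ('rV[R]_d -> R) * ('I_d -> 'rV[R]_d -> R)) :=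
  H10 O p.1 p.2 /\
  forall v : testfun O,
    intO O (fun x => \sum_(j < d) p.2 j x * partial j (sval v) x) = phi v.

(* the pair of (-Delta)^-1 phi and its gradient *)
Definition inv_laplacian phi : ('rV[R]_d -> R) * ('I_d -> 'rV[R]_d -> R) :=
  xget (fun=> 0, fun _ _ => 0) (is_inv_laplacian phi).

(* <phi, psi>_(H^-1) = <(-Delta)^-1 phi, psi>_(L^2) for psi in L^2(O), the only
   case used *)
Definition dotHm1 phi psi : R :=
  intO O (fun x => (inv_laplacian phi).1 x * density psi x).

(* chi = b . nabla (-Delta)^-1 phi *)
Definition is_transport (b : 'rV[R]_d -> 'rV[R]_d) phi chi :=
  is_density chi (fun x => \sum_(j < d) b x 0 j * (inv_laplacian phi).2 j x).

(* G s = e^(s B), B phi = b . nabla (-Delta)^-1 phi: a C_0-group of contractions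
   with generator B, leaving L^2(O) invariant *)
Definition is_transport_group (b : 'rV[R]_d -> 'rV[R]_d)
    (G : R -> Hm1 O -> Hm1 O) :=
  (forall s (a : R) phi psi, G s (a *: phi + psi) = a *: G s phi + G s psi) /\
  [/\ forall phi, G 0 phi = phi,
      forall s s' phi, G (s + s') phi = G s (G s' phi),
      forall s phi, `|G s phi| <= `|phi|,
      forall phi, continuous (fun s => G s phi)
    & forall phi, exists2 chi, is_transport b phi chi
        & h^-1 *: (G h phi - phi) @[h --> 0^'] --> chi] /\
  forall s phi, in_L2 phi -> in_L2 (G s phi).

(* Variational solution on [t, +oo) of
     x' = Gam(r,t) Delta beta(Gam(t,r) x) + F,   x(t) = x0,
   for the Gelfand triple L^2(O) < H^-1(O) < L^2(O)^*, tested in H^-1 against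
   psi in L^2(O). Here Gam(r,t) is the H^-1-adjoint of Gam(t,r) and
   <Delta beta(y), psi>_(H^-1) = - <beta(y), psi>_(L^2), which carries the
   Dirichlet condition. *)
Definition variational_solution (beta : R -> R) (Gam : R -> R -> Hm1 O -> Hm1 O)
    (t : R) (x0 : Hm1 O) (F x : R -> Hm1 O) :=
  let rhs psi r :=
    - intO O (fun y => beta (density (Gam t r (x r)) y) *
                       density (Gam t r psi) y)
    + dotHm1 (F r) psi in
  [/\ x t = x0,
      {within `[t, +oo[, continuous x},
      forall s, t <= s ->
        (\int[lebesgue_measure]_(r in `[t, s]) (L2norm (x r)) ^+ 2 < +oo)%E
    & forall s psi, t <= s -> in_L2 psi ->
        lebesgue_measure.-integrable `[t, s] (EFin \o rhs psi) /\
        dotHm1 (x s) psi =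
          dotHm1 x0 psi + \int[lebesgue_measure]_(r in `[t, s]) rhs psi r].
End pivot.

Definition admissible_beta {R : realType} (beta : R -> R) :=
  (exists L : R, forall r s, `|beta r - beta s| <= L * `|r - s|) /\
  exists2 alpha : R, 0 < alpha &
    forall r s, alpha * (r - s) ^+ 2 <= (beta r - beta s) * (r - s).

Definition admissible_f {R : realType} {d : nat} {O1 O2 O : set 'rV[R]_d}
    {U : Type} (f : Hm1 O1 -> Hm1 O2 -> U -> Hm1 O) :=
  [/\ exists2 L : R, 0 < L & forall x x' y y' u,
        `|f x y u - f x' y' u| <= L * (`|x - x'| + `|y - y'|),
      exists M : R, forall u, `|f 0 0 u| <= M,
      forall x y u, in_L2 x -> in_L2 y -> in_L2 (f x y u),
      exists2 L : R, 0 < L & forall x x' y y' u,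
        in_L2 x -> in_L2 x' -> in_L2 y -> in_L2 y' ->
        (L2norm (f x y u - f x' y' u)%R <=
           L%:E * (L2norm (x - x')%R + L2norm (y - y')%R))%E
    & exists M : R, forall u, (L2norm (f 0%R 0%R u) <= M%:E)%E].

Section stochastic_basis.
Context {R : realType} {dO : measure_display} {Omega : measurableType dO}.
Variables (P : probability Omega R) (F : R -> set (set Omega)).

(* only the times t >= 0 matter *)
Definition usual_filtration :=
  [/\ forall t : R, 0 <= t -> sigma_algebra setT (F t),
      forall t : R, 0 <= t -> F t `<=` measurable,
      forall s t : R, 0 <= s -> s <= t -> F s `<=` F t,
      forall t : R, 0 <= t -> F t = [set A | forall s, t < s -> F s A]
    & forall N, P.-negligible N -> F 0 N].

Definition brownian (W : R -> Omega -> R) :=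
  [/\ {ae P, forall w, W 0 w = 0},
      {ae P, forall w, {within `[0, +oo[, continuous (W^~ w)}},
      forall (t : R) B, 0 <= t -> measurable B -> F t (W t @^-1` B),
      forall (s t : R) B, 0 <= s -> s < t -> measurable B ->
        P [set w | B (W t w - W s w)] = normal_prob 0 (Num.sqrt (t - s)) B
    & forall (s t : R) A B, 0 <= s -> s < t -> F s A -> measurable B ->
        P (A `&` [set w | B (W t w - W s w)]) =
        (P A * P [set w | B (W t w - W s w)%R])%E].

Definition adapted_at (E : topologicalType) (s : R) (X : Omega -> E) :=
  forall V, open V -> F s (X @^-1` V).

Definition progressive (U : topologicalType) (u : R -> Omega -> U) :=
  forall (t : R) V, 0 <= t -> open V ->
    <<s [set A `*` B | A in [set A : set R | measurable A /\ A `<=` `[0, t]]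
                     & B in F t] >>
      [set p | 0 <= p.1 <= t /\ V (u p.1 p.2)].

End stochastic_basis.

Section control_system.
Context {R : realType} {d : nat} {O1 O2 : set 'rV[R]_d}.
Context {dO : measure_display} {Omega : measurableType dO} {U : metricType R}.
Variables (P : probability Omega R) (F : R -> set (set Omega)).
Local Notation H := (Hm1 O1 * Hm1 O2)%type.

Definition sqnorm (p : H) : R := `|p.1| ^+ 2 + `|p.2| ^+ 2.

(* L^2(Omega, F_s, P; K) *)
Definition L2Omega (K : set H) (s : R) : set (Omega -> H) :=
  [set X | [/\ adapted_at F s X, ('E_P[fun w => sqnorm (X w)] < +oo)%E
             & {ae P, forall w, K (X w)}]].

Definition distL2 (X : Omega -> H) (A : set (Omega -> H)) : \bar R :=
  ereal_inf
    [set Lnorm P 2%:E (fun w => (Num.sqrt (sqnorm (X w - Y w)))%:E) | Y in A].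

Variable W : R -> Omega -> R.

(* Gamma(t, s) at w, for the group G s = e^(s B) *)
Definition Gam (O : set 'rV[R]_d) (G : R -> Hm1 O -> Hm1 O) (w : Omega)
  (t s : R) : Hm1 O -> Hm1 O := G (W s w - W t w).

Variables (G1 : R -> Hm1 O1 -> Hm1 O1) (G2 : R -> Hm1 O2 -> Hm1 O2).

Definition hatK (K : set H) (t s : R) : set (Omega -> H) :=
  [set (fun w => (Gam G1 w s t (theta w).1, Gam G2 w s t (theta w).2))
    | theta in L2Omega K s].

Variables (beta1 beta2 : R -> R).
Variables (f1 : Hm1 O1 -> Hm1 O2 -> U -> Hm1 O1)
          (f2 : Hm1 O1 -> Hm1 O2 -> U -> Hm1 O2).

Definition random_solution (t : R) (xi : Omega -> H) (drift z : R -> Omega -> H) :=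
  (forall s, t <= s -> adapted_at F s (z s)) /\
  {ae P, forall w,
    variational_solution beta1 (Gam G1 w) t (xi w).1
      (fun r => (drift r w).1) (fun r => (z r w).1) /\
    variational_solution beta2 (Gam G2 w) t (xi w).2
      (fun r => (drift r w).2) (fun r => (z r w).2)}.

Definition solves_system (t : R) (xi : Omega -> H) (u : R -> Omega -> U)
    (z : R -> Omega -> H) :=
  random_solution t xi
    (fun r w =>
       let x := Gam G1 w t r (z r w).1 in
       let y := Gam G2 w t r (z r w).2 in
       (Gam G1 w r t (f1 x y (u r w)), Gam G2 w r t (f2 x y (u r w)))) z.

Definition solves_scheme (t : R) (xi : Omega -> H) (u : R -> Omega -> U)
    (z : R -> Omega -> H) :=
  random_solution t xi
    (fun r w => (f1 (xi w).1 (xi w).2 (u r w), f2 (xi w).1 (xi w).2 (u r w))) z.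

(* z t xi u is (x^{t,xi,u}, y^{t,xi,u}) *)
Definition nearly_viable (T : R) (K : set H)
    (z : R -> (Omega -> H) -> (R -> Omega -> U) -> R -> Omega -> H) :=
  forall (t : R) xi, 0 <= t -> t < T -> L2Omega K t xi ->
    ereal_inf
      [set ereal_sup [set distL2 (z t xi u s) (L2Omega K s) | s in `[t, T]]
        | u in @progressive R dO Omega F U] = 0%E.

Definition quasi_tangent_at (K : set H)
    (zhat : R -> (Omega -> H) -> (R -> Omega -> U) -> R -> Omega -> H)
    (t : R) (xi : Omega -> H) :=
  limf_einf (fun eps : R =>
    ereal_inf
      [set (((eps ^+ 2)^-1)%R%:E *
            'E_P[fun w => sqnorm (zhat t xi u (t + eps)%R w - theta w)%R])%E
        | u in @progressive R dO Omega F U & theta in L2Omega K (t + eps)])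
    0^'+ = 0%E.

End control_system.

(* Main.v *)
Require Import Defs.
From mathcomp Require Import all_boot all_order all_algebra.
From mathcomp Require Import all_classical all_reals all_analysis.
From mathcomp Require Import measurable_realfun.
From mathcomp Require Import ring lra.

Set Implicit Arguments.
Unset Strict Implicit.
Unset Printing Implicit Defensive.

Import Order.TTheory GRing.Theory Num.Theory.
Import numFieldNormedType.Exports.

Local Open Scope classical_set_scope.
Local Open Scope ring_scope.

(** The proof works with the flow of the system in the moving frame,
    [flow t xi u s = Gamma(t,s) z t xi u s]. It has the cocycle property
    ([flow_flow]), and as [Gamma] is isometric on [H^-1] and permutes the
    [K]-valued random elements ([hatK_rframes]), it is as far from them as [z].

    One path of [W]. Everything rests on an energy inequality for variational
    solutions in the triple [L^2 < H^-1 < (L^2)^*]. The chain rule for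
    [|x|^2] is justified by regularising one of the two factors with the resolvent
    [(1 - l Delta)^-1] ([riemann_sum], [energy_inequality]); this needs [H^-1] as
    a Hilbert space, that is the Dirichlet problem and the Poincare inequality.
    The frames preserve [L^2] with bounds because the generator
    [b . nabla (-Delta)^-1] of the group maps [H^-1] to [L^2] ([group_increment]).
    As [beta] is monotone, only the drifts contribute to the energy of a
    difference ([solution_compare]). Gronwall's lemma then gives an a priori
    bound, a Lipschitz dependence on the initial value uniform in the control and
    blind to the future of the control ([system_lipschitz]), a displacement
    [O(h)] when the control changes ([system_control]), and a distance between
    the system and the scheme after a time [h] that is at most [4 h] times the
    change of the drift, hence [O(h)] times the displacement of the solution and
    of the frames ([scheme_error]).

    Mean square. Along one reference control this displacement is dominated and
    tends to [0] on each path, hence in mean square; another control changes it by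
    [O(h)] only. So the scheme is [o(h)]-close to the system uniformly in the
    control ([scheme_local]).

    Near viability implies quasi-tangency: near viability provides controls that
    end within [o(h)] of [K] at time [t + h], and [scheme_local] moves this to
    the scheme.

    Quasi-tangency implies near viability: by this and [scheme_local], from any
    [K]-valued [x] at time [t] one can reach, in some time [h], a [K]-valued [y]
    up to [e h]. Such steps are concatenated up to the final time
    ([near_viability]): a node is a time, a [K]-valued state and the control used
    so far, and one node follows another when the two solutions issued from them
    stay close, at most [e] times the elapsed time, for every later control. In
    this form the errors add up without a Lipschitz constant, and the relation is
    transitive. Increasing sequences of nodes have upper bounds since
    [L^2(Omega; H^-1)] is complete, [K] is closed and progressive controls can be
    glued, so a Brezis-Browder argument reaches the final time. *)

(** * Semi-inner products *)

Section semi_inner_product.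
Context {R : realType} {V : lmodType R}.

Record semi_inner (S : set V) (a : V -> V -> R) : Prop := SemiInner {
  si0 : S 0 ;
  siP : forall c u v, S u -> S v -> S (c *: u + v) ;
  siL : forall c u v w, S u -> S v -> S w ->
    a (c *: u + v) w = c * a u w + a v w ;
  siC : forall u v, S u -> S v -> a u v = a v u ;
  si_ge0 : forall u, S u -> 0 <= a u u }.

Variables (S : set V) (a : V -> V -> R).
Hypothesis Sa : semi_inner S a.
Let nrm u := Num.sqrt (a u u).

Lemma siD u v : S u -> S v -> S (u + v).
Proof. by move=> Su Sv; rewrite -[u]scale1r; apply: (siP Sa). Qed.

Lemma siZ c u : S u -> S (c *: u).
Proof. by move=> Su; rewrite -[_ *: _]addr0; apply: (siP Sa) => //; exact: si0 Sa. Qed.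

Lemma siB u v : S u -> S v -> S (u - v).
Proof. by move=> Su Sv; rewrite addrC -scaleN1r; apply: (siP Sa). Qed.

Lemma si_Dl u v w : S u -> S v -> S w -> a (u + v) w = a u w + a v w.
Proof. by move=> *; rewrite -[u in LHS]scale1r (siL Sa)// mul1r. Qed.

Lemma si_0l w : S w -> a 0 w = 0.
Proof.
move=> Sw; have S0 := si0 Sa; have := si_Dl S0 S0 Sw.
by rewrite addr0 => /eqP; rewrite -subr_eq subrr => /eqP.
Qed.

Lemma si_Zl c u w : S u -> S w -> a (c *: u) w = c * a u w.
Proof.
by move=> Su Sw; rewrite -[c *: u]addr0 (siL Sa)// ?si_0l ?addr0//; exact: si0 Sa.
Qed.

Lemma si_Bl u v w : S u -> S v -> S w -> a (u - v) w = a u w - a v w.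
Proof. by move=> Su Sv Sw; rewrite addrC -scaleN1r (siL Sa)// mulN1r addrC. Qed.

Lemma si_Dr u v w : S u -> S v -> S w -> a w (u + v) = a w u + a w v.
Proof.
by move=> Su Sv Sw; rewrite (siC Sa) ?si_Dl// ?(siC Sa Sw)//; exact: siD.
Qed.

Lemma si_Zr c u w : S u -> S w -> a w (c *: u) = c * a w u.
Proof. by move=> Su Sw; rewrite (siC Sa) ?si_Zl ?(siC Sa Sw)//; exact: siZ. Qed.

Lemma si_Br u v w : S u -> S v -> S w -> a w (u - v) = a w u - a w v.
Proof.
by move=> Su Sv Sw; rewrite (siC Sa) ?si_Bl ?(siC Sa Sw)//; exact: siB.
Qed.

(** Serves twice: for the Cauchy-Schwarz inequality and, the constant term being
    the defect of a minimising sequence, for the rate in [riesz_sequence]. *)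
Lemma quadratic_ge0 (p q r : R) : 0 <= p ->
  (forall t, 0 <= p * t ^+ 2 + 2 * q * t + r) -> q ^+ 2 <= p * r.
Proof.
move=> p0 h; have [pe|pn0] := eqVneq p 0.
  move: h; rewrite pe mul0r => h; have [->|q0] := eqVneq q 0; first by rewrite expr0n.
  have := h (- (r + 1) / (2 * q)).
  have -> : 0 * (- (r + 1) / (2 * q)) ^+ 2 + 2 * q * (- (r + 1) / (2 * q)) + r = -1.
    by field.
  lra.
have pp : 0 < p by rewrite lt0r pn0.
have := h (- q / p).
have -> : p * (- q / p) ^+ 2 + 2 * q * (- q / p) + r = r - q ^+ 2 / p by field.
by rewrite subr_ge0 ler_pdivrMr// mulrC.
Qed.

Lemma si_expand c u v : S u -> S v ->
  a (c *: u + v) (c *: u + v) = a u u * c ^+ 2 + 2 * a u v * c + a v v.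
Proof.
move=> Su Sv; have Sc := siZ c Su.
rewrite (siL Sa)//; last exact: (siP Sa).
rewrite !si_Dr// !si_Zr// (siC Sa Sv Su); ring.
Qed.

Lemma si_CS2 u v : S u -> S v -> a u v ^+ 2 <= a u u * a v v.
Proof.
move=> Su Sv; apply: quadratic_ge0; first exact: si_ge0 Sa _ Su.
by move=> t; rewrite -si_expand//; apply: (si_ge0 Sa); exact: (siP Sa).
Qed.

Lemma si_CS u v : S u -> S v -> `|a u v| <= nrm u * nrm v.
Proof.
move=> Su Sv; rewrite -sqrtr_sqr /nrm -sqrtrM ?(si_ge0 Sa)//.
by apply: ler_wsqrtr; exact: si_CS2.
Qed.

Lemma si_sqr u : S u -> nrm u ^+ 2 = a u u.
Proof. by move=> Su; rewrite sqr_sqrtr// (si_ge0 Sa). Qed.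

Lemma si_triangle u v : S u -> S v -> nrm (u + v) <= nrm u + nrm v.
Proof.
move=> Su Sv; rewrite -(@ler_pXn2r _ 2)// ?nnegrE ?sqrtr_ge0 ?addr_ge0 ?sqrtr_ge0//.
rewrite si_sqr; last exact: siD.
rewrite -[u in a (u + v) _]scale1r -[u in X in a _ X]scale1r si_expand//.
have := le_trans (ler_norm _) (si_CS Su Sv).
have := si_sqr Su; have := si_sqr Sv; nra.
Qed.

Lemma si_nrmZ c u : S u -> nrm (c *: u) = `|c| * nrm u.
Proof.
move=> Su; have Sc := siZ c Su.
rewrite /nrm si_Zl// si_Zr// mulrA -expr2 sqrtrM ?sqr_ge0//.
by rewrite sqrtr_sqr.
Qed.

Lemma si_nrmBC u v : S u -> S v -> nrm (u - v) = nrm (v - u).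
Proof.
move=> Su Sv; have := si_nrmZ (-1) (siB Sv Su).
by rewrite scaleN1r opprB normrN normr1 mul1r.
Qed.

(** A minimising sequence of [a u u - 2 phi u] represents [phi] up to an
    explicit rate; the minimiser itself need not exist, [V] not being assumed
    complete. *)
Lemma riesz_sequence (phi : V -> R) (C : R) :
  (forall c u v, S u -> S v -> phi (c *: u + v) = c * phi u + phi v) ->
  (forall u, S u -> `|phi u| <= C * nrm u) ->
  exists v : nat -> V, (forall n, S (v n)) /\
    forall n w, S w -> `|a (v n) w - phi w| <= nrm w / n.+1%:R.
Proof.
move=> philin phiC; pose q u := a u u - 2 * phi u.
pose I := inf [set q u | u in S].
have S0 := si0 Sa.
have lbq : forall u, S u -> - C ^+ 2 <= q u.
  move=> u Su; rewrite /q -si_sqr//.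
  have := le_trans (ler_norm _) (phiC _ Su); have := sqr_ge0 (nrm u - C); nra.
have hI : has_inf [set q u | u in S].
  by split; [exists (q 0), 0|exists (- C ^+ 2) => _ [u Su <-]; exact: lbq].
have qI u : S u -> I <= q u.
  by move=> Su; apply: (ge_inf hI.2); exists u.
have phi0 : phi 0 = 0.
  have := philin 1 _ _ S0 S0; rewrite scale1r addr0 mul1r => /eqP.
  by rewrite -subr_eq subrr => /eqP.
have /choice[v hv] : forall n : nat, exists u, S u /\ q u < I + (n.+1%:R ^- 2).
  move=> n; have e0 : 0 < (n.+1%:R ^- 2 : R) by rewrite invr_gt0 exprn_gt0.
  by have [_ [u Su <-] qu] := inf_adherent e0 hI; exists u.
exists v; split=> [n|n w Sw]; first by have [] := hv n.
have [Sv qv] := hv n.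
have key t : 0 <= a w w * t ^+ 2 + 2 * (a (v n) w - phi w) * t + n.+1%:R ^- 2.
  have := qI _ (siP Sa t Sw Sv); rewrite /q si_expand// philin//.
  move: qv; rewrite /q (siC Sa Sw Sv); move: (n.+1%:R ^- 2) => e; lra.
have := quadratic_ge0 (si_ge0 Sa Sw) key.
rewrite -(ler_sqrt _ (mulr_ge0 (si_ge0 Sa Sw) _)) ?invr_ge0 ?exprn_ge0//.
rewrite sqrtr_sqr sqrtrM ?(si_ge0 Sa)// -exprVn sqrtr_sqr.
rewrite (@ger0_norm _ n.+1%:R^-1) ?invr_ge0 ?ler0n //.
Qed.

(** The sequences of [riesz_sequence] are Cauchy: test the difference of two
    terms against itself. *)
Lemma riesz_cauchy (phi : V -> R) (v : nat -> V) :
  (forall n, S (v n)) ->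
  (forall n w, S w -> `|a (v n) w - phi w| <= nrm w / n.+1%:R) ->
  forall m n, nrm (v m - v n) <= m.+1%:R^-1 + n.+1%:R^-1.
Proof.
move=> Sv hv m n; set w := v m - v n; have Sw : S w by exact: siB.
have [w0|w0] := eqVneq (nrm w) 0.
  by rewrite w0 addr_ge0// invr_ge0.
have wp : 0 < nrm w by rewrite lt0r w0 sqrtr_ge0.
rewrite -(ler_pM2l wp) -expr2 si_sqr// {1}/w si_Bl// mulrDr.
rewrite (_ : _ - _ = (a (v m) w - phi w) - (a (v n) w - phi w)); last by ring.
apply: le_trans (ler_norm _) _; apply: le_trans (ler_normB _ _) _.
by apply: lerD; apply: hv.
Qed.

End semi_inner_product.

(** * Square integrable functions *)

(** Adding and subtracting the geometric bound of the remainder makes the sequence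
    monotone, which gives the limit and its rate at once. *)
Lemma geometric_cvg {R : realType} (x : nat -> R) (B : R) :
  (forall k, `|x k.+1 - x k| <= B * 2%:R ^- k) ->
  exists2 l, x n @[n --> \oo] --> l & forall k, `|l - x k| <= 2 * B * 2%:R ^- k.
Proof.
move=> hx; pose e k := 2 * B * (2%:R : R) ^- k.
have B0 : 0 <= B by have := hx 0; rewrite expr0 invr1 mulr1; apply: le_trans.
have eS k : e k.+1 = B * 2%:R ^- k by rewrite /e exprS; field.
have e2 k : e k = 2 * (B * 2%:R ^- k) by rewrite /e mulrA.
have p2 k : 0 <= B * (2%:R : R) ^- k by rewrite mulr_ge0 ?invr_ge0 ?exprn_ge0.
have hx' k := hx k; pose y k := x k - e k; pose z k := x k + e k.
have yS : nondecreasing_seq y.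
  apply/nondecreasing_seqP => k; rewrite /y eS e2.
  by have := hx k; rewrite ler_norml => /andP[]; lra.
have zS : nonincreasing_seq z.
  apply/nonincreasing_seqP => k; rewrite /z eS e2.
  by have := hx k; rewrite ler_norml => /andP[]; lra.
have yz k : y k <= z 0.
  apply: le_trans (zS 0 k (leq0n k)); rewrite /y /z e2.
  by have := p2 k; lra.
have cy : cvgn y.
  by apply: nondecreasing_is_cvgn => //; exists (z 0) => _ [k _ <-].
have ce : e n @[n --> \oo] --> (0 : R).
  have -> : e = geometric (2 * B) (2%:R^-1).
    by apply/funext => k; rewrite /geometric/= /e exprVn.
  apply: cvg_geometric; rewrite ger0_norm ?invr_ge0//; lra.
have cx : x n @[n --> \oo] --> limn y.
  have -> : x = y \+ e by apply/funext => k; rewrite /y /= subrK.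
  by rewrite -[X in _ --> X]addr0; apply: cvgD.
exists (limn y) => // k; rewrite -/(e k).
have h1 := nondecreasing_cvgn_le yS cy k.
have h2 : limn y <= z k.
  have cz : z n @[n --> \oo] --> limn y.
    by rewrite -[X in _ --> X]addr0; apply: cvgD.
  rewrite -(cvg_lim (@Rhausdorff R) cz); apply: nonincreasing_cvgn_ge => //.
  by apply/cvg_ex; exists (limn y).
rewrite ler_norml; move: h1 h2; rewrite /y /z; lra.
Qed.

Section square_integrable.
Context {dT : measure_display} {T : measurableType dT} {R : realType}.
Variables (mu : {measure set T -> \bar R}) (D : set T).
Hypothesis mD : measurable D.
Implicit Types f g : T -> R.

Definition sqint f := measurable_fun D f /\
  (\int[mu]_(x in D) ((f x) ^+ 2)%:E < +oo)%E.

Definition ip2 f g : R := \int[mu]_(x in D) (f x * g x).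
Definition nrm2 f : R := Num.sqrt (ip2 f f).

Lemma sqint_integrable f : sqint f ->
  mu.-integrable D (EFin \o (fun x => f x ^+ 2)).
Proof.
move=> [mf hf]; apply/integrableP; split.
  by apply/measurable_EFinP; exact: measurable_funX.
rewrite (eq_integral (fun x => (f x ^+ 2)%:E))// => x _ /=.
by rewrite ger0_norm// sqr_ge0.
Qed.

Lemma integrableRD f g : mu.-integrable D (EFin \o f) ->
  mu.-integrable D (EFin \o g) -> mu.-integrable D (EFin \o (fun x => f x + g x)).
Proof. by move=> hf hg; exact: (integrableD mD hf hg). Qed.

Lemma integrableRZ c f : mu.-integrable D (EFin \o f) ->
  mu.-integrable D (EFin \o (fun x => c * f x)).
Proof. by move=> hf; exact: (integrableZl mD c hf). Qed.

Lemma integrableRB f g : mu.-integrable D (EFin \o f) ->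
  mu.-integrable D (EFin \o g) -> mu.-integrable D (EFin \o (fun x => f x - g x)).
Proof. by move=> hf hg; exact: (integrableB mD hf hg). Qed.

Lemma sqint_prod f g : sqint f -> sqint g ->
  mu.-integrable D (EFin \o (fun x => f x * g x)).
Proof.
move=> Hf Hg; have := integrableD mD (sqint_integrable Hf) (sqint_integrable Hg).
apply: le_integrable => //.
  by apply/measurable_EFinP; apply: measurable_funM; [case: Hf|case: Hg].
move=> x _; change ((`|f x * g x|)%:E <= (`|f x ^+ 2 + g x ^+ 2|)%:E)%E.
rewrite lee_fin.
rewrite [leRHS]ger0_norm ?addr_ge0 ?sqr_ge0// ler_norml; apply/andP; split.
  have := sqr_ge0 (f x + g x); have := sqr_ge0 (f x); have := sqr_ge0 (g x); nra.
have := sqr_ge0 (f x - g x); have := sqr_ge0 (f x); have := sqr_ge0 (g x); nra.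
Qed.

Lemma sqint_le f g : measurable_fun D f -> sqint g ->
  (forall x, D x -> `|f x| <= `|g x|) -> sqint f.
Proof.
move=> mf [mg hg] fg; split=> //; apply: le_lt_trans hg.
apply: ge0_le_integral => //.
- by move=> x _; rewrite lee_fin sqr_ge0.
- by apply/measurable_EFinP; exact: measurable_funX.
- by apply/measurable_EFinP; exact: measurable_funX.
- move=> x Dx; rewrite lee_fin -(real_normK (num_real (f x))).
  by rewrite -(real_normK (num_real (g x))) ler_pXn2r ?nnegrE ?normr_ge0// fg.
Qed.

Lemma sqint_P c f g : sqint f -> sqint g -> sqint (c *: f + g).
Proof.
move=> Hf Hg; have mfg : measurable_fun D (c *: f + g).
  apply: measurable_funD; last by case: Hg.
  by apply: measurable_funM; [exact: measurable_cst|case: Hf].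
split=> //.
have : mu.-integrable D (EFin \o (fun x => 2 * c ^+ 2 * f x ^+ 2 + 2 * g x ^+ 2)).
  by apply: integrableRD; apply: integrableRZ; exact: sqint_integrable.
move=> /integrableP[_]; apply: le_lt_trans.
apply: ge0_le_integral => //.
- by move=> x _; rewrite lee_fin sqr_ge0.
- by apply/measurable_EFinP; exact: measurable_funX.
- apply/measurable_EFinP; apply: measurableT_comp => //.
  apply: measurable_funD; apply: measurable_funM => //; apply: measurable_funX.
    by case: Hf.
  by case: Hg.
- move=> x _ /=; rewrite lee_fin.
  rewrite ger0_norm; last first.
    by apply: addr_ge0; [apply: mulr_ge0; [apply: mulr_ge0|]|apply: mulr_ge0] => //; exact: sqr_ge0.
  have -> : (c *: f + g) x = c * f x + g x by [].
  have := sqr_ge0 (c * f x - g x); nra.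
Qed.

Lemma sqint0 : sqint 0.
Proof.
split; first exact: measurable_cst.
rewrite (eq_integral (cst 0%E)) ?integral0 ?ltry// => x _ /=.
by rewrite expr0n.
Qed.

Lemma sqint_semi_inner : semi_inner sqint ip2.
Proof.
split; [exact: sqint0|exact: sqint_P| | |].
- move=> c u v w Su Sv Sw; rewrite /ip2 -RintegralZl//; last exact: sqint_prod.
  rewrite -RintegralD//; last exact: sqint_prod.
    apply: eq_Rintegral => x _; rewrite mulrA -mulrDl//.
  by apply: integrableRZ; exact: sqint_prod.
- by move=> u v _ _; apply: eq_Rintegral => x _; rewrite mulrC.
- by move=> u _; apply: Rintegral_ge0 => x _; rewrite -expr2 sqr_ge0.
Qed.

Let SI := sqint_semi_inner.

Lemma sqint_ipE f : sqint f ->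
  (\int[mu]_(x in D) ((f x) ^+ 2)%:E = (ip2 f f)%:E)%E.
Proof.
move=> Hf; rewrite /ip2 /Rintegral fineK//.
exact: (integrable_fin_num mD (sqint_integrable Hf)).
Qed.

Lemma ip2_ae f f' g : sqint f -> sqint f' -> sqint g ->
  {ae mu, forall x, D x -> f x = f' x} -> ip2 f g = ip2 f' g.
Proof.
move=> Hf Hf' Hg ff'; rewrite /ip2 /Rintegral; congr fine.
apply: ae_eq_integral => //.
- by apply/measurable_EFinP; apply: measurable_funM; [case: Hf|case: Hg].
- by apply/measurable_EFinP; apply: measurable_funM; [case: Hf'|case: Hg].
- by apply: filterS ff' => x /= h Dx; rewrite h.
Qed.

(** Chebyshev with summable weights: a sequence that is geometrically small in
    mean square is geometrically small at almost every point. *)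
Lemma fast_cauchy_ae (a : nat -> T -> R) (C : R) :
  (forall k, measurable_fun D (a k)) ->
  (forall k, (\int[mu]_(x in D) ((a k x) ^+ 2)%:E <= (C * 16%:R ^- k)%:E)%E) ->
  {ae mu, forall x, D x -> exists B : R, forall k, `|a k x| <= B * 2%:R ^- k}.
Proof.
move=> ma ha.
pose h x := (\sum_(k <oo) (4%:R ^+ k * a k x ^+ 2)%:E)%E.
have C0 : 0 <= C.
  have := ha 0; rewrite expr0 invr1 mulr1 -[C%:E]/(C%:E) => {}ha.
  rewrite -lee_fin; apply: le_trans ha.
  by apply: integral_ge0 => x _; rewrite lee_fin sqr_ge0.
have p4 k : 0 <= 4%:R ^+ k :> R by exact: exprn_ge0.
have mt k : measurable_fun D (fun x => (4%:R ^+ k * a k x ^+ 2)%:E).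
  apply/measurable_EFinP; apply: measurable_funM => //; exact: measurable_funX.
have t0 k x : D x -> (0 <= (4%:R ^+ k * a k x ^+ 2)%:E)%E.
  by move=> _; rewrite lee_fin mulr_ge0// sqr_ge0.
have mh : measurable_fun D h by apply: ge0_emeasurable_sum => // k x Dx _; exact: t0.
have h0 x : D x -> (0 <= h x)%E by move=> Dx; apply: nneseries_ge0 => k _ _; exact: t0.
have ih : mu.-integrable D h.
  apply/integrableP; split=> //.
  rewrite (eq_integral h); last by move=> x /set_mem Dx; rewrite gee0_abs// h0.
  rewrite integral_nneseries//.
  apply: (@le_lt_trans _ _ (2 * C)%:E); last exact: ltry.
  have It k : (\int[mu]_(x in D) (4%:R ^+ k * a k x ^+ 2)%:E <= (C * 4%:R ^- k)%:E)%E.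
    under eq_integral do rewrite EFinM.
    rewrite ge0_integralZl//; last first.
    - by move=> x _; rewrite lee_fin sqr_ge0.
    - by apply/measurable_EFinP; exact: measurable_funX.
    apply: (@le_trans _ _ ((4%:R ^+ k)%:E * (C * 16%:R ^- k)%:E)%E).
      by apply: lee_wpmul2l => //; rewrite lee_fin.
    rewrite -EFinM lee_fin.
    rewrite (_ : 16%:R = 4%:R * 4%:R :> R); last by rewrite -natrM.
    rewrite exprMn invfM mulrCA mulrA mulrA mulfK//; exact: expf_neq0.
  apply: lime_le.
    by apply: is_cvg_nneseries => k _ _; apply: integral_ge0 => x Dx; exact: t0.
  apply: nearW => n.
  apply: (@le_trans _ _ (\sum_(0 <= k < n) (C * 4%:R ^- k)%:E)%E).
    by apply: lee_sum => k _; exact: It.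
  rewrite sumEFin lee_fin.
  apply: (@le_trans _ _ (2 * C * (1 - 4%:R ^- n))).
    elim: n => [|n IH]; first by rewrite big_geq// expr0 invr1 subrr mulr0.
    rewrite big_nat_recr//= exprS invfM.
    apply: le_trans (lerD IH (lexx _)) _.
    have : 0 <= (4%:R : R) ^- n by rewrite invr_ge0.
    move: (4%:R ^- n) => e e0; nra.
  rewrite ler_piMr ?mulr_ge0// gerBl invr_ge0; exact: p4.
have := integrable_ae mD ih; apply: filterS => x /= hx Dx.
exists (Num.sqrt (fine (h x))) => k.
have : ((4%:R ^+ k * a k x ^+ 2)%:E <= (fine (h x))%:E)%E.
  rewrite fineK ?hx//; rewrite /h.
  have := @nneseries_lim_ge R (fun k => (4%:R ^+ k * a k x ^+ 2)%:E) xpredT 0 k.+1.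
  move=> /(_ (fun i _ _ => t0 i x Dx)); apply: le_trans.
  by rewrite big_nat_recr//= leeDr// sume_ge0// => i _; exact: t0.
rewrite lee_fin => H.
have -> : `|a k x| = Num.sqrt (4%:R ^+ k * a k x ^+ 2) * 2%:R ^- k.
  rewrite sqrtrM// sqrtr_sqr (_ : 4%:R = 2%:R ^+ 2 :> R); last by rewrite -natrX.
  rewrite -exprM mulnC exprM sqrtr_sqr (@ger0_norm _ (2%:R ^+ k)) ?exprn_ge0//.
  by rewrite mulrAC mulfV ?mul1r// expf_neq0.
by apply: ler_wpM2r; rewrite ?invr_ge0 ?exprn_ge0//; exact: ler_wsqrtr.
Qed.

Lemma fatou_le (h : nat -> T -> \bar R) (l : T -> \bar R) (c : \bar R) :
  (forall k, measurable_fun D (h k)) -> (forall k x, D x -> (0 <= h k x)%E) ->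
  (forall x, D x -> h ^~ x @ \oo --> l x) ->
  (forall k, (\int[mu]_(x in D) h k x <= c)%E) ->
  (\int[mu]_(x in D) l x <= c)%E.
Proof.
move=> mh h0 hl hc; have := fatou mu mD mh h0.
rewrite (eq_integral l); last first.
  move=> x /set_mem Dx; have := hl x Dx => /[dup] hlx /cvgP hlx'.
  by rewrite is_cvg_limn_einfE//; apply/cvg_lim.
move=> /le_trans; apply; rewrite limn_einf_lim; apply: lime_le.
  exact: is_cvg_einfs.
apply: nearW => k; apply: le_trans (hc k).
by apply: ereal_inf_lbound; exists k => /=.
Qed.

(** The subsequence of indices [4^k] converges almost everywhere at a geometric
    rate; Fatou's lemma carries the Cauchy estimates to the limit. *)
Lemma L2_complete (f : nat -> T -> R) : (forall n, sqint (f n)) ->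
  (forall m n, nrm2 (f m - f n) <= m.+1%:R^-1 + n.+1%:R^-1) ->
  exists2 g, sqint g & forall n, nrm2 (g - f n) <= 2 / n.+1%:R.
Proof.
move=> Hf fC; pose g k := f (4 ^ k)%N.
have int_sq m n : (\int[mu]_(x in D) ((f m x - f n x) ^+ 2)%:E <=
    ((m.+1%:R^-1 + n.+1%:R^-1) ^+ 2)%:E)%E.
  have Hmn : sqint (f m - f n) by apply: (siB SI).
  rewrite [leLHS](sqint_ipE Hmn) lee_fin -(si_sqr SI)//.
  by rewrite ler_pXn2r ?nnegrE ?addr_ge0 ?invr_ge0 ?sqrtr_ge0//; exact: fC.
have [k|k|N [mN N0 subN]] := @fast_cauchy_ae (fun k x => g k.+1 x - g k x) 4.
- by apply: measurable_funB; case: (Hf (4 ^ k)%N); case: (Hf (4 ^ k.+1)%N).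
- apply: le_trans (int_sq _ _) _; rewrite lee_fin.
  have e4 : 0 < (4%:R : R) ^+ k by exact: exprn_gt0.
  have -> : 4 * 16%:R ^- k = (2 * 4%:R ^- k) ^+ 2 :> R.
    rewrite exprMn exprVn -exprM mulnC exprM (_ : 4%:R ^+ 2 = 16%:R :> R); last first.
      by rewrite -natrX.
    by rewrite -(natrX _ 2 2).
  rewrite ler_pXn2r ?nnegrE ?addr_ge0 ?mulr_ge0 ?invr_ge0 ?(ltW e4)//.
  rewrite mulrDl mul1r; apply: lerD.
    rewrite lef_pV2 ?posrE// -natrX ler_nat.
    by apply: leq_trans (leqnSn _); rewrite leq_exp2l.
  by rewrite lef_pV2 ?posrE// -natrX ler_nat.
(* Set to zero on the exceptional set, the subsequence converges everywhere. *)
pose G k x := g k x * \1_(~` N) x.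
have mG k : measurable_fun D (G k).
  by apply: measurable_funM; [case: (Hf (4 ^ k)%N)|exact: measurable_indic (measurableC mN)].
have GN x k : ~ N x -> G k x = g k x.
  by move=> Nx; rewrite /G indicE mem_set ?mulr1.
have GN0 x k : N x -> G k x = 0.
  by move=> Nx; rewrite /G indicE memNset ?mulr0// => /(_ Nx).
have cG x : D x -> cvgn (G ^~ x).
  move=> Dx; have [Nx|Nx] := pselect (N x).
    rewrite (_ : G ^~ x = cst 0); first exact: is_cvg_cst.
    by apply/funext => k; rewrite GN0.
  have [B hB] : exists B : R, forall k, `|g k.+1 x - g k x| <= B * 2%:R ^- k.
    by apply: contrapT => nB; apply: Nx; apply: subN => /(_ Dx).
  have [l hl _] := geometric_cvg hB.
  apply/cvg_ex; exists l; rewrite (_ : G ^~ x = g ^~ x)//.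
  by apply/funext => k; rewrite GN.
pose gl : T -> R := fun x => limn (G ^~ x).
have cGl x : D x -> G ^~ x @ \oo --> gl x by move=> Dx; exact: cG.
have mgl : measurable_fun D gl by exact: measurable_fun_cvg mG cGl.
have gli n : (\int[mu]_(x in D) ((gl x - f n x) ^+ 2)%:E <= ((2 / n.+1%:R) ^+ 2)%:E)%E.
  apply: (@fatou_le (fun k x => ((G (n + k)%N x - f n x) ^+ 2)%:E)).
  - move=> k; apply/measurable_EFinP; apply: measurable_funX.
    by apply: measurable_funB => //; case: (Hf n).
  - by move=> k x _; rewrite lee_fin sqr_ge0.
  - move=> x Dx; apply: cvg_EFin; first exact: nearW.
    have cGn : (fun k => G (n + k)%N x) @ \oo --> gl x by exact: (cvg_comp _ _ (cvg_addnl n) (cGl x Dx)).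
    rewrite (_ : _ \o _ = (fun k => (G (n + k)%N x - f n x) * (G (n + k)%N x - f n x)))//.
    by apply: cvgM; apply: cvgB => //; exact: cvg_cst.
  - move=> k; apply: le_trans (_ : (_ <= ((((4 ^ (n + k)).+1%:R^-1 + n.+1%:R^-1) ^+ 2)%:E))%E) _.
      apply: le_trans (int_sq _ _); rewrite le_eqVlt; apply/orP; left; apply/eqP.
      apply: ge0_ae_eq_integral => //.
      + apply/measurable_EFinP; apply: measurable_funX.
        by apply: measurable_funB => //; case: (Hf n).
      + apply/measurable_EFinP; apply: measurable_funX.
        by apply: measurable_funB; [case: (Hf (4 ^ (n + k))%N)|case: (Hf n)].
      + by move=> x _; rewrite lee_fin sqr_ge0.
      + by move=> x _; rewrite lee_fin sqr_ge0.
      + exists N; split=> // x /= nx; apply: contrapT => Nx; apply: nx => _.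
        by rewrite GN.
    rewrite lee_fin ler_pXn2r ?nnegrE ?addr_ge0 ?mulr_ge0 ?invr_ge0//.
    rewrite mulrDl mul1r; apply: lerD => //; rewrite lef_pV2 ?posrE// ler_nat ltnS.
    apply: (@leq_trans (n + k)); first exact: leq_addr.
    by apply/ltnW; apply: ltn_expl.
have Hgf n : sqint (gl - f n).
  split; first by apply: measurable_funB => //; case: (Hf n).
  by apply: le_lt_trans (gli n) _; rewrite ltry.
have Hg : sqint gl.
  by have := siD SI (Hgf 0%N) (Hf 0%N); rewrite subrK.
exists gl => // n; rewrite -(@ler_pXn2r _ 2)// ?nnegrE ?sqrtr_ge0 ?mulr_ge0 ?invr_ge0//.
rewrite (si_sqr SI)// -lee_fin; apply: le_trans (gli n).
by rewrite -(sqint_ipE (Hgf n)).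
Qed.

End square_integrable.

(** * Smooth functions and bumps *)

Section flat_function.
Context {R : realType}.

Lemma is_derive_cvg {V W : normedModType R} (f : V -> W) (x v : V) (df : W) :
  (fun h : R => h^-1 *: (f (h *: v + x) - f x)) @ 0^' --> df ->
  is_derive x v f df.
Proof.
move=> h; apply: DeriveDef; first by apply/cvg_ex; exists df.
exact: (cvg_lim (@norm_hausdorff _ W) h).
Qed.

(** [y^-n e^(-1/y)], extended by [0] to [y <= 0]: the span of these functions is
    stable under differentiation, which makes every one of them smooth. *)
Definition flat (n : nat) (y : R) : R :=
  if 0 < y then y ^- n * expR (- y^-1) else 0.

Lemma flat_le0 n y : y <= 0 -> flat n y = 0.
Proof. by rewrite /flat leNgt => /negbTE ->. Qed.

Lemma flat_bound n (y : R) : `|flat n y| <= (n.+2)`!%:R * y ^+ 2.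
Proof.
rewrite /flat; case: ifPn => [y0|_]; last first.
  by rewrite normr0 mulr_ge0// sqr_ge0.
rewrite ger0_norm; last by rewrite mulr_ge0 ?invr_ge0 ?expR_ge0// exprn_ge0// ltW.
have yV : 0 < y^-1 by rewrite invr_gt0.
have yn : 0 < y ^- n.+2 by rewrite invr_gt0 exprn_gt0.
have f0 : 0 < ((n.+2)`!%:R : R) by rewrite ltr0n fact_gt0.
have h : y ^- n.+2 <= (n.+2)`!%:R * expR y^-1.
  have := expR_ge1Dxn n.+1 (ltW yV); rewrite exprVn => h.
  rewrite -ler_pdivrMl// mulrC; apply: le_trans h; lra.
have -> : y ^- n = y ^- n.+2 * y ^+ 2.
  by rewrite -addn2 exprD; field; rewrite ?expf_neq0 ?gt_eqF.
rewrite mulrAC ler_wpM2r ?sqr_ge0//.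
by rewrite expRN ler_pdivrMr// expR_gt0.
Qed.

Lemma is_derive_flat n (y : R) :
  is_derive y 1 (flat n) (flat n.+2 y - n%:R * flat n.+1 y).
Proof.
have [y0|y0|->] := ltgtP y 0.
- rewrite !flat_le0 ?ltW// mulr0 subrr.
  apply: (near_eq_is_derive (f := cst 0)) => //.
  have := lt_nbhsl y0.
  by apply: filterS => z z0; rewrite flat_le0// ltW.
- have -> : flat n.+2 y - n%:R * flat n.+1 y =
      (y ^- n.+2 - n%:R * y ^- n.+1) * expR (- y^-1).
    by rewrite /flat y0; ring.
  apply: (near_eq_is_derive (f := fun z : R => z ^- n * expR (- z^-1))) => //.
    have := lt_nbhsr y0.
    by apply: filterS => z z0; rewrite /flat z0.
  have yn0 : y != 0 by rewrite gt_eqF.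
  have d1 : is_derive y 1 (fun z : R => z^-1) (- y ^- 2).
    by have := is_deriveV yn0 (is_derive_id y (1 : R)); rewrite /GRing.scale/= mulr1.
  have d2 : is_derive y 1 (fun z : R => expR (- z^-1)) (y ^- 2 * expR (- y^-1)).
    have d1N : is_derive y 1 (fun z : R => - z^-1) (- - y ^- 2) := is_deriveN d1.
    have := is_derive1_comp (f := expR) (g := fun z : R => - z^-1) (is_derive_expR (- y^-1)) d1N.
    by rewrite opprK mulrC.
  have d3 : is_derive y 1 (fun z : R => z ^- n) (- n%:R * y ^- n.+1).
    have := is_deriveX n d1 => d3.
    have -> : (fun z : R => z ^- n) = (fun z : R => z^-1) ^+ n.
      by apply/funext => z; rewrite -exprVn exprfctE.
    apply: is_derive_eq; rewrite /GRing.scale/=.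
    case: n {d3} => [|n]; first by rewrite !mulr0n oppr0 !mul0r.
    rewrite -mulr_natl exprVn/= !exprS; field.
    rewrite yn0 expf_neq0//.
  have := is_deriveM d3 d2.
  rewrite (_ : (fun z => z ^- n) * _ = (fun z => z ^- n * expR (- z^-1)))// => d4.
  apply: is_derive_eq; rewrite /GRing.scale/=.
  rewrite !exprS; field.
  by rewrite yn0 expf_neq0.
- rewrite !flat_le0// mulr0 subrr; apply: is_derive_cvg.
  apply/cvgr0Pnorm_lt => e e0.
  have c0 : 0 < ((n.+2)`!%:R : R) by rewrite ltr0n fact_gt0.
  near=> h; rewrite (flat_le0 n (lexx 0)) subr0 addr0 /GRing.scale/= mulr1 normrM.
  have h0 : 0 < `|h| by rewrite normr_gt0; near: h; exact: nbhs_dnbhs_neq.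
  rewrite normfV mulrC ltr_pdivrMr//.
  apply: le_lt_trans (flat_bound n h) _.
  rewrite -(real_normK (num_real h)) expr2 mulrA ltr_pM2r// mulrC -ltr_pdivlMr//.
  near: h; apply: dnbhs0_lt; exact: divr_gt0.
Unshelve. all: by end_near. Qed.

Lemma continuous_flat n : continuous (flat n).
Proof.
move=> y; apply: differentiable_continuous; apply/derivable1_diffP.
by have [] := is_derive_flat n y.
Qed.

Lemma flat0_ge0 y : 0 <= flat 0 y.
Proof.
by rewrite /flat; case: ifP => // _; rewrite mulr_ge0 ?expR_ge0 ?invr_ge0.
Qed.

Lemma flat0_le1 y : flat 0 y <= 1.
Proof.
rewrite /flat; case: ifP => // y0; rewrite expr0 invr1 mul1r expR_le1.
by rewrite oppr_le0 invr_ge0 ltW.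
Qed.

Lemma cvg_flat0 y : 0 < y -> flat 0 (n.+1%:R * y) @[n --> \oo] --> (1 : R).
Proof.
move=> y0.
have -> : (fun n : nat => flat 0 (n.+1%:R * y)) =
    expR \o (fun n : nat => - (y^-1 * (n.+1%:R)^-1)).
  by apply/funext => n; rewrite /flat mulr_gt0//= expr0 invr1 mul1r invfM mulrC.
rewrite -[X in _ --> X]expR0; apply: continuous_cvg; first exact: continuous_expR.
rewrite -[X in _ --> X]oppr0; apply: cvgN; rewrite -[X in _ --> X](mulr0 y^-1).
by apply: cvgM; [exact: cvg_cst|exact: cvg_harmonic].
Qed.

End flat_function.

Section smooth_functions.
Context {R : realType} {d : nat}.
Local Notation Rd := 'rV[R]_d.
Implicit Types f g : Rd -> R.

Lemma C_closure_contT k f : C_closure k setT f -> continuous f.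
Proof.
move=> h; have {h} : {within closure [set: Rd], continuous f} by case: k h => [|k] [].
by rewrite (_ : closure _ = setT) => [/(proj2 (continuous_subspace_setT _))|]; last exact: closureT.
Qed.

Lemma smooth_continuous f : smooth f -> continuous f.
Proof. by move=> h; exact: C_closure_contT (h 0%N). Qed.

Lemma smooth_is_derive f j x : smooth f ->
  is_derive x (delta_mx 0 j) f (partial j f x).
Proof.
move=> h; have [_ /(_ j)[g /(_ x Logic.I)[dfx _] _]] := h 1%N.
exact: derivableP.
Qed.

Lemma smooth_partial f j : smooth f -> smooth (partial j f).
Proof.
move=> h k; have [_ /(_ j)[g hg Cg]] := h k.+1.
by rewrite (_ : partial j f = g)//; apply/funext => x; have [] := hg x Logic.I.
Qed.

(** Smoothness is the largest class of continuous functions that is stable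
    under partial derivatives. *)
Lemma smooth_coind (Q : (Rd -> R) -> Prop) f : Q f ->
  (forall g, Q g -> continuous g /\ forall j, exists2 g', Q g' &
    forall x, is_derive x (delta_mx 0 j) g (g' x)) -> smooth f.
Proof.
move=> Qf hQ k; elim: k f Qf => [|k IH] f Qf; have [cf df] := hQ _ Qf.
  by split=> //; exact: continuous_subspaceT.
split; first exact: continuous_subspaceT.
move=> j; have [g' Qg' hg'] := df j; exists g'; last exact: IH.
by move=> x _; have [h1 h2] := hg' x.
Qed.

Lemma is_derive_coord (phi : R -> R) (c e : R) (i j : 'I_d) (x : Rd) (l : R) :
  is_derive (c * x 0 j + e) 1 phi l ->
  is_derive x (delta_mx 0 i) (fun x => phi (c * x 0 j + e)) (c * (i == j)%:R * l).
Proof.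
move=> hphi; pose D : R := (i == j)%:R.
pose q (h : R) := c * (h * D + x 0 j) + e.
have q0 : q 0 = c * x 0 j + e by rewrite /q mul0r add0r.
have dq : is_derive (0 : R) 1 q (c * D).
  apply: is_derive_cvg; apply: cvg_near_cst; near=> h.
  have h0 : h != 0 by near: h; exact: nbhs_dnbhs_neq.
  by rewrite /q /GRing.scale/= mulr1 addr0; field.
have dpq : is_derive (0 : R) 1 (phi \o q) (l * (c * D)).
  by apply: is_derive1_comp; rewrite q0.
have -> : c * D * l = l * (c * D) by rewrite mulrC.
apply: is_derive_cvg; have [cl <-] := dpq.
rewrite (_ : (fun h : R => _) =
  (fun h : R => h^-1 *: ((phi \o q \o shift 0) (h *: 1) - (phi \o q) 0))); first exact: cl.
apply/funext => h; rewrite /= !mxE eqxx/= addr0 /q mul0r add0r.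
by rewrite /GRing.scale/= mulr1 eq_sym.
Unshelve. all: by end_near. Qed.

(** A class large enough to contain the bumps and stable under differentiation, to
    which [smooth_coind] applies; with [El_smooth] it also gives the algebra of
    smooth functions. *)
Inductive elementary : (Rd -> R) -> Prop :=
| El_smooth f : smooth f -> elementary f
| El_cst c : elementary (cst c)
| El_flat n c e j : elementary (fun x => flat n (c * x 0 j + e))
| El_add f g : elementary f -> elementary g -> elementary (f + g)
| El_mul f g : elementary f -> elementary g -> elementary (f * g).

Lemma elementary_smooth f : elementary f -> smooth f.
Proof.
move=> Ef; apply: (@smooth_coind elementary) => // {Ef f} f.
elim=> {f} [f sf|c|n c e j|f g _ [cf df] _ [cg dg]|f g Ef [cf df] Eg [cg dg]].
- split=> [|j]; first exact: smooth_continuous.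
  exists (partial j f); first by apply: El_smooth; exact: smooth_partial.
  by move=> x; exact: smooth_is_derive.
- split=> [|j]; first by move=> x; exact: cst_continuous.
  by exists (cst 0) => [|x]; [exact: El_cst|exact: is_derive_cst].
- split=> [x|i].
    apply: (@continuous_comp _ _ _ (fun x : Rd => c * x 0 j + e) (flat n)).
      have h : continuous (fun x : Rd => c * x 0 j + e).
        move=> y; have hj : (fun x : Rd => x 0 j) @ y --> (y 0 j : R) by exact: coord_continuous.
        exact: (@cvgD _ _ _ (nbhs y) _ _ _ _ _ (@cvgM _ _ (nbhs y) _ _ _ _ _ (cvg_cst c) hj) (cvg_cst e)).
      exact: h.
    exact: continuous_flat.
  exists (cst (c * (i == j)%:R) * ((fun x => flat n.+2 (c * x 0 j + e)) +
    cst (- n%:R) * (fun x => flat n.+1 (c * x 0 j + e)))).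
    apply: El_mul; first exact: El_cst.
    by apply: El_add; [exact: El_flat|apply: El_mul; [exact: El_cst|exact: El_flat]].
  move=> x; apply: is_derive_coord.
  have := is_derive_flat n (c * x 0 j + e).
  by rewrite -mulNr.
- split=> [x|j]; first exact: (@cvgD _ _ _ (nbhs x) _ _ _ _ _ (cf x) (cg x)).
  have [f' Ef' hf] := df j; have [g' Eg' hg] := dg j.
  by exists (f' + g') => [|x]; [exact: El_add|exact: is_deriveD].
- split=> [x|j]; first exact: (@cvgM _ _ (nbhs x) _ _ _ _ _ (cf x) (cg x)).
  have [f' Ef' hf] := df j; have [g' Eg' hg] := dg j.
  exists (f * g' + g * f') => [|x]; first by apply: El_add; exact: El_mul.
  exact: is_deriveM.
Qed.

Lemma smoothD f g : smooth f -> smooth g -> smooth (f + g).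
Proof. by move=> sf sg; apply/elementary_smooth/El_add; exact: El_smooth. Qed.

Lemma smoothZ c f : smooth f -> smooth (c *: f).
Proof.
move=> sf; rewrite (_ : c *: f = cst c * f)//.
by apply/elementary_smooth/El_mul; [exact: El_cst|exact: El_smooth].
Qed.

Lemma partialP c f g j : smooth f -> smooth g ->
  partial j (c *: f + g) = c *: partial j f + partial j g.
Proof.
move=> sf sg; apply/funext => x.
have hf := smooth_is_derive j x sf; have hg := smooth_is_derive j x sg.
by have [_] := is_deriveD (is_deriveZ c hf) hg.
Qed.

(** Increasing to the indicator of the open box, from inside. *)
Definition box_bump (m : nat) (a b : 'I_d -> R) : Rd -> R := fun x =>
  \prod_(j < d) (flat 0 (m.+1%:R * (x 0 j - a j)) * flat 0 (m.+1%:R * (b j - x 0 j))).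

Lemma smooth_bump m a b : smooth (box_bump m a b).
Proof.
apply: elementary_smooth; rewrite /box_bump.
rewrite (_ : (fun x => _) = \prod_(j < d)
  ((fun x : Rd => flat 0 (m.+1%:R * x 0 j + (- (m.+1%:R * a j)))) *
   (fun x : Rd => flat 0 ((- m.+1%:R) * x 0 j + m.+1%:R * b j)))); last first.
  apply/funext => x; rewrite fct_prodE; apply: eq_bigr => j _ /=.
  by congr (flat _ _ * flat _ _); ring.
elim/big_ind: _ => [|f g Ef Eg|j _]; [exact: El_cst|exact: El_mul|].
by apply: El_mul; exact: El_flat.
Qed.

Definition box (a b : 'I_d -> R) : set Rd := [set x | forall j, a j < x 0 j < b j].
Definition cbox (a b : 'I_d -> R) : set Rd := [set x | forall j, a j <= x 0 j <= b j].

Lemma bump_ge0 m a b x : 0 <= box_bump m a b x.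
Proof. by apply: prodr_ge0 => j _; rewrite mulr_ge0 ?flat0_ge0. Qed.

Lemma bump_le1 m a b x : box_bump m a b x <= 1.
Proof.
rewrite /box_bump; apply: prodr_ile1 => j _.
by rewrite mulr_ge0 ?flat0_ge0//= mulr_ile1 ?flat0_ge0 ?flat0_le1.
Qed.

Lemma bump_out m a b x : ~ box a b x -> box_bump m a b x = 0.
Proof.
move=> /existsNP[j] /negP; rewrite negb_and -!leNgt => h.
apply/eqP/prodf_eq0; exists j => //; rewrite mulf_eq0; apply/orP.
by case/orP: h => h; [left|right]; rewrite flat_le0// pmulr_rle0// subr_le0.
Qed.

Lemma cvg_bump a b x : box a b x -> box_bump m a b x @[m --> \oo] --> (1 : R).
Proof.
move=> xab; rewrite -[X in _ --> X](@big1_eq R 1 *%R 'I_d (index_enum _) xpredT).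
apply: cvg_big => [|j _]; first exact: mul_continuous.
rewrite -[X in _ --> X]mulr1.
by have /andP[h1 h2] := xab j; apply: cvgM; apply: cvg_flat0; rewrite subr_gt0.
Qed.

Lemma compact_cbox a b : compact (cbox a b).
Proof.
have := @rV_compact R d (fun j => `[a j, b j]%classic) (fun j => @segment_compact R (a j) (b j)).
congr compact; apply/seteqP; split=> x /= h j; have := h j; rewrite ?in_itv//=.
Qed.

Lemma bump_test (O : set Rd) m a b : cbox a b `<=` O -> is_test O (box_bump m a b).
Proof.
move=> abO; split; first exact: smooth_bump.
exists (cbox a b); split=> //; first exact: compact_cbox.
move=> x nx; apply: bump_out => h; apply: nx => j.
by have /andP[h1 h2] := h j; rewrite !ltW.
Qed.

(** The countability of this base allows almost everywhere statements on all boxes. *)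
Lemma rational_box (O : set Rd) (x : Rd) : open O -> O x ->
  exists ab : {ffun 'I_d -> rat * rat},
    box (fun j => ratr (ab j).1) (fun j => ratr (ab j).2) x /\
    cbox (fun j => ratr (ab j).1) (fun j => ratr (ab j).2) `<=` O.
Proof.
move=> oO Ox; have /nbhs_ballP[e /= e0 eO] := open_nbhs_nbhs (conj oO Ox).
have /choice[p hp] : forall j, exists p : rat * rat,
    (x 0 j - e < ratr p.1 < x 0 j) /\ (x 0 j < ratr p.2 < x 0 j + e).
  move=> j; have /rat_in_itvoo[q1 h1] : x 0 j - e < x 0 j by lra.
  have /rat_in_itvoo[q2 h2] : x 0 j < x 0 j + e by lra.
  by exists (q1, q2); move: h1 h2; rewrite !in_itv.
exists [ffun j => p j]; split.
  by move=> j; rewrite !ffunE; have [/andP[_ ->] /andP[-> _]] := hp j.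
move=> y hy; apply: eO; split=> // i j; rewrite ord1.
have := hy j; rewrite !ffunE => /andP[h1 h2].
have [/andP[h3 h4] /andP[h5 h6]] := hp j.
rewrite /ball/= ltr_norml; lra.
Qed.

End smooth_functions.

(** * Lebesgue measure on row vectors *)

Section row_vectors.
Context {R : realType} {d : nat}.
Local Notation Rd := 'rV[R]_d.
Local Notation T := (d.-tuple (measurableTypeR R)).
Local Notation mu := (lebesgue_tuple (R := R) d).
Local Notation ratbox ab :=
  (box (fun j => ratr (ab j).1) (fun j => ratr (ab j).2)).

Lemma measurable_box (a b : 'I_d -> R) : measurable (pt @^-1` box a b : set T).
Proof.
rewrite (_ : _ @^-1` _ = \bigcap_(j in [set: 'I_d]) ((fun t : T => tnth t j) @^-1` `]a j, b j[)); last first.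
  apply/seteqP; split=> t /= h.
    by move=> j _; have := h j; rewrite mxE /= in_itv.
  by move=> j; have := h j Logic.I; rewrite mxE /= in_itv.
apply: fin_bigcap_measurable => [|j _]; first exact: finite_finset.
rewrite -[X in measurable X]setTI.
by apply: (@measurable_tnth _ (measurableTypeR R)) => //; exact: measurable_itv.
Qed.

Lemma open_measurable_pt (O : set Rd) : open O -> measurable (pt @^-1` O : set T).
Proof.
move=> oO.
pose A (ab : {ffun 'I_d -> rat * rat}) : set T :=
  if `[< cbox (fun j => ratr (ab j).1 : R) (fun j => ratr (ab j).2) `<=` O >]
  then pt @^-1` ratbox ab else set0.
rewrite (_ : pt @^-1` O = \bigcup_n (oapp A set0 (unpickle n))).
  apply: bigcupT_measurable => n; case: (unpickle n) => [ab|] //=.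
  by rewrite /A; case: asboolP => // _; exact: measurable_box.
apply/seteqP; split=> [t /= Ot|t [n _]].
  have [ab [h1 h2]] := rational_box oO Ot.
  by exists (pickle ab) => //; rewrite pickleK/= /A asboolT.
case: (unpickle n) => [ab|] //=; rewrite /A; case: asboolP => // h hb.
by apply: h => j; have /andP[h1 h2] := hb j; rewrite !ltW.
Qed.

Lemma continuous_measurable_pt (f : Rd -> R) (D : set T) : measurable D ->
  continuous f -> measurable_fun D (f \o pt).
Proof.
move=> mD cf; apply: (@measurable_funS _ _ _ _ setT) => //.
apply: (measurability _ (RGenOInfty.measurableE R)).
move=> /= _ [_ [a ->]] <-; rewrite setTI comp_preimage.
by apply: open_measurable_pt; move/continuousP : cf; apply; exact: rray_open.
Qed.

(** The pi-system for the Dynkin induction of [fundamental_bumps]. *)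
Definition boxes : set (set T) := [set A | exists a b, A = pt @^-1` box a b].

Lemma boxes_setI : setI_closed boxes.
Proof.
move=> _ _ [a [b ->]] [a' [b' ->]].
exists (fun j => Num.max (a j) (a' j)), (fun j => Num.min (b j) (b' j)).
apply/seteqP; split=> t /=.
  move=> [h h'] j; have := h j; have := h' j; rewrite gt_max lt_min.
  by move=> /andP[-> ->] /andP[-> ->].
by move=> h; split=> j; have := h j; rewrite gt_max lt_min => /andP[/andP[? ?] /andP[? ?]]; apply/andP.
Qed.

Lemma boxes_generate : (measurable : set (set T)) = <<s boxes >>.
Proof.
rewrite eqEsubset; split; last first.
  apply: smallest_sub; first exact: sigma_algebra_measurable.
  by move=> _ [a [b ->]]; exact: measurable_box.
apply: smallest_sub; first exact: smallest_sigma_algebra.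
elim/big_ind: _ => [A []//|P Q hP hQ A [/hP|/hQ]//|j _].
rewrite [X in preimage_set_system _ _ X](RGenOInfty.measurableE R) -g_sigma_preimageE.
apply: smallest_sub; first exact: smallest_sigma_algebra.
move=> _ [_ [x ->] <-]; rewrite setTI.
rewrite (_ : _ @^-1` _ = \bigcup_n pt @^-1` box
    (fun i => if i == j then x else - n%:R) (fun=> n%:R)).
  have [_ _ bigcup_boxes] := smallest_sigma_algebra setT boxes.
  apply: bigcup_boxes => n.
  by apply: sub_sigma_algebra; eexists; eexists.
apply/seteqP; split=> t /=.
  rewrite in_itv/= andbT => xt.
  pose M := \big[Num.max/0]_(i < d) `|tnth t i|.
  exists (Num.truncn M).+1 => //= i; rewrite mxE.
  have : `|tnth t i| < (Num.truncn M).+1%:R.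
    apply: le_lt_trans (truncnS_gt _); exact: le_bigmax.
  by rewrite ltr_norml => /andP[]; case: eqP => [->|_] h1 h2; apply/andP.
by move=> [n _ /(_ j)]; rewrite eqxx mxE in_itv/= andbT => /andP[].
Qed.

End row_vectors.

Section bounded_sets.
Context {R : realType}.

Lemma lebesgue_cube n (M : R) :
  measurable [set t : n.-tuple (measurableTypeR R) | forall j, `|tnth t j| <= M] /\
  (lebesgue_tuple n [set t : n.-tuple (measurableTypeR R) | forall j, (`|tnth t j| <= M)%R] < +oo)%E.
Proof.
have mC k : measurable [set t : k.-tuple (measurableTypeR R) | forall j, `|tnth t j| <= M].
  rewrite (_ : [set t | _] = \bigcap_(j in [set: 'I_k]) ((fun t : k.-tuple (measurableTypeR R) => tnth t j) @^-1` `[- M, M])); last first.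
    apply/seteqP; split=> t /= h.
      by move=> j _; have := h j; rewrite /= in_itv/= ler_norml.
    by move=> j; have := h j Logic.I; rewrite /= in_itv/= ler_norml.
  apply: fin_bigcap_measurable => [|j _]; first exact: finite_finset.
  rewrite -[X in measurable X]setTI.
  by apply: (@measurable_tnth _ (measurableTypeR R)) => //; exact: measurable_itv.
split; first exact: mC.
elim: n => [|n IH]; first by rewrite /= diracE; case: (_ \in _); rewrite ltry.
rewrite /= /lebesgue_step /pushforward.
rewrite (_ : _ @^-1` _ = `[- M, M]%classic `*` [set t : n.-tuple (measurableTypeR R) | forall j, `|tnth t j| <= M]).
  rewrite product_measure1E//=; last exact: (mC n).
  apply: lte_mul_pinfty => //; last by rewrite lebesgue_measure_itv; case: ifP.
apply/seteqP; split=> [[x t]|[x t]] /=.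
  move=> h; split; first by have := h ord0; rewrite in_itv/= -ler_norml tnth0.
  by move=> j; have := h (lift ord0 j); rewrite tnthS.
rewrite in_itv/= -ler_norml => -[h1 h2] j.
by case: (unliftP ord0 j) => [i ->|->]; rewrite ?tnth0 ?tnthS.
Qed.

End bounded_sets.

Section fundamental_lemma.
Context {R : realType} {d : nat}.
Local Notation Rd := 'rV[R]_d.
Local Notation T := (d.-tuple (measurableTypeR R)).
Local Notation mu := (lebesgue_tuple (R := R) d).
Variable O : set Rd.
Hypotheses (oO : open O) (bO : bounded_set O).
Local Notation D := (pt @^-1` O : set T).

Lemma bounded_coord : exists2 M : R, 0 < M & forall x, O x -> forall j, `|x 0 j| <= M.
Proof.
have [M [_ hM]] := bO; exists (`|M| + 1); first by rewrite ltr_wpDl.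
move=> x Ox j; have M1 : M < `|M| + 1 by rewrite (le_lt_trans (ler_norm M))// ltrDl.
apply: le_trans (hM _ M1 x Ox); rewrite [leRHS]mx_normrE.
exact: (le_bigmax _ (fun ij : 'I_1 * 'I_d => `|x ij.1 ij.2|) (0, j)).
Qed.

Let mD : measurable D := open_measurable_pt oO.

Lemma domain_finite : (mu D < +oo)%E.
Proof.
have [M M0 hM] := bounded_coord; have [mC fC] := @lebesgue_cube R d M.
apply: le_lt_trans fC; apply: le_measure; rewrite ?inE//.
by move=> t /= Ot j; have := hM _ Ot j; rewrite mxE.
Qed.

Lemma sqint_bounded (f : T -> R) (C : R) : measurable_fun D f ->
  (forall t, D t -> `|f t| <= C) -> sqint mu D f.
Proof.
move=> mf fC; apply: (@sqint_le _ _ _ mu D mD f (cst C)) => //.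
  split; first exact: measurable_cst.
  rewrite (eq_integral (cst (C ^+ 2)%:E))// integral_cst//.
  have := domain_finite; have := measure_ge0 mu D.
  by move=> h1 h2; apply: lte_mul_pinfty => //; rewrite lee_fin sqr_ge0.
by move=> t Dt; rewrite (le_trans (fC t Dt))// ler_norm.
Qed.

Lemma sqint_int (f : T -> R) : sqint mu D f -> mu.-integrable D (EFin \o f).
Proof.
move=> Hf; have H1 : sqint mu D (cst 1).
  by apply: (@sqint_bounded _ 1) => [|t _]; [exact: measurable_cst|rewrite normr1].
have := sqint_prod mD Hf H1; congr (mu.-integrable _ _).
by apply/funext => t /=; rewrite mulr1.
Qed.

(** The bumps converge boundedly to the indicator of the box. *)
Lemma bump_integral (g : T -> R) (a b : 'I_d -> R) : sqint mu D g ->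
  (forall m, ip2 mu D g (box_bump m a b \o pt) = 0) -> cbox a b `<=` O ->
  (\int[mu]_(t in pt @^-1` box a b) (g t)%:E = 0)%E.
Proof.
move=> Hg g0 abO.
have mbox := measurable_box a b.
have bD : pt @^-1` box a b `<=` D.
  by move=> t h; apply: abO => j; have /andP[h1 h2] := h j; rewrite !ltW.
have ig := sqint_int Hg; have mg : measurable_fun D g by case: Hg.
have mv m : measurable_fun D (box_bump m a b \o pt).
  by apply: continuous_measurable_pt => //; apply: smooth_continuous; exact: smooth_bump.
have [|||||_ _] := @dominated_convergence _ _ _ mu D mD
  (fun m t => (g t * box_bump m a b (pt t))%:E)
  (fun t => (g t * \1_(pt @^-1` box a b) t)%:E) (fun t => `|(g t)%:E|)%E.
- by move=> m; apply/measurable_EFinP; exact: (measurable_funM mg (mv m)).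
- by apply/measurable_EFinP; apply: measurable_funM => //; exact: measurable_indic.
- apply: aeW => t Dt; apply: cvg_EFin; first exact: nearW.
  rewrite (_ : _ \o _ = (fun m => g t * box_bump m a b (pt t)))//.
  apply: cvgM; first exact: cvg_cst.
  rewrite indicE; have [h|h] := pselect (box a b (pt t)).
    by rewrite mem_set//=; exact: cvg_bump.
  rewrite memNset//= (_ : (fun m => _) = cst 0); first exact: cvg_cst.
  by apply/funext => m; rewrite bump_out.
- exact: integrable_abse.
- apply: aeW => t m Dt; rewrite lee_fin normrM ler_piMr//.
  by rewrite ger0_norm ?bump_ge0// bump_le1.
rewrite (_ : (fun _ => _) = cst 0%E); last first.
  apply/funext => m /=; rewrite -(fineK (integrable_fin_num mD (sqint_prod mD Hg _))).
    by have := g0 m; rewrite /ip2 /Rintegral => ->.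
  apply: (@sqint_bounded _ 1) => [|t _]; first exact: (mv m).
  by rewrite /= ger0_norm ?bump_ge0// bump_le1.
move=> h; have := cvg_unique (@ereal_hausdorff R) h (cvg_cst 0%E).
move=> E; rewrite -(setIidr bD) integral_mkcondr -[RHS](E _ _).
apply: eq_integral => t _; rewrite patchE indicE.
by case: ifP => _; rewrite ?mulr1 ?mulr0.
Qed.

(** The integral of [g] vanishes on the boxes inside [O], hence, by Dynkin
    induction, on the measurable subsets of each of them. *)
Lemma fundamental_bumps (g : T -> R) : sqint mu D g ->
  (forall m a b, cbox a b `<=` O -> ip2 mu D g (box_bump m a b \o pt) = 0) ->
  {ae mu, forall t, D t -> g t = 0}.
Proof.
move=> Hg g0; have ig := sqint_int Hg; have mg : measurable_fun D g by case: Hg.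
pose B (ab : {ffun 'I_d -> rat * rat}) : set T :=
  pt @^-1` box (fun j => ratr (ab j).1 : R) (fun j => ratr (ab j).2).
pose C (ab : {ffun 'I_d -> rat * rat}) : set Rd :=
  cbox (fun j => ratr (ab j).1 : R) (fun j => ratr (ab j).2).
have mB ab : measurable (B ab) by exact: measurable_box.
have BD ab : C ab `<=` O -> B ab `<=` D.
  by move=> h t Bt; apply: h => j; have /andP[h1 h2] := Bt j; rewrite !ltW.
have igS A : measurable A -> A `<=` D -> mu.-integrable A (EFin \o g).
  by move=> mA AD; exact: integrableS ig.
have key ab : C ab `<=` O -> forall A, measurable A ->
    (\int[mu]_(t in A `&` B ab) (g t)%:E = 0)%E.
  move=> CO A; rewrite [X in X A -> _]boxes_generate => mA.
  have ID X : X `&` B ab `<=` D by move=> t [_ Bt]; exact: BD Bt.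
  apply: (@dynkin_induction _ _ boxes (fun A => \int[mu]_(t in A `&` B ab) (g t)%:E = 0)%E
    boxes_generate boxes_setI) mA => {A}.
  - by rewrite setTI; apply: bump_integral => // m; exact: g0.
  - move=> _ [a [b ->]].
    have -> : pt @^-1` box a b `&` B ab = pt @^-1` box
      (fun j => Num.max (a j) (ratr (ab j).1)) (fun j => Num.min (b j) (ratr (ab j).2)).
      apply/seteqP; split=> t /=.
        move=> [h h'] j; have := h j; have := h' j; rewrite gt_max lt_min.
        by move=> /andP[-> ->] /andP[-> ->].
      by move=> h; split=> j; have := h j; rewrite gt_max lt_min => /andP[/andP[? ?] /andP[? ?]]; apply/andP.
    set a' := fun j : 'I_d => Num.max _ _; set b' := fun j : 'I_d => Num.min _ _.
    have sub : cbox a' b' `<=` O.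
      move=> x hx; apply: CO => j; have := hx j.
      by rewrite ge_max le_min => /andP[/andP[_ ->] /andP[_ ->]].
    by apply: bump_integral => // m; exact: g0.
  - move=> S mS S0; have mSB : measurable (S `&` B ab) by exact: measurableI.
    have mCB : measurable (~` S `&` B ab) by apply: measurableI => //; exact: measurableC.
    have E : B ab = (S `&` B ab) `|` (~` S `&` B ab).
      by rewrite -setIUl setUv setTI.
    have : (\int[mu]_(t in B ab) (g t)%:E = 0)%E by apply: bump_integral => // m; exact: g0.
    rewrite {1}E integral_setU_EFin//.
    + by rewrite S0 add0e.
    + by rewrite -E; apply/measurable_EFinP; apply: (measurable_int mu); apply: igS => //; exact: BD.
    + by apply/disj_setPS => t [[? _] []].
  - move=> F mF tF F0; rewrite setI_bigcupl integral_bigcup.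
    + by rewrite eseries0// => i _ _; exact: F0.
    + by apply: trivIset_setIr.
    + by move=> k; exact: measurableI.
    + by apply: igS; [apply: bigcupT_measurable => k; exact: measurableI|move=> t [k _ [_ Bt]]; exact: (BD _ CO _ Bt)].
have aeB ab : C ab `<=` O -> {ae mu, forall t, B ab t -> g t = 0}.
  move=> CO; have : ae_eq mu (B ab) (EFin \o g) (cst 0%E).
    apply: integral_ae_eq => //; first by apply: igS => //; exact: BD.
    move=> E EB mE; rewrite integral_cst// mul0e.
    by have := key _ CO E mE; rewrite setIidl.
  by apply: filterS => t /= h Bt; have [] := h Bt.
have : {ae mu, forall t, forall n ab, unpickle n = Some ab -> C ab `<=` O -> B ab t -> g t = 0}.
  apply/ae_foralln => n; case: (unpickle n) => [ab|]; last exact: aeW.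
  have [CO|nCO] := pselect (C ab `<=` O); last by apply: aeW => t ab' [<-].
  by apply: filterS (aeB _ CO) => t h ab' [<-] _.
move=> h; apply: filterS h => t h Dt.
have [ab [h1 h2]] := rational_box oO Dt.
by apply: (h (pickle ab) ab) => //; rewrite pickleK.
Qed.

(** The fundamental lemma of the calculus of variations, in [L^2]. *)
Lemma fundamental_lemma (g : T -> R) : sqint mu D g ->
  (forall v, is_test O v -> ip2 mu D g (v \o pt) = 0) ->
  {ae mu, forall t, D t -> g t = 0}.
Proof.
move=> Hg g0; apply: fundamental_bumps => // m a b abO.
by apply: g0; exact: bump_test.
Qed.

End fundamental_lemma.

(** * Test functions and the Poincare inequality *)

Lemma semi_inner_sum {R : realType} {V : lmodType R} (I : finType) (S : I -> set V)
  (a : I -> V -> V -> R) : (forall i, semi_inner (S i) (a i)) ->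
  semi_inner (fun u => forall i, S i u) (fun u v => \sum_i a i u v).
Proof.
move=> h; split.
- by move=> i; exact: si0 (h i).
- by move=> c u v Su Sv i; apply: siP (h i) _ _ _ _ _.
- move=> c u v w Su Sv Sw; rewrite mulr_sumr -big_split/=.
  by apply: eq_bigr => i _; apply: siL (h i) _ _ _ _ _ _ _.
- by move=> u v Su Sv; apply: eq_bigr => i _; apply: siC (h i) _ _ _ _.
- by move=> u Su; apply: sumr_ge0 => i _; apply: si_ge0 (h i) _ _.
Qed.

(** The inner products of functions, of vector fields and of gradients all arise
    from that of [L^2] by linear maps and finite sums. *)
Lemma semi_inner_pull {R : realType} {V W : lmodType R} (S : set W)
  (a : W -> W -> R) (Q : set V) (L : V -> W) : semi_inner S a ->
  Q 0 -> (forall c u v, Q u -> Q v -> Q (c *: u + v)) ->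
  (forall u, Q u -> S (L u)) ->
  (forall c u v, Q u -> Q v -> L (c *: u + v) = c *: L u + L v) ->
  semi_inner Q (fun u v => a (L u) (L v)).
Proof.
move=> h Q0 QP QS LL; split=> //.
- by move=> c u v w Qu Qv Qw; rewrite LL// (siL h)//; exact: QS.
- by move=> u v Qu Qv; apply: (siC h); exact: QS.
- by move=> u Qu; apply: (si_ge0 h); exact: QS.
Qed.

Section test_functions.
Context {R : realType} {d : nat}.
Local Notation Rd := 'rV[R]_d.
Local Notation T := (d.-tuple (measurableTypeR R)).
Local Notation mu := (lebesgue_tuple (R := R) d).
Variable O : set Rd.
Implicit Types u v : Rd -> R.

Lemma test_smooth v : is_test O v -> smooth v. Proof. by case. Qed.

Lemma test_out v x : is_test O v -> ~ O x -> v x = 0.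
Proof. by move=> [_ [C [_ CO hC]]] nO; apply: hC => /CO. Qed.

Lemma test_P c u v : is_test O u -> is_test O v -> is_test O (c *: u + v).
Proof.
move=> [su [C [cC CO hC]]] [sv [C' [cC' CO' hC']]]; split.
  by apply: smoothD => //; exact: smoothZ.
exists (C `|` C'); split; first exact: compactU.
  by move=> x [/CO|/CO'].
move=> x /not_orP[nC nC']; have -> : (c *: u + v) x = c * u x + v x by [].
by rewrite hC// hC'// mulr0 addr0.
Qed.

Lemma test0 : is_test O 0.
Proof.
split; last by exists set0; split=> //; exact: compact0.
by apply: elementary_smooth; exact: El_cst.
Qed.

Lemma test_partial j v : is_test O v -> is_test O (partial j v).
Proof.
move=> [sv [C [cC CO hC]]]; split; first exact: smooth_partial.
exists C; split=> // x nC.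
have oC : open (~` C) by apply: closed_openC; apply: compact_closed => //; exact: norm_hausdorff.
have nx : \forall y \near x, v y = cst 0 y.
  have /open_nbhs_nbhs := conj oC (nC : (~` C) x).
  by apply: filterS => y /hC.
by rewrite /partial (near_eq_derive _ nx) derive_cst.
Qed.

Lemma test_bounded v : is_test O v -> exists2 C : R, 0 <= C & forall x, `|v x| <= C.
Proof.
move=> [sv [C [cC CO hC]]].
have : compact (v @` C).
  apply: continuous_compact => //; apply: continuous_subspaceT.
  exact: smooth_continuous.
move=> /compact_bounded [M [_ hM]]; exists (`|M| + 1); first by rewrite addr_ge0.
move=> x; have [Cx|nCx] := pselect (C x); last by rewrite hC// normr0 addr_ge0.
apply: hM; last by exists x.
by rewrite (le_lt_trans (ler_norm M))// ltrDl.
Qed.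

Hypotheses (oO : open O) (bO : bounded_set O).
Local Notation D := (pt @^-1` O : set T).
Let mD : measurable D := open_measurable_pt oO.

Lemma test_sqint v : is_test O v -> sqint mu D (v \o pt).
Proof.
move=> tv; have [C _ hC] := test_bounded tv.
apply: (@sqint_bounded _ _ O oO bO _ C) => [|t _]; last exact: hC.
apply: continuous_measurable_pt => //; apply: smooth_continuous.
exact: test_smooth.
Qed.

(** The inner products of [L^2], on functions and on vector fields of row
    vectors. *)
Definition L2fun u := sqint mu D (u \o pt).
Definition L2ip u v : R := ip2 mu D (u \o pt) (v \o pt).
Definition L2field (G : 'I_d -> Rd -> R) := forall j, L2fun (G j).
Definition gip (G H : 'I_d -> Rd -> R) : R := \sum_j L2ip (G j) (H j).
Definition grad v : 'I_d -> Rd -> R := fun j => partial j v.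

Lemma L2fun_si : semi_inner L2fun L2ip.
Proof.
apply: (@semi_inner_pull R (Rd -> R) (T -> R) (sqint mu D) (ip2 mu D) L2fun
  (fun u => u \o pt)) => //.
- exact: sqint_semi_inner.
- exact: (si0 (sqint_semi_inner mu mD)).
- by move=> c u v Hu Hv; exact: (siP (sqint_semi_inner mu mD) c Hu Hv).
Qed.

Lemma L2field_si : semi_inner L2field gip.
Proof.
apply: (@semi_inner_sum R ('I_d -> Rd -> R) 'I_d (fun j G => L2fun (G j))
  (fun j G H => L2ip (G j) (H j))) => j.
apply: (@semi_inner_pull R ('I_d -> Rd -> R) (Rd -> R) L2fun L2ip _
  (fun G => G j)) => //.
- exact: L2fun_si.
- exact: (si0 L2fun_si).
- by move=> c u v Hu Hv; exact: (siP L2fun_si c Hu Hv).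
Qed.

Lemma grad_P c u v : is_test O u -> is_test O v ->
  grad (c *: u + v) = c *: grad u + grad v.
Proof.
move=> tu tv; apply/funext => j; rewrite /grad partialP//; exact: test_smooth.
Qed.

Lemma grad_L2 v : is_test O v -> L2field (grad v).
Proof. by move=> tv j; apply: test_sqint; exact: test_partial. Qed.

Lemma test_L2si : semi_inner (is_test O) L2ip.
Proof.
apply: (@semi_inner_pull R _ _ L2fun L2ip (is_test O) id) => //.
- exact: L2fun_si.
- exact: test0.
- exact: test_P.
- exact: test_sqint.
Qed.

Lemma test_gsi : semi_inner (is_test O) (fun u v => gip (grad u) (grad v)).
Proof.
apply: (@semi_inner_pull R _ _ L2field gip (is_test O) grad) => //.
- exact: L2field_si.
- exact: test0.
- exact: test_P.
- exact: grad_L2.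
- exact: grad_P.
Qed.

Lemma intO_gip G H : L2field G -> L2field H ->
  intO O (fun x => \sum_j G j x * H j x) = gip G H.
Proof.
move=> hG hH; rewrite /intO /gip /L2ip /ip2.
have [+ _] : \int[mu]_(t in D) (\sum_(j <- index_enum 'I_d) G j (pt t) * H j (pt t)) =
    \sum_(j <- index_enum 'I_d) \int[mu]_(t in D) (G j (pt t) * H j (pt t)) /\
    mu.-integrable D (EFin \o (fun t => \sum_(j <- index_enum 'I_d) G j (pt t) * H j (pt t))).
  elim: (index_enum 'I_d) => [|j s [IH1 IH2]].
    split; first by rewrite big_nil (@eq_Rintegral _ _ _ mu D (cst 0)) ?Rintegral_cst ?mul0r// => t _; rewrite big_nil.
    rewrite (_ : _ \o _ = cst 0%E); first exact: integrable0.
    by apply/funext => t /=; rewrite big_nil.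
  have ij := sqint_prod mD (hG j) (hH j).
  split.
    under eq_Rintegral do rewrite big_cons.
    by rewrite RintegralD// IH1 big_cons.
  rewrite (_ : _ \o _ = EFin \o (fun t => G j (pt t) * H j (pt t) +
    \sum_(j <- s) G j (pt t) * H j (pt t))); first exact: integrableRD.
  by apply/funext => t /=; rewrite big_cons.
exact.
Qed.

Lemma H10normE v : is_test O v -> H10norm O v = Num.sqrt (gip (grad v) (grad v)).
Proof. by move=> tv; rewrite /H10norm -intO_gip//; exact: grad_L2. Qed.

End test_functions.

Section poincare.
Context {R : realType} {n : nat}.
Local Notation Rd := 'rV[R]_n.+1.
Local Notation T := (n.+1.-tuple (measurableTypeR R)).
Local Notation mu := (lebesgue_tuple (R := R) n.+1).
Variable O : set Rd.
Hypotheses (oO : open O) (bO : bounded_set O).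
Local Notation D := (pt @^-1` O : set T).
Let mD : measurable D := open_measurable_pt oO.

Let pcons (x : R) (t : n.-tuple (measurableTypeR R)) : Rd := pt (tuple_cons (x, t)).

Let pconsE x t : pcons x t = x *: delta_mx 0 ord0 + pcons 0 t.
Proof.
apply/rowP => j; rewrite !mxE eqxx/=.
case: (unliftP ord0 j) => [i ->|->]; rewrite ?tnth0 ?tnthS ?addr0/=.
  by rewrite mulr0 add0r.
by rewrite mulr1.
Qed.

(** The integral of [d/dx_0 (x_0 v^2)] over a line parallel to the first axis
    vanishes, [v] being zero near both ends. *)
Let line_integral (v : Rd -> R) (M : R) (t : n.-tuple (measurableTypeR R)) :
  is_test O v -> 0 < M -> (forall x, O x -> forall j, `|x 0 j| <= M) ->
  (\int[lebesgue_measure]_x ((v (pcons x t)) ^+ 2 +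
     2 * x * v (pcons x t) * partial ord0 v (pcons x t))%:E = 0)%E.
Proof.
move=> tv M0 hM.
pose w x := v (pcons x t); pose w' x := partial ord0 v (pcons x t).
have c_pcons : continuous (fun x => pcons x t).
  rewrite (_ : (fun x => _) = (fun x : R => x *: delta_mx 0 ord0 + pcons 0 t)).
    move=> x; have h : (fun x : R => x *: (delta_mx 0 ord0 : Rd)) @ x --> x *: (delta_mx 0 ord0 : Rd).
      exact: scalel_continuous.
    exact: (@cvgD _ _ _ (nbhs x) _ _ _ _ _ h (cvg_cst (pcons 0 t))).
  by apply/funext => x; exact: pconsE.
have cw : continuous w.
  by move=> x; apply: (@continuous_comp _ _ _ (fun x => pcons x t) v); [exact: c_pcons|exact: (smooth_continuous (test_smooth tv))].
have cw' : continuous w'.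
  move=> x; apply: (@continuous_comp _ _ _ (fun x => pcons x t) (partial ord0 v)); first exact: c_pcons.
  exact: (smooth_continuous (smooth_partial ord0 (test_smooth tv))).
have dw x : is_derive x (1 : R) w (w' x).
  apply: is_derive_cvg.
  have [cl E] := smooth_is_derive ord0 (pcons x t) (test_smooth tv).
  rewrite /w' -E; move: cl; rewrite /derivable /derive => cl.
  rewrite (_ : (fun h : R => _) = (fun h : R => h^-1 *: ((v \o shift (pcons x t)) (h *: delta_mx 0 ord0) - v (pcons x t)))); first exact: cl.
  apply/funext => h /=; rewrite /w [h *: 1]mulr1 pconsE.
  by rewrite [in X in _ = _ *: (v X - _)]pconsE scalerDl addrA.
pose k x := x * (w x * w x); pose k' x := w x ^+ 2 + 2 * x * w x * w' x.
have dk x : is_derive x (1 : R) k (k' x).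
  have := is_deriveM (is_derive_id x (1 : R)) (is_deriveM (dw x) (dw x)).
  rewrite (_ : id * (w * w) = k)// => h; apply: is_derive_eq.
  by rewrite /k' /GRing.scale/=; change ((w * w) x) with (w x * w x); ring.
have ck' : continuous k'.
  move=> x; have h1 : (fun x => w x * w x) @ x --> w x * w x by apply: cvgM; exact: cw.
  have h2 : (fun x : R => 2 * x) @ x --> 2 * x by apply: cvgM; [exact: cvg_cst|exact: cvg_id].
  exact: (cvgD h1 (cvgM (cvgM h2 (cw x)) (cw' x))).
pose N := M + 1.
have w0 x : N <= `|x| -> w x = 0.
  move=> hx; apply: (test_out tv) => Ox; have := hM _ Ox ord0.
  by rewrite mxE tnth0/=; rewrite /N in hx; lra.
have N0 : 0 < N by rewrite /N addr_gt0.
have NN : - N < N by lra.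
rewrite [LHS](_ : _ = \int[lebesgue_measure]_(x in `[(- N)%R, N]) (k' x)%:E)%E; last first.
  rewrite [RHS]integral_mkcond; apply: eq_integral => x _; rewrite patchE.
  case: ifPn => // /negP; rewrite inE/= in_itv/= -ler_norml => /negP; rewrite -ltNge => hx.
  by rewrite -/(w x) w0 ?ltW// expr0n/= mulr0 mul0r addr0.
rewrite (@continuous_FTC2 R k' k)//.
- rewrite /k w0 ?mul0r ?mulr0 ?w0 ?mul0r ?mulr0 ?subee//.
  + by rewrite normrN ger0_norm// ltW.
  + by rewrite ger0_norm// ltW.
- exact: continuous_subspaceT.
- have ck : continuous k.
    by move=> x; apply: differentiable_continuous; apply/derivable1_diffP; have [] := dk x.
  split; [by move=> x _; have [] := dk x|exact: cvg_at_right_filter (ck _)|exact: cvg_at_left_filter (ck _)].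
- by move=> x _; rewrite derive1E; have [_ ->] := dk x.
Qed.

Let P_integral (v : Rd -> R) : is_test O v ->
  \int[mu]_(t in D) (v (pt t) ^+ 2 + 2 * (pt t) 0 ord0 * v (pt t) * partial ord0 v (pt t)) = 0.
Proof.
move=> tv; have [M M0 hM] := bounded_coord bO.
pose h x := v x ^+ 2 + 2 * x 0 ord0 * v x * partial ord0 v x.
have ch : continuous h.
  move=> x; have cv := smooth_continuous (test_smooth tv).
  have cp := smooth_continuous (smooth_partial ord0 (test_smooth tv)).
  have h1 : (fun x : Rd => v x * v x) @ x --> v x * v x.
    exact: (@cvgM _ _ (nbhs x) _ _ _ _ _ (cv x) (cv x)).
  have h0 : (fun x : Rd => x 0 ord0) @ x --> x 0 ord0 by exact: coord_continuous.
  have h2 : (fun x : Rd => 2 * x 0 ord0) @ x --> 2 * x 0 ord0.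
    exact: (@cvgM _ _ (nbhs x) _ _ _ _ _ (cvg_cst _) h0).
  have h3 : (fun x : Rd => 2 * x 0 ord0 * v x) @ x --> 2 * x 0 ord0 * v x.
    exact: (@cvgM _ _ (nbhs x) _ _ _ _ _ h2 (cv x)).
  exact: (@cvgD _ _ _ (nbhs x) _ _ _ _ _ h1 (@cvgM _ _ (nbhs x) _ _ _ _ _ h3 (cp x))).
have h0 x : ~ O x -> h x = 0.
  by move=> nO; rewrite /h (test_out tv nO) expr0n/= mulr0 mul0r addr0.
have mh : measurable_fun setT (fun t : T => (h (pt t))%:E).
  by apply/measurable_EFinP; exact: continuous_measurable_pt.
have ih : mu.-integrable D (fun t => (h (pt t))%:E).
  have [C C0 hC] := test_bounded tv; have [C' C'0 hC'] := test_bounded (test_partial ord0 tv).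
  apply: (@sqint_int _ _ O oO bO); apply: (@sqint_bounded _ _ O oO bO _ (C ^+ 2 + 2 * M * C * C')).
    exact: continuous_measurable_pt.
  move=> t Dt; apply: (le_trans (ler_normD _ _)); apply: lerD.
    by rewrite normrX ler_pXn2r ?nnegrE.
  rewrite !normrM; apply: ler_pM => //; apply: ler_pM => //.
  by rewrite ger0_norm// ler_pM2l//; exact: hM.
have ihT : mu.-integrable setT (fun t => (h (pt t))%:E).
  rewrite integrable_mkcond// in ih.
  move: ih; congr (mu.-integrable _ _); apply/funext => t; rewrite patchE.
  by case: ifPn => // /negP; rewrite inE => nO; rewrite h0.
rewrite /Rintegral (_ : (\int[mu]_(t in D) _)%E = (\int[mu]_t (h (pt t))%:E)%E); last first.
  rewrite integral_mkcond; apply: eq_integral => t _; rewrite patchE.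
  by case: ifPn => // /negP; rewrite inE => nO; rewrite h0.
have ihP : (lebesgue_measure \x lebesgue_tuple n)%E.-integrable setT
    (fun p => (h (pt (tuple_cons p)))%:E).
  apply/integrableP; split.
    by apply: (measurableT_comp mh); exact: measurable_tuple_cons.
  have /integrableP[_] := ihT.
  rewrite [X in (X < _)%E -> _](@ge0_integral_pushforward _ _ _ _ _ (@tuple_cons R n)
     (@measurable_tuple_cons R n) (lebesgue_measure \x lebesgue_tuple n)%E setT
     (fun t => `|(h (pt t))%:E|)%E)//.
  exact: measurableT_comp.
rewrite [X in fine X](@integral_pushforward _ _ _ _ _ (@tuple_cons R n)
     (@measurable_tuple_cons R n) (lebesgue_measure \x lebesgue_tuple n)%E setT
     (fun t => (h (pt t))%:E))//.
rewrite preimage_setT -(integral21_prod_meas1 ihP).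
rewrite (eq_integral (cst 0%E)) ?integral0//= => t _.
rewrite /fubini_G -[RHS](@line_integral v M t tv M0 hM); apply: eq_integral => x _.
by rewrite /h [(pt _) 0 ord0]mxE tnth0.
Qed.

(** By [P_integral], [|v|^2 = - 2 <v, x_0 d_0 v>], and [x_0] is bounded on [O]. *)
Lemma poincare : exists2 C : R, 0 <= C & forall v, is_test O v ->
  Num.sqrt (L2ip O v v) <= C * H10norm O v.
Proof.
have [M M0 hM] := bounded_coord bO; exists (2 * M); first by rewrite mulr_ge0// ltW.
move=> v tv; have SI := sqint_semi_inner mu mD.
have Hv := test_sqint oO bO tv; have Hp := test_sqint oO bO (test_partial ord0 tv).
pose xp : T -> R := fun t => (pt t) 0 ord0 * partial ord0 v (pt t).
have mc : measurable_fun D (fun t : T => (pt t) 0 ord0).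
  by apply: (@continuous_measurable_pt _ _ (fun x : Rd => x 0 ord0)) => //; exact: coord_continuous.
have Hxp : sqint mu D xp.
  apply: (@sqint_le _ _ _ mu D mD xp (M *: (partial ord0 v \o pt))).
  - by apply: measurable_funM => //; case: Hp.
  - exact: (siZ SI M Hp).
  - move=> t Dt; have -> : (M *: (partial ord0 v \o pt)) t = M * partial ord0 v (pt t) by [].
    by rewrite !normrM ler_wpM2r// (le_trans (hM _ Dt ord0))// ler_norm.
have xpM : nrm2 mu D xp <= M * nrm2 mu D (partial ord0 v \o pt).
  rewrite -(ger0_norm (ltW M0)) -(si_nrmZ SI)//; apply: ler_wsqrtr.
  apply: le_Rintegral => //; [exact: sqint_prod|apply: sqint_prod => //; exact: (siZ SI)|].
  move=> t Dt; have -> : (M *: (partial ord0 v \o pt)) t = M * partial ord0 v (pt t) by [].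
  rewrite -!expr2 -(real_normK (num_real (xp t))) -(real_normK (num_real (M * _))).
  by rewrite ler_pXn2r ?nnegrE// !normrM ler_wpM2r// (le_trans (hM _ Dt ord0))// ler_norm.
have E : L2ip O v v = - 2 * ip2 mu D (v \o pt) xp.
  have := P_integral tv.
  rewrite (@eq_Rintegral _ _ _ mu D (fun t => v (pt t) * v (pt t) + 2 * (v (pt t) * xp t))); last first.
    by move=> t _; rewrite /xp; ring.
  rewrite RintegralD//; last 2 first.
  - exact: (sqint_prod mD Hv Hv).
  - by apply: integrableRZ => //; exact: (sqint_prod mD Hv Hxp).
  rewrite RintegralZl//; last exact: (sqint_prod mD Hv Hxp).
  by rewrite /L2ip /ip2; move: (\int[_]_(_ in _) _) => a; move: (\int[_]_(_ in _) _) => b; rewrite -/(ip2 _ _ _ _); lra.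
have CS := si_CS SI Hv Hxp.
have gle : nrm2 mu D (partial ord0 v \o pt) <= H10norm O v.
  rewrite (H10normE oO bO tv) /gip; apply: ler_wsqrtr.
  rewrite (bigD1 ord0)//= lerDl; apply: sumr_ge0 => j _.
  by apply: (si_ge0 SI); exact: (test_sqint oO bO (test_partial j tv)).
have [v0|v0] := eqVneq (Num.sqrt (L2ip O v v)) 0.
  by rewrite v0 !mulr_ge0 ?sqrtr_ge0// ltW.
have vp : 0 < Num.sqrt (L2ip O v v) by rewrite lt0r v0 sqrtr_ge0.
rewrite -(ler_pM2l vp) -expr2 (si_sqr SI Hv) -/(L2ip O v v) [leLHS]E.
apply: le_trans (ler_norm _) _; rewrite normrM normrN (@ger0_norm _ 2)//.
apply: (@le_trans _ _ (2 * (Num.sqrt (L2ip O v v) * nrm2 mu D xp))).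
  by rewrite ler_pM2l.
set s := Num.sqrt _.
rewrite (_ : s * (2 * M * H10norm O v) = 2 * (s * (M * H10norm O v))); last by ring.
by rewrite !ler_pM2l//; apply: (le_trans xpM); rewrite ler_pM2l.
Qed.

End poincare.

(** * The dual space as a Hilbert space *)

Section L2_functions.
Context {R : realType} {d : nat}.
Local Notation Rd := 'rV[R]_d.
Local Notation T := (d.-tuple (measurableTypeR R)).
Local Notation mu := (lebesgue_tuple (R := R) d).
Variable O : set Rd.
Hypotheses (oO : open O) (bO : bounded_set O).
Local Notation D := (pt @^-1` O : set T).
Let mD : measurable D := open_measurable_pt oO.
Let LS := L2fun_si oO.

Definition nL2 (u : Rd -> R) : R := Num.sqrt (L2ip O u u).

Let unpt (x : Rd) : T := [tuple x 0 j | j < d].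

Let unptK t : unpt (pt t) = t.
Proof. by apply: eq_from_tnth => j; rewrite tnth_mktuple mxE. Qed.

Lemma L2fun_complete (f : nat -> Rd -> R) (C : R) : 0 < C ->
  (forall n, L2fun O (f n)) ->
  (forall m n, nL2 (f m - f n) <= C * (m.+1%:R^-1 + n.+1%:R^-1)) ->
  exists2 g, L2fun O g & forall n, nL2 (g - f n) <= C * (2 / n.+1%:R).
Proof.
move=> C0 Hf hf; pose f' n : T -> R := C^-1 *: (f n \o pt).
have SI := sqint_semi_inner mu mD.
have [||g Hg hg] := @L2_complete _ _ _ mu D mD f'.
- by move=> n; exact: (siZ SI C^-1 (Hf n)).
- move=> m n; have E := si_nrmZ SI C^-1 (siB SI (Hf m) (Hf n)).
  rewrite /f' -scalerBr [leLHS]E.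
  have Ci : 0 <= C^-1 by rewrite invr_ge0 ltW.
  by rewrite (ger0_norm Ci) ler_pdivrMl//; exact: hf.
exists ((C *: g) \o unpt).
  rewrite /L2fun (_ : _ \o _ = C *: g); first exact: (siZ SI).
  by apply/funext => t /=; rewrite unptK.
move=> n; rewrite /nL2 /L2ip.
rewrite (_ : _ \o pt = C *: (g - f' n)); last first.
  apply/funext => t /=; change (C * g (unpt (pt t)) - f n (pt t) = C * (g t - C^-1 * f n (pt t))).
  by rewrite unptK; field; rewrite gt_eqF.
have Hgf : sqint mu D (g - f' n) by apply: (siB SI) => //; exact: (siZ SI C^-1 (Hf n)).
have := si_nrmZ SI C Hgf; rewrite /nrm2 => ->.
by rewrite (ger0_norm (ltW C0)) ler_pM2l//; exact: hg.
Qed.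

(** A function orthogonal to all test functions is null almost everywhere, hence
    orthogonal to everything. *)
Lemma L2_test_zero g h : L2fun O g -> L2fun O h ->
  (forall v, is_test O v -> L2ip O g v = 0) -> L2ip O g h = 0.
Proof.
move=> Hg Hh g0; have aeg := fundamental_lemma oO bO Hg g0.
have SI := sqint_semi_inner mu mD.
rewrite /L2ip (@ip2_ae _ _ _ mu D mD (g \o pt) 0 (h \o pt))//.
  exact: (si_0l SI).
exact: (si0 SI).
Qed.

Lemma L2_test_eq g g' h : L2fun O g -> L2fun O g' -> L2fun O h ->
  (forall v, is_test O v -> L2ip O g v = L2ip O g' v) -> L2ip O g h = L2ip O g' h.
Proof.
move=> Hg Hg' Hh gg'; apply/eqP; rewrite -subr_eq0 -(si_Bl LS)//; apply/eqP.
apply: L2_test_zero => //; first exact: (siB LS).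
by move=> v tv; rewrite (si_Bl LS)// ?gg' ?subrr//; exact: test_sqint.
Qed.

(** The minimising sequence of test functions is Cauchy in [L^2]; its limit
    represents [phi] and is approximated by test functions by construction. *)
Lemma L2_riesz (phi : (Rd -> R) -> R) (C : R) : 0 <= C ->
  (forall c u v, is_test O u -> is_test O v -> phi (c *: u + v) = c * phi u + phi v) ->
  (forall v, is_test O v -> `|phi v| <= C * nL2 v) ->
  exists g, [/\ L2fun O g, forall v, is_test O v -> L2ip O g v = phi v, nL2 g <= C
    & forall e, 0 < e -> exists2 v, is_test O v & nL2 (g - v) < e].
Proof.
move=> C0 philin phiC; have TS := test_L2si oO bO.
have [v [tv hv]] := riesz_sequence TS philin phiC.
have [|n|m n|g Hg hg] := @L2fun_complete v 1; rewrite ?mul1r//.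
- exact: test_sqint.
- exact: (riesz_cauchy TS tv hv).
have Hv n := test_sqint oO bO (tv n).
have gphi w : is_test O w -> L2ip O g w = phi w.
  move=> tw; have Hw := test_sqint oO bO tw.
  have hd n : `|L2ip O g w - phi w| <= (3 * nL2 w) / n.+1%:R.
    rewrite (_ : _ - _ = L2ip O (g - v n) w + (L2ip O (v n) w - phi w)); last first.
      by rewrite (si_Bl LS Hg (Hv n) Hw); ring.
    rewrite (_ : 3 * _ / _ = (1 * (2 / n.+1%:R)) * nL2 w + nL2 w / n.+1%:R); last by ring.
    apply: (le_trans (ler_normD _ _)); apply: lerD; last exact: hv.
    apply: (le_trans (si_CS LS (siB LS Hg (Hv n)) Hw)).
    by rewrite ler_wpM2r ?sqrtr_ge0//; exact: hg.
  apply/eqP; rewrite -subr_eq0 -normr_le0; apply/ler_addgt0Pr => e e0; rewrite add0r.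
  have [n _ /(_ n (leqnn n))] := near_infty_natSinv_lt (PosNum (divr_gt0 e0 (ltr_wpDl (mulr_ge0 (ler0n R 3) (sqrtr_ge0 _ : 0 <= nL2 w)) ltr01))).
  rewrite /= => hn; apply: (le_trans (hd n)).
  have w0 : 0 <= nL2 w by exact: sqrtr_ge0.
  have : n.+1%:R^-1 * (3 * nL2 w + 1) < e by rewrite -ltr_pdivlMr// ltr_wpDl// mulr_ge0.
  have : 0 < (n.+1%:R : R)^-1 by rewrite invr_gt0.
  move: (n.+1%:R^-1) (nL2 w) w0 => i a; nra.
have gdense e : 0 < e -> exists2 v, is_test O v & nL2 (g - v) < e.
  move=> e0; have [n _ /(_ n (leqnn n))/= hn] := near_infty_natSinv_lt (PosNum (divr_gt0 e0 (ltr0n R 2))).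
  exists (v n) => //; apply: (le_lt_trans (hg n)); rewrite mul1r.
  by move: hn; rewrite ltr_pdivlMr// mulrC.
exists g; split=> //.
apply/ler_addgt0Pr => e e0; have [w tw gw] := gdense _ (divr_gt0 e0 (ltr0n R 3)).
have Hw := test_sqint oO bO tw.
have tri : nL2 w <= nL2 g + e / 3.
  rewrite (_ : w = g + (w - g)); last by rewrite addrC subrK.
  apply: (le_trans (si_triangle LS Hg (siB LS Hw Hg))); rewrite lerD2l.
  by rewrite (si_nrmBC LS)// ltW.
have [g0|g0] := eqVneq (nL2 g) 0; first by rewrite g0 addr_ge0// ltW.
have gp : 0 < nL2 g by rewrite lt0r g0 sqrtr_ge0.
have h1 : nL2 g ^+ 2 = L2ip O g w + L2ip O g (g - w).
  by rewrite (si_sqr LS Hg) (si_Br LS Hg Hw Hg); ring.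
have h2 : L2ip O g w <= C * nL2 w.
  by rewrite gphi//; apply: (le_trans (ler_norm _)); exact: phiC.
have h3 : L2ip O g (g - w) <= nL2 g * (e / 3).
  apply: (le_trans (ler_norm _)); apply: (le_trans (si_CS LS Hg (siB LS Hg Hw))).
  by rewrite ler_pM2l// ltW.
rewrite leNgt; apply/negP => hlt.
have : C * nL2 w <= C * (nL2 g + e / 3) by rewrite ler_wpM2l.
have : 0 <= (nL2 g - (C + e)) * nL2 g by apply: mulr_ge0; [rewrite subr_ge0 ltW|exact: ltW].
nra.
Qed.

(** [L2_riesz] yields a limit of test functions with the same inner products with
    test functions as [g]; the difference is null almost everywhere. *)
Lemma test_dense g e : L2fun O g -> 0 < e -> exists2 v, is_test O v & nL2 (g - v) < e.
Proof.
move=> Hg e0.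
have [||v tv|h [Hh hv _ hd]] := @L2_riesz (fun v => L2ip O g v) (nL2 g).
- exact: sqrtr_ge0.
- move=> c u v tu tv; have Hu := test_sqint oO bO tu; have Hv := test_sqint oO bO tv.
  by rewrite (si_Dr LS)//; [rewrite (si_Zr LS)|exact: (siZ LS)].
- by apply: (si_CS LS) => //; exact: test_sqint.
have [v tv hv'] := hd e e0; exists v => //.
have Hv := test_sqint oO bO tv.
rewrite (_ : g - v = (g - h) + (h - v)); last by rewrite addrA subrK.
have Hgh := siB LS Hg Hh.
apply: le_lt_trans (si_triangle LS Hgh (siB LS Hh Hv)) _.
rewrite (_ : Num.sqrt (L2ip O (g - h) (g - h)) = 0) ?add0r//.
rewrite L2_test_zero ?sqrtr0// => w tw; have Hw := test_sqint oO bO tw.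
by rewrite (si_Bl LS)// hv// subrr.
Qed.

End L2_functions.

Section dual_space.
Context {R : realType} {n : nat}.
Local Notation Rd := 'rV[R]_n.+1.
Local Notation T := (n.+1.-tuple (measurableTypeR R)).
Local Notation mu := (lebesgue_tuple (R := R) n.+1).
Variable O : set Rd.
Hypotheses (oO : open O) (bO : bounded_set O).
Local Notation D := (pt @^-1` O : set T).
Let mD : measurable D := open_measurable_pt oO.
Let LS := L2fun_si oO.
Let FS := L2field_si oO.
Let GS := test_gsi oO bO.
Implicit Types phi psi chi : Hm1 O.
Local Notation nL2 := (nL2 O).
Let nG G := Num.sqrt (gip O G G).

(** The value of a distribution at a function, [0] off the test functions. *)
Definition ev phi (u : Rd -> R) : R :=
  if pselect (is_test O u) is left p then phi (exist _ u p) else 0.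

Lemma evE phi (u : testfun O) : phi u = ev phi (sval u).
Proof.
case: u => u tu; rewrite /ev/=; case: pselect => // tu'.
by rewrite (Prop_irrelevance tu tu').
Qed.

Lemma ev_lin phi c u v : is_test O u -> is_test O v ->
  ev phi (c *: u + v) = c * ev phi u + ev phi v.
Proof.
move=> tu tv; have [+ _] := asboolP _ (hm1P phi).
move=> /(_ c (exist _ u tu) (exist _ v tv) (exist _ (c *: u + v) (test_P c tu tv)) erefl).
by rewrite !evE.
Qed.

Lemma ev_P c phi psi u : ev (c *: phi + psi) u = c * ev phi u + ev psi u.
Proof. by rewrite /ev; case: pselect => // _; rewrite mulr0 addr0. Qed.

Lemma ev_B phi psi u : ev (phi - psi) u = ev phi u - ev psi u.
Proof. by rewrite addrC -scaleN1r ev_P mulN1r addrC. Qed.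

Lemma ev_bound phi u : is_test O u -> `|ev phi u| <= `|phi| * H10norm O u.
Proof. by move=> tu; have := Hm1_bound phi (exist _ u tu); rewrite evE. Qed.

Lemma Hm1_le phi C : 0 <= C -> (forall v, is_test O v -> `|ev phi v| <= C * H10norm O v) ->
  `|phi| <= C.
Proof.
move=> C0 h; apply: Hm1norm_le => // v; rewrite evE; apply: h.
by case: v.
Qed.

Lemma mk_Hm1 (f : (Rd -> R) -> R) C :
  (forall c u v, is_test O u -> is_test O v -> f (c *: u + v) = c * f u + f v) ->
  (forall v, is_test O v -> `|f v| <= C * H10norm O v) ->
  exists phi : Hm1 O, forall v, is_test O v -> ev phi v = f v.
Proof.
move=> flin fC; have fP : (fun v : testfun O => f (sval v)) \in @is_Hm1 R n.+1 O.
  apply/asboolP; split; last by exists C => v; apply: fC; case: v.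
  by move=> a [u tu] [v tv] [w tw]/= ->; exact: flin.
by exists (MkHm1 fP) => v tv; rewrite -(evE _ (exist _ v tv)).
Qed.

(** The Dirichlet problem is solvable: the minimising sequence converges in
    [L^2] by the Poincare inequality. *)
Lemma inv_laplacian_ex phi : exists p, is_inv_laplacian phi p.
Proof.
have [C0 C00 hP] := poincare oO bO.
have phiC u : is_test O u -> `|ev phi u| <= `|phi| * nG (grad u).
  by move=> tu; rewrite /nG -(H10normE oO bO)//; exact: ev_bound.
have [v [tv hv]] := riesz_sequence GS (ev_lin phi) phiC.
have vC := riesz_cauchy GS tv hv.
have Hv k := test_sqint oO bO (tv k).
have Hgv k := grad_L2 oO bO (tv k).
have gradB k l : grad (v k - v l) = grad (v k) - grad (v l).
  by rewrite addrC -scaleN1r (grad_P (-1) (tv l) (tv k)) scaleN1r addrC.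
have C1 : 0 < C0 + 1 by rewrite ltr_wpDl.
have [k|k l|u Hu hu] := @L2fun_complete R n.+1 O oO v (C0 + 1) C1; first exact: Hv.
  have tB : is_test O (v k - v l) by apply: (siB GS).
  apply: (le_trans (hP _ tB)); apply: ler_pM => //; first exact: sqrtr_ge0.
    by rewrite lerDl.
  by rewrite (H10normE oO bO tB); exact: vC.
have /choice[gu hgu] : forall j, exists g, L2fun O g /\
    forall k, nL2 (g - grad (v k) j) <= 1 * (2 / k.+1%:R).
  move=> j; have [k|k l|g Hg hg] := @L2fun_complete R n.+1 O oO (fun k => grad (v k) j) 1 ltr01.
  - exact: Hgv.
  - rewrite mul1r; apply: le_trans (vC k l); apply: ler_wsqrtr.
    rewrite gradB /gip (bigD1 j)//= lerDl sumr_ge0// => i _.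
    by apply: (si_ge0 LS); exact: (siB LS (Hgv k i) (Hgv l i)).
  - by exists g.
have Hgu : L2field O gu by move=> j; have [] := hgu j.
have small (b : R) : 0 <= b -> (fun k : nat => b * (2 / k.+1%:R)) @ \oo --> (0 : R).
  move=> b0; rewrite -[X in _ --> X](mulr0 (b * 2)).
  rewrite (_ : (fun k : nat => _) = (fun k : nat => (b * 2) * k.+1%:R^-1)); last first.
    by apply/funext => k; rewrite mulrA.
  by apply: cvgM; [exact: cvg_cst|exact: cvg_harmonic].
exists (u, gu); split=> /=.
  split=> //.
  exists (fun k => exist _ (v k) (tv k)); split=> /=.
    apply: (squeeze_cvgr _ (cvg_cst (0 : R)) (small _ (ltW C1))).
    by apply: nearW => k; rewrite sqrtr_ge0; exact: hu.
  move=> j; apply: (squeeze_cvgr _ (cvg_cst (0 : R)) (small 1 ler01)).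
  by apply: nearW => k; rewrite sqrtr_ge0; have [_] := hgu j; exact.
move=> w; have tw : is_test O (sval w) by case: w.
have Hgw := grad_L2 oO bO tw.
rewrite (@intO_gip _ _ O oO gu (grad (sval w)))// evE.
have nn k : nG (gu - grad (v k)) <= n.+1%:R * (2 / k.+1%:R).
  have c0 : 0 <= 2 / k.+1%:R :> R by rewrite divr_ge0.
  rewrite -[leRHS]ger0_norm ?mulr_ge0// -sqrtr_sqr; apply: ler_wsqrtr.
  apply: (@le_trans _ _ (\sum_(j < n.+1) (2 / k.+1%:R) ^+ 2)).
    apply: ler_sum => j _; have Hj : L2fun O (gu j - grad (v k) j) by exact: (siB LS (Hgu j) (Hgv k j)).
    rewrite -(si_sqr LS Hj) ler_pXn2r ?nnegrE ?sqrtr_ge0//.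
    by have [_ /(_ k)] := hgu j; rewrite mul1r.
  rewrite sumr_const card_ord -[leLHS]mulr_natl [leRHS]exprMn ler_wpM2r ?sqr_ge0//.
  by rewrite expr2 -natrM ler_nat leq_pmull.
have hd k : `|gip O gu (grad (sval w)) - ev phi (sval w)| <=
    (n.+1%:R * 2 + 1) * nG (grad (sval w)) / k.+1%:R.
  have HB : L2field O (gu - grad (v k)) := siB FS Hgu (Hgv k).
  rewrite (_ : _ - _ = gip O (gu - grad (v k)) (grad (sval w)) +
     (gip O (grad (v k)) (grad (sval w)) - ev phi (sval w))); last first.
    by rewrite (si_Bl FS Hgu (Hgv k) Hgw); ring.
  rewrite (_ : (_ + 1) * _ / _ = (n.+1%:R * (2 / k.+1%:R)) * nG (grad (sval w)) +
    nG (grad (sval w)) / k.+1%:R); last by ring.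
  apply: (le_trans (ler_normD _ _)); apply: lerD; last exact: hv.
  apply: (le_trans (si_CS FS HB Hgw)).
  by rewrite ler_wpM2r ?sqrtr_ge0//; exact: nn.
apply/eqP; rewrite -subr_eq0 -normr_le0.
have : (fun k : nat => (n.+1%:R * 2 + 1) * nG (grad (sval w)) / k.+1%:R) @ \oo --> (0 : R).
  rewrite -[X in _ --> X](mulr0 ((n.+1%:R * 2 + 1) * nG (grad (sval w)))).
  by apply: cvgM; [exact: cvg_cst|exact: cvg_harmonic].
move=> hc; rewrite -(cvg_lim (@Rhausdorff R) hc); apply: limr_ge; first by apply/cvg_ex; exists 0.
exact: nearW.
Qed.

Definition gradinv phi : 'I_n.+1 -> Rd -> R := (inv_laplacian phi).2.

Lemma inv_laplacianP phi : is_inv_laplacian phi (inv_laplacian phi).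
Proof. exact: (xgetPex _ (inv_laplacian_ex phi)). Qed.

Lemma gradinv_L2 phi : L2field O (gradinv phi).
Proof. by have [[_ ? _] _] := inv_laplacianP phi. Qed.

Lemma inv_L2 phi : L2fun O (inv_laplacian phi).1.
Proof. by have [[? _ _] _] := inv_laplacianP phi. Qed.

Lemma gradinv_test phi w : is_test O w -> gip O (gradinv phi) (grad w) = ev phi w.
Proof.
move=> tw; have [_ /(_ (exist _ w tw))] := inv_laplacianP phi.
rewrite evE/= => <-; rewrite (@intO_gip _ _ O oO (gradinv phi) (grad w))//.
  exact: gradinv_L2.
exact: grad_L2.
Qed.

Lemma inv_approx phi : exists v : nat -> Rd -> R, [/\ forall k, is_test O (v k),
   nL2 ((inv_laplacian phi).1 - v k) @[k --> \oo] --> (0 : R)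
   & nG (gradinv phi - grad (v k)) @[k --> \oo] --> (0 : R)].
Proof.
have [[_ Hg [v [hv hgv]]] _] := inv_laplacianP phi.
exists (fun k => sval (v k)); split; [by move=> k; case: (v k)|exact: hv|].
rewrite -sqrtr0; apply: continuous_cvg; first exact: sqrt_continuous.
rewrite -[X in _ --> X](@big1_eq R 0 +%R 'I_n.+1 (index_enum _) xpredT) /gip.
apply: cvg_big => [|j _]; first exact: add_continuous.
rewrite (_ : (fun k => _) = (fun k => nL2 (gradinv phi j - grad (sval (v k)) j) ^+ 2)); last first.
  apply/funext => k; rewrite (si_sqr LS)//; apply: (siB LS (Hg j)).
  by apply: grad_L2 => //; case: (v k).
have := cvgM (hgv j) (hgv j); rewrite mulr0; exact.
Qed.

(** The inner product of [H^-1], through the gradients of the solutions of the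
    Dirichlet problem. *)
Definition ipH phi psi : R := gip O (gradinv phi) (gradinv psi).

Lemma ev_cvg phi psi (v : nat -> Rd -> R) : (forall k, is_test O (v k)) ->
  nG (gradinv psi - grad (v k)) @[k --> \oo] --> (0 : R) ->
  ev phi (v k) @[k --> \oo] --> ipH phi psi.
Proof.
move=> tv hv; apply/cvgrPdist_le => e e0.
move/cvgr0Pnorm_lt : hv => hv.
have a0 : 0 < nG (gradinv phi) + 1 by rewrite ltr_wpDl// sqrtr_ge0.
near=> k; rewrite -gradinv_test// /ipH.
have Hb := siB FS (gradinv_L2 psi) (grad_L2 oO bO (tv k)).
have := si_CS FS (gradinv_L2 phi) Hb.
rewrite (si_Br FS (gradinv_L2 _) (grad_L2 oO bO (tv k)) (gradinv_L2 _)) -/(nG _) -/(nG _).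
move=> /le_trans; apply.
have h : nG (gradinv psi - grad (v k)) < e / (nG (gradinv phi) + 1).
  rewrite -[ltLHS]ger0_norm ?sqrtr_ge0//; near: k.
  by apply: hv; exact: divr_gt0.
rewrite ltr_pdivlMr// in h; apply: ltW; apply: le_lt_trans h.
by rewrite mulrC ler_wpM2l ?sqrtr_ge0// lerDl.
Unshelve. all: by end_near. Qed.

Lemma ipH_si : semi_inner [set: Hm1 O] ipH.
Proof.
split=> //.
- move=> c phi psi chi _ _ _; have [v [tv _ hv]] := inv_approx chi.
  have h1 := ev_cvg (phi := (c *: phi + psi)) tv hv.
  have h2 : (fun k => c * ev phi (v k) + ev psi (v k)) @ \oo --> c * ipH phi chi + ipH psi chi.
    by apply: cvgD; [apply: cvgM; [exact: cvg_cst|exact: ev_cvg]|exact: ev_cvg].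
  have E : (fun k => ev (c *: phi + psi) (v k)) = (fun k => c * ev phi (v k) + ev psi (v k)).
    by apply/funext => k; rewrite ev_P.
  by rewrite E in h1; exact: (cvg_unique (@Rhausdorff R) h1 h2).
- by move=> phi psi _ _; apply: (siC FS); exact: gradinv_L2.
- by move=> phi _; apply: (si_ge0 FS); exact: gradinv_L2.
Qed.

(** The dual norm is attained in the limit, along test functions that approximate
    the solution of the Dirichlet problem. *)
Lemma ipH_norm phi : ipH phi phi = `|phi| ^+ 2.
Proof.
have le1 : `|phi| <= nG (gradinv phi).
  apply: Hm1_le => [|v tv]; first exact: sqrtr_ge0.
  rewrite -gradinv_test// (H10normE oO bO)//.
  by apply: (si_CS FS); [exact: gradinv_L2|exact: grad_L2].
have [v [tv _ hv]] := inv_approx phi.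
have h1 := ev_cvg (phi := phi) tv hv.
have le2 : ipH phi phi <= `|phi| * nG (gradinv phi).
  have h2 : (fun k => `|phi| * (nG (gradinv phi) + nG (gradinv phi - grad (v k)))) @ \oo -->
      `|phi| * (nG (gradinv phi) + 0).
    by apply: cvgM; [exact: cvg_cst|apply: cvgD => //; exact: cvg_cst].
  rewrite addr0 in h2; apply: ler_cvg_to h1 h2 _; apply: nearW => k.
  apply: (le_trans (ler_norm _)); apply: (le_trans (ev_bound _ (tv k))).
  rewrite ler_wpM2l// (H10normE oO bO)//.
  have Hgv := grad_L2 oO bO (tv k).
  have := si_triangle FS (gradinv_L2 phi) (siB FS Hgv (gradinv_L2 phi)).
  by rewrite (addrC (gradinv phi)) subrK (si_nrmBC FS Hgv (gradinv_L2 phi)).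
have E := si_sqr FS (gradinv_L2 phi); rewrite -/(ipH phi phi) -/(nG _) in E.
have [g0|g0] := eqVneq (nG (gradinv phi)) 0.
  have : `|phi| = 0 by apply/eqP; rewrite eq_le normr_ge0 -{1}g0 le1.
  by move=> ->; rewrite -E g0.
have gp : 0 < nG (gradinv phi) by rewrite lt0r g0 sqrtr_ge0.
have -> : `|phi| = nG (gradinv phi).
  by apply/eqP; rewrite eq_le le1 -(ler_pM2r gp) -expr2 E.
by rewrite E.
Qed.

Lemma ipH_CS phi psi : `|ipH phi psi| <= `|phi| * `|psi|.
Proof.
have := si_CS ipH_si (I : [set: Hm1 O] phi) (I : [set: Hm1 O] psi).
by rewrite !ipH_norm !sqrtr_sqr !normr_id.
Qed.

End dual_space.

(** * Square integrable elements of the dual space *)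

Section densities.
Context {R : realType} {n : nat}.
Local Notation Rd := 'rV[R]_n.+1.
Variable O : set Rd.
Hypotheses (oO : open O) (bO : bounded_set O).
Let LS := L2fun_si oO.
Let HS := ipH_si oO bO.
Implicit Types phi psi chi : Hm1 O.

Lemma ipHC phi psi : ipH phi psi = ipH psi phi. Proof. exact: (siC HS). Qed.

Lemma ipHBl phi psi chi : ipH (phi - psi) chi = ipH phi chi - ipH psi chi.
Proof. exact: (si_Bl HS). Qed.

Lemma ipHBr phi psi chi : ipH chi (phi - psi) = ipH chi phi - ipH chi psi.
Proof. exact: (si_Br HS). Qed.

Lemma ipHDr phi psi chi : ipH chi (phi + psi) = ipH chi phi + ipH chi psi.
Proof. exact: (si_Dr HS). Qed.

Lemma densityP phi : in_L2 phi -> is_density phi (density phi).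
Proof. by move=> [g hg]; exact: (xgetPex _ (ex_intro _ g hg)). Qed.

Lemma is_densityE phi g : is_density phi g <->
  L2fun O g /\ forall v, is_test O v -> ev phi v = L2ip O g v.
Proof.
split=> [[Hg h]|[Hg h]]; split=> // v.
  by move=> tv; have := h (exist _ v tv); rewrite evE.
by rewrite evE; apply: h; case: v.
Qed.

Lemma density_L2 phi : in_L2 phi -> L2fun O (density phi).
Proof. by move=> /densityP/is_densityE[]. Qed.

Lemma density_test phi v : in_L2 phi -> is_test O v ->
  L2ip O (density phi) v = ev phi v.
Proof. by move=> /densityP/is_densityE[_ h] tv; rewrite h. Qed.

(** Densities are unique up to null sets only, so [density] is handled through its
    inner products. *)
Lemma density_ip phi g h : is_density phi g -> L2fun O h ->
  L2ip O (density phi) h = L2ip O g h.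
Proof.
move=> hg Hh; have ip : in_L2 phi by exists g.
move/is_densityE : hg => [Hg hg].
apply: (L2_test_eq oO bO) => //; first exact: density_L2.
by move=> v tv; rewrite density_test// hg.
Qed.

Lemma is_density_P c phi psi g h : is_density phi g -> is_density psi h ->
  is_density (c *: phi + psi) (c *: g + h).
Proof.
move=> /is_densityE[Hg hg] /is_densityE[Hh hh]; apply/is_densityE; split.
  exact: (siP LS).
move=> v tv; have Hv := test_sqint oO bO tv.
by rewrite ev_P hg// hh// (siL LS).
Qed.

Lemma in_L2_P c phi psi : in_L2 phi -> in_L2 psi -> in_L2 (c *: phi + psi).
Proof. by move=> [g hg] [h hh]; eexists; exact: is_density_P hg hh. Qed.

Lemma in_L2_0 : in_L2 (0 : Hm1 O).
Proof.
exists 0; apply/is_densityE; split; first exact: (si0 LS).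
move=> v tv; rewrite (si_0l LS) ?/ev; last exact: test_sqint.
by case: pselect.
Qed.

Lemma density_lin c phi psi h : in_L2 phi -> in_L2 psi -> L2fun O h ->
  L2ip O (density (c *: phi + psi)) h =
    c * L2ip O (density phi) h + L2ip O (density psi) h.
Proof.
move=> ip iq Hh; rewrite (density_ip (is_density_P c (densityP ip) (densityP iq)))//.
by rewrite (siL LS)//; exact: density_L2.
Qed.

Definition dotL2 phi psi : R := L2ip O (density phi) (density psi).
Definition el2 phi : R := Num.sqrt (dotL2 phi phi).

Lemma dotL2_si : semi_inner (@in_L2 R n.+1 O) dotL2.
Proof.
split.
- exact: in_L2_0.
- exact: in_L2_P.
- by move=> c phi psi chi ip iq ir; rewrite /dotL2 density_lin//; exact: density_L2.
- by move=> phi psi ip iq; apply: (siC LS); exact: density_L2.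
- by move=> phi ip; apply: (si_ge0 LS); exact: density_L2.
Qed.
Let DS := dotL2_si.

Lemma el2_triB phi psi : in_L2 phi -> in_L2 psi -> el2 (phi - psi) <= el2 phi + el2 psi.
Proof.
move=> ip iq; have := si_triangle DS ip (siZ DS (-1) iq).
by rewrite (si_nrmZ DS (-1) iq) scaleN1r normrN normr1 mul1r.
Qed.

Lemma el2_bound phi v : in_L2 phi -> is_test O v -> `|ev phi v| <= el2 phi * nL2 O v.
Proof.
move=> ip tv; rewrite -density_test//; apply: (si_CS LS); first exact: density_L2.
exact: test_sqint.
Qed.

(** Riesz representation on the dense subspace of test functions. *)
Lemma in_L2_crit phi C : 0 <= C ->
  (forall v, is_test O v -> `|ev phi v| <= C * nL2 O v) -> in_L2 phi /\ el2 phi <= C.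
Proof.
move=> C0 hC; have [|g [Hg gphi gC _]] := @L2_riesz R n.+1 O oO bO (ev phi) C C0 _ hC.
  by move=> c u v tu tv; exact: ev_lin.
have dg : is_density phi g by apply/is_densityE; split=> // v tv; rewrite gphi.
have ip : in_L2 phi by exists g.
split=> //; rewrite /el2 /dotL2 (density_ip dg); last exact: density_L2.
by rewrite (siC LS) ?(density_ip dg)//; exact: density_L2.
Qed.

Lemma L2norm_in phi : in_L2 phi -> L2norm phi = (el2 phi)%:E.
Proof.
move=> ip; have key g : is_density phi g -> normL2 O g = el2 phi.
  move=> dg; have Hg : L2fun O g by case/is_densityE : dg.
  have Hd := density_L2 ip; rewrite /el2 /dotL2 (density_ip dg)//.
  by rewrite (siC LS)// (density_ip dg).
rewrite /L2norm (_ : [set _ | _ in _] = [set (el2 phi)%:E]) ?ereal_inf1//.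
apply/seteqP; split=> [_ [g dg <-]|_ ->]/=; first by rewrite key.
by exists (density phi); [exact: densityP|rewrite key//; exact: densityP].
Qed.

Lemma L2norm_out phi : ~ in_L2 phi -> L2norm phi = +oo%E.
Proof.
move=> nip; rewrite /L2norm (_ : [set _ | _ in _] = set0) ?ereal_inf0//.
by apply/seteqP; split=> [x [g dg _]|x []]//; apply: nip; exists g.
Qed.

Lemma el2_ge0 phi : 0 <= el2 phi. Proof. exact: sqrtr_ge0. Qed.

Definition poincare_const : R := xget 0 [set C | 0 <= C /\ forall v, is_test O v ->
  nL2 O v <= C * H10norm O v].

Lemma poincare_constP : 0 <= poincare_const /\ forall v, is_test O v ->
  nL2 O v <= poincare_const * H10norm O v.
Proof.
have [C C0 hC] := poincare oO bO.
by apply: (xgetPex 0 (P := [set C | 0 <= C /\ forall v, is_test O v -> nL2 O v <= C * H10norm O v])); exists C.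
Qed.

Lemma norm_el2 phi : in_L2 phi -> `|phi| <= poincare_const * el2 phi.
Proof.
have [P0 hP] := poincare_constP.
move=> ip; apply: Hm1_le => [|v tv]; first by rewrite mulr_ge0// el2_ge0.
apply: (le_trans (el2_bound ip tv)); rewrite (mulrC poincare_const) -mulrA ler_wpM2l ?el2_ge0//.
exact: hP.
Qed.

(** Green's formula, through test functions that approximate the solution of the
    Dirichlet problem. *)
Lemma dotHm1_ip phi psi : in_L2 psi -> dotHm1 phi psi = ipH phi psi.
Proof.
move=> iq; have [v [tv hv hgv]] := inv_approx oO bO phi.
have h1 := ev_cvg (phi := psi) oO bO tv hgv.
rewrite (siC HS (I : [set: Hm1 O] phi) (I : [set: Hm1 O] psi)).
have Hd := density_L2 iq; have Hp := inv_L2 oO bO phi.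
have -> : dotHm1 phi psi = L2ip O (density psi) (inv_laplacian phi).1.
  by rewrite (siC LS).
apply/esym/(cvg_unique (@Rhausdorff R) h1); apply/cvgrPdist_le => e e0.
move/cvgr0Pnorm_lt : hv => hv.
have a0 : 0 < el2 psi + 1 by rewrite ltr_wpDl// el2_ge0.
near=> k; rewrite -density_test//; have Hv := test_sqint oO bO (tv k).
rewrite -(si_Br LS Hp Hv Hd).
apply: (le_trans (si_CS LS Hd (siB LS Hp Hv))); rewrite -/(el2 psi).
have h : nL2 O ((inv_laplacian phi).1 - v k) < e / (el2 psi + 1).
  rewrite -[ltLHS]ger0_norm ?sqrtr_ge0//; near: k.
  by apply: hv; exact: divr_gt0.
rewrite ltr_pdivlMr// in h; apply: ltW; apply: le_lt_trans h.
by rewrite mulrC ler_wpM2l ?sqrtr_ge0// lerDl.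
Unshelve. all: by end_near. Qed.

Lemma norm2_split phi psi : `|phi + psi| ^+ 2 = `|phi| ^+ 2 + 2 * ipH phi psi + `|psi| ^+ 2.
Proof.
rewrite -!(ipH_norm oO bO) -{1 2}[phi]scale1r (si_expand HS)//.
by rewrite expr1n mulr1 mulr1.
Qed.

(** The limit of the densities defines a distribution in [H^-1] by the Poincare
    inequality. *)
Lemma in_L2_complete (f : nat -> Hm1 O) (C : R) : 0 < C -> (forall k, in_L2 (f k)) ->
  (forall k l, el2 (f k - f l) <= C * (k.+1%:R^-1 + l.+1%:R^-1)) ->
  exists2 g, in_L2 g & forall k, el2 (g - f k) <= C * (2 / k.+1%:R).
Proof.
move=> C0 If hf.
have nE phi psi : in_L2 phi -> in_L2 psi -> forall u, is_density phi u ->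
    el2 (phi - psi) = nL2 O (u - density psi).
  move=> ip iq u du; have Hu : L2fun O u by case/is_densityE : du.
  have dB : is_density (phi - psi) (u - density psi).
    rewrite (_ : phi - psi = -1 *: psi + phi); last by rewrite scaleN1r addrC.
    rewrite (_ : u - density psi = -1 *: density psi + u); last by rewrite scaleN1r addrC.
    exact: is_density_P (densityP iq) du.
  have iB : in_L2 (phi - psi) by exists (u - density psi).
  have HB : L2fun O (u - density psi) by case/is_densityE : dB.
  rewrite /el2 /dotL2 (density_ip dB); last exact: density_L2.
  by rewrite (siC LS) ?(density_ip dB)//; exact: density_L2.
have [|k l|g Hg hg] := @L2fun_complete R n.+1 O oO (fun k => density (f k)) C C0.
- by move=> k; exact: density_L2.
- by rewrite -(nE _ _ (If k) (If l) _ (densityP (If k))).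
have [P0 hP] := poincare_constP.
have [||phi hphi] := @mk_Hm1 R n O (fun v => L2ip O g v) (nL2 O g * poincare_const).
- move=> c u v tu tv; have Hu := test_sqint oO bO tu; have Hv := test_sqint oO bO tv.
  by rewrite (si_Dr LS)//; [rewrite (si_Zr LS)|exact: (siZ LS)].
- move=> v tv; apply: (le_trans (si_CS LS Hg (test_sqint oO bO tv))).
  by rewrite -mulrA ler_wpM2l ?sqrtr_ge0//; exact: hP.
have dphi : is_density phi g by apply/is_densityE.
have ip : in_L2 phi by exists g.
by exists phi => // k; rewrite (nE _ _ ip (If k) g).
Qed.

(** The resolvent of the operator defined by the [L^2] form on [H^-1]:
    [(1 - l Delta)^-1]. It regularises [H^-1] into [L^2]. *)
Lemma resolvent_ex (l : R) (phi : Hm1 O) : 0 < l -> exists u, in_L2 u /\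
  forall psi, in_L2 psi -> ipH u psi + l * dotL2 u psi = ipH phi psi.
Proof.
move=> l0; pose a u v := ipH u v + l * dotL2 u v.
have Sa : semi_inner (@in_L2 R n.+1 O) a.
  split; [exact: in_L2_0|exact: in_L2_P| | |].
  - by move=> c u v w iu iv iw; rewrite /a (siL HS)// (siL DS)//; ring.
  - by move=> u v iu iv; rewrite /a (siC HS)// (siC DS).
  - by move=> u iu; rewrite /a addr_ge0 ?(si_ge0 HS)// mulr_ge0 ?(si_ge0 DS)// ltW.
have aH u : in_L2 u -> `|u| <= Num.sqrt (a u u).
  move=> iu; rewrite -[leLHS]normr_id -sqrtr_sqr; apply: ler_wsqrtr.
  by rewrite /a (ipH_norm oO bO) lerDl mulr_ge0 ?(si_ge0 DS)// ltW.
have aL u : in_L2 u -> el2 u <= (Num.sqrt l)^-1 * Num.sqrt (a u u).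
  move=> iu; rewrite ler_pdivlMl ?sqrtr_gt0//.
  rewrite -sqrtrM ?(ltW l0)//; apply: ler_wsqrtr.
  by rewrite /a lerDr (ipH_norm oO bO) sqr_ge0.
have [||v [iv hv]] := @riesz_sequence R _ _ a Sa (ipH phi) `|phi|.
- move=> c u v iu iv; rewrite (si_Dr HS)// (si_Zr HS)//.
- move=> u iu; apply: (le_trans (ipH_CS oO bO phi u)).
  by rewrite ler_wpM2l//; exact: aH.
have vC := riesz_cauchy Sa iv hv.
have li : 0 < (Num.sqrt l)^-1 by rewrite invr_gt0 sqrtr_gt0.
have [k j|g ig hg] := in_L2_complete li iv.
  apply: (le_trans (aL _ (siB DS (iv k) (iv j)))).
  by rewrite ler_pM2l.
exists g; split=> // psi ips.
have hd k : `|a g psi - ipH phi psi| <=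
    (poincare_const * (Num.sqrt l)^-1 * 2 * `|psi| + l * (Num.sqrt l)^-1 * 2 * el2 psi +
     Num.sqrt (a psi psi)) / k.+1%:R.
  have igv := siB DS ig (iv k).
  have -> : a g psi - ipH phi psi = ipH (g - v k) psi + l * dotL2 (g - v k) psi +
      (a (v k) psi - ipH phi psi).
    by rewrite /a (si_Bl HS)// (si_Bl DS ig (iv k) ips); ring.
  rewrite !mulrDl; apply: (le_trans (ler_normD _ _)); apply: lerD; last exact: hv.
  apply: (le_trans (ler_normD _ _)); apply: lerD.
    apply: (le_trans (ipH_CS oO bO _ _)).
    rewrite [leRHS](_ : _ = (poincare_const * ((Num.sqrt l)^-1 * (2 / k.+1%:R))) * `|psi|); last by ring.
    rewrite ler_wpM2r//; apply: (le_trans (norm_el2 igv)).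
    by rewrite ler_wpM2l//; have [] := poincare_constP.
  rewrite normrM (ger0_norm (ltW l0)).
  rewrite [leRHS](_ : _ = l * (((Num.sqrt l)^-1 * (2 / k.+1%:R)) * el2 psi)); last by ring.
  rewrite ler_pM2l//; apply: (le_trans (si_CS DS igv ips)).
  by rewrite ler_wpM2r ?sqrtr_ge0//; exact: hg.
apply/eqP; rewrite -subr_eq0 -normr_le0; move: hd; set b := (X in forall k, _ <= X / _) => hd.
have hc : (fun k : nat => b / k.+1%:R) @ \oo --> (0 : R).
  by rewrite -[X in _ --> X](mulr0 b); apply: cvgM; [exact: cvg_cst|exact: cvg_harmonic].
rewrite -(cvg_lim (@Rhausdorff R) hc); apply: limr_ge; first by apply/cvg_ex; exists 0.
exact: nearW.
Qed.

Definition resolvent (l : R) (phi : Hm1 O) : Hm1 O := xget 0 [set u | in_L2 u /\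
  forall psi, in_L2 psi -> ipH u psi + l * dotL2 u psi = ipH phi psi].

Section resolvent_properties.
Variables (l : R).
Hypothesis l0 : 0 < l.
Local Notation J := (resolvent l).

Lemma resolventP phi : in_L2 (J phi) /\
  forall psi, in_L2 psi -> ipH (J phi) psi + l * dotL2 (J phi) psi = ipH phi psi.
Proof. exact: (xgetPex 0 (resolvent_ex phi l0)). Qed.

Lemma resolvent_in phi : in_L2 (J phi). Proof. by have [] := resolventP phi. Qed.

Lemma resolvent_sym phi psi : ipH (J phi) psi = ipH phi (J psi).
Proof.
have [i1 h1] := resolventP phi; have [i2 h2] := resolventP psi.
by rewrite (ipHC (J phi)) -(h2 _ i1) -(h1 _ i2) (ipHC (J psi)) (siC DS i2 i1).
Qed.

(** Test the equation of the difference against the difference: its [L^2] part is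
    what [resolvent] gains. *)
Lemma resolvent_el2 phi psi : el2 (J phi - J psi) <= (Num.sqrt l)^-1 * `|phi - psi|.
Proof.
have [i1 h1] := resolventP phi; have [i2 h2] := resolventP psi.
have iu := siB DS i1 i2; set u := J phi - J psi in iu *.
have E : `|u| ^+ 2 + l * el2 u ^+ 2 = ipH (phi - psi) u.
  have a1 : ipH u u = ipH (J phi) u - ipH (J psi) u := ipHBl _ _ _.
  have a2 : dotL2 u u = dotL2 (J phi) u - dotL2 (J psi) u := si_Bl DS i1 i2 iu.
  have e0 : el2 u ^+ 2 = dotL2 u u := si_sqr DS iu.
  have e1 := h1 u iu; have e2 := h2 u iu; have e4 := ipH_norm oO bO u.
  have e3 : ipH (phi - psi) u = ipH phi u - ipH psi u := ipHBl _ _ _.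
  rewrite -e4 e0 e3 -e1 -e2 a1 a2.
  by move: (ipH _ u) (ipH _ u) (dotL2 _ u) (dotL2 _ u) => x y z t; ring.
have := le_trans (ler_norm _) (ipH_CS oO bO (phi - psi) u); rewrite -E => h.
rewrite ler_pdivlMl ?sqrtr_gt0//.
rewrite -(@ler_pXn2r _ 2)// ?nnegrE ?mulr_ge0 ?sqrtr_ge0//.
rewrite exprMn (sqr_sqrtr (ltW l0)).
have := sqr_ge0 (`|phi - psi| - `|u|); nra.
Qed.

Lemma resolvent_le phi : in_L2 phi -> el2 (J phi) <= el2 phi /\
  `|phi - J phi| ^+ 2 <= l * el2 phi ^+ 2.
Proof.
move=> ip; have [i1 h1] := resolventP phi.
have ie := siB DS ip i1.
have E : `|phi - J phi| ^+ 2 = l * (dotL2 (J phi) phi - el2 (J phi) ^+ 2).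
  have a2 : dotL2 (J phi) (phi - J phi) = dotL2 (J phi) phi - dotL2 (J phi) (J phi).
    exact: (si_Br DS ip i1 i1).
  by rewrite -(ipH_norm oO bO) ipHBl -(h1 _ ie) (si_sqr DS i1) a2; ring.
have ge : el2 (J phi) ^+ 2 <= dotL2 (J phi) phi.
  by rewrite -subr_ge0 -(pmulr_rge0 _ l0) -E sqr_ge0.
have CS := le_trans (ler_norm _) (si_CS DS i1 ip); rewrite -/(el2 _) -/(el2 phi) in CS.
have h1' := el2_ge0 (J phi); have h2' := el2_ge0 phi.
have le1 : el2 (J phi) <= el2 phi by rewrite leNgt; apply/negP => hlt; nra.
by split=> //; rewrite E ler_pM2l//; nra.
Qed.

End resolvent_properties.

(** Test functions act continuously for the weaker norm, which turns the weak
    convergence of the resolvents into strong convergence in [L^2]. *)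
Lemma resolvent_cvg phi e : in_L2 phi -> 0 < e -> exists2 d, 0 < d &
  forall l, 0 < l -> l < d -> el2 (phi - resolvent l phi) <= e.
Proof.
move=> ip e0; have p0 := el2_ge0 phi.
(* [q] makes [2 (q / 2 * (2 el2 phi) + q)], the bound obtained at the end, at most
   [e ^+ 2]; [b] makes the pairing with the test function at most [q]. *)
pose q := e ^+ 2 / (4 * (el2 phi + 1)).
have q1 : 0 < el2 phi + 1 by rewrite ltr_wpDl.
have q0 : 0 < q by rewrite divr_gt0 ?exprn_gt0// mulr_gt0.
have [v tv hv] := test_dense oO bO (density_L2 ip) (divr_gt0 q0 (ltr0n R 2)).
have h0 : 0 <= H10norm O v by exact: sqrtr_ge0.
pose b := q / ((el2 phi + 1) * (H10norm O v + 1)).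
have b0 : 0 < b by rewrite divr_gt0// mulr_gt0// ltr_wpDl.
exists (b ^+ 2) => [|l l0 lb]; first by rewrite exprn_gt0.
have [i1 _] := resolventP l0 phi; have [le1 le2] := resolvent_le l0 ip.
have ie := siB DS ip i1; set w := phi - resolvent l phi in ie le2 *.
have Hv := test_sqint oO bO tv; have Hp := density_L2 ip; have Hw := density_L2 ie.
have w2 : el2 w <= 2 * el2 phi.
  by apply: (le_trans (el2_triB ip i1)); rewrite mulr_natl mulr2n lerD2l.
have wH : `|w| <= b * el2 phi.
  have pb : 0 <= b * el2 phi by apply: mulr_ge0; [exact: ltW|].
  rewrite -(@ler_pXn2r _ 2) ?nnegrE// exprMn.
  by apply: (le_trans le2); rewrite ler_wpM2r ?sqr_ge0// ltW.
have E : el2 w ^+ 2 <= 2 * dotL2 phi w.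
  have a1 : dotL2 w w = dotL2 phi w - dotL2 (resolvent l phi) w := si_Bl DS ip i1 ie.
  have a2 : dotL2 phi w = dotL2 phi phi - dotL2 phi (resolvent l phi) := si_Br DS ip i1 ip.
  have a3 : dotL2 (resolvent l phi) w =
      dotL2 (resolvent l phi) phi - dotL2 (resolvent l phi) (resolvent l phi).
    exact: (si_Br DS ip i1 i1).
  have a4 := siC DS i1 ip; have a5 := si_sqr DS ip; have a6 := si_sqr DS i1.
  rewrite (si_sqr DS ie) a1 a2 a3 a4 -a5 -a6 -/(el2 _) -/(el2 phi).
  have : el2 (resolvent l phi) ^+ 2 <= el2 phi ^+ 2.
    by rewrite ler_pXn2r ?nnegrE ?el2_ge0.
  rewrite -/(el2 (resolvent l phi)); move: (el2 _ ^+ 2) (el2 _ ^+ 2) (dotL2 _ _) => x y z.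
  by lra.
have D1 : dotL2 phi w = L2ip O (density phi - v) (density w) + ev w v.
  rewrite -density_test// (siC LS Hw Hv) (si_Bl LS Hp Hv Hw).
  by rewrite subrK.
have D2 : L2ip O (density phi - v) (density w) <= q / 2 * el2 w.
  apply: (le_trans (ler_norm _)); apply: (le_trans (si_CS LS (siB LS Hp Hv) Hw)).
  by rewrite ler_wpM2r ?sqrtr_ge0// ltW.
have D3 : ev w v <= q.
  apply: (le_trans (ler_norm _)); apply: (le_trans (ev_bound _ tv)).
  apply: (@le_trans _ _ (b * (el2 phi + 1) * (H10norm O v + 1))).
    apply: ler_pM => //; last by rewrite lerDl.
    by apply: (le_trans wH); rewrite ler_pM2l// lerDl.
  by rewrite /b -mulrA divfK// gt_eqF// mulr_gt0// ltr_wpDl.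
have Q : q * (4 * (el2 phi + 1)) = e ^+ 2 by rewrite /q divfK// gt_eqF// mulr_gt0.
rewrite -(@ler_pXn2r _ 2)// ?nnegrE ?sqrtr_ge0 ?(ltW e0)//.
apply: (le_trans E); rewrite D1 -Q.
have : q / 2 * el2 w <= q / 2 * (2 * el2 phi) by rewrite ler_pM2l// divr_gt0.
nra.
Qed.

End densities.

(** * Completeness and separability of the dual space *)

(** Rational bumps suffice to test against, the bumps being continuous in their
    end points. *)
Lemma fundamental_rational {R : realType} {d : nat} (O : set 'rV[R]_d)
  (oO : open O) (bO : bounded_set O) (g : d.-tuple (measurableTypeR R) -> R) :
  let D := pt @^-1` O in let mu := lebesgue_tuple (R := R) d in
  sqint mu D g ->
  (forall m (ab : {ffun 'I_d -> rat * rat}),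
    cbox (fun j => ratr (ab j).1) (fun j => ratr (ab j).2) `<=` O ->
    ip2 mu D g (box_bump m (fun j => ratr (ab j).1) (fun j => ratr (ab j).2) \o pt) = 0) ->
  {ae mu, forall t, D t -> g t = 0}.
Proof.
move=> D mu Hg g0; apply: (fundamental_bumps oO bO Hg) => m a b abO.
have mD : measurable D := open_measurable_pt oO.
have /choice[q hq] : forall k : nat, exists q : {ffun 'I_d -> rat * rat}, forall j,
    (a j < ratr (q j).1 < a j + k.+1%:R^-1) /\ (b j - k.+1%:R^-1 < ratr (q j).2 < b j).
  move=> k; have k0 : 0 < k.+1%:R^-1 :> R by rewrite invr_gt0.
  have /choice[p hp] : forall j, exists p : rat * rat,
      (a j < ratr p.1 < a j + k.+1%:R^-1) /\ (b j - k.+1%:R^-1 < ratr p.2 < b j).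
    move=> j; have /rat_in_itvoo[q1 h1] : a j < a j + k.+1%:R^-1 by rewrite ltrDl.
    have /rat_in_itvoo[q2 h2] : b j - k.+1%:R^-1 < b j by rewrite gtrBl.
    by exists (q1, q2); move: h1 h2; rewrite !in_itv.
  by exists [ffun j => p j] => j; rewrite ffunE.
pose A k j : R := ratr (q k j).1; pose B k j : R := ratr (q k j).2.
have kO k : cbox (A k) (B k) `<=` O.
  move=> x hx; apply: abO => j; have [/andP[h1 _] /andP[_ h2]] := hq k j.
  by have /andP[h3 h4] := hx j; rewrite (le_trans (ltW h1))// (le_trans h4)// ltW.
have cA j : A k j @[k --> \oo] --> a j.
  apply: (@squeeze_cvgr _ _ _ _ (fun=> a j) (fun k => a j + k.+1%:R^-1)).
  - by apply: nearW => k; have [/andP[h1 h2] _] := hq k j; rewrite !ltW.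
  - exact: cvg_cst.
  - by rewrite -[X in _ --> X]addr0; apply: cvgD; [exact: cvg_cst|exact: cvg_harmonic].
have cB j : B k j @[k --> \oo] --> b j.
  apply: (@squeeze_cvgr _ _ _ _ (fun k => b j - k.+1%:R^-1) (fun=> b j)).
  - by apply: nearW => k; have [_ /andP[h1 h2]] := hq k j; rewrite !ltW.
  - by rewrite -[X in _ --> X]subr0; apply: cvgB; [exact: cvg_cst|exact: cvg_harmonic].
  - exact: cvg_cst.
have ig := sqint_int oO bO Hg; have mg : measurable_fun D g by case: Hg.
have mv a' b' : measurable_fun D (box_bump m a' b' \o pt).
  by apply: continuous_measurable_pt => //; apply: smooth_continuous; exact: smooth_bump.
have [|||||_ _] := @dominated_convergence _ _ _ mu D mD
  (fun k t => (g t * box_bump m (A k) (B k) (pt t))%:E)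
  (fun t => (g t * box_bump m a b (pt t))%:E) (fun t => `|(g t)%:E|)%E.
- by move=> k; apply/measurable_EFinP; exact: (measurable_funM mg (mv _ _)).
- by apply/measurable_EFinP; exact: (measurable_funM mg (mv _ _)).
- apply: aeW => t Dt; apply: cvg_EFin; first exact: nearW.
  rewrite (_ : _ \o _ = (fun k => g t * box_bump m (A k) (B k) (pt t)))//.
  apply: cvgM; first exact: cvg_cst.
  apply: cvg_big => [|j _]; first exact: mul_continuous.
  have cf : continuous (flat 0 : R -> R) := @continuous_flat R 0.
  apply: cvgM.
    apply: (continuous_cvg _ (cf _)); apply: cvgM; first exact: cvg_cst.
    by apply: cvgB; [exact: cvg_cst|exact: cA].
  apply: (continuous_cvg _ (cf _)); apply: cvgM; first exact: cvg_cst.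
  by apply: cvgB; [exact: cB|exact: cvg_cst].
- exact: integrable_abse.
- apply: aeW => t k Dt; rewrite lee_fin normrM ler_piMr//.
  by rewrite ger0_norm ?bump_ge0// bump_le1.
rewrite (_ : (fun _ => _) = cst 0%E); last first.
  apply/funext => k /=; rewrite -(fineK (integrable_fin_num mD (sqint_prod mD Hg _))).
    by have := g0 m (q k) (kO k); rewrite /ip2 /Rintegral => ->.
  apply: (@sqint_bounded _ _ _ oO bO _ 1) => [|t _]; first exact: mv.
  by rewrite /= ger0_norm ?bump_ge0// bump_le1.
move=> h; have := cvg_unique (@ereal_hausdorff R) h (cvg_cst 0%E).
by rewrite /ip2 /Rintegral => E; rewrite /= E.
Qed.

Section dual_space_topology.
Context {R : realType} {n : nat}.
Variable O : set 'rV[R]_n.+1.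
Hypotheses (oO : open O) (bO : bounded_set O).
Let HS := ipH_si oO bO.
Let LS := L2fun_si oO.
Implicit Types phi psi chi : Hm1 O.

(** A Cauchy sequence converges at each test function, and the bounds pass to the
    limit. *)
Lemma Hm1_complete (f : nat -> Hm1 O) (r : nat -> R) :
  (forall k l, (k <= l)%N -> `|f k - f l| <= r k) -> r k @[k --> \oo] --> 0 ->
  exists g, forall k, `|g - f k| <= r k.
Proof.
move=> hf hr; have r0 k : 0 <= r k := le_trans (normr_ge0 _) (hf k k (leqnn k)).
have hv v k l : is_test O v -> (k <= l)%N -> `|ev (f k) v - ev (f l) v| <= r k * H10norm O v.
  move=> tv kl; rewrite -ev_B; apply: (le_trans (ev_bound _ tv)).
  by rewrite ler_wpM2r ?sqrtr_ge0//; exact: hf.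
have cv v : is_test O v -> cvg (ev (f k) v @[k --> \oo]).
  move=> tv; apply/cauchy_cvgP/cauchy_exP => e e0.
  have h : (fun k => r k * H10norm O v) @ \oo --> (0 : R).
    by rewrite -(mul0r (H10norm O v)); apply: cvgM; [exact: hr|exact: cvg_cst].
  move/cvgr0Pnorm_lt : h => /(_ e e0)[N _ hN]; exists (ev (f N) v); exists N => // l Nl /=.
  apply: le_lt_trans (hv v N l tv Nl) _; apply: le_lt_trans (ler_norm _) _.
  exact: (hN N (leqnn N)).
pose g v := lim (ev (f k) v @[k --> \oo]).
have gv v k : is_test O v -> `|g v - ev (f k) v| <= r k * H10norm O v.
  move=> tv; have h : (fun l => `|ev (f l) v - ev (f k) v|) @ \oo --> `|g v - ev (f k) v|.
    by apply: cvg_norm; apply: cvgB; [exact: cv|exact: cvg_cst].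
  rewrite -(cvg_lim (@Rhausdorff R) h); apply: limr_le; first by apply/cvg_ex; eexists; exact: h.
  by exists k => // l kl; rewrite distrC; exact: hv.
have [||phi hphi] := @mk_Hm1 R n O g (r 0 + `|f 0|).
- move=> c u v tu tv; apply/cvg_lim => //.
  rewrite (_ : (fun k => _) = (fun k => c * ev (f k) u + ev (f k) v)); last first.
    by apply/funext => k; rewrite ev_lin.
  by apply: cvgD; [apply: cvgM; [exact: cvg_cst|exact: cv]|exact: cv].
- move=> v tv; rewrite mulrDl -[g v](subrK (ev (f 0) v)); apply: (le_trans (ler_normD _ _)).
  by apply: lerD; [exact: gv|exact: ev_bound].
exists phi => k; apply: Hm1_le => // v tv.
by rewrite ev_B hphi//; exact: gv.
Qed.

(** Riesz representation on a subspace that need not be closed: the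
    representer is a limit of its elements. *)
Lemma Hm1_riesz (S : set (Hm1 O)) (l : Hm1 O -> R) (C : R) : semi_inner S (@ipH R n O) ->
  (forall c u v, S u -> S v -> l (c *: u + v) = c * l u + l v) ->
  (forall u, S u -> `|l u| <= C * `|u|) ->
  exists g, (forall w, S w -> ipH g w = l w) /\
    exists2 v : nat -> Hm1 O, (forall k, S (v k)) & forall k, `|g - v k| <= 2 / k.+1%:R.
Proof.
move=> SS ll lC; have nE (u : Hm1 O) : Num.sqrt (ipH u u) = `|u|.
  by rewrite (ipH_norm oO bO) sqrtr_sqr normr_id.
have [|v [Sv hv]] := riesz_sequence SS ll (C := C).
  by move=> u Su; rewrite nE; exact: lC.
have vC := riesz_cauchy SS Sv hv.
have [k l' kl||g hg] := @Hm1_complete v (fun k => 2 / k.+1%:R).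
- rewrite -nE; apply: (le_trans (vC _ _)); rewrite mulr_natl mulr2n lerD2l.
  by rewrite lef_pV2 ?posrE// ler_nat.
- by rewrite -[X in _ --> X](mulr0 2); apply: cvgM; [exact: cvg_cst|exact: cvg_harmonic].
exists g; split; last by exists v.
move=> w Sw; have hd k : `|ipH g w - l w| <= (3 * `|w|) / k.+1%:R.
  rewrite (_ : _ - _ = ipH (g - v k) w + (ipH (v k) w - l w)); last first.
    by rewrite (ipHBl oO bO); ring.
  rewrite (_ : 3 * _ / _ = (2 / k.+1%:R) * `|w| + `|w| / k.+1%:R); last by ring.
  apply: (le_trans (ler_normD _ _)); apply: lerD; last by rewrite -(nE w); exact: hv.
  by apply: (le_trans (ipH_CS oO bO _ _)); rewrite ler_wpM2r.
apply/eqP; rewrite -subr_eq0 -normr_le0.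
have hc : (fun k : nat => (3 * `|w|) / k.+1%:R) @ \oo --> (0 : R).
  by rewrite -[X in _ --> X](mulr0 (3 * `|w|)); apply: cvgM; [exact: cvg_cst|exact: cvg_harmonic].
rewrite -(cvg_lim (@Rhausdorff R) hc); apply: limr_ge; first by apply/cvg_ex; exists 0.
exact: nearW.
Qed.

Lemma ipHZr (c : R) phi psi : ipH phi (c *: psi) = c * ipH phi psi.
Proof. exact: (si_Zr HS). Qed.

(** The Dirichlet problem determines gradients up to null sets only; linearity
    holds because the gradients of both sides differ by a field of norm zero. *)
Lemma gip_gradinv_lin (c : R) phi psi w : L2field O w ->
  gip O (gradinv (c *: phi + psi)) w = c * gip O (gradinv phi) w + gip O (gradinv psi) w.
Proof.
move=> Hw; have FS := L2field_si oO.
pose a := gradinv (c *: phi + psi); pose b := c *: gradinv phi + gradinv psi.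
have Ha : L2field O a := gradinv_L2 oO bO _.
have H1 := gradinv_L2 oO bO phi; have H2 := gradinv_L2 oO bO psi.
have Hb : L2field O b := siP FS c H1 H2.
have HG := siB FS Ha Hb.
have G0 chi : gip O (a - b) (gradinv chi) = 0.
  have H3 := gradinv_L2 oO bO chi.
  rewrite (si_Bl FS Ha Hb H3) (siL FS c H1 H2 H3).
  rewrite -/(ipH (c *: phi + psi) chi) -/(ipH phi chi) -/(ipH psi chi).
  by rewrite (siL HS)// subrr.
have GG : gip O (a - b) (a - b) = 0.
  rewrite (si_Br FS Ha Hb HG) G0 sub0r (si_Dr FS (siZ FS c H1) H2 HG).
  by rewrite (si_Zr FS c H1 HG) !G0 mulr0 addr0 oppr0.
have := si_CS FS HG Hw; rewrite GG sqrtr0 mul0r normr_le0 (si_Bl FS Ha Hb Hw) subr_eq0 => /eqP ->.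
by rewrite (siL FS c H1 H2 Hw).
Qed.

Lemma Hm1_represents w : L2field O w -> exists e, forall phi, ipH phi e = gip O (gradinv phi) w.
Proof.
move=> Hw; have FS := L2field_si oO.
have [|phi _|e [he _]] := @Hm1_riesz setT (fun phi => gip O (gradinv phi) w) (Num.sqrt (gip O w w)) HS.
- by move=> c u v _ _; exact: gip_gradinv_lin.
- apply: (le_trans (si_CS FS (gradinv_L2 oO bO phi) Hw)).
  by rewrite -/(ipH phi phi) (ipH_norm oO bO) sqrtr_sqr normr_id mulrC.
by exists e => phi; rewrite (ipHC oO bO) he.
Qed.

(** A countable family with trivial orthogonal: the representers of the
    integrals of the gradient against rational bumps. *)
Lemma Hm1_total : exists e : nat -> Hm1 O, forall phi, (forall k, ipH phi (e k) = 0) -> phi = 0.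
Proof.
pose I := {ffun 'I_n.+1 -> rat * rat}.
pose inO (ab : I) := cbox (fun j => ratr (ab j).1 : R) (fun j => ratr (ab j).2) `<=` O.
pose bmp (m : nat) (ab : I) : 'rV[R]_n.+1 -> R :=
  box_bump m (fun j => ratr (ab j).1) (fun j => ratr (ab j).2).
have FS := L2field_si oO.
have /choice[e he] : forall k : nat, exists e : Hm1 O, forall (j : 'I_n.+1) m (ab : I),
    unpickle k = Some (j, m, ab) -> inO ab ->
    forall phi, ipH phi e = L2ip O (gradinv phi j) (bmp m ab).
  move=> k; case: (unpickle k) => [[[j m] ab]|]; last by exists 0.
  have [abO|nabO] := pselect (inO ab); last by exists 0 => j' m' ab' [_ _ <-].
  have Hb := test_sqint oO bO (bump_test m abO).
  pose w (i : 'I_n.+1) := if i == j then bmp m ab else 0.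
  have Hw : L2field O w by move=> i; rewrite /w; case: ifP => _; [exact: Hb|exact: (si0 LS)].
  have [e he] := Hm1_represents Hw.
  exists e => _ _ _ [<- <- <-] _ phi; rewrite he /gip (bigD1 j)//= big1 ?addr0 => [|i /negPf ij].
    by rewrite /w eqxx.
  have Hg := gradinv_L2 oO bO phi i.
  by rewrite (siC LS Hg (Hw i)) /w ij; exact: (si_0l LS).
exists e => phi h; apply/eqP; rewrite -normr_eq0 -sqrf_eq0 -(ipH_norm oO bO) /ipH /gip big1// => j _.
have Hg := gradinv_L2 oO bO phi j.
have SI := sqint_semi_inner (lebesgue_tuple (R := R) n.+1) (open_measurable_pt oO).
rewrite /L2ip (@ip2_ae _ _ _ _ _ (open_measurable_pt oO) _ 0)//.
- exact: (si_0l SI Hg).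
- exact: (si0 SI).
- apply: (fundamental_rational oO bO Hg) => m ab abO.
  by have := he (pickle (j, m, ab)) j m ab (pickleK _) abO phi; rewrite h => E; rewrite [RHS]E.
Qed.

(** The norm of [H^-1] is a supremum over countably many continuous linear
    forms. *)
Lemma Hm1_norming : exists D : nat -> Hm1 O, forall phi c, 0 <= c ->
  (forall k, `|ipH phi (D k)| <= c * `|D k|) -> `|phi| <= c.
Proof.
have [e he] := Hm1_total.
pose comb (T : Type) (c : T -> R) (s : seq (nat * T)) : Hm1 O := \sum_(p <- s) c p.2 *: e p.1.
pose S : set (Hm1 O) := range (comb R id).
have S0 : S 0 by exists [::] => //; rewrite /comb big_nil.
have SP c u v : S u -> S v -> S (c *: u + v).
  move=> [s _ <-] [s' _ <-]; exists ([seq (p.1, c * p.2) | p <- s] ++ s') => //.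
  rewrite /comb big_cat big_map scaler_sumr/=; congr (_ + _).
  by apply: eq_bigr => p _; rewrite scalerA.
have Se k : S (e k) by exists [:: (k, 1)] => //; rewrite /comb big_seq1 scale1r.
have SS : semi_inner S (@ipH R n O).
  split=> //.
  - by move=> c u v w _ _ _; exact: (siL HS).
  - by move=> u v _ _; exact: (siC HS).
  - by move=> u _; exact: (si_ge0 HS).
exists (fun k => if unpickle k is Some s then comb rat ratr s else 0) => phi c c0 hc.
have hQ s : `|ipH phi (comb rat ratr s)| <= c * `|comb rat ratr s|.
  by have := hc (pickle s); rewrite pickleK.
have approx u eps : S u -> 0 < eps -> exists s, `|u - comb rat ratr s| <= eps.
  move=> [s _ <-]; elim: s eps => [|p s IH] eps eps0.
    by exists [::]; rewrite /comb !big_nil subr0 normr0 ltW.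
  have [s' hs'] := IH (eps / 2) (divr_gt0 eps0 (ltr0n R 2)).
  have h0 : 0 < `|e p.1| + 1 by rewrite ltr_wpDl.
  have /rat_in_itvoo[q] : p.2 < p.2 + eps / 2 / (`|e p.1| + 1).
    by rewrite ltrDl !divr_gt0.
  rewrite in_itv/= => /andP[q1 q2]; exists ((p.1, q) :: s').
  rewrite /comb !big_cons/= -/(comb R id s) -/(comb rat ratr s') opprD addrACA -scalerBl.
  apply: (le_trans (ler_normD _ _)); rewrite [leRHS](splitr eps); apply: lerD => //.
  rewrite normrZ distrC ger0_norm ?subr_ge0 ?(ltW q1)//.
  have : (ratr q - p.2) * (`|e p.1| + 1) <= eps / 2.
    by rewrite -ler_pdivlMr// lerBlDl ltW.
  by apply: le_trans; rewrite ler_wpM2l ?subr_ge0 ?(ltW q1)// lerDl.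
have hS u : S u -> `|ipH phi u| <= c * `|u|.
  move=> Su; rewrite leNgt; apply/negP => hlt.
  pose eps := (`|ipH phi u| - c * `|u|) / (2 * (c + `|phi| + 1)).
  have k0 : 0 < c + `|phi| + 1 by rewrite ltr_wpDl// addr_ge0.
  have eps0 : 0 < eps by rewrite divr_gt0 ?subr_gt0// mulr_gt0.
  have [s hs] := approx u eps Su eps0; set w := comb rat ratr s in hs.
  have e1 : `|ipH phi u| <= `|phi| * eps + c * (`|u| + eps).
    rewrite (_ : ipH phi u = ipH phi (u - w) + ipH phi w); last by rewrite (ipHBr oO bO) subrK.
    apply: (le_trans (ler_normD _ _)); apply: lerD.
      by apply: (le_trans (ipH_CS oO bO _ _)); rewrite ler_wpM2l.
    apply: (le_trans (hQ s)); rewrite ler_wpM2l// -/w.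
    rewrite -[w](subrK u); apply: (le_trans (ler_normD _ _)).
    by rewrite addrC lerD2l distrC.
  have e2 : eps * (2 * (c + `|phi| + 1)) = `|ipH phi u| - c * `|u|.
    by rewrite /eps divfK// gt_eqF// mulr_gt0.
  have := mulr_ge0 c0 (ltW eps0); have := mulr_ge0 (normr_ge0 phi) (ltW eps0).
  nra.
have [|g [hg [v Sv hv]]] := Hm1_riesz SS _ hS.
  by move=> a u v _ _; rewrite (ipHDr oO bO) ipHZr.
have gphi : g = phi.
  apply/eqP; rewrite -subr_eq0; apply/eqP; apply: he => k.
  by rewrite (ipHBl oO bO) hg// subrr.
have [->|p0] := eqVneq phi 0; first by rewrite normr0.
have pp : 0 < `|phi| by rewrite normr_gt0.
rewrite -(ler_pM2r pp) -expr2 -(ipH_norm oO bO).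
have hd k : ipH phi phi - c * `|phi| <= ((`|phi| + c) * 2) / k.+1%:R.
  have := hv k; rewrite gphi => hk.
  have a1 : ipH phi phi = ipH phi (phi - v k) + ipH phi (v k) by rewrite (ipHBr oO bO) subrK.
  have a2 := le_trans (ler_norm _) (ipH_CS oO bO phi (phi - v k)).
  have a3 := le_trans (ler_norm _) (hS _ (Sv k)).
  have a4 : `|v k| <= `|phi| + `|phi - v k|.
    by rewrite -{1}[v k](subrK phi) addrC (distrC phi); exact: ler_normD.
  have a5 : c * `|v k| <= c * (`|phi| + `|phi - v k|) by rewrite ler_wpM2l.
  have a6 : `|phi| * `|phi - v k| <= `|phi| * (2 / k.+1%:R) by rewrite ler_wpM2l.
  have a7 : c * `|phi - v k| <= c * (2 / k.+1%:R) by rewrite ler_wpM2l.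
  move: a1 a2 a3 a5 a6 a7; rewrite -mulrA mulrDl mulrDr.
  move: (_ / _) (`|phi - _|) (`|v k|) (ipH _ _) (ipH _ _) (ipH _ _) => x y z p q r; lra.
have hc' : (fun k : nat => ((`|phi| + c) * 2) / k.+1%:R) @ \oo --> (0 : R).
  by rewrite -[X in _ --> X](mulr0 ((`|phi| + c) * 2)); apply: cvgM; [exact: cvg_cst|exact: cvg_harmonic].
rewrite -subr_le0 -(cvg_lim (@Rhausdorff R) hc'); apply: limr_ge; first by apply/cvg_ex; exists 0.
exact: nearW.
Qed.

End dual_space_topology.

(** * The nonlinear form *)

Section nonlinear_form.
Context {R : realType} {n : nat}.
Local Notation Rd := 'rV[R]_n.+1.
Variable O : set Rd.
Hypotheses (oO : open O) (bO : bounded_set O).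
Local Notation D := (pt @^-1` O).
Local Notation mu := (lebesgue_tuple (R := R) n.+1).
Let mD : measurable D := open_measurable_pt oO.
Let LS := L2fun_si oO.
Let SI := sqint_semi_inner mu mD.
Variable beta : R -> R.
Hypothesis hbeta : admissible_beta beta.
Implicit Types y phi psi : Hm1 O.

Definition nonlin y psi : R := intO O (fun z => beta (density y z) * density psi z).

Lemma L2_int_le (f g : Rd -> R) : mu.-integrable D (EFin \o (f \o pt)) ->
  mu.-integrable D (EFin \o (g \o pt)) -> (forall x, O x -> f x <= g x) ->
  intO O f <= intO O g.
Proof. by move=> hf hg fg; apply: le_Rintegral => // t Dt; exact: fg. Qed.

Lemma nL2_le (f g : Rd -> R) (c : R) : 0 <= c -> measurable_fun D (f \o pt) -> L2fun O g ->
  (forall x, O x -> `|f x| <= c * `|g x|) -> L2fun O f /\ nL2 O f <= c * nL2 O g.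
Proof.
move=> c0 mf Hg fg; have Hcg := siZ LS c Hg.
have fg' x : O x -> `|f x| <= `|(c *: g) x|.
  by move=> Ox; rewrite (_ : (c *: g) x = c * g x)// normrM (ger0_norm c0); exact: fg.
have Hf : L2fun O f by apply: (sqint_le mD mf Hcg) => t Dt; exact: fg'.
split=> //; rewrite -(ger0_norm c0) -(si_nrmZ LS c Hg); apply: ler_wsqrtr.
apply: le_Rintegral => //; [exact: (sqint_prod mD Hf Hf)|exact: (sqint_prod mD Hcg Hcg)|].
move=> t Dt /=; rewrite -!expr2 -(real_normK (num_real (f _))) -(real_normK (num_real ((c *: g) _))).
by rewrite ler_pXn2r ?nnegrE//; exact: fg'.
Qed.

Lemma L2_cst (c : R) : L2fun O (cst c).
Proof. by apply: (@sqint_bounded _ _ _ oO bO _ `|c|); [exact: measurable_cst|]. Qed.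

Let Lip : exists2 L : R, 0 <= L & forall r s, `|beta r - beta s| <= L * `|r - s|.
Proof.
have [[L hL] _] := hbeta; exists `|L| => // r s.
by apply: (le_trans (hL r s)); rewrite ler_wpM2r ?ler_norm.
Qed.

Let cbeta : continuous beta.
Proof.
have [L L0 hL] := Lip; move=> x; apply/cvgrPdist_le => e e0.
have L1 : 0 < L + 1 by rewrite ltr_wpDl.
exists (e / (L + 1)) => /=; first exact: divr_gt0.
move=> y xy; apply: (le_trans (hL x y)).
have : `|x - y| * (L + 1) <= e by rewrite -ler_pdivlMr// ltW.
by apply: le_trans; rewrite mulrC ler_wpM2l// lerDl.
Qed.

Let mbeta (g : Rd -> R) : L2fun O g -> measurable_fun D ((beta \o g) \o pt).
Proof.
by move=> [mg _]; apply: (measurableT_comp (continuous_measurable_fun cbeta) mg).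
Qed.

Lemma L2_beta (g : Rd -> R) : L2fun O g -> L2fun O (beta \o g).
Proof.
move=> Hg; have [L L0 hL] := Lip.
have mB : measurable_fun D (((beta \o g) - cst (beta 0)) \o pt).
  by apply: measurable_funB; [exact: mbeta|exact: measurable_cst].
have [|H1 _] := nL2_le L0 mB Hg.
  by move=> x _; have := hL (g x) 0; rewrite subr0.
rewrite (_ : beta \o g = ((beta \o g) - cst (beta 0)) + cst (beta 0)); last by rewrite subrK.
exact: (siD LS H1 (L2_cst _)).
Qed.

Let nonlinE y psi : nonlin y psi = L2ip O (beta \o density y) (density psi).
Proof. by []. Qed.

Lemma nonlin_lin y c phi psi : in_L2 y -> in_L2 phi -> in_L2 psi ->
  nonlin y (c *: phi + psi) = c * nonlin y phi + nonlin y psi.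
Proof.
move=> iy ip iq; have Hb := L2_beta (density_L2 iy).
have H1 := density_L2 ip; have H2 := density_L2 iq.
have H3 := density_L2 (in_L2_P oO bO c ip iq).
rewrite !nonlinE (siC LS Hb H3) (siC LS Hb H1) (siC LS Hb H2).
exact: density_lin.
Qed.

Lemma density_B phi psi : in_L2 phi -> in_L2 psi ->
  is_density (phi - psi) (density phi - density psi).
Proof.
move=> ip iq; rewrite (_ : phi - psi = -1 *: psi + phi); last by rewrite scaleN1r addrC.
rewrite (_ : density phi - density psi = -1 *: density psi + density phi); last by rewrite scaleN1r addrC.
exact: (is_density_P oO bO _ (densityP iq) (densityP ip)).
Qed.

Lemma el2_density phi psi : in_L2 phi -> in_L2 psi ->
  el2 (phi - psi) = nL2 O (density phi - density psi).
Proof.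
move=> ip iq; have dB := density_B ip iq.
have iB : in_L2 (phi - psi) by eexists; exact: dB.
have HB : L2fun O (density phi - density psi) := siB LS (density_L2 ip) (density_L2 iq).
rewrite /el2 /dotL2 (density_ip oO bO dB (density_L2 iB)).
by rewrite (siC LS HB (density_L2 iB)) (density_ip oO bO dB HB).
Qed.

Lemma nonlin_bounds : exists L c : R, [/\ 0 <= L, 0 <= c,
  forall y y' psi, in_L2 y -> in_L2 y' -> in_L2 psi ->
    `|nonlin y psi - nonlin y' psi| <= L * el2 (y - y') * el2 psi &
  forall y psi, in_L2 y -> in_L2 psi -> `|nonlin y psi| <= (c + L * el2 y) * el2 psi].
Proof.
have [L L0 hL] := Lip; exists L, (nL2 O (cst (beta 0))).
have lipB (g h : Rd -> R) : L2fun O g -> L2fun O h ->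
    nL2 O ((beta \o g) - (beta \o h)) <= L * nL2 O (g - h).
  move=> Hg Hh; have [||//] := nL2_le (f := (beta \o g) - (beta \o h)) L0 _ (siB LS Hg Hh).
    by apply: measurable_funB; exact: mbeta.
  by move=> x _; exact: hL.
split=> //; first exact: sqrtr_ge0.
- move=> y y' psi iy iy' ips; have H1 := density_L2 iy; have H2 := density_L2 iy'.
  have H3 := density_L2 ips; have B1 := L2_beta H1; have B2 := L2_beta H2.
  rewrite !nonlinE -(si_Bl LS B1 B2 H3); apply: (le_trans (si_CS LS (siB LS B1 B2) H3)).
  by rewrite ler_wpM2r ?sqrtr_ge0// (el2_density iy iy'); exact: lipB.
- move=> y psi iy ips; have H1 := density_L2 iy; have H3 := density_L2 ips.
  have B1 := L2_beta H1; rewrite nonlinE; apply: (le_trans (si_CS LS B1 H3)).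
  rewrite ler_wpM2r ?sqrtr_ge0//; have Hc := L2_cst (beta 0).
  rewrite (_ : beta \o density y = cst (beta 0) + ((beta \o density y) - (beta \o (cst 0)))); last first.
    by rewrite addrC subrK.
  have B2 : L2fun O ((beta \o density y) - (beta \o cst 0)) := siB LS B1 Hc.
  apply: (le_trans (si_triangle LS Hc B2)); rewrite lerD2l.
  have := lipB _ _ H1 (L2_cst 0); rewrite /el2 /dotL2.
  by rewrite (_ : density y - cst 0 = density y)//; apply/funext => x; exact: subr0.
Qed.

Lemma nonlin_monotone y y' : in_L2 y -> in_L2 y' ->
  0 <= nonlin y (y - y') - nonlin y' (y - y').
Proof.
move=> iy iy'; have H1 := density_L2 iy; have H2 := density_L2 iy'.
have B1 := L2_beta H1; have B2 := L2_beta H2; have dB := density_B iy iy'.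
have iB : in_L2 (y - y') by eexists; exact: dB.
have HB : L2fun O (density y - density y') := siB LS H1 H2.
have B12 : L2fun O ((beta \o density y) - (beta \o density y')) := siB LS B1 B2.
have H3 := density_L2 iB; rewrite !nonlinE -(si_Bl LS B1 B2 H3).
rewrite (siC LS B12 H3) (density_ip oO bO dB B12) (siC LS HB B12).
apply: Rintegral_ge0 => t _ /=; have [_ [a a0 ha]] := hbeta.
by apply: le_trans (ha _ _); rewrite mulr_ge0 ?sqr_ge0// ltW.
Qed.

(** [beta r * r >= alpha r^2 + beta 0 * r] is bounded below, by [- k], and [O] has
    finite measure. *)
Lemma nonlin_lower_bound : exists2 c : R, 0 <= c & forall y, in_L2 y -> - c <= nonlin y y.
Proof.
have [_ [a a0 ha]] := hbeta; pose k := beta 0 ^+ 2 / (4 * a).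
have k0 : 0 <= k by rewrite divr_ge0 ?sqr_ge0// mulr_ge0// ltW.
exists (intO O (cst k)) => [|y iy]; first exact: Rintegral_ge0.
have H1 := density_L2 iy; have B1 := L2_beta H1.
have Ik : mu.-integrable D (EFin \o (cst k \o pt)) := sqint_int oO bO (L2_cst k).
rewrite (_ : - _ = intO O (fun z => (-1) * cst k z)); last first.
  by have := RintegralZl (-1) mD Ik; rewrite mulN1r /intO => <-.
apply: L2_int_le; first exact: integrableRZ.
  exact: (sqint_prod mD B1 H1).
move=> x _ /=; have := ha (density y x) 0; rewrite !subr0 => h.
have e1 : k * (4 * a) = beta 0 ^+ 2 by rewrite /k divfK// gt_eqF// mulr_gt0.
have : 0 <= (2 * a * density y x + beta 0) ^+ 2 by exact: sqr_ge0.
set r := density y x in h *; set b := beta 0 in h e1 *; set c := beta r in h *.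
move=> h2; have : 0 <= (k + a * r ^+ 2 + b * r) * (4 * a) by nra.
rewrite pmulr_lge0 ?mulr_gt0// => h3; nra.
Qed.

End nonlinear_form.

(** * The transport group *)

Lemma bounded_on_closure {R : realType} {d : nat} (O : set 'rV[R]_d) (f : 'rV[R]_d -> R) :
  bounded_set O -> {within closure O, continuous f} ->
  exists2 M : R, 0 <= M & forall x, O x -> `|f x| <= M.
Proof.
move=> [M [_ hM]] cf.
have bC : bounded_set (closure O).
  exists (`|M| + 2); split; first exact: num_real.
  move=> K MK x cx; have [y [Oy xy]] := cx _ (nbhsx_ballx x 1 ltr01).
  have h1 : `|y| <= `|M| + 1.
    by apply: (hM _ _ y Oy); rewrite (le_lt_trans (ler_norm M))// ltrDl.
  rewrite -ball_normE/= in xy; rewrite -[x](subrK y).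
  apply: (le_trans (ler_normD _ _)); apply: (@le_trans _ _ (1 + (`|M| + 1))).
    by apply: lerD => //; exact: ltW.
  by rewrite addrCA (ltW MK).
have := continuous_compact cf (bounded_closed_compact bC (@closed_closure _ O)).
move=> /compact_bounded [N [_ hN]]; exists (`|N| + 1); first by rewrite addr_ge0.
move=> x Ox; apply: (hN (`|N| + 1)); first by rewrite (le_lt_trans (ler_norm N))// ltrDl.
by exists x => //; exact: subset_closure.
Qed.

Section transport_group.
Context {R : realType} {n : nat}.
Variable O : set 'rV[R]_n.+1.
Hypotheses (oO : open O) (bO : bounded_set O).
Variables (b : 'rV[R]_n.+1 -> 'rV[R]_n.+1) (G : R -> Hm1 O -> Hm1 O).
Hypotheses (hb : admissible_field O b) (hG : is_transport_group b G).
Let LS := L2fun_si oO.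
Let FS := L2field_si oO.
Let DS := dotL2_si oO bO.
Implicit Types phi psi chi : Hm1 O.

(** [b] is bounded on [O], being continuous on its compact closure. *)
Lemma transport_bound : exists2 C : R, 0 <= C & forall phi chi, is_transport b phi chi ->
  in_L2 chi /\ el2 chi <= C * `|phi|.
Proof.
have [hC _ _] := hb.
have /choice[M hM] : forall j, exists M : R, 0 <= M /\ forall x, O x -> `|b x 0 j| <= M.
  move=> j; have [cb _] := hC j.
  by have [M M0 hM] := bounded_on_closure bO cb; exists M.
pose C := \sum_j M j; have C0 : 0 <= C by apply: sumr_ge0 => j _; have [] := hM j.
exists C => // phi chi tr; have ichi : in_L2 chi by eexists; exact: tr.
split=> //; pose g x := \sum_(j < n.+1) b x 0 j * gradinv phi j x.
have {}tr : is_density chi g := tr; have Hg : L2fun O g by case/is_densityE : tr.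
have Hf := gradinv_L2 oO bO phi.
pose q x := \sum_j gradinv phi j x * gradinv phi j x.
have gq x : O x -> g x * g x <= C ^+ 2 * q x.
  move=> Ox; have q0 : 0 <= q x by apply: sumr_ge0 => j _; rewrite -expr2 sqr_ge0.
  have : `|g x| <= C * Num.sqrt (q x).
    apply: (le_trans (ler_norm_sum _ _ _)); rewrite /C mulr_suml.
    apply: ler_sum => j _; rewrite normrM; apply: ler_pM => //; first by apply: (hM j).2.
    rewrite -sqrtr_sqr; apply: ler_wsqrtr; rewrite expr2 /q (bigD1 j)//= lerDl.
    by apply: sumr_ge0 => i _; rewrite -expr2 sqr_ge0.
  rewrite -(ler_pXn2r (n := 2))// ?nnegrE ?mulr_ge0 ?sqrtr_ge0// exprMn sqr_sqrtr//.
  by rewrite real_normK ?num_real// expr2.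
have iq : (lebesgue_tuple (R := R) n.+1).-integrable (pt @^-1` O) (EFin \o (q \o pt)).
  rewrite (_ : EFin \o _ = (fun t => \sum_j (gradinv phi j (pt t) * gradinv phi j (pt t))%:E)%E); last first.
    by apply/funext => t; rewrite /= sumEFin.
  apply: integrable_sum; first exact: open_measurable_pt.
  by move=> j _; exact: (sqint_prod (open_measurable_pt oO) (Hf j) (Hf j)).
rewrite -[C * _]ger0_norm ?mulr_ge0// -sqrtr_sqr; apply: ler_wsqrtr.
rewrite /dotL2 (density_ip oO bO tr (density_L2 ichi)) (siC LS Hg (density_L2 ichi)).
rewrite (density_ip oO bO tr Hg) exprMn -(ipH_norm oO bO).
rewrite /ipH -(intO_gip oO Hf Hf) -/q.
apply: (@le_trans _ _ (intO O (fun x => C ^+ 2 * q x))); last first.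
  by rewrite /intO RintegralZl//; exact: open_measurable_pt.
apply: (@L2_int_le _ _ O oO (fun x => g x * g x) (fun x => C ^+ 2 * q x)) => //; first exact: (sqint_prod (open_measurable_pt oO) Hg Hg).
by apply: integrableRZ => //; exact: open_measurable_pt.
Qed.

Lemma group_lin s c phi psi : G s (c *: phi + psi) = c *: G s phi + G s psi.
Proof. by have [h _] := hG. Qed.

Lemma groupB s phi psi : G s (phi - psi) = G s phi - G s psi.
Proof. by rewrite addrC -scaleN1r group_lin scaleN1r addrC. Qed.

Lemma group0 phi : G 0 phi = phi.
Proof. by have [_ [[-> _ _ _ _] _]] := hG. Qed.

Lemma groupD s s' phi : G (s + s') phi = G s (G s' phi).
Proof. by have [_ [[_ -> _ _ _] _]] := hG. Qed.

Lemma groupN s phi : G (- s) (G s phi) = phi.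
Proof. by rewrite -groupD addNr group0. Qed.

(** The inverse [G (- s)] is a contraction too. *)
Lemma group_norm s phi : `|G s phi| = `|phi|.
Proof.
have [_ [[_ _ h _ _] _]] := hG; apply/eqP; rewrite eq_le h/=.
by rewrite -{1}[phi](groupN s) h.
Qed.

(** Polarisation. *)
Lemma group_ip s phi psi : ipH (G s phi) (G s psi) = ipH phi psi.
Proof.
have h1 := norm2_split oO bO phi psi; have h2 := norm2_split oO bO (G s phi) (G s psi).
have e : G s phi + G s psi = G s (phi + psi).
  by rewrite -{2}[phi]scale1r group_lin scale1r.
by rewrite e !group_norm h1 in h2; lra.
Qed.

Lemma group_adj s phi psi : ipH (G s phi) psi = ipH phi (G (- s) psi).
Proof. by rewrite -(group_ip (- s)) groupN. Qed.

Lemma group_in s phi : in_L2 phi -> in_L2 (G s phi).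
Proof. by have [_ [_]] := hG; apply. Qed.

Lemma group_derive v phi s : is_test O v -> exists chi, is_transport b (G s phi) chi /\
  is_derive s (1 : R) (fun s => ev (G s phi) v) (ev chi v).
Proof.
move=> tv; have [_ [[_ _ _ _ h] _]] := hG.
have [chi tr hc] := h (G s phi); exists chi; split=> //.
apply: is_derive_cvg; apply/cvgrPdist_le => e e0.
have H0 : 0 < H10norm O v + 1 by rewrite ltr_wpDl// sqrtr_ge0.
move/cvgrPdist_le : hc => /(_ _ (divr_gt0 e0 H0)).
apply: filterS => k; have -> : (k *: 1 : R) = k by rewrite /GRing.scale/= mulr1.
move=> hk; set d := (X in `|chi - X|) in hk.
have -> : k^-1 *: (ev (G (k + s) phi) v - ev (G s phi) v) = ev d v.
  have E0 : ev (0 : Hm1 O) v = 0 by rewrite -[0](subrr (0 : Hm1 O)) ev_B subrr.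
  have -> : ev d v = k^-1 * ev (G k (G s phi) - G s phi) v + ev (0 : Hm1 O) v.
    by rewrite -ev_P addr0.
  by rewrite E0 addr0 ev_B groupD.
rewrite -ev_B; apply: (le_trans (ev_bound _ tv)).
apply: (@le_trans _ _ (e / (H10norm O v + 1) * (H10norm O v + 1))); last by rewrite divfK ?gt_eqF.
by apply: ler_pM => //; [exact: sqrtr_ge0|rewrite lerDl].
Qed.

Lemma group_map_continuous s : continuous (G s).
Proof.
move=> phi; apply/(@cvgrPdist_lt R (Hm1 O) (Hm1 O) (nbhs phi) (nbhs_filter phi)) => e e0.
by apply: filterS (nbhsx_ballx phi e e0) => psi; rewrite -ball_normE /= -groupB group_norm.
Qed.

(** The increments of the group gain integrability, since its generator maps
    [H^-1] to [L^2]. *)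
Lemma group_increment : exists2 C : R, 0 <= C & forall s phi,
  in_L2 (G s phi - phi) /\ el2 (G s phi - phi) <= C * `|s| * `|phi|.
Proof.
have [C C0 hC] := transport_bound; exists C => // s phi.
apply: (in_L2_crit oO bO); first by rewrite !mulr_ge0.
move=> v tv; rewrite ev_B -{2}[phi]group0.
pose f r := ev (G r phi) v.
have /choice[chi hchi] : forall r, exists chi, is_transport b (G r phi) chi /\
  is_derive r (1 : R) f (ev chi v) by move=> r; exact: group_derive.
have cf : continuous f.
  by move=> r; apply: differentiable_continuous; apply/derivable1_diffP; have [_ []] := hchi r.
have bd r : `|ev (chi r) v| <= C * `|phi| * nL2 O v.
  have [tr _] := hchi r; have [ir hr] := hC _ _ tr.
  apply: (le_trans (el2_bound oO bO ir tv)); rewrite ler_wpM2r ?sqrtr_ge0//.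
  by rewrite group_norm in hr.
have lip r r' : r <= r' -> `|f r' - f r| <= C * `|phi| * nL2 O v * (r' - r).
  move=> rr; have [||c _ ->] := @MVT_segment R f (fun r => ev (chi r) v) r r' rr.
  - by move=> x _; have [] := hchi x.
  - exact: continuous_subspaceT.
  by rewrite normrM (ger0_norm (x := r' - r)) ?subr_ge0// ler_wpM2r ?subr_ge0.
rewrite (_ : C * `|s| * `|phi| * nL2 O v = C * `|phi| * nL2 O v * `|s|); last by ring.
have [s0|s0] := leP 0 s.
  by have := lip 0 s s0; rewrite subr0 (ger0_norm s0).
by have := lip s 0 (ltW s0); rewrite distrC (ltr0_norm s0) sub0r.
Qed.

(** The first bound uses the Poincare inequality; the second one makes the group
    bounded on [L^2], uniformly on bounded times. *)
Lemma group_bounds : exists2 C : R, 0 <= C & forall s phi,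
  `|G s phi - phi| <= C * `|s| * `|phi| /\
  (in_L2 phi -> el2 (G s phi) <= (1 + C * `|s|) * el2 phi).
Proof.
have [C C0 hC] := group_increment; have [P0 _] := poincare_constP oO bO.
exists (poincare_const O * C); first exact: mulr_ge0.
move=> s phi; have [i1 h1] := hC s phi; split.
  apply: (le_trans (norm_el2 oO bO i1)).
  by rewrite -!mulrA ler_wpM2l// mulrA.
move=> ip; rewrite -[G s phi](subrK phi).
apply: (le_trans (si_triangle DS i1 ip)); rewrite mulrDl mul1r addrC lerD2l.
apply: (le_trans h1); rewrite (_ : _ * el2 phi = C * `|s| * (poincare_const O * el2 phi)); last by ring.
by rewrite ler_wpM2l ?mulr_ge0//; exact: norm_el2.
Qed.

End transport_group.

(** * Paths in the dual space *)

Section path_measurability.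
Context {R : realType} {n : nat}.
Variable O : set 'rV[R]_n.+1.
Hypotheses (oO : open O) (bO : bounded_set O).

(** The sublevel sets of the [L^2] norm are closed in [H^-1], being defined by
    inequalities against test functions. *)
Lemma L2norm_measurable (x : R -> Hm1 O) (a b : R) : {within `[a, b], continuous x} ->
  measurable_fun `[a, b] (fun r => L2norm (x r)).
Proof.
move=> /subspace_continuousP cx mI.
apply: (measurability _ (ErealGenOInfty.measurableE R)) => // _ [_ [c ->] <-].
rewrite [X in measurable X](_ : _ = `[a, b] `\` (`[a, b] `&` [set r | (L2norm (x r) <= c%:E)%E])); last first.
  apply/seteqP; split=> r /=.
    move=> [Ir]; rewrite in_itv/= andbT => h; split=> // -[_]; rewrite leNgt h//.
  move=> [Ir h]; split=> //; rewrite in_itv/= andbT ltNge; apply/negP => h'.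
  by apply: h.
apply: measurableD => //; apply: closed_measurable.
have [c0|c0] := ltP c 0.
  rewrite (_ : _ `&` _ = set0); first exact: closed0.
  apply/seteqP; split=> r // [_ /=]; rewrite leNgt => /negP; apply.
  have [i|i] := pselect (in_L2 (x r)); last by rewrite L2norm_out// ltry.
  by rewrite L2norm_in// lte_fin (lt_le_trans c0)// el2_ge0.
rewrite (_ : _ `&` _ = [set r | `[a, b]%classic r /\
    forall v, is_test O v -> `|ev (x r) v| <= c * nL2 O v]); last first.
  apply/seteqP; split=> r /= [Ir h]; split=> //.
    move=> v tv; have [i|i] := pselect (in_L2 (x r)); last by rewrite L2norm_out// in h.
    rewrite L2norm_in// lee_fin in h.
    by apply: (le_trans (el2_bound oO bO i tv)); rewrite ler_wpM2r ?sqrtr_ge0.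
  by have [i1 h1] := in_L2_crit oO bO c0 h; rewrite L2norm_in.
move=> r cr.
have Ir : `[a, b]%classic r.
  apply: (@interval_closed _ (BLeft a) (BRight b)) => //.
  by apply: closure_subset cr => y [].
split=> // v tv; rewrite leNgt; apply/negP => hlt.
pose e := (`|ev (x r) v| - c * nL2 O v) / (H10norm O v + 1).
have H0 : 0 < H10norm O v + 1 by rewrite ltr_wpDl// sqrtr_ge0.
have e0 : 0 < e by rewrite divr_gt0// subr_gt0.
have /cvgrPdist_lt/(_ e e0) := cx r Ir; rewrite near_withinE => /cr [s [[Is hs] ds]].
have {}ds := ds Is.
have h1 := ev_bound (x r - x s) tv; rewrite ev_B in h1.
have h2 : `|ev (x r) v| <= `|ev (x r) v - ev (x s) v| + `|ev (x s) v|.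
  by rewrite -{1}[ev (x r) v](subrK (ev (x s) v)); exact: ler_normD.
have h3 := hs v tv.
have h4 : `|x r - x s| * (H10norm O v + 1) < `|ev (x r) v| - c * nL2 O v.
  by rewrite -ltr_pdivlMr.
have := normr_ge0 (x r - x s); lra.
Qed.

End path_measurability.

(** * The energy inequality *)

Lemma uniform_continuity {R : realType} {V : normedModType R} (x : R -> V) (a b e : R) :
  {within `[a, b], continuous x} -> 0 < e ->
  exists2 d, 0 < d & forall r r', r \in `[a, b] -> r' \in `[a, b] -> `|r - r'| < d ->
    `|x r - x r'| < e.
Proof.
move=> /subspace_continuousP cx e0.
pose P (d r : R) := forall r', r' \in `[a, b] -> `|r - r'| < d -> r \in `[a, b] -> `|x r - x r'| < e.
have : \forall d \near (0 : R)^'+, `[a, b]%classic `<=` P d.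
  have /compact_near_coveringP := @segment_compact R a b; apply => r Ir.
  have /cvgrPdist_lt/(_ _ (divr_gt0 e0 (ltr0n R 2))) := cx r Ir.
  rewrite near_withinE => -[h /= h0 hx].
  have hx' r' : r' \in `[a, b] -> `|r - r'| < h -> `|x r - x r'| < e / 2.
    by move=> Ir' rr; exact: hx.
  have h2 : 0 < h / 2 by rewrite divr_gt0.
  exists (ball r (h / 2), [set d | d < h / 2]) => /=.
    split; first exact: nbhsx_ballx.
    exact: nbhs_right_lt.
  move=> [y d] /= [yr dh] r' Ir' yr' Iy; rewrite -ball_normE/= in yr.
  have r1 : `|r - y| < h by apply: (lt_trans yr); rewrite ltr_pdivrMr// ltr_pMr// ltr1n.
  have r2 : `|r - r'| < h.
    rewrite -(subrKA y) (splitr h); apply: le_lt_trans (ler_normD _ _) _.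
    by apply: ltrD => //; exact: lt_trans yr' dh.
  rewrite -(subrKA (x r)) (splitr e); apply: le_lt_trans (ler_normD _ _) _.
  by apply: ltrD; [rewrite distrC; exact: hx'|exact: hx'].
move=> [d /= d0 hd]; have d2 : 0 < d / 2 by rewrite divr_gt0.
exists (d / 2) => // r r' Ir Ir' rr; apply: (hd (d / 2)) => //=.
by rewrite sub0r normrN gtr0_norm// ltr_pdivrMr// ltr_pMr// ltr1n.
Qed.

Lemma integrable_setU {dT : measure_display} {T : measurableType dT} {R : realType}
  (mu : {measure set T -> \bar R}) (A B : set T) (f : T -> \bar R) :
  measurable A -> measurable B -> [disjoint A & B] ->
  mu.-integrable A f -> mu.-integrable B f -> mu.-integrable (A `|` B) f.
Proof.
move=> mA mB AB /integrableP[mfA fA] /integrableP[mfB fB].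
have mf : measurable_fun (A `|` B) f by apply/measurable_funU.
apply/integrableP; split=> //; rewrite ge0_integral_setU//.
  by rewrite lte_add_pinfty.
exact: measurableT_comp.
Qed.

Lemma ae_lebesgue_imp {R : realType} (Q Q' : R -> Prop) :
  {ae @lebesgue_measure R, forall r, Q r} -> (forall r, Q r -> Q' r) ->
  {ae @lebesgue_measure R, forall r, Q' r}.
Proof. by move=> h QQ; apply: (@filterS _ _ (ae_filter_ringOfSetsType _) _ _ _ h). Qed.

Lemma telescope2 {R : realType} (x y z : R) : y - x + (z - y) = z - x.
Proof. by ring. Qed.

Lemma split_midpoint {R : realType} (x y z : R) : x + y - 2 * z = x - z + (y - z).
Proof. by ring. Qed.

Section energy.
Context {R : realType} {n : nat}.
Variable O : set 'rV[R]_n.+1.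
Hypotheses (oO : open O) (bO : bounded_set O).
Let DS := dotL2_si oO bO.
Local Notation leb := (@lebesgue_measure R).
Implicit Types phi psi : Hm1 O.

Lemma resolvent_norm l phi : 0 < l -> `|resolvent l phi| <= `|phi|.
Proof.
move=> l0; have [i1 h1] := resolventP oO bO l0 phi.
have := h1 _ i1; rewrite (ipH_norm oO bO) => e1.
have e2 := le_trans (ler_norm _) (ipH_CS oO bO phi (resolvent l phi)).
have e3 := mulr_ge0 (ltW l0) (si_ge0 DS i1).
rewrite leNgt; apply/negP => hlt; have := normr_ge0 phi; nra.
Qed.

Variables (t s : R) (w : R -> Hm1 O) (A : Hm1 O -> R -> R) (k e h : R -> R).
Hypotheses (ts : t <= s) (k0 : forall r, 0 <= k r) (cw : {within `[t, s], continuous w}).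
Hypothesis hw : forall psi, in_L2 psi -> leb.-integrable `[t, s] (EFin \o A psi) /\
  forall b, b \in `[t, s] -> ipH (w b) psi = ipH (w t) psi + \int[leb]_(r in `[t, b]) A psi r.

(** What the weak formulation yields at almost every time; [k] bounds the form on
    [L^2] and [h] its value at the solution itself. *)
Definition energy_point r := [/\ in_L2 (w r),
  forall c phi psi, in_L2 phi -> in_L2 psi -> A (c *: phi + psi) r = c * A phi r + A psi r,
  forall psi, in_L2 psi -> `|A psi r| <= k r * el2 psi,
  A (w r) r <= h r & el2 (w r) <= e r].

Hypothesis aeP : {ae leb, forall r, `[t, s]%classic r -> energy_point r}.

Lemma weak_increment psi a b : in_L2 psi -> t <= a -> a <= b -> b <= s ->
  leb.-integrable `]a, b] (EFin \o A psi) /\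
  ipH (w b - w a) psi = \int[leb]_(r in `]a, b]) A psi r.
Proof.
move=> ip ta ab bs; have [ia hA] := hw ip.
have iab x y : t <= x -> y <= s -> forall z, leb.-integrable [set` Interval (BSide z x) (BRight y)] (EFin \o A psi).
  move=> tx ys z; apply: integrableS ia => //= r; rewrite /= !in_itv/=.
  move=> /andP[h1 h2]; rewrite (le_trans h2 ys) andbT (le_trans tx)//.
  by case: z h1 => //= /ltW.
split; first exact: (iab a b _ _ false).
have ia' : a \in `[t, s] by rewrite in_itv/= ta (le_trans ab).
have ib' : b \in `[t, s] by rewrite in_itv/= bs (le_trans ta).
rewrite (ipHBl oO bO) (hA _ ib') (hA _ ia').
rewrite -(@Rintegral_itvB _ _ (BLeft t) (BRight b) a)//; [ring|exact: (iab t b _ _ true)].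
Qed.

(** On each interval of a fine partition, the increment of [<w, J w>] is the integral
    of [A (J (w a) + J (w b))] by the symmetry of [J], and the uniform continuity
    of [w] in [H^-1] is one of [J w] in [L^2]. *)
Lemma riemann_sum l : 0 < l -> exists S : R -> R,
  [/\ leb.-integrable `]t, s] (EFin \o S),
   \int[leb]_(r in `]t, s]) S r = ipH (w s) (resolvent l (w s)) - ipH (w t) (resolvent l (w t)) &
   forall r, `]t, s]%classic r -> energy_point r ->
     `|S r - 2 * A (resolvent l (w r)) r| <= 2 * l * k r].
Proof.
move=> l0; pose J := @resolvent R n O l; pose q r := ipH (w r) (J (w r)).
have JL phi : in_L2 (J phi) := resolvent_in oO bO l0 phi.
have sl : 0 < Num.sqrt l by rewrite sqrtr_gt0.
(* The resolvent is [1 / sqrt l]-Lipschitz into [L^2]: oscillations of [w] below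
   [l sqrt l] make those of [J w] at most [l]. *)
have [d d0 hd] := uniform_continuity cw (mulr_gt0 l0 sl).
pose good S a b := [/\ leb.-integrable `]a, b] (EFin \o S),
   \int[leb]_(r in `]a, b]) S r = q b - q a &
   forall r, `]a, b]%classic r -> energy_point r -> `|S r - 2 * A (J (w r)) r| <= 2 * l * k r].
suff : exists S, good S t s by [].
have piece a b : t <= a -> a <= b -> b <= s -> b - a < d -> exists S, good S a b.
  move=> ta ab bs bad; pose psi := J (w a) + J (w b).
  have ip : in_L2 psi := siD DS (JL _) (JL _).
  have [ia ea] := weak_increment ip ta ab bs; exists (A psi); split=> //.
    rewrite -ea (ipHBl oO bO) !(ipHDr oO bO) /q.
    have := resolvent_sym oO bO l0 (w a) (w b); rewrite -/J (ipHC oO bO (J (w a))) => E.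
    rewrite E; move: (ipH _ (J (w a))) (ipH _ (J (w b))) (ipH _ (J (w b))) => x y z; ring.
  move=> r /=; rewrite in_itv/= => /andP[ar rb] [iw lA bA _ _].
  have Is x : a <= x -> x <= b -> x \in `[t, s].
    by move=> ax xb; rewrite in_itv/= (le_trans ta ax) (le_trans xb bs).
  have step x : a <= x -> x <= b -> `|A (J (w x) - J (w r)) r| <= k r * l.
    move=> ax xb; have ij := siB DS (JL (w x)) (JL (w r)).
    apply: (le_trans (bA _ ij)).
    apply: ler_wpM2l => //.
    apply: (le_trans (resolvent_el2 oO bO l0 _ _)); rewrite ler_pdivrMl//.
    apply/ltW; rewrite mulrC; apply: hd; [exact: Is|apply: Is => //; exact: ltW|].
    by rewrite ltr_norml; apply/andP; split; lra.
  have e1 : A psi r - 2 * A (J (w r)) r = A (J (w a) - J (w r)) r + A (J (w b) - J (w r)) r.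
    have eB x y : in_L2 x -> in_L2 y -> A (x - y) r = A x r - A y r.
      by move=> ix iy; rewrite addrC -scaleN1r lA// mulN1r addrC.
    have -> : A psi r = A (J (w a)) r + A (J (w b)) r.
      by rewrite /psi -{1}[J (w a)]scale1r lA// mul1r.
    rewrite (eB _ _ (JL _) (JL _)) (eB _ _ (JL _) (JL _)).
    exact: split_midpoint.
  rewrite e1; apply: (le_trans (ler_normD _ _)).
  rewrite (_ : 2 * l * k r = k r * l + k r * l); last by ring.
  by apply: lerD; apply: step => //; rewrite ltW// (lt_le_trans ar).
have glue a b c : a <= b -> b <= c -> (exists S, good S a b) -> (exists S, good S b c) ->
    exists S, good S a c.
  move=> ab bc [S [i1 e1 b1]] [S' [i2 e2 b2]].
  pose T r := if r <= b then S r else S' r; exists T.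
  have U : `]a, c]%classic = `]a, b]%classic `|` `]b, c]%classic.
    by rewrite -itv_bndbnd_setU// bnd_simp.
  have T1 : {in `]a, b]%classic, T =1 S}.
    by move=> r /set_mem/=; rewrite in_itv/= /T => /andP[_ ->].
  have T2 : {in `]b, c]%classic, T =1 S'}.
    by move=> r /set_mem/=; rewrite in_itv/= /T => /andP[h1 _]; rewrite leNgt h1.
  have dis : [disjoint `]a, b]%classic & `]b, c]%classic].
    apply/disj_setPS => r [/=]; rewrite !in_itv/= => /andP[_ h1] /andP[h2 _].
    by move: h1; rewrite leNgt h2.
  have j1 : leb.-integrable `]a, b] (EFin \o T).
    by apply: eq_integrable i1 => // r Ir /=; rewrite T1.
  have j2 : leb.-integrable `]b, c] (EFin \o T).
    by apply: eq_integrable i2 => // r Ir /=; rewrite T2.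
  split.
  - by rewrite U; apply: integrable_setU.
  - have iU : leb.-integrable (`]a, b] `|` `]b, c]) (EFin \o T) by apply: integrable_setU.
    rewrite U; have -> : \int[leb]_(r in `]a, b] `|` `]b, c]) T r =
      \int[leb]_(r in `]a, b]) T r + \int[leb]_(r in `]b, c]) T r by apply: Rintegral_setU.
    have -> : \int[leb]_(r in `]a, b]) T r = q b - q a by rewrite -e1; apply: eq_Rintegral.
    have -> : \int[leb]_(r in `]b, c]) T r = q c - q b by rewrite -e2; apply: eq_Rintegral.
    exact: telescope2.
  - rewrite U => r [Ir|Ir]; first by rewrite T1 ?inE//; exact: b1.
    by rewrite T2 ?inE//; exact: b2.
have [N hN] : exists N : nat, (s - t) / d < N.+1%:R.
  by exists (Num.bound ((s - t) / d)); apply: (lt_trans (archi_boundP _)); rewrite ?ltr_nat// divr_ge0 ?subr_ge0// ltW.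
pose eta := (s - t) / N.+1%:R; have eta0 : 0 <= eta by rewrite divr_ge0// subr_ge0.
have etad : eta < d by rewrite ltr_pdivrMr// mulrC -ltr_pdivrMr.
have etaN : N.+1%:R * eta = s - t by rewrite /eta mulrC divfK.
suff H m : (m <= N.+1)%N -> exists S, good S t (t + m%:R * eta).
  by have := H _ (leqnn _); rewrite etaN addrC subrK.
elim: m => [_|m IH mN].
  rewrite mul0r addr0; apply: piece => //; by rewrite subrr.
have le1 : t + m%:R * eta <= t + m.+1%:R * eta by rewrite lerD2l ler_wpM2r// ler_nat.
apply: (glue _ (t + m%:R * eta)) => //; first by rewrite lerDl mulr_ge0.
  by apply: IH; exact: ltnW.
apply: piece => //; first by rewrite lerDl mulr_ge0.
  by rewrite -[leRHS](subrK t) -etaN addrC lerD2r ler_wpM2r// ler_nat.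
by rewrite -natr1 mulrDl mul1r opprD addrACA subrr add0r addrAC subrr add0r.
Qed.

Hypotheses (ik : leb.-integrable `[t, s] (EFin \o k))
  (ike : leb.-integrable `[t, s] (EFin \o (fun r => k r * e r)))
  (ih : leb.-integrable `[t, s] (EFin \o h)).

(** The identity [d |w|^2 = 2 A w dt] makes sense only after regularising one of
    the two factors by the resolvent; the parameter of the resolvent then tends to
    [0] by dominated convergence. *)
Lemma energy_L2 : in_L2 (w s) ->
  `|w s| ^+ 2 <= `|w t| ^+ 2 + 2 * \int[leb]_(r in `[t, s]) h r.
Proof.
move=> iws; pose l (m : nat) : R := m.+1%:R^-1.
have l0 m : 0 < l m by rewrite invr_gt0.
have cl : l m @[m --> \oo] --> 0 by exact: cvg_harmonic.
have /choice[S hS] := fun m => riemann_sum (l0 m).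
pose J m := @resolvent R n O (l m).
have sub (f : R -> R) : leb.-integrable `[t, s] (EFin \o f) -> leb.-integrable `]t, s] (EFin \o f).
  by apply: integrableS => // r; rewrite /= !in_itv/= => /andP[/ltW -> ->].
have ik' := sub _ ik; have ike' := sub _ ike; have ih' := sub _ ih.
have mS m : measurable_fun `]t, s] (S m).
  by have [i _ _] := hS m; apply/measurable_EFinP; exact: (measurable_int leb i).
have mh : measurable_fun `]t, s] h by apply/measurable_EFinP; exact: (measurable_int leb ih').
pose T m r := Num.max (S m r) (2 * h r).
have mT m : measurable_fun `]t, s] (T m).
  by apply: measurable_maxr => //; apply: measurable_funM => //; exact: measurable_cst.
have ae' : {ae leb, forall r, `]t, s]%classic r -> energy_point r}.
  apply: (ae_lebesgue_imp aeP) => r hr Ir; apply: hr.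
  by move: Ir; rewrite /= !in_itv/= => /andP[/ltW -> ->].
have l1 m : l m <= 1 by rewrite invf_le1// ler1n.
have key r : `]t, s]%classic r -> energy_point r -> forall m,
    S m r - 2 * h r <= 2 * (k r * (el2 (w r - J m (w r)) + l m)) /\
    `|S m r| <= 2 * (k r * e r + k r).
  move=> Ir hr m; have [_ _ /(_ r Ir hr)] := hS m; have [iw lA bA Ah ee] := hr.
  have [iJ _] := resolventP oO bO (l0 m) (w r).
  have [J1 J2] := resolvent_le oO bO (l0 m) iw; rewrite -/(J m) in J1 J2 iJ *.
  have eB x y : in_L2 x -> in_L2 y -> A (x - y) r = A x r - A y r.
    by move=> ix iy; rewrite addrC -scaleN1r lA// mulN1r addrC.
  have a1' := bA _ (siB DS iw iJ); rewrite eB// in a1'.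
  have a2 := bA _ iJ.
  have a3 : k r * el2 (J m (w r)) <= k r * e r by rewrite ler_wpM2l//; exact: le_trans ee.
  have a4 : l m * k r <= k r by rewrite ler_piMl.
  rewrite ler_norml in a1'; have /andP[a5 a6] := a1'.
  rewrite ler_norml in a2; have /andP[a7 a8] := a2.
  rewrite ler_norml => /andP[h1 h2]; rewrite mulrDr (mulrC (k r) (l m)) ler_norml.
  move: a3 a4 a5 a6 a7 a8 h1 h2 Ah; rewrite -(mulrA 2 (l m)).
  move: (l m * k r) (k r * _) (k r * _) (k r * e r) (A (J m (w r)) r) (A (w r) r) => p x y z a b.
  clear; move=> *; split; [lra|apply/andP; split; lra].
have ib : leb.-integrable `]t, s] (EFin \o (fun r => 2 * (k r * e r + k r) + 2 * `|h r|)).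
  apply: integrableRD => //; first by apply: integrableRZ => //; exact: integrableRD.
  by apply: integrableRZ => //; exact: (integrable_abse ih').
have [|||||_ _] := @dominated_convergence _ _ _ leb `]t, s]%classic (measurable_itv _)
  (fun m r => (T m r)%:E) (fun r => (2 * h r)%:E)
  (fun r => (2 * (k r * e r + k r) + 2 * `|h r|)%:E).
- by move=> m; apply/measurable_EFinP; exact: mT.
- by apply/measurable_EFinP; apply: measurable_funM => //; exact: measurable_cst.
- apply: (ae_lebesgue_imp ae') => r hr Ir; have {}hr := hr Ir; have kr := key r Ir hr.
  apply: cvg_EFin; first exact: nearW.
  have c1 : el2 (w r - J m (w r)) @[m --> \oo] --> 0.
    have [iw _ _ _ _] := hr; apply/cvgr0Pnorm_le => eps eps0.
    have [d d0 hd] := resolvent_cvg oO bO iw eps0.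
    move/cvgr0Pnorm_lt : cl => /(_ d d0); apply: filterS => m lm.
    rewrite ger0_norm ?el2_ge0//; apply: hd => //.
    by apply: le_lt_trans lm; exact: ler_norm.
  have c2 : (fun m => 2 * h r + 2 * (k r * (el2 (w r - J m (w r)) + l m))) @ \oo --> 2 * h r.
    rewrite -[X in _ --> X]addr0; apply: cvgD; first exact: cvg_cst.
    rewrite -[X in _ --> X](mulr0 2); apply: cvgM; first exact: cvg_cst.
    rewrite -[X in _ --> X](mulr0 (k r)); apply: cvgM; first exact: cvg_cst.
    by rewrite -[X in _ --> X](addr0 0); apply: cvgD.
  apply: (squeeze_cvgr _ (cvg_cst (2 * h r)) c2); apply: nearW => m.
  rewrite /T le_max lexx orbT ge_max; have [h1 _] := kr m.
  have h2 : 0 <= k r * (el2 (w r - J m (w r)) + l m).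
    by rewrite mulr_ge0// addr_ge0 ?el2_ge0// ltW.
  apply/andP; split; lra.
- exact: ib.
- apply: (ae_lebesgue_imp ae') => r hr m Ir; have {}hr := hr Ir; have [_ h1] := key r Ir hr m.
  rewrite lee_fin /T; have h2 := le_trans (normr_ge0 _) h1.
  rewrite /Num.max; case: ifP => _; last by rewrite (le_trans h1)// lerDl mulr_ge0.
  by rewrite normrM (ger0_norm (x := 2))// lerDr.
move=> cT.
have iT m : leb.-integrable `]t, s] (EFin \o T m).
  have [iS _ _] := hS m.
  apply: (@le_integrable _ _ _ leb _ _ _ (EFin \o (fun r => `|S m r| + 2 * `|h r|))) => //.
  - by apply/measurable_EFinP; exact: mT.
  - move=> r _ /=; rewrite lee_fin [leRHS]ger0_norm ?addr_ge0 ?mulr_ge0// /T /Num.max.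
    case: ifP => _; last by rewrite lerDl mulr_ge0.
    by rewrite normrM (ger0_norm (x := 2))// lerDr.
  - apply: integrableRD => //; first exact: (integrable_abse iS).
    by apply: integrableRZ => //; exact: (integrable_abse ih').
have qT m : ipH (w s) (J m (w s)) - ipH (w t) (J m (w t)) <= \int[leb]_(r in `]t, s]) T m r.
  have [i1 e1 b1] := hS m; rewrite -e1; apply: le_Rintegral => //.
  by move=> r Ir; rewrite /T le_max lexx.
have cTr : \int[leb]_(r in `]t, s]) T m r @[m --> \oo] --> 2 * \int[leb]_(r in `[t, s]) h r.
  rewrite -(Rintegral_itv_obnd_cbnd ih') -RintegralZl//.
  apply: fine_cvg; move: cT; rewrite /Rintegral fineK//.
  by apply: (integrable_fin_num _ (integrableRZ _ 2 ih')).
have qs m : `|w s| ^+ 2 - `|w s| * (Num.sqrt (l m) * el2 (w s)) - `|w t| ^+ 2 <=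
    \int[leb]_(r in `]t, s]) T m r.
  apply: le_trans (qT m).
  have [_ J2] := resolvent_le oO bO (l0 m) iws; rewrite -/(J m) in J2.
  have a1 : `|w s - J m (w s)| <= Num.sqrt (l m) * el2 (w s).
    rewrite -(ler_pXn2r (n := 2))// ?nnegrE ?mulr_ge0 ?sqrtr_ge0 ?el2_ge0//.
    by rewrite exprMn sqr_sqrtr// ltW.
  have a2 := le_trans (ler_norm _) (ipH_CS oO bO (w s) (w s - J m (w s))).
  rewrite (ipHBr oO bO) (ipH_norm oO bO) in a2.
  have a3 := le_trans (ler_norm _) (ipH_CS oO bO (w t) (J m (w t))).
  have a4 : `|w t| * `|J m (w t)| <= `|w t| ^+ 2.
    by rewrite expr2 ler_wpM2l//; exact: resolvent_norm.
  have a5 : `|w s| * `|w s - J m (w s)| <= `|w s| * (Num.sqrt (l m) * el2 (w s)).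
    by rewrite ler_wpM2l.
  move: a2 a3 a4 a5; move: (ipH (w s) _) (ipH (w t) _) (`|w t| * _) (`|w s| * `|_|)
    (`|w s| * (_ * _)) (`|w s| ^+ 2) (`|w t| ^+ 2) => x1 x2 x3 x4 x5 x6 x7.
  by move=> *; lra.
have cq : (fun m => `|w s| ^+ 2 - `|w s| * (Num.sqrt (l m) * el2 (w s)) - `|w t| ^+ 2) @ \oo -->
    `|w s| ^+ 2 - `|w t| ^+ 2.
  apply: cvgB; last exact: cvg_cst.
  rewrite -[X in _ --> X]subr0; apply: cvgB; first exact: cvg_cst.
  rewrite -[X in _ --> X](mulr0 `|w s|); apply: cvgM; first exact: cvg_cst.
  rewrite -[X in _ --> X](mul0r (el2 (w s))); apply: cvgM; last exact: cvg_cst.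
  by rewrite -sqrtr0; apply: continuous_cvg; [exact: sqrt_continuous|exact: cl].
by rewrite -lerBlDl; apply: (ler_cvg_to cq cTr); exact: nearW.
Qed.

End energy.

(** [energy_L2] applies at almost every final time; by continuity the inequality
    extends to all of them. *)
Lemma energy_inequality {R : realType} {n : nat} (O : set 'rV[R]_n.+1)
  (oO : open O) (bO : bounded_set O) (t s : R) (w : R -> Hm1 O)
  (A : Hm1 O -> R -> R) (k e h : R -> R) :
  let leb := @lebesgue_measure R in
  t <= s -> (forall r, 0 <= k r) -> (forall r, `[t, s]%classic r -> 0 <= h r) ->
  {within `[t, s], continuous w} ->
  (forall psi, in_L2 psi -> leb.-integrable `[t, s] (EFin \o A psi) /\
    forall b, b \in `[t, s] ->
      ipH (w b) psi = ipH (w t) psi + \int[leb]_(r in `[t, b]) A psi r) ->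
  {ae leb, forall r, `[t, s]%classic r -> energy_point w A k e h r} ->
  leb.-integrable `[t, s] (EFin \o k) ->
  leb.-integrable `[t, s] (EFin \o (fun r => k r * e r)) ->
  leb.-integrable `[t, s] (EFin \o h) ->
  `|w s| ^+ 2 <= `|w t| ^+ 2 + 2 * \int[leb]_(r in `[t, s]) h r.
Proof.
move=> leb; rewrite le_eqVlt => /predU1P[<- _ h0 _ _ _ _ _ _|ts k0 h0 cw hw aeP ik ike ih].
  by rewrite lerDl mulr_ge0// Rintegral_ge0.
pose I := \int[leb]_(r in `[t, s]) h r.
have subI b : b <= s -> `[t, b]%classic `<=` (`[t, s]%classic : set R).
  by move=> bs r /=; rewrite !in_itv/= => /andP[-> /le_trans]; apply.
have step b : t <= b -> b <= s -> in_L2 (w b) -> `|w b| ^+ 2 <= `|w t| ^+ 2 + 2 * I.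
  move=> tb bs iw; have sI := subI b bs.
  apply: (@le_trans _ _ (`|w t| ^+ 2 + 2 * \int[leb]_(r in `[t, b]) h r)).
    apply: (energy_L2 oO bO (A := A) (k := k) (e := e)) => //.
    - exact: continuous_subspaceW cw.
    - move=> psi ip; have [ia hA] := hw psi ip; split; first exact: integrableS ia.
      by move=> c /sI Ic; exact: hA.
    - by apply: (ae_lebesgue_imp aeP) => r hr /sI.
    - exact: integrableS ik.
    - exact: integrableS ike.
    - exact: integrableS ih.
  have e1 := Rintegral_itvB (a := BLeft t) (b := BRight s) (x := b) ih tb bs.
  rewrite lerD2l ler_pM2l// -subr_ge0 /I e1; apply: Rintegral_ge0 => r Ir; apply: h0.
  by move: Ir; rewrite /= !in_itv/= => /andP[br ->]; rewrite (le_trans tb)// ltW.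
rewrite leNgt; apply/negP => hlt; rewrite -/I in hlt.
have cs : (fun r => `|w r| ^+ 2) @ within `[t, s] (nbhs s) --> `|w s| ^+ 2.
  have ss : `[t, s]%classic s by rewrite /= in_itv/= lexx ltW.
  have cn : (fun r => `|w r|) @ within `[t, s] (nbhs s) --> `|w s|.
    by apply: cvg_norm; exact: ((subspace_continuousP `[t, s] w).1 cw s ss).
  by apply: cvgM; exact: cn.
have /cvgrPdist_lt/(_ (`|w s| ^+ 2 - (`|w t| ^+ 2 + 2 * I))) := cs.
rewrite subr_gt0 => /(_ hlt); rewrite near_withinE => -[d /= d0 hd].
pose a := Num.max t (s - d / 2).
have as_ : a < s by rewrite gt_max ts/= gtrBl divr_gt0.
have [N [mN N0 sN]] := aeP.
have [r Ir Nr] : exists2 r, `]a, s[%classic r & ~ N r.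
  apply: contrapT => /forall2NP hN.
  have sub : `]a, s[%classic `<=` N.
    by move=> r Ir; have [//|/contrapT] := hN r.
  have m1 : (leb `]a, s[%classic <= leb N)%E by apply: le_measure; rewrite ?inE.
  have N0' : leb N = 0%E := N0.
  move: m1; rewrite N0' /leb lebesgue_measure_itv/= lte_fin as_.
  by rewrite leNgt -EFinB lte_fin subr_gt0 as_.
have Ir' : `[t, s]%classic r.
  move: Ir; rewrite /= !in_itv/= gt_max => /andP[/andP[/ltW -> _] /ltW ->] //.
have [iw _ _ _ _] : energy_point w A k e h r.
  apply: contrapT => nP; apply: Nr; apply: sN => /= hP; exact: nP (hP Ir').
move: (Ir'); rewrite /= in_itv/= => /andP[tr rs].
have le1 := step r tr rs iw.
have : `|s - r| < d.
  move: Ir; rewrite /= in_itv/= gt_max => /andP[/andP[_ h1] h2].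
  rewrite ger0_norm ?subr_ge0//; lra.
move=> /hd /(_ Ir'); rewrite ltr_norml => /andP[_]; lra.
Qed.

(** * Estimates along one path *)

Section gronwall.
Context {R : realType}.
Local Notation leb := (@lebesgue_measure R).

Lemma within_integrable (f : R -> R) (a b : R) : {within `[a, b], continuous f} ->
  leb.-integrable `[a, b] (EFin \o f).
Proof. by move=> cf; apply: continuous_compact_integrable => //; exact: segment_compact. Qed.

Lemma lebesgue_segment (t s : R) : t <= s -> leb `[t, s]%classic = (s - t)%:E.
Proof.
rewrite lebesgue_measure_itv/= lte_fin le_eqVlt => /predU1P[->|->].
  by rewrite ltxx subrr.
by rewrite EFinB.
Qed.

Lemma Rintegral_segment_cst (t s c : R) : t <= s -> \int[leb]_(r in `[t, s]) c = c * (s - t).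
Proof.
move=> ts; rewrite Rintegral_cst// [RHS](_ : _ = c * fine (s - t)%:E)//.
by congr (_ * fine _); exact: lebesgue_segment.
Qed.

Lemma within_sub (V : topologicalType) (f : R -> V) (a b s : R) : b <= s ->
  {within `[a, s], continuous f} -> {within `[a, b], continuous f}.
Proof.
move=> bs; apply: continuous_subspaceW => r; rewrite /= !in_itv/= => /andP[-> /le_trans]; exact.
Qed.

Lemma int_exp (l : R) (t b : R) : 0 < l -> t <= b ->
  \int[leb]_(r in `[t, b]) expR (l * (r - t)) = (expR (l * (b - t)) - 1) / l.
Proof.
move=> l0; rewrite le_eqVlt => /predU1P[<-|tb].
  by rewrite set_itv1 Rintegral_set1 subrr mulr0 expR0 subrr mul0r.
have ce : continuous (fun r : R => expR (l * (r - t))).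
  move=> r; apply: continuous_comp; last exact: continuous_expR.
  by apply: cvgM; [exact: cvg_cst|apply: cvgB; [exact: cvg_id|exact: cvg_cst]].
have dF (r : R) : is_derive r (1 : R) (fun r => l^-1 * expR (l * (r - t))) (expR (l * (r - t))).
  have d1 : is_derive r (1 : R) (fun r => l * (r - t)) l.
    have := is_deriveZ l (is_deriveB (is_derive_id r (1 : R)) (is_derive_cst t r (1 : R))).
    by move=> h; apply: is_derive_eq; rewrite subr0 /GRing.scale/= mulr1.
  have d2 := @is_derive1_comp R expR (fun r => l * (r - t)) r _ _ (is_derive_expR _) d1.
  have d3 := is_deriveZ l^-1 d2; apply: is_derive_eq.
  by rewrite /GRing.scale/= mulrCA mulVf ?mulr1// gt_eqF.
have cF : continuous (fun r : R => l^-1 * expR (l * (r - t))).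
  by move=> r; apply: cvgM; [exact: cvg_cst|exact: ce].
rewrite /Rintegral (@continuous_FTC2 R (fun r => expR (l * (r - t))) (fun r => l^-1 * expR (l * (r - t))))//=.
- by rewrite subrr mulr0 expR0 mulr1 mulrBl mul1r mulrC.
- exact: continuous_subspaceT.
- split; [by move=> x _; have [] := dF x|exact: cvg_at_right_filter (cF _)|exact: cvg_at_left_filter (cF _)].
- by move=> x _; rewrite derive1E; have [_ ->] := dF x.
Qed.

(** Maximise [q / E], where the weight [E] grows at the rate [2 C], so that the
    integral absorbs only half of the maximum. *)
Lemma gronwall (q : R -> R) (t s a C : R) : t <= s -> 0 < C -> 0 <= a ->
  {within `[t, s], continuous q} ->
  (forall b, t <= b -> b <= s -> q b <= a + C * \int[leb]_(r in `[t, b]) q r) ->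
  q s <= 2 * a * expR (2 * C * (s - t)).
Proof.
move=> ts C0 a0 cq hq; pose E r := expR (2 * C * (r - t)).
have cE : continuous (fun r : R => (E r)^-1).
  move=> r; rewrite /E; apply: cvgV; first by rewrite gt_eqF ?expR_gt0.
  apply: continuous_comp; last exact: continuous_expR.
  by apply: cvgM; [exact: cvg_cst|apply: cvgB; [exact: cvg_id|exact: cvg_cst]].
have E0 r : 0 < E r by exact: expR_gt0.
have cp : {within `[t, s], continuous (fun r => q r * (E r)^-1)}.
  move=> r; apply: (@cvgM _ _ (nbhs (r : subspace `[t, s]))); first exact: cq.
  exact: (continuous_subspaceT cE).
have [c Ic hc] := EVT_max ts cp; pose m := q c * (E c)^-1.
have {}hc r : t <= r -> r <= s -> q r <= m * E r.
  by move=> tr rs; rewrite -ler_pdivrMr//; apply: hc; rewrite in_itv/= tr.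
have m0 : m <= 2 * a.
  rewrite leNgt; apply/negP => hlt; have m0 : 0 <= m by apply: le_trans (ltW hlt); rewrite mulr_ge0.
  move: Ic; rewrite in_itv/= => /andP[tc cs].
  have cEc : continuous (fun r : R => m * E r).
    move=> r; apply: cvgM; first exact: cvg_cst.
    apply: continuous_comp; last exact: continuous_expR.
    by apply: cvgM; [exact: cvg_cst|apply: cvgB; [exact: cvg_id|exact: cvg_cst]].
  have h1 : \int[leb]_(r in `[t, c]) q r <= m * ((E c - 1) / (2 * C)).
    rewrite -int_exp ?mulr_gt0// -RintegralZl//; last first.
      apply: within_integrable; apply: continuous_subspaceT => r.
      apply: continuous_comp; last exact: continuous_expR.
      by apply: cvgM; [exact: cvg_cst|apply: cvgB; [exact: cvg_id|exact: cvg_cst]].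
    apply: le_Rintegral => //.
    - by apply: within_integrable; exact: within_sub cq.
    - by apply: within_integrable; exact: continuous_subspaceT.
    - by move=> r; rewrite /= in_itv/= => /andP[tr rc]; apply: hc => //; exact: le_trans cs.
  have h2 := hq c tc cs.
  have h3 : C * \int[leb]_(r in `[t, c]) q r <= m * (E c - 1) / 2.
    rewrite [leRHS](_ : _ = C * (m * ((E c - 1) / (2 * C)))); last by field; rewrite gt_eqF.
    by rewrite ler_pM2l.
  have h4 : q c = m * E c by rewrite /m divfK// gt_eqF.
  have h5 : 1 <= E c by rewrite -expR0 ler_expR !mulr_ge0 ?subr_ge0// ltW.
  have h6 : 0 <= m * (E c - 1) by rewrite mulr_ge0// subr_ge0.
  move: h2 h3 h6 hlt; rewrite h4 mulrBr mulr1; move: (m * E c) (C * _) => x y; lra.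
by apply: (le_trans (hc s ts (lexx _))); rewrite ler_pM2r.
Qed.

(** At a maximum [c] of [p], the hypothesis yields [p c ^+ 2 <= 2 m (p c) (c - t)]. *)
Lemma sup_estimate (p : R -> R) (t s m : R) : t <= s -> 0 <= m -> (forall r, 0 <= p r) ->
  {within `[t, s], continuous p} ->
  (forall b, t <= b -> b <= s -> p b ^+ 2 <= 2 * \int[leb]_(r in `[t, b]) (m * p r)) ->
  p s <= 2 * m * (s - t).
Proof.
move=> ts m0 p0 cp hp; have [c] := EVT_max ts cp.
rewrite in_itv/= => /andP[tc cs] hc.
have {}hc r : t <= r -> r <= s -> p r <= p c by move=> tr rs; apply: hc; rewrite in_itv/= tr.
apply: (le_trans (hc s ts (lexx s))).
have h1 : \int[leb]_(r in `[t, c]) (m * p r) <= m * p c * (c - t).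
  rewrite -Rintegral_segment_cst//.
  apply: le_Rintegral => //.
  - apply: within_integrable => r; apply: (@cvgM _ _ (nbhs (r : subspace `[t, c]))); first exact: cvg_cst.
    exact: (within_sub cs cp).
  - by apply: within_integrable; apply: continuous_subspaceT => r; exact: cvg_cst.
  - move=> r; rewrite /= in_itv/= => /andP[tr rc]; rewrite ler_wpM2l//.
    by apply: hc => //; exact: le_trans cs.
have h2 := hp c tc cs.
have [->|pc] := eqVneq (p c) 0; first by rewrite !mulr_ge0// subr_ge0.
have pp : 0 < p c by rewrite lt0r pc p0.
rewrite -(ler_pM2r pp) -expr2; apply: (le_trans h2).
apply: (@le_trans _ _ (2 * (m * p c * (c - t)))); first by rewrite ler_pM2l.
rewrite (_ : 2 * m * (s - t) * p c = 2 * (m * p c * (s - t))); last by ring.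
by rewrite ler_pM2l// ler_wpM2l ?mulr_ge0// lerD2r.
Qed.

End gronwall.

Section one_path.
Context {R : realType} {n : nat}.
Variable O : set 'rV[R]_n.+1.
Hypotheses (oO : open O) (bO : bounded_set O).
Variables (b : 'rV[R]_n.+1 -> 'rV[R]_n.+1) (G : R -> Hm1 O -> Hm1 O).
Hypotheses (hb : admissible_field O b) (hG : is_transport_group b G).
Variable beta : R -> R.
Hypothesis hbeta : admissible_beta beta.
Variable W : R -> R.
Let leb := @lebesgue_measure R.
Let DS := dotL2_si oO bO.

Definition frame (a c : R) (phi : Hm1 O) : Hm1 O := G (W c - W a) phi.
Definition solution := @variational_solution R n.+1 O beta frame.
Definition sol_rhs t (x F : R -> Hm1 O) psi r : R :=
  - nonlin beta (frame t r (x r)) (frame t r psi) + ipH (F r) psi.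

Lemma solution_weak t x0 F x s : solution t x0 F x -> t <= s -> forall psi, in_L2 psi ->
  leb.-integrable `[t, s] (EFin \o sol_rhs t x F psi) /\
  ipH (x s) psi = ipH (x t) psi + \int[leb]_(r in `[t, s]) sol_rhs t x F psi r.
Proof.
move=> [x0E _ _ h] ts psi ip; have [] := h s psi ts ip.
have -> : (fun r => - intO O (fun y => beta (density (frame t r (x r)) y) *
    density (frame t r psi) y) + dotHm1 (F r) psi) = sol_rhs t x F psi.
  by apply/funext => r; rewrite /sol_rhs (dotHm1_ip oO bO (F r) ip).
by rewrite !(dotHm1_ip oO bO _ ip) x0E.
Qed.

Lemma solution_continuous t x0 F x s : solution t x0 F x -> {within `[t, s], continuous x}.
Proof.
move=> [_ + _ _]; apply: continuous_subspaceW => r.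
by rewrite /= !in_itv/= => /andP[->].
Qed.

Lemma sqint_interval t s (f : R -> R) : t <= s -> sqint leb `[t, s] f ->
  leb.-integrable `[t, s] (EFin \o f) /\ leb.-integrable `[t, s] (EFin \o (fun r => f r * f r)).
Proof.
move=> ts Hf; split; last exact: sqint_prod.
have H1 : sqint leb `[t, s] (cst 1).
  split; first exact: measurable_cst.
  rewrite (eq_integral (cst 1%:E)); last by move=> r _; rewrite expr1n.
  rewrite integral_cst// mul1e.
  by have E := lebesgue_segment ts; rewrite [X in (X < _)%E]E ltry.
have P : leb.-integrable `[t, s] (EFin \o (fun r => f r * cst 1 r)) by apply: sqint_prod.
move: P; congr (leb.-integrable _ _).
by apply/funext => r /=; rewrite mulr1.
Qed.

Lemma solution_L2 t x0 F x s : solution t x0 F x -> t <= s ->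
  sqint leb `[t, s] (fun r => fine (L2norm (x r))) /\
  {ae leb, forall r, `[t, s]%classic r -> in_L2 (x r) /\ el2 (x r) = fine (L2norm (x r))}.
Proof.
move=> sx ts; have cx := @solution_continuous t x0 F x s sx.
have mL := L2norm_measurable oO bO cx; have [_ _ fin _] := sx.
have L0 r : (0 <= L2norm (x r))%E.
  have [i|i] := pselect (in_L2 (x r)); last by rewrite L2norm_out.
  by rewrite L2norm_in// lee_fin el2_ge0.
have iL : leb.-integrable `[t, s] (fun r => (L2norm (x r) ^+ 2)%E).
  apply/integrableP; split; first exact: (emeasurable_funM mL mL).
  apply: le_lt_trans (fin s ts); rewrite le_eqVlt; apply/orP; left; apply/eqP.
  by apply: eq_integral => r _; rewrite gee0_abs// expe_ge0.
have aeL : {ae leb, forall r, `[t, s]%classic r -> in_L2 (x r) /\ el2 (x r) = fine (L2norm (x r))}.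
  apply: (ae_lebesgue_imp (integrable_ae _ iL)) => // r h Ir; have {}h := h Ir.
  have [i|i] := pselect (in_L2 (x r)); first by rewrite L2norm_in.
  by move: h; rewrite L2norm_out.
split=> //; split; first exact: (measurableT_comp (fine_measurable _)).
apply: le_lt_trans (fin s ts); apply: ge0_le_integral => //.
- by move=> r _; rewrite lee_fin sqr_ge0.
- by apply/measurable_EFinP; apply: measurable_funX; exact: (measurableT_comp (fine_measurable _)).
- by have /integrableP[] := iL.
- move=> r _; have [i|i] := pselect (in_L2 (x r)).
    by rewrite L2norm_in//= EFin_expe.
  by rewrite (L2norm_out i) [leRHS]expe2 mulyy leey.
Qed.

Hypothesis cW : {within `[0, +oo[, continuous W}.

Lemma path_bounded t s : 0 <= t -> exists2 M : R, 0 <= M &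
  forall r, r \in `[t, s] -> `|W r - W t| <= M.
Proof.
move=> t0; have [ts|st] := leP t s; last first.
  by exists 0 => // r; rewrite in_itv/= => /andP[h1 h2]; move: (le_trans h1 h2); rewrite leNgt st.
have cf : {within `[t, s], continuous (fun r => `|W r - W t|)}.
  have cW' : {within `[t, s], continuous W}.
    by apply: continuous_subspaceW cW => r; rewrite /= !in_itv/= andbT => /andP[/(le_trans t0) ->].
  move=> r; apply: cvg_norm; apply: (@cvgB _ _ _ (nbhs (r : subspace `[t, s]))); first exact: cW'.
  exact: cvg_cst.
by have [c _ hc] := EVT_max ts cf; exists `|W c - W t|.
Qed.

Lemma frame_bound t s : 0 <= t -> exists2 g : R, 0 <= g &
  forall r psi, r \in `[t, s] -> in_L2 psi -> el2 (frame t r psi) <= g * el2 psi.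
Proof.
move=> t0; have [M M0 hM] := path_bounded s t0; have [C C0 hC] := group_bounds oO bO hb hG.
exists (1 + C * M) => [|r psi Ir ip]; first by rewrite addr_ge0// mulr_ge0.
have [_ /(_ ip) h] := hC (W r - W t) psi; apply: (le_trans h).
by rewrite ler_wpM2r ?el2_ge0// lerD2l ler_wpM2l//; exact: hM.
Qed.

Lemma frame_in t r psi : in_L2 psi -> in_L2 (frame t r psi).
Proof. exact: group_in hG _ _. Qed.

Lemma sol_rhs_lin t x F r c phi psi : in_L2 (x r) -> in_L2 phi -> in_L2 psi ->
  sol_rhs t x F (c *: phi + psi) r = c * sol_rhs t x F phi r + sol_rhs t x F psi r.
Proof.
move=> ix ip iq; rewrite /sol_rhs {2}/frame (group_lin hG) -/(frame t r phi) -/(frame t r psi).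
rewrite (nonlin_lin oO bO hbeta)//; [|exact: frame_in..].
by rewrite (ipHDr oO bO) (ipHZr oO bO); ring.
Qed.

Lemma ae_not_end (s : R) : {ae leb, forall r, r != s}.
Proof.
exists [set s]; split=> //; first exact: lebesgue_measure_set1.
by move=> r /= /negP; rewrite negbK => /eqP.
Qed.

Lemma ae_lebesgue_and (P Q : R -> Prop) : {ae leb, forall r, P r} -> {ae leb, forall r, Q r} ->
  {ae leb, forall r, P r /\ Q r}.
Proof. by move=> hP hQ; apply: (@filterS2 _ _ (ae_filter_ringOfSetsType _) _ _ _ _ hP hQ). Qed.

Lemma linear_integrable t s (c d : R) (e : R -> R) : t <= s -> sqint leb `[t, s] e ->
  leb.-integrable `[t, s] (EFin \o (fun r => c * e r + d)) /\
  leb.-integrable `[t, s] (EFin \o (fun r => (c * e r + d) * e r)).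
Proof.
move=> ts Hf; have [i1 i2] := sqint_interval ts Hf.
have id : leb.-integrable `[t, s] (EFin \o (fun r => d)).
  by apply: within_integrable; apply: continuous_subspaceT => r; exact: cvg_cst.
split; first by apply: integrableRD => //; exact: integrableRZ.
have P : leb.-integrable `[t, s] (EFin \o (fun r => c * (e r * e r) + d * e r)).
  by apply: integrableRD => //; exact: integrableRZ.
by move: P; congr (leb.-integrable _ _); apply/funext => r /=; congr EFin; ring.
Qed.

(** The energy inequality for the difference of two solutions: the nonlinear
    term is dissipative, only the drifts contribute. *)
Lemma solution_compare t s x0 x0' F F' x x' (g : R -> R) : 0 <= t -> t <= s ->
  solution t x0 F x -> solution t x0' F' x' ->
  {within `[t, s], continuous g} -> (forall r, r \in `[t, s] -> 0 <= g r) ->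
  (forall r, r \in `[t, s[ -> `|F r - F' r| <= g r) ->
  `|x s - x' s| ^+ 2 <= `|x0 - x0'| ^+ 2 + 2 * \int[leb]_(r in `[t, s]) (g r * `|x r - x' r|).
Proof.
move=> t0 ts sx sx' cg g0 hF; have x0E : x t = x0 by case: sx.
have x0E' : x' t = x0' by case: sx'.
have [cx cx'] := (@solution_continuous _ _ _ _ s sx, @solution_continuous _ _ _ _ s sx').
have cw : {within `[t, s], continuous (fun r => x r - x' r)}.
  by move=> r; apply: (@cvgB _ _ _ (nbhs (r : subspace `[t, s]))); [exact: cx|exact: cx'].
pose e1 r := fine (L2norm (x r)); pose e1' r := fine (L2norm (x' r)).
have [He ae1] := solution_L2 sx ts; have [He' ae1'] := solution_L2 sx' ts.
have mI : measurable (`[t, s]%classic : set (measurableTypeR R)) := measurable_itv _.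
have Hs : sqint leb `[t, s] (e1 + e1') by apply: (siD (sqint_semi_inner leb mI)).
have [ga ga0 hga] := frame_bound s t0.
have [L [c [L0 c0 hlip _]]] := nonlin_bounds oO bO hbeta.
have [P0 hP] := poincare_constP oO bO.
have [rM IM hM] := EVT_max ts cg; have M0 := g0 _ IM.
pose k r := `|L * ga * ga * (e1 + e1') r + g rM * poincare_const O|.
have eg r : 0 <= (e1 + e1') r.
  have : 0 <= e1 r /\ 0 <= e1' r.
    have p (phi : Hm1 O) : 0 <= fine (L2norm phi).
      have [i|i] := pselect (in_L2 phi); last by rewrite L2norm_out.
      by rewrite L2norm_in//= el2_ge0.
    by split; exact: p.
  by case=> h1 h2; rewrite addr_ge0.
have kE : k = (fun r => L * ga * ga * (e1 + e1') r + g rM * poincare_const O).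
  by apply/funext => r; rewrite /k ger0_norm// addr_ge0// !mulr_ge0.
have [ik ike] := linear_integrable (L * ga * ga) (g rM * poincare_const O) ts Hs.
rewrite -x0E -x0E'.
apply: (energy_inequality oO bO (w := fun r => x r - x' r)
  (A := fun psi r => sol_rhs t x F psi r - sol_rhs t x' F' psi r) (k := k) (e := e1 + e1')) => //.
- by move=> r; exact: normr_ge0.
- by move=> r Ir; rewrite mulr_ge0//; exact: g0.
- move=> psi ip; split.
    apply: integrableRB => //; first exact: (solution_weak sx ts ip).1.
    exact: (solution_weak sx' ts ip).1.
  move=> b0 Ib; have tb : t <= b0 by move: Ib; rewrite in_itv/= => /andP[].
  have [i1 e2] := solution_weak sx tb ip; have [i1' e2'] := solution_weak sx' tb ip.
  rewrite (@RintegralB _ _ _ leb)// (ipHBl oO bO) e2 e2' (ipHBl oO bO).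
  by rewrite opprD addrACA.
- have h := ae_lebesgue_and (ae_lebesgue_and ae1 ae1') (ae_not_end s).
  apply: (ae_lebesgue_imp h) => r [[h1 h1'] rs] Ir.
  have [i1 n1] := h1 Ir; have [i1' n1'] := h1' Ir.
  have iw := siB DS i1 i1'.
  have Ir' : r \in `[t, s[.
    by move: Ir; rewrite /= !in_itv/= => /andP[-> h2]; rewrite lt_neqAle rs.
  have f1 := hF r Ir'; have f2 := hM r Ir.
  have f1x := frame_in t r i1; have f1x' := frame_in t r i1'.
  have fB : frame t r (x r) - frame t r (x' r) = frame t r (x r - x' r) by rewrite /frame (groupB hG).
  have wE : el2 (x r - x' r) <= (e1 + e1') r.
    by apply: (le_trans (el2_triB oO bO i1 i1')); rewrite n1 n1'.
  have AE psi : sol_rhs t x F psi r - sol_rhs t x' F' psi r = ipH (F r - F' r) psi -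
      (nonlin beta (frame t r (x r)) (frame t r psi) - nonlin beta (frame t r (x' r)) (frame t r psi)).
    rewrite /sol_rhs (ipHBl oO bO); move: (ipH _ _) (ipH _ _) (nonlin _ _ _) (nonlin _ _ _) => p q u v; ring.
  split=> //.
  + by move=> c1 phi psi ip iq; rewrite !sol_rhs_lin//; ring.
  + move=> psi ip; rewrite AE; apply: (le_trans (ler_normB _ _)).
    rewrite kE mulrDl addrC; apply: lerD.
      apply: (le_trans (hlip _ _ _ f1x f1x' (frame_in t r ip))); rewrite fB.
      have q1 := hga r _ Ir iw; have q2 := hga r _ Ir ip.
      rewrite (_ : L * ga * ga * (e1 + e1') r * el2 psi = L * (ga * (e1 + e1') r) * (ga * el2 psi)); last by ring.
      apply: ler_pM => //; [by rewrite mulr_ge0// el2_ge0|exact: el2_ge0|].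
      by rewrite ler_wpM2l//; apply: (le_trans q1); rewrite ler_wpM2l.
    apply: (le_trans (ipH_CS oO bO _ _)); rewrite -mulrA; apply: ler_pM => //.
      exact: le_trans f1 f2.
    exact: norm_el2.
  + rewrite AE -fB; have := nonlin_monotone oO bO hbeta f1x f1x'.
    have := le_trans (ler_norm _) (ipH_CS oO bO (F r - F' r) (x r - x' r)).
    have : `|F r - F' r| * `|x r - x' r| <= g r * `|x r - x' r| by rewrite ler_wpM2r.
    move: (nonlin _ _ _) (nonlin _ _ _) (ipH _ _) (`|_| * _) (g r * _) => p1 p2 p3 p4 p5.
    by move=> u1 u2 u3; lra.
- by rewrite kE.
- by rewrite kE.
- apply: within_integrable => r; apply: (@cvgM _ _ (nbhs (r : subspace `[t, s]))); first exact: cg.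
  by apply: cvg_norm; exact: cw.
Qed.

(** The same inequality for one solution; the value of [beta] at [0] costs a
    constant. *)
Lemma solution_apriori c t s x0 F x (g : R -> R) : 0 <= c ->
  (forall y : Hm1 O, in_L2 y -> - c <= nonlin beta y y) -> 0 <= t -> t <= s -> solution t x0 F x ->
  {within `[t, s], continuous g} -> (forall r, r \in `[t, s] -> 0 <= g r) ->
  (forall r, r \in `[t, s] -> `|F r| <= g r) ->
  `|x s| ^+ 2 <= `|x0| ^+ 2 + 2 * \int[leb]_(r in `[t, s]) (c + g r * `|x r|).
Proof.
move=> c0 hc t0 ts sx cg g0 hF.
have x0E : x t = x0 by case: sx.
have cx := @solution_continuous _ _ _ _ s sx.
have [He ae1] := solution_L2 sx ts; pose e1 r := fine (L2norm (x r)).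
have [ga ga0 hga] := frame_bound s t0.
have [L [c1 [L0 c10 _ hbd]]] := nonlin_bounds oO bO hbeta.
have [P0 hP] := poincare_constP oO bO.
have [rM IM hM] := EVT_max ts cg.
have M0 := g0 _ IM.
pose d := c1 * ga + g rM * poincare_const O.
have d0 : 0 <= d by rewrite addr_ge0// mulr_ge0.
pose k r := `|L * ga * ga * e1 r + d|.
have eg r : 0 <= e1 r.
  rewrite /e1; have [i|i] := pselect (in_L2 (x r)); last by rewrite L2norm_out.
  by rewrite L2norm_in//= el2_ge0.
have kE : k = (fun r => L * ga * ga * e1 r + d).
  by apply/funext => r; rewrite /k ger0_norm// addr_ge0// !mulr_ge0.
have [ik ike] := linear_integrable (L * ga * ga) d ts He.
rewrite -x0E.
apply: (energy_inequality oO bO (w := x) (A := fun psi r => sol_rhs t x F psi r) (k := k) (e := e1)) => //.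
- by move=> r; exact: normr_ge0.
- by move=> r Ir; rewrite addr_ge0// mulr_ge0//; exact: g0.
- move=> psi ip; split; first exact: (solution_weak sx ts ip).1.
  move=> b0 Ib; have tb : t <= b0 by move: Ib; rewrite in_itv/= => /andP[].
  exact: (solution_weak sx tb ip).2.
- apply: (ae_lebesgue_imp ae1) => r h1 Ir; have [i1 n1] := h1 Ir.
  have f1x := frame_in t r i1.
  split=> //; last by rewrite n1.
  + by move=> c2 phi psi ip iq; rewrite sol_rhs_lin.
  + move=> psi ip; rewrite /sol_rhs addrC; apply: (le_trans (ler_normB _ _)).
    have q1 := hga r _ Ir i1; have q2 := hga r _ Ir ip.
    rewrite kE /d (_ : (_ + _) * el2 psi = g rM * (poincare_const O * el2 psi) + (c1 + L * (ga * e1 r)) * (ga * el2 psi)); last by ring.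
    apply: lerD.
      apply: (le_trans (ipH_CS oO bO _ _)); apply: ler_pM => //; last exact: norm_el2.
      by apply: (le_trans (hF r Ir)); exact: hM.
    apply: (le_trans (hbd _ _ f1x (frame_in t r ip))); apply: ler_pM => //.
    + by rewrite addr_ge0// mulr_ge0// el2_ge0.
    + exact: el2_ge0.
    + by rewrite lerD2l ler_wpM2l// /e1 -n1.
  + rewrite /sol_rhs; have := hc _ f1x.
    have := le_trans (ler_norm _) (ipH_CS oO bO (F r) (x r)).
    have : `|F r| * `|x r| <= g r * `|x r| by rewrite ler_wpM2r//; exact: hF.
    lra.
- by rewrite kE.
- by rewrite kE.
- apply: within_integrable => r; apply: (@cvgD _ _ _ (nbhs (r : subspace `[t, s]))); first exact: cvg_cst.
  apply: (@cvgM _ _ (nbhs (r : subspace `[t, s]))); first exact: cg.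
  by apply: cvg_norm; exact: cx.
Qed.

(** Changing the origin of the frame turns a solution started at [t] into one
    started at a later time [t']. *)
Lemma solution_restart t t' x0 F x : 0 <= t -> t <= t' -> solution t x0 F x ->
  solution t' (frame t t' (x t')) (fun r => frame t t' (F r)) (fun r => frame t t' (x r)).
Proof.
move=> t0 tt sx; have [x0E cx fin _] := sx.
have cx' : {within `[t', +oo[, continuous (fun r => frame t t' (x r))}.
  have c1 : {within `[t', +oo[, continuous x}.
    by apply: continuous_subspaceW cx => r; rewrite /= !in_itv/= !andbT; exact: le_trans.
  move=> r; apply: (@continuous_comp (subspace `[t', +oo[) _ _ x (frame t t')); first exact: c1.
  exact: (group_map_continuous hG).
have fE r phi : frame t' r (frame t t' phi) = frame t r phi.
  by rewrite /frame -(groupD hG) subrKA.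
split=> //.
- move=> s ts; have ts' := le_trans tt ts.
  have [C C0 hC] := group_bounds oO bO hb hG; pose u := W t' - W t.
  have Cu : 0 < 1 + C * `|u| by rewrite ltr_wpDr// mulr_ge0.
  have L0 (phi : Hm1 O) : (0 <= L2norm phi)%E.
    have [i|i] := pselect (in_L2 phi); last by rewrite L2norm_out.
    by rewrite L2norm_in// lee_fin el2_ge0.
  have m1 : measurable_fun `[t', s] (fun r => L2norm (frame t t' (x r))).
    apply: (L2norm_measurable oO bO); apply: continuous_subspaceW cx' => r.
    by rewrite /= !in_itv/= => /andP[->].
  have m2 : measurable_fun `[t', s] (fun r => L2norm (x r)).
    apply: (L2norm_measurable oO bO); apply: continuous_subspaceW (@solution_continuous _ _ _ _ s sx) => r.
    by rewrite /= !in_itv/= => /andP[/(le_trans tt) -> ->].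
  have mI : measurable (`[t', s]%classic : set (measurableTypeR R)) := measurable_itv _.
  apply: (@le_lt_trans _ _ (\int[leb]_(r in `[t', s]) (((1 + C * `|u|) ^+ 2)%:E * (L2norm (x r)) ^+ 2))%E).
    apply: ge0_le_integral => //.
    - by move=> r _; rewrite expe_ge0.
    - exact: (emeasurable_funM m1 m1).
    - by apply: emeasurable_funM; [exact: measurable_cst|exact: (emeasurable_funM m2 m2)].
    - move=> r _; have [i|i] := pselect (in_L2 (x r)).
        rewrite (L2norm_in oO bO (frame_in t t' i)) (L2norm_in oO bO i) -!EFin_expe -EFinM lee_fin.
        rewrite -exprMn ler_pXn2r ?nnegrE ?mulr_ge0 ?el2_ge0 ?(ltW Cu)//.
        exact: (hC u (x r)).2.
      by rewrite (L2norm_out i) [X in (_ * X)%E]expe2 mulyy gt0_muley ?leey// lte_fin exprn_gt0.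
  rewrite ge0_integralZl//; [|exact: (emeasurable_funM m2 m2)|by move=> r _; rewrite expe_ge0|by rewrite lee_fin sqr_ge0].
  rewrite lte_mul_pinfty//; first by rewrite lee_fin sqr_ge0.
  apply: le_lt_trans (fin s ts'); apply: ge0_subset_integral => //.
  - by have := L2norm_measurable oO bO (@solution_continuous _ _ _ _ s sx) => m3; exact: (emeasurable_funM m3 m3).
  - by move=> r _; rewrite expe_ge0.
  - by move=> r; rewrite /= !in_itv/= => /andP[/(le_trans tt) -> ->].
- move=> s psi ts ip; have ts' := le_trans tt ts.
  pose psi' := frame t' t psi; have ip' : in_L2 psi' by exact: frame_in.
  have aE phi : ipH (frame t t' phi) psi = ipH phi psi'.
    by rewrite /frame (group_adj oO bO hG) /psi' /frame opprB.
  rewrite (_ : (fun r : R => _) = sol_rhs t x F psi'); last first.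
    apply/funext => r; rewrite /sol_rhs (dotHm1_ip oO bO _ ip) aE.
    rewrite -[frame t' r psi](_ : frame t r psi' = _); first by rewrite fE.
    by rewrite /psi' /frame -(groupD hG) subrKA.
  have [i1 e1] := solution_weak sx ts' ip'; have [i2 e2] := solution_weak sx tt ip'.
  have i3 : leb.-integrable `]t', s] (EFin \o sol_rhs t x F psi').
    apply: integrableS i1 => // r; rewrite /= !in_itv/= => /andP[/ltW/(le_trans tt) -> ->] //.
  split.
    apply: integrableS i1 => // r; rewrite /= !in_itv/= => /andP[/(le_trans tt) -> ->] //.
  rewrite !(dotHm1_ip oO bO _ ip) !aE e1 e2 -(Rintegral_itv_obnd_cbnd i3).
  rewrite -(@Rintegral_itvB _ _ (BLeft t) (BRight s) t')//; ring.
Qed.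

End one_path.

(** * Estimates for the coupled system along one path *)

Section within_continuity.
Context {R : realType} {V : normedModType R}.
Variables (t s : R).
Local Notation wc f := {within `[t, s], continuous f}.

Lemma wc_cst (T : topologicalType) (c : T) : wc (fun _ : R => c).
Proof. by apply: continuous_subspaceT => r; exact: cvg_cst. Qed.

Lemma wcD (f g : R -> V) : wc f -> wc g -> wc (fun r => f r + g r).
Proof. by move=> cf cg r; apply: (@cvgD _ _ _ (nbhs (r : subspace `[t, s]))); [exact: cf|exact: cg]. Qed.

Lemma wcB (f g : R -> V) : wc f -> wc g -> wc (fun r => f r - g r).
Proof. by move=> cf cg r; apply: (@cvgB _ _ _ (nbhs (r : subspace `[t, s]))); [exact: cf|exact: cg]. Qed.

Lemma wcM (f g : R -> R) : wc f -> wc g -> wc (fun r => f r * g r).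
Proof. by move=> cf cg r; apply: (@cvgM _ _ (nbhs (r : subspace `[t, s]))); [exact: cf|exact: cg]. Qed.

Lemma wc_norm (f : R -> V) : wc f -> wc (fun r => `|f r|).
Proof. by move=> cf r; apply: cvg_norm; exact: cf. Qed.

End within_continuity.

Section product_norm.
Context {R : realType} {n : nat}.
Variables (O1 O2 : set 'rV[R]_n.+1).
Hypotheses (oO1 : open O1) (bO1 : bounded_set O1) (oO2 : open O2) (bO2 : bounded_set O2).
Local Notation H := (Hm1 O1 * Hm1 O2)%type.
Implicit Types p q : H.

Definition nH p : R := Num.sqrt (sqnorm p).

Lemma sqnorm_ge0 p : 0 <= sqnorm p. Proof. by rewrite addr_ge0// sqr_ge0. Qed.

Lemma nH_ge0 p : 0 <= nH p. Proof. exact: sqrtr_ge0. Qed.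

Lemma nH2 p : nH p ^+ 2 = sqnorm p. Proof. by rewrite sqr_sqrtr// sqnorm_ge0. Qed.

Lemma nH_fst p : `|p.1| <= nH p.
Proof. by rewrite -[leLHS]normr_id -sqrtr_sqr; apply: ler_wsqrtr; rewrite lerDl sqr_ge0. Qed.

Lemma nH_snd p : `|p.2| <= nH p.
Proof. by rewrite -[leLHS]normr_id -sqrtr_sqr; apply: ler_wsqrtr; rewrite lerDr sqr_ge0. Qed.

Lemma nH0 : nH 0 = 0.
Proof. by rewrite /nH /sqnorm /= !normr0 expr0n/= addr0 sqrtr0. Qed.

Lemma nH_le p : nH p <= `|p.1| + `|p.2|.
Proof.
rewrite -(ler_pXn2r (n := 2))// ?nnegrE ?addr_ge0 ?nH_ge0// nH2 /sqnorm sqrrD.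
by rewrite addrAC lerDl mulrn_wge0// mulr_ge0.
Qed.

Lemma nH_D p q : nH (p + q) <= nH p + nH q.
Proof.
have S1 := ipH_si oO1 bO1; have S2 := ipH_si oO2 bO2.
have SS : semi_inner [set: H] (fun p q => ipH p.1 q.1 + ipH p.2 q.2).
  split=> //.
  - by move=> c u v w _ _ _; rewrite /= (siL S1)// (siL S2)//; ring.
  - by move=> u v _ _; rewrite /= (siC S1)// (siC S2).
  - by move=> u _; rewrite addr_ge0// ?(si_ge0 S1)// (si_ge0 S2).
have E u : Num.sqrt (ipH u.1 u.1 + ipH u.2 u.2) = nH u.
  by rewrite (ipH_norm oO1 bO1) (ipH_norm oO2 bO2).
by rewrite -!E; exact: (si_triangle SS).
Qed.

Lemma nH_N p : nH (- p) = nH p.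
Proof. by rewrite /nH /sqnorm !normrN. Qed.

Lemma nH_B p q : nH (p - q) = nH (q - p).
Proof. by rewrite -nH_N opprB. Qed.

Lemma nH_tri p q r : nH (p - r) <= nH (p - q) + nH (q - r).
Proof. by rewrite -(subrKA q p); exact: nH_D. Qed.

Lemma nH_0 p : nH p = 0 -> p = 0.
Proof.
move=> p0; have h1 := nH_fst p; have h2 := nH_snd p; move: h1 h2.
by rewrite p0 !normr_le0; case: p {p0} => x y /= /eqP -> /eqP ->.
Qed.

Lemma sum_norm_nH p : `|p.1| + `|p.2| <= 2 * nH p.
Proof. by rewrite mulr_natl mulr2n lerD ?nH_fst ?nH_snd. Qed.

End product_norm.

Section coupled_path.
Context {R : realType} {n : nat}.
Variables (O1 O2 : set 'rV[R]_n.+1).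
Hypotheses (oO1 : open O1) (bO1 : bounded_set O1) (oO2 : open O2) (bO2 : bounded_set O2).
Variables (b1 b2 : 'rV[R]_n.+1 -> 'rV[R]_n.+1).
Variables (G1 : R -> Hm1 O1 -> Hm1 O1) (G2 : R -> Hm1 O2 -> Hm1 O2).
Hypotheses (hb1 : admissible_field O1 b1) (hb2 : admissible_field O2 b2).
Hypotheses (hG1 : is_transport_group b1 G1) (hG2 : is_transport_group b2 G2).
Variables (beta1 beta2 : R -> R).
Hypotheses (hbeta1 : admissible_beta beta1) (hbeta2 : admissible_beta beta2).
Variables (U : Type) (f1 : Hm1 O1 -> Hm1 O2 -> U -> Hm1 O1)
  (f2 : Hm1 O1 -> Hm1 O2 -> U -> Hm1 O2).
Hypotheses (hf1 : admissible_f f1) (hf2 : admissible_f f2).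
Local Notation H := (Hm1 O1 * Hm1 O2)%type.
Let leb := @lebesgue_measure R.
Implicit Types (W : R -> R) (u : R -> U) (z : R -> H) (xi p : H).

Definition frames W (a c : R) (p : H) : H := (frame G1 W a c p.1, frame G2 W a c p.2).

Definition drift p (v : U) : H := (f1 p.1 p.2 v, f2 p.1 p.2 v).

Definition pair_solution W t xi (F z : R -> H) :=
  solution G1 beta1 W t xi.1 (fun r => (F r).1) (fun r => (z r).1) /\
  solution G2 beta2 W t xi.2 (fun r => (F r).2) (fun r => (z r).2).

Definition system_drift W t u z r : H := frames W r t (drift (frames W t r (z r)) (u r)).

Definition cpath W := {within `[0, +oo[, continuous W}.

Lemma frames_nH W a c p : nH (frames W a c p) = nH p.
Proof. by rewrite /nH /sqnorm /= (group_norm hG1) (group_norm hG2). Qed.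

Lemma framesB W a c p q : frames W a c (p - q) = frames W a c p - frames W a c q.
Proof. by rewrite /frames /frame (groupB hG1) (groupB hG2). Qed.

Lemma framesK W a c e p : frames W c e (frames W a c p) = frames W a e p.
Proof. by rewrite /frames /frame /= -(groupD hG1) -(groupD hG2) subrKA. Qed.

Lemma frames_id W a p : frames W a a p = p.
Proof. by rewrite /frames /frame subrr (group0 hG1) (group0 hG2) -surjective_pairing. Qed.

Lemma drift_bounds : exists L M : R, [/\ 0 <= L, 0 <= M,
  forall p q v, nH (drift p v - drift q v) <= L * nH (p - q) &
  forall p v, nH (drift p v) <= M + L * nH p].
Proof.
have [[L1 L10 hL1] [M1 hM1] _ _ _] := hf1; have [[L2 L20 hL2] [M2 hM2] _ _ _] := hf2.
have lip p q v : nH (drift p v - drift q v) <= 2 * (L1 + L2) * nH (p - q).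
  apply: (le_trans (nH_le _)); have s := sum_norm_nH (p - q).
  have h1 := hL1 p.1 q.1 p.2 q.2 v; have h2 := hL2 p.1 q.1 p.2 q.2 v.
  apply: (le_trans (lerD h1 h2)); rewrite -mulrDl [leRHS](_ : _ = (L1 + L2) * (2 * nH (p - q))); last by ring.
  by rewrite ler_wpM2l// addr_ge0// ltW.
exists (2 * (L1 + L2)), (`|M1| + `|M2|); split=> //.
  by rewrite mulr_ge0// addr_ge0// ltW.
move=> p v; rewrite -[drift p v](subrK (drift 0 v)).
apply: (le_trans (nH_D oO1 bO1 oO2 bO2 _ _)); rewrite addrC; apply: lerD.
  apply: (le_trans (nH_le _)); apply: lerD; first exact: le_trans (hM1 v) (ler_norm _).
  exact: le_trans (hM2 v) (ler_norm _).
by have := lip p 0 v; rewrite subr0.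
Qed.

Lemma pair_continuous W t xi F z s : pair_solution W t xi F z ->
  {within `[t, s], continuous (fun r => (z r).1)} /\
  {within `[t, s], continuous (fun r => (z r).2)}.
Proof. by move=> [h1 h2]; split; [exact: solution_continuous h1|exact: solution_continuous h2]. Qed.

(** The energy inequality at the maximum of the distance, for each component. *)
Lemma pair_perturb W t s xi F F' z z' m : cpath W -> 0 <= t -> t <= s -> 0 <= m ->
  pair_solution W t xi F z -> pair_solution W t xi F' z' ->
  (forall r, r \in `[t, s[ -> nH (F r - F' r) <= m) ->
  nH (z s - z' s) <= 4 * m * (s - t).
Proof.
move=> cW t0 ts m0 sz sz' hF; have [cz1 cz2] := pair_continuous s sz.
have [cz1' cz2'] := pair_continuous s sz'; have [s1 s2] := sz; have [s1' s2'] := sz'.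
apply: (le_trans (nH_le _)).
have e1 : `|(z s).1 - (z' s).1| <= 2 * m * (s - t).
  apply: (sup_estimate (p := fun r => `|(z r).1 - (z' r).1|)) => //.
    by apply: wc_norm; exact: wcB.
  move=> c tc cs; have := solution_compare oO1 bO1 hb1 hG1 hbeta1 cW t0 tc s1 s1' (@wc_cst R t c R m).
  rewrite subrr normr0 expr0n/= add0r; apply=> // r Ir; have Ir' : r \in `[t, s[.
    by move: Ir; rewrite !in_itv/= => /andP[-> /lt_le_trans]; apply.
  exact: le_trans (nH_fst _) (hF r Ir').
have e2 : `|(z s).2 - (z' s).2| <= 2 * m * (s - t).
  apply: (sup_estimate (p := fun r => `|(z r).2 - (z' r).2|)) => //.
    by apply: wc_norm; exact: wcB.
  move=> c tc cs; have := solution_compare oO2 bO2 hb2 hG2 hbeta2 cW t0 tc s2 s2' (@wc_cst R t c R m).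
  rewrite subrr normr0 expr0n/= add0r; apply=> // r Ir; have Ir' : r \in `[t, s[.
    by move: Ir; rewrite !in_itv/= => /andP[-> /lt_le_trans]; apply.
  exact: le_trans (nH_snd _) (hF r Ir').
by apply: (le_trans (lerD e1 e2)); rewrite -!mulrDl -natrD.
Qed.

Lemma sqrt_bound (q q0 C : R) : 0 <= q0 -> 0 <= C -> q <= C * q0 ->
  Num.sqrt q <= Num.sqrt C * Num.sqrt q0.
Proof. by move=> q00 C0 h; rewrite -sqrtrM//; exact: ler_wsqrtr. Qed.

(** Gronwall's lemma on the sum of the energy inequalities of both components.
    Comparing the controls before [s] only gives causality, with [xi = xi']. *)
Lemma system_lipschitz T : exists2 C : R, 0 <= C & forall W t s xi xi' u u' z z',
  cpath W -> 0 <= t -> t <= s -> s <= T ->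
  pair_solution W t xi (system_drift W t u z) z ->
  pair_solution W t xi' (system_drift W t u' z') z' ->
  (forall r, r \in `[t, s[ -> u r = u' r) ->
  nH (z s - z' s) <= C * nH (xi - xi').
Proof.
have [L [M [L0 M0 hL _]]] := drift_bounds.
pose C := 4 * L + 1; have C0 : 0 < C by rewrite ltr_wpDl// mulr_ge0.
exists (Num.sqrt (2 * expR (2 * C * T))); first exact: sqrtr_ge0.
move=> W t s xi xi' u u' z z' cW t0 ts sT sz sz' uu.
pose q r := sqnorm (z r - z' r).
have [cz1 cz2] := pair_continuous s sz; have [cz1' cz2'] := pair_continuous s sz'.
have [s1 s2] := sz; have [s1' s2'] := sz'.
have cw1 : {within `[t, s], continuous (fun r => `|(z r).1 - (z' r).1|)} by apply: wc_norm; exact: wcB.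
have cw2 : {within `[t, s], continuous (fun r => `|(z r).2 - (z' r).2|)} by apply: wc_norm; exact: wcB.
pose g r := L * (`|(z r).1 - (z' r).1| + `|(z r).2 - (z' r).2|).
have cg : {within `[t, s], continuous g} by apply: wcM; [exact: wc_cst|exact: wcD].
have cq : {within `[t, s], continuous q} by apply: wcD; exact: wcM.
have g0 r : 0 <= g r by rewrite mulr_ge0// addr_ge0.
have hF r : r \in `[t, s[ -> nH (system_drift W t u z r - system_drift W t u' z' r) <= g r.
  move=> Ir; rewrite /system_drift -framesB frames_nH uu//; apply: (le_trans (hL _ _ _)).
  by rewrite -framesB frames_nH ler_wpM2l//; exact: nH_le.
have key b : t <= b -> b <= s -> q b <= sqnorm (xi - xi') + C * \int[leb]_(r in `[t, b]) q r.
  move=> tb bs.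
  have Ib r : r \in `[t, b[ -> r \in `[t, s[.
    by rewrite !in_itv/= => /andP[-> /lt_le_trans]; apply.
  have cgb := within_sub bs cg.
  have c1 := solution_compare oO1 bO1 hb1 hG1 hbeta1 cW t0 tb s1 s1' cgb (fun r _ => g0 r)
     (fun r Ir => le_trans (nH_fst _) (hF r (Ib r Ir))).
  have c2 := solution_compare oO2 bO2 hb2 hG2 hbeta2 cW t0 tb s2 s2' cgb (fun r _ => g0 r)
     (fun r Ir => le_trans (nH_snd _) (hF r (Ib r Ir))).
  have i1 := within_integrable (within_sub bs (wcM cg cw1)).
  have i2 := within_integrable (within_sub bs (wcM cg cw2)).
  have iq := within_integrable (within_sub bs cq).
  have i12 : leb.-integrable `[t, b] (EFin \o (fun r => g r * `|(z r).1 - (z' r).1| + g r * `|(z r).2 - (z' r).2|)).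
    by apply: integrableRD.
  apply: (le_trans (lerD c1 c2)); rewrite addrACA lerD2l -mulrDr.
  rewrite -(@RintegralD _ _ _ leb)// -(RintegralZl 2)//.
  rewrite -(RintegralZl C)//; apply: le_Rintegral => //.
  - exact: integrableRZ.
  - exact: integrableRZ.
  - move=> r _; rewrite /g /q /sqnorm /C /=.
    move: (`|_ - _|) (`|_ - _|) => x y.
    have := mulr_ge0 L0 (sqr_ge0 (x - y)); have := sqr_ge0 x; have := sqr_ge0 y; lra.
have q0 := sqnorm_ge0 (xi - xi').
have := gronwall ts C0 q0 cq key => h.
have E0 : 0 <= 2 * expR (2 * C * T) by rewrite mulr_ge0// expR_ge0.
apply: sqrt_bound => //.
apply: (le_trans h); rewrite mulrAC ler_wpM2r// ler_pM2l// ler_expR.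
rewrite ler_pM2l ?mulr_gt0//; lra.
Qed.

(** The energy inequality of one solution, with [1] added to the energy so that
    Gronwall's lemma absorbs the constants. *)
Lemma system_apriori T : exists2 C : R, 0 <= C & forall W t s xi u z,
  cpath W -> 0 <= t -> t <= s -> s <= T ->
  pair_solution W t xi (system_drift W t u z) z -> nH (z s) <= C * (1 + nH xi).
Proof.
have [L [M [L0 M0 _ hM]]] := drift_bounds.
have [k1 k10 hk1] := nonlin_lower_bound oO1 bO1 hbeta1.
have [k2 k20 hk2] := nonlin_lower_bound oO2 bO2 hbeta2.
pose C := 2 * (k1 + k2 + M + 2 * L) + 1.
have C0 : 0 < C by rewrite ltr_wpDl// mulr_ge0// !addr_ge0// mulr_ge0.
exists (Num.sqrt (2 * expR (2 * C * T))); first exact: sqrtr_ge0.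
move=> W t s xi u z cW t0 ts sT sz.
pose q r := sqnorm (z r) + 1.
have [cz1 cz2] := pair_continuous s sz; have [s1 s2] := sz.
have cw1 := wc_norm cz1; have cw2 := wc_norm cz2.
pose g r := M + L * (`|(z r).1| + `|(z r).2|).
have cg : {within `[t, s], continuous g}.
  by apply: wcD; [exact: wc_cst|apply: wcM; [exact: wc_cst|exact: wcD]].
have cq : {within `[t, s], continuous q}.
  by apply: wcD; [apply: wcD; exact: wcM|exact: wc_cst].
have g0 r : 0 <= g r by rewrite addr_ge0// mulr_ge0// addr_ge0.
have hF r : nH (system_drift W t u z r) <= g r.
  rewrite /system_drift frames_nH; apply: (le_trans (hM _ _)); rewrite frames_nH lerD2l ler_wpM2l//.
  exact: nH_le.
have key b : t <= b -> b <= s -> q b <= (sqnorm xi + 1) + C * \int[leb]_(r in `[t, b]) q r.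
  move=> tb bs; have cgb := within_sub bs cg.
  have c1 := solution_apriori oO1 bO1 hb1 hG1 hbeta1 cW k10 hk1 t0 tb s1 cgb (fun r _ => g0 r)
     (fun r _ => le_trans (nH_fst _) (hF r)).
  have c2 := solution_apriori oO2 bO2 hb2 hG2 hbeta2 cW k20 hk2 t0 tb s2 cgb (fun r _ => g0 r)
     (fun r _ => le_trans (nH_snd _) (hF r)).
  have i1 := within_integrable (within_sub bs (wcD (@wc_cst R t s R k1) (wcM cg cw1))).
  have i2 := within_integrable (within_sub bs (wcD (@wc_cst R t s R k2) (wcM cg cw2))).
  have iq := within_integrable (within_sub bs cq).
  rewrite /q {1}/sqnorm [leRHS]addrAC lerD2r; apply: (le_trans (lerD c1 c2)).
  have i12 : leb.-integrable `[t, b] (EFin \o (fun r => (k1 + g r * `|(z r).1|) + (k2 + g r * `|(z r).2|))).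
    by apply: integrableRD.
  rewrite addrACA lerD2l -mulrDr.
  rewrite -(@RintegralD _ _ _ leb)// -(RintegralZl 2)//.
  rewrite -(RintegralZl C)//; apply: le_Rintegral => //.
  - exact: integrableRZ.
  - exact: integrableRZ.
  - move=> r _; rewrite /g /q /sqnorm /C /=.
    move: (`|_|) (`|_|) => x y.
    have h1 := mulr_ge0 L0 (sqr_ge0 (x - y)); have h2 := mulr_ge0 M0 (sqr_ge0 (x - 1)).
    have h3 := mulr_ge0 M0 (sqr_ge0 (y - 1)); have h4 := sqr_ge0 x; have h5 := sqr_ge0 y.
    have h6 := mulr_ge0 k10 h4; have h7 := mulr_ge0 k10 h5.
    have h8 := mulr_ge0 k20 h4; have h9 := mulr_ge0 k20 h5.
    have h10 := mulr_ge0 L0 h4; have h11 := mulr_ge0 L0 h5.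
    have h12 := mulr_ge0 M0 h4; have h13 := mulr_ge0 M0 h5.
    lra.
have q0 : 0 <= sqnorm xi + 1 by rewrite addr_ge0// sqnorm_ge0.
have := gronwall ts C0 q0 cq key => h.
have E0 : 0 <= 2 * expR (2 * C * T) by rewrite mulr_ge0// expR_ge0.
apply: (@le_trans _ _ (Num.sqrt (2 * expR (2 * C * T)) * Num.sqrt (sqnorm xi + 1))).
  apply: sqrt_bound => //; apply: (@le_trans _ _ (q s)); first by rewrite lerDl.
  apply: (le_trans h); rewrite mulrAC ler_wpM2r// ler_pM2l// ler_expR.
  rewrite ler_pM2l ?mulr_gt0//; lra.
rewrite ler_wpM2l ?sqrtr_ge0// -[leRHS]ger0_norm ?addr_ge0 ?nH_ge0// -sqrtr_sqr.
apply: ler_wsqrtr; rewrite -nH2 sqrrD expr1n mul1r addrC -addrA lerD2l lerDr.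
by rewrite mulrn_wge0// nH_ge0.
Qed.

Lemma pair_restart W t t' xi F z : cpath W -> 0 <= t -> t <= t' ->
  pair_solution W t xi F z ->
  pair_solution W t' (frames W t t' (z t')) (fun r => frames W t t' (F r))
    (fun r => frames W t t' (z r)).
Proof.
move=> cW t0 tt [s1 s2]; split.
  exact: (solution_restart oO1 bO1 hb1 hG1 t0 tt s1).
exact: (solution_restart oO2 bO2 hb2 hG2 t0 tt s2).
Qed.

Lemma system_restart W t t' xi u z : cpath W -> 0 <= t -> t <= t' ->
  pair_solution W t xi (system_drift W t u z) z ->
  pair_solution W t' (frames W t t' (z t'))
    (system_drift W t' u (fun r => frames W t t' (z r))) (fun r => frames W t t' (z r)).
Proof.
move=> cW t0 tt h; have h' := pair_restart cW t0 tt h.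
have -> : system_drift W t' u (fun r => frames W t t' (z r)) =
    (fun r => frames W t t' (system_drift W t u z r)).
  by apply/funext => r; rewrite /system_drift !framesK.
exact: h'.
Qed.

(** The frames are isometric, so only the increment of the group matters. *)
Lemma frames_bound : exists2 C : R, 0 <= C & forall W t r r' p q,
  nH (frames W t r p - frames W t r' q) <= nH (p - q) + C * `|W r - W r'| * nH q.
Proof.
have [C1 C10 hC1] := group_bounds oO1 bO1 hb1 hG1.
have [C2 C20 hC2] := group_bounds oO2 bO2 hb2 hG2.
exists (C1 + C2); first exact: addr_ge0.
move=> W t r r' p q; apply: (le_trans (nH_tri oO1 bO1 oO2 bO2 _ (frames W t r q) _)).
rewrite -framesB frames_nH lerD2l -(framesK W t r' r) -(frames_nH W t r' q).
move: (frames W t r' q) => {}q; apply: (le_trans (nH_le _)).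
have [h1 _] := hC1 (W r - W r') q.1; have [h2 _] := hC2 (W r - W r') q.2.
apply: (le_trans (lerD h1 h2)); rewrite !mulrDl; apply: lerD.
  by rewrite ler_wpM2l ?mulr_ge0// nH_fst.
by rewrite ler_wpM2l ?mulr_ge0// nH_snd.
Qed.

(** The local error of the scheme: freezing the drift at the initial value costs
    the displacement of the solution plus that of the frames. *)
Lemma scheme_error : exists L M C : R, [/\ 0 <= L, 0 <= M, 0 <= C &
  forall W t s xi u z zh m, cpath W -> 0 <= t -> t <= s -> 0 <= m ->
  pair_solution W t xi (system_drift W t u z) z ->
  pair_solution W t xi (fun r => drift xi (u r)) zh ->
  (forall r, r \in `[t, s[ -> L * nH (frames W t r (z r) - xi) +
     Num.min 2 (C * `|W r - W t|) * (M + L * nH xi) <= m) ->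
  nH (z s - zh s) <= 4 * m * (s - t)].
Proof.
have [L [M [L0 M0 hL hM]]] := drift_bounds; have [C C0 hC] := frames_bound.
exists L, M, C; split=> // W t s xi u z zh m cW t0 ts m0 sz szh hm.
apply: (pair_perturb cW t0 ts m0 sz szh) => r Ir; apply: le_trans (hm r Ir).
set d := drift xi (u r).
apply: (le_trans (nH_tri oO1 bO1 oO2 bO2 _ (frames W r t d) _)); apply: lerD.
  by rewrite /system_drift -framesB frames_nH; exact: hL.
have dM : nH d <= M + L * nH xi by exact: hM.
apply: (@le_trans _ _ (Num.min 2 (C * `|W r - W t|) * nH d)); last first.
  by rewrite ler_wpM2l// le_min; apply/andP; split => //; exact: mulr_ge0.
rewrite -{2}(frames_id W r d) minr_pMl ?nH_ge0// le_min; apply/andP; split.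
  apply: (le_trans (nH_D oO1 bO1 oO2 bO2 _ _)).
  by rewrite nH_N !frames_nH mulr_natl mulr2n.
by have := hC W r t r d d; rewrite subrr nH0 add0r distrC.
Qed.

(** The a priori bound controls the difference of the drifts, whatever the
    controls. *)
Lemma system_control T : exists2 C : R, 0 <= C & forall W t s xi u u' z z',
  cpath W -> 0 <= t -> t <= s -> s <= T ->
  pair_solution W t xi (system_drift W t u z) z ->
  pair_solution W t xi (system_drift W t u' z') z' ->
  nH (z s - z' s) <= C * (1 + nH xi) * (s - t).
Proof.
have [L [M [L0 M0 hL hM]]] := drift_bounds; have [K K0 hK] := system_apriori T.
exists (4 * (2 * (M + L * K))); first by rewrite !mulr_ge0// addr_ge0// mulr_ge0.
move=> W t s xi u u' z z' cW t0 ts sT sz sz'.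
have n1 : 0 <= 1 + nH xi by rewrite addr_ge0// nH_ge0.
have B v y r : r \in `[t, s[ -> pair_solution W t xi (system_drift W t v y) y ->
    nH (system_drift W t v y r) <= (M + L * K) * (1 + nH xi).
  rewrite in_itv/= => /andP[tr rs] sy; rewrite /system_drift frames_nH.
  apply: (le_trans (hM _ _)); rewrite frames_nH mulrDl; apply: lerD.
    by rewrite ler_peMr// lerDl nH_ge0.
  rewrite -mulrA ler_wpM2l//; apply: (hK _ _ _ _ _ _ cW t0 tr _ sy).
  exact: le_trans (ltW rs) sT.
have := pair_perturb (m := 2 * ((M + L * K) * (1 + nH xi))) cW t0 ts _ sz sz'.
rewrite !mulrA; apply.
  by rewrite !mulr_ge0// addr_ge0// mulr_ge0.
move=> r Ir; apply: (le_trans (nH_D oO1 bO1 oO2 bO2 _ _)); rewrite nH_N -!mulrA mulr_natl mulr2n.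
by apply: lerD; exact: B.
Qed.

End coupled_path.

(** * Near viability from local steps *)

Section abstract_viability.
Context {R : realType} (E C : Type).
Variables (T : R) (L K : R -> set E) (rd : E -> E -> R) (prog : set (R -> C)).
Variables (Phi : R -> E -> (R -> C) -> R -> E) (C0 : R).
Hypotheses (rdxx : forall x, rd x x = 0)
  (rdC : forall x y, rd x y = rd y x)
  (rd_tri : forall x y z, L T x -> L T y -> L T z -> rd x z <= rd x y + rd y z)
  (L_mono : forall s s', 0 <= s -> s <= s' -> L s `<=` L s')
  (K_mono : forall s s', 0 <= s -> s <= s' -> K s `<=` K s')
  (KL : forall s, K s `<=` L s)
  (Phi_in : forall t x u s, 0 <= t -> t <= s -> s <= T -> L t x -> prog u -> L s (Phi t x u s))
  (Phi0 : forall t x u, 0 <= t -> t <= T -> L t x -> prog u -> rd (Phi t x u t) x = 0)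
  (C00 : 0 <= C0)
  (Phi_lip : forall t x y u s, 0 <= t -> t <= s -> s <= T -> L t x -> L t y -> prog u ->
     rd (Phi t x u s) (Phi t y u s) <= C0 * rd x y)
  (Phi_flow : forall t x u s s', 0 <= t -> t <= s -> s <= s' -> s' <= T -> L t x -> prog u ->
     rd (Phi t x u s') (Phi s (Phi t x u s) u s') = 0)
  (Phi_causal : forall t x u u' s, 0 <= t -> t <= s -> s <= T -> L t x -> prog u -> prog u' ->
     (forall r, t <= r -> r < s -> u r = u' r) -> rd (Phi t x u s) (Phi t x u' s) = 0)
  (Phi_cont : forall t x u (s : nat -> R) s0, 0 <= t -> (forall k, t <= s k) -> (forall k, s k <= T) ->
     t <= s0 -> s0 <= T -> s k @[k --> \oo] --> s0 -> L t x -> prog u ->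
     rd (Phi t x u (s k)) (Phi t x u s0) @[k --> \oo] --> 0)
  (K_closed : forall s x, 0 <= s -> s <= T -> L s x ->
     (forall e, 0 < e -> exists2 y, K s y & rd x y <= e) -> K s x)
  (complete : forall s (x : nat -> E) (r : nat -> R), 0 <= s -> s <= T -> (forall k, L s (x k)) ->
     (forall k l, (k <= l)%N -> rd (x k) (x l) <= r k) -> r k @[k --> \oo] --> 0 ->
     exists2 y, L s y & forall k, rd (x k) y <= r k)
  (prog_cat : forall u v t, prog u -> prog v -> prog (fun r => if r < t then u r else v r))
  (prog_lim : forall (u : nat -> R -> C) (t : nat -> R), (forall k, prog (u k)) ->
     (forall k, t k <= t k.+1) -> (forall k r, r < t k -> u k.+1 r = u k r) ->
     exists2 v, prog v & forall k r, r < t k -> v r = u k r)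
  (step : forall t x e, 0 <= t -> t < T -> K t x -> 0 < e -> exists h v y,
     [/\ 0 < h, t + h <= T, prog v, K (t + h) y &
         rd (Phi t x v (t + h)) y <= e * h /\
         forall s, t <= s -> s <= t + h -> rd (Phi t x v s) x <= e]).

Variables (t0 : R) (e : R).
Hypotheses (t00 : 0 <= t0) (e0 : 0 < e).

Record node := Node { ntime : R ; nstate : E ; nctl : R -> C }.
Implicit Types a b c : node.

Definition valid a := [/\ t0 <= ntime a, ntime a <= T, K (ntime a) (nstate a) & prog (nctl a)].

(** The solution issued from [a] stays close to [K] up to the time of [b], and is
    close to the one issued from [b] afterwards, whatever the control used there;
    this makes the relation transitive without loss in the constants. *)
Definition follows a b := [/\ ntime a <= ntime b,
  forall r, r < ntime a -> nctl b r = nctl a r,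
  forall u, prog u -> (forall r, r < ntime b -> u r = nctl b r) ->
    forall s, ntime b <= s -> s <= T ->
      rd (Phi (ntime a) (nstate a) u s) (Phi (ntime b) (nstate b) u s) <=
        e * (ntime b - ntime a) &
  forall s, ntime a <= s -> s <= ntime b -> exists2 y, K s y &
    rd (Phi (ntime a) (nstate a) (nctl b) s) y <= e * (1 + (ntime b - ntime a))].

Let LT s x : 0 <= s -> s <= T -> L s x -> L T x.
Proof. by move=> s0 sT; exact: L_mono. Qed.

Let valid0 a : valid a -> 0 <= ntime a.
Proof. by case=> h _ _ _; exact: le_trans h. Qed.

Let PT a u s : valid a -> prog u -> ntime a <= s -> s <= T -> L T (Phi (ntime a) (nstate a) u s).
Proof.
move=> va pu as_ sT; have a0 := valid0 va; have [_ _ Ka _] := va.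
by apply: (LT (le_trans a0 as_) sT); apply: Phi_in => //; exact: KL.
Qed.

Let KT s y : 0 <= s -> s <= T -> K s y -> L T y.
Proof. by move=> s0 sT /KL; exact: LT. Qed.

Lemma follows_refl a : valid a -> follows a a.
Proof.
move=> va; have a0 := valid0 va; have [_ aT Ka pa] := va; split=> //.
  by move=> u _ _ s _ _; rewrite rdxx subrr mulr0.
move=> s as_ sa; have -> : s = ntime a by apply/eqP; rewrite eq_le as_ sa.
exists (nstate a) => //; rewrite Phi0//; last exact: KL.
by rewrite subrr addr0 mulr1 ltW.
Qed.

Lemma follows_trans a b c : valid a -> valid b -> valid c ->
  follows a b -> follows b c -> follows a c.
Proof.
move=> va vb vc [ab cab dab kab] [bc cbc dbc kbc].
have a0 := valid0 va; have [_ aT Ka pa] := va; have [_ bT Kb pb] := vb; have [_ cT Kc pc] := vc.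
split; first exact: le_trans bc.
- by move=> r ra; rewrite cbc ?cab//; exact: lt_le_trans ab.
- move=> u pu uc s cs sT; have bs := le_trans bc cs.
  have ub r : r < ntime b -> u r = nctl b r by move=> rb; rewrite uc ?cbc//; exact: lt_le_trans bc.
  apply: (le_trans (rd_tri (PT va pu (le_trans ab bs) sT) (PT vb pu bs sT) (PT vc pu cs sT))).
  apply: (le_trans (lerD (dab u pu ub s bs sT) (dbc u pu uc s cs sT))).
  by rewrite -mulrDr addrC subrKA.
- move=> s as_ sc; have sT := le_trans sc cT; have s0 := le_trans a0 as_.
  have [sb|bs] := leP s (ntime b).
    have [y Ky hy] := kab s as_ sb; exists y => //.
    apply: (le_trans (rd_tri (PT va pc as_ sT) (PT va pb as_ sT) (KT s0 sT Ky))).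
    rewrite Phi_causal//; [|exact: KL|by move=> r _ rs; rewrite cbc//; exact: lt_le_trans sb].
    rewrite add0r; apply: (le_trans hy); rewrite ler_pM2l// lerD2l lerD2r//.
  have [y Ky hy] := kbc s (ltW bs) sc; exists y => //.
  apply: (le_trans (rd_tri (PT va pc as_ sT) (PT vb pc (ltW bs) sT) (KT s0 sT Ky))).
  apply: (le_trans (lerD (dab _ pc cbc s (ltW bs) sT) hy)).
  by rewrite -mulrDr ler_pM2l//; lra.
Qed.

Lemma follows_step a : valid a -> ntime a < T -> exists b, [/\ valid b, follows a b & ntime a < ntime b].
Proof.
move=> va aT; have a0 := valid0 va; have [ta _ Ka pa] := va.
have C1 : 0 < C0 + 1 by rewrite ltr_wpDl.
have e1 : 0 < e / (C0 + 1) by rewrite divr_gt0.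
have ee : e / (C0 + 1) * (C0 + 1) = e by rewrite divfK// gt_eqF.
have [h [v [y [h0 hT pv Ky [hy hx]]]]] := step a0 aT Ka e1.
have ah : ntime a <= ntime a + h by rewrite lerDl ltW.
have ah0 := le_trans a0 ah.
pose w r := if r < ntime a then nctl a r else v r.
have pw : prog w by exact: prog_cat.
have La : L (ntime a) (nstate a) by exact: KL.
have wE r : ntime a <= r -> w r = v r by rewrite /w ltNge => ->.
have LP u s : prog u -> ntime a <= s -> s <= ntime a + h -> L T (Phi (ntime a) (nstate a) u s).
  by move=> pu as_ sh; apply: PT => //; exact: le_trans hT.
have uv u s : prog u -> ntime a <= s -> s <= ntime a + h ->
    (forall r, r < ntime a + h -> u r = w r) ->
    rd (Phi (ntime a) (nstate a) u s) (Phi (ntime a) (nstate a) v s) = 0.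
  move=> pu as_ sh uw; apply: Phi_causal => //; first exact: le_trans hT.
  by move=> r ar rs; rewrite uw ?wE//; exact: lt_le_trans sh.
exists (Node (ntime a + h) y w); split; last by rewrite ltrDl.
  by split=> //=; exact: le_trans ah.
have Lx : L T (nstate a) by apply: (LT a0) => //; exact: ltW.
split=> //=.
- by move=> r ra; rewrite /w ra.
- move=> u pu uw s hs sT; have LTy : L T y by apply: KT Ky.
  have as_ := le_trans ah hs; have L1 := PT va pu as_ sT.
  have Lu : L (ntime a + h) (Phi (ntime a) (nstate a) u (ntime a + h)) by apply: Phi_in.
  have L2 : L T (Phi (ntime a + h) (Phi (ntime a) (nstate a) u (ntime a + h)) u s).
    by apply: (LT (le_trans ah0 hs) sT); apply: Phi_in.
  have L3 : L T (Phi (ntime a + h) y u s).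
    by apply: (LT (le_trans ah0 hs) sT); apply: Phi_in => //; exact: KL.
  apply: (le_trans (rd_tri L1 L2 L3)); rewrite Phi_flow// add0r.
  apply: (le_trans (Phi_lip ah0 hs sT Lu (KL Ky) pu)).
  have h1 : rd (Phi (ntime a) (nstate a) u (ntime a + h)) y <= e / (C0 + 1) * h.
    by apply: (le_trans (rd_tri (LP u _ pu ah (lexx _)) (LP v _ pv ah (lexx _)) LTy)); rewrite uv// add0r.
  apply: (@le_trans _ _ (C0 * (e / (C0 + 1) * h))); first by rewrite ler_wpM2l.
  rewrite addrAC subrr add0r -{2}ee mulrA ler_pM2r// mulrC ler_pM2l//.
  by rewrite lerDl.
- move=> s as_ sh; exists (nstate a); first exact: (K_mono a0 as_).
  have sT := le_trans sh hT.
  apply: (le_trans (rd_tri (LP w s pw as_ sh) (LP v s pv as_ sh) Lx)).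
  rewrite uv// add0r; apply: (le_trans (hx s as_ sh)).
  rewrite addrAC subrr add0r; apply: (@le_trans _ _ e).
    by rewrite ler_pdivrMr//; apply: ler_peMr; [exact: ltW|rewrite lerDr].
  by rewrite ler_peMr ?ltW// ltrDl.
Qed.

(** An increasing sequence of nodes has an upper bound: the solutions it issues
    form a Cauchy sequence at the limit time. *)
Lemma follows_limit (a : nat -> node) : (forall k, valid (a k)) ->
  (forall k, follows (a k) (a k.+1)) -> exists b, [/\ valid b, forall k, follows (a k) b &
    ntime (a k) @[k --> \oo] --> ntime b].
Proof.
move=> va fa; pose t k := ntime (a k); pose x k := nstate (a k).
have f0 k : 0 <= t k := valid0 (va k).
have tT k : t k <= T by have [] := va k.
have mono k l : (k <= l)%N -> follows (a k) (a l).
  elim: l => [|l IH]; first by rewrite leqn0 => /eqP ->; exact: follows_refl.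
  rewrite leq_eqVlt => /predU1P[->|]; first exact: follows_refl.
  by rewrite ltnS => /IH h; apply: follows_trans h (fa l).
have tm k l : (k <= l)%N -> t k <= t l by move=> /mono[].
have ct : t k @[k --> \oo] --> limn t.
  apply: nondecreasing_is_cvgn; first by move=> k l; exact: tm.
  by exists T => _ [k _ <-].
set s0 := limn t in ct.
have ts k : t k <= s0.
  by apply: nondecreasing_cvgn_le.
have sT : s0 <= T.
  by apply: limr_le; [apply/cvg_ex; exists s0|exact: nearW].
have s00 : 0 <= s0 := le_trans (f0 0%N) (ts 0%N).
have [v pv hv] : exists2 v, prog v & forall k r, r < t k -> v r = nctl (a k) r.
  apply: (prog_lim (u := fun k => nctl (a k)) (t := t)).
  - by move=> k; have [] := va k.
  - by move=> k; exact: tm.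
  - by move=> k r; have [_ h _ _] := fa k; exact: h.
pose Y k := Phi (t k) (x k) v s0.
have LY k : L s0 (Y k) by apply: Phi_in => //; apply: KL; have [] := va k.
pose r k := e * (s0 - t k).
have YY k l : (k <= l)%N -> rd (Y k) (Y l) <= r k.
  move=> kl; have [_ _ h _] := mono k l kl.
  apply: (le_trans (h v pv (hv l) s0 (ts l) sT)); rewrite ler_pM2l// lerD2r; exact: ts.
have cr : r k @[k --> \oo] --> 0.
  rewrite -[X in _ --> X](mulr0 e) -[in X in _ --> X](subrr s0).
  by apply: cvgM; [exact: cvg_cst|apply: cvgB; [exact: cvg_cst|exact: ct]].
have [y Ly hy] := complete s00 sT LY YY cr.
have LTY k : L T (Y k) by exact: LT (LY k).
have LTy : L T y by exact: LT Ly.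
have Kx k : K (t k) (x k) by have [] := va k.
have LTx k : L T (x k) := KT (f0 k) (tT k) (Kx k).
have small eps : 0 < eps -> exists k, r k <= eps.
  move=> ep; move/cvgr0Pnorm_le : cr => /(_ eps ep)[k _ /(_ k (leqnn k))] h.
  by exists k; exact: le_trans (ler_norm _) h.
have Ky : K s0 y.
  apply: K_closed => // eps ep; have [k rk] := small (eps / 4) (divr_gt0 ep (ltr0n R 4)).
  have c1 : rd (Phi (t k) (x k) v (t (l + k)%N)) (Y k) @[l --> \oo] --> 0.
    apply: Phi_cont => //; [by move=> l; apply: tm; rewrite leq_addl| |exact: KL].
    by rewrite (cvg_shiftn k t).
  move/cvgr0Pnorm_le : c1 => /(_ _ (divr_gt0 ep (ltr0n R 4)))[l0 _ /(_ l0 (leqnn _))] h1.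
  have {}h1 := le_trans (ler_norm _) h1; set l := (l0 + k)%N in h1.
  have kl : (k <= l)%N by rewrite leq_addl.
  exists (x l); first exact: (K_mono (f0 l) (ts l)).
  have [_ _ h _] := mono k l kl.
  have h2 := h v pv (hv l) (t l) (lexx _) (tT l).
  have Pl k' : L (t k') (x k') := KL (Kx k').
  have L1 : L T (Phi (t k) (x k) v (t l)) := PT (va k) pv (tm _ _ kl) (tT l).
  have L2 : L T (Phi (t l) (x l) v (t l)) := PT (va l) pv (lexx _) (tT l).
  have h3 : rd (Phi (t l) (x l) v (t l)) (x l) = 0 by apply: Phi0.
  have h4 : e * (t l - t k) <= r k by rewrite ler_pM2l// lerD2r.
  have h5 : rd y (Y k) <= r k by rewrite rdC.
  have h6 : rd (Y k) (Phi (t k) (x k) v (t l)) <= eps / 4 by rewrite rdC.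
  apply: (le_trans (rd_tri LTy (LTY k) (LTx l))).
  apply: (@le_trans _ _ (eps / 4 + (eps / 4 + eps / 4))); last by lra.
  apply: lerD; first exact: le_trans rk.
  apply: (le_trans (rd_tri (LTY k) L1 (LTx l))); apply: lerD => //.
  apply: (le_trans (rd_tri L1 L2 (LTx l))); rewrite h3 addr0.
  by apply: (le_trans h2); exact: le_trans rk.
exists (Node s0 y v); split=> //.
  by split=> //=; apply: le_trans (ts 0%N); have [] := va 0%N.
move=> k; split=> /=; [exact: ts|by move=> r' rk; exact: hv| |].
- move=> u pu uv s ss sT'; apply/ler_addgt0Pr => eps ep.
  have C1 : 0 < C0 + 1 by rewrite ltr_wpDl.
  have [l0 rl0] := small (eps / (C0 + 1)) (divr_gt0 ep C1).
  pose l := maxn l0 k; have kl : (k <= l)%N by rewrite leq_maxr.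
  have rl : r l <= eps / (C0 + 1).
    by apply: le_trans rl0; rewrite ler_pM2l// lerD2l lerN2 tm// leq_maxl.
  have ul r' : r' < t l -> u r' = nctl (a l) r' by move=> h; rewrite uv ?(hv l)//; exact: lt_le_trans h (ts l).
  have tls := le_trans (ts l) ss; have tks := le_trans (ts k) ss.
  have [_ _ h _] := mono k l kl; have h1 := h u pu ul s tls sT'.
  have L1 := PT (va k) pu tks sT'; have L2 := PT (va l) pu tls sT'.
  have Lz : L s0 (Phi (t l) (x l) u s0) by apply: Phi_in => //; exact: KL.
  have L3 : L T (Phi s0 (Phi (t l) (x l) u s0) u s).
    by apply: (LT (le_trans s00 ss) sT'); apply: Phi_in.
  have L4 : L T (Phi s0 y u s) by apply: (LT (le_trans s00 ss) sT'); apply: Phi_in.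
  apply: (le_trans (rd_tri L1 L2 L4)); apply: lerD.
    by apply: (le_trans h1); rewrite ler_pM2l// lerD2r; exact: ts.
  have E0 : rd (Phi (ntime (a l)) (nstate (a l)) u s) (Phi s0 (Phi (t l) (x l) u s0) u s) = 0.
    exact: (Phi_flow (f0 l) (ts l) ss sT' (KL (Kx l)) pu).
  apply: (le_trans (rd_tri L2 L3 L4)); rewrite E0 add0r; apply: (le_trans (Phi_lip s00 ss sT' Lz Ly pu)).
  have LTz : L T (Phi (t l) (x l) u s0) by exact: LT Lz.
  have h2 : rd (Phi (t l) (x l) u s0) y <= r l.
    have E1 : rd (Phi (t l) (x l) u s0) (Y l) = 0.
      by apply: Phi_causal => //; [exact: KL|move=> r' _ rs; exact: uv].
    by apply: (le_trans (rd_tri LTz (LTY l) LTy)); rewrite E1 add0r.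
  apply: (@le_trans _ _ (C0 * (eps / (C0 + 1)))); first by rewrite ler_wpM2l//; exact: le_trans rl.
  by rewrite mulrCA ler_piMr ?ltW// ltr_pdivrMr// mul1r ltrDl.
- move=> s ks ss; have s0' : 0 <= s := le_trans (f0 k) ks.
  have sT' := le_trans ss sT; have Lks := PT (va k) pv ks sT'.
  have [sl|nsl] := pselect (exists l, s < t l).
    have [l0 sl0] := sl; pose l := maxn l0 k.
    have sl' : s <= t l by apply: (le_trans (ltW sl0)); rewrite tm// leq_maxl.
    have [_ _ _ h] := mono k l (leq_maxr _ _).
    have [z Kz hz] := h s ks sl'; exists z => //.
    have pl : prog (nctl (a l)) by have [] := va l.
    apply: (le_trans (rd_tri Lks (PT (va k) pl ks sT') (KT s0' sT' Kz))).
    have E1 : rd (Phi (ntime (a k)) (nstate (a k)) v s)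
        (Phi (ntime (a k)) (nstate (a k)) (nctl (a l)) s) = 0.
      apply: (Phi_causal (f0 k) ks sT' (KL (Kx k)) pv pl).
      by move=> r' _ rs; apply: hv; exact: lt_le_trans rs sl'.
    rewrite E1 add0r; apply: (le_trans hz); rewrite ler_pM2l// lerD2l lerD2r; exact: ts.
  have -> : s = s0.
    apply/eqP; rewrite eq_le ss/=; apply: limr_le; first by apply/cvg_ex; exists s0.
    by apply: nearW => l; rewrite leNgt; apply/negP => h; apply: nsl; exists l.
  exists y => //; apply: (le_trans (hy k)).
  by rewrite ler_pM2l// lerDr.
Qed.

(** The argument of Brezis and Browder: choose each node of a
    sequence to advance the time by more than half of what is possible. *)
Lemma follows_final a0 : valid a0 -> exists b, [/\ valid b, follows a0 b & ntime b = T].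
Proof.
move=> va0; apply: contrapT => no.
pose P a := valid a /\ follows a0 a.
(* The times that can still be reached from [a]. *)
pose S a : R := sup [set ntime b | b in [set b | valid b /\ follows a b]].
have PS a b : valid a -> valid b -> follows a b -> ntime b <= S a.
  move=> va vb fab; apply: ub_le_sup; last by exists b.
  by exists T => _ [c [[_ cT _ _] _] <-].
have next a : exists b, P a -> [/\ valid b, follows a b & (ntime a + S a) / 2 < ntime b].
  have [[va fa]|nP] := pselect (P a); last by exists a.
  have aT : ntime a < T.
    rewrite lt_neqAle; have [_ -> _ _] := va; rewrite andbT; apply/eqP => aT.
    by apply: no; exists a.
  have [b [vb fb ab]] := follows_step va aT.
  have aS : (ntime a + S a) / 2 < S a by have := PS a b va vb fb; lra.
  have hs : has_sup [set ntime b | b in [set b | valid b /\ follows a b]].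
    by split; [exists (ntime b), b|exists T => _ [c [[_ cT _ _] _] <-]].
  have d0 : 0 < S a - (ntime a + S a) / 2 by rewrite subr_gt0.
  have [_ [c [vc fc] <-] hc] := sup_adherent d0 hs.
  by exists c => _; split=> //; move: hc; rewrite -/(S a) opprB addrC subrK.
have [nx hnx] := choice next.
pose a k := iter k nx a0.
have Pa k : P (a k).
  elim: k => [|k [va fa]]; first by split => //; exact: follows_refl.
  have [vb fb _] := hnx _ (conj va fa); split => //.
  exact: follows_trans va0 va vb fa fb.
have ha k := hnx _ (Pa k).
have [b [vb fb ct]] := follows_limit (fun k => (Pa k).1) (fun k => let: And3 _ f _ := ha k in f).
have bT : ntime b < T.
  rewrite lt_neqAle; have [_ -> _ _] := vb; rewrite andbT; apply/eqP => bT.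
  by apply: no; exists b; split=> //; exact: (fb 0%N).
have [c [vc fc bc]] := follows_step vb bT.
have key k : ntime c <= 2 * ntime (a k.+1) - ntime (a k).
  have [_ _ h] := ha k; have := PS _ _ (Pa k).1 vc (follows_trans (Pa k).1 vb vc (fb k) fc).
  rewrite -/(a k.+1) in h *; rewrite [a k.+1]/= ; lra.
have ck : (fun k => 2 * ntime (a k.+1) - ntime (a k)) @ \oo --> 2 * ntime b - ntime b.
  apply: cvgB => //; apply: cvgM; first exact: cvg_cst.
  by rewrite (cvg_shiftS (fun k => ntime (a k))).
have : ntime c <= 2 * ntime b - ntime b.
  by apply: (ler_cvg_to (cvg_cst (ntime c)) ck); exact: nearW.
by rewrite mulr_natl mulr2n addrK leNgt bc.
Qed.

(** Concatenate local steps until the final time; the solutions issued from the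
    successive nodes stay close to each other by the transitivity of [follows]. *)
Theorem near_viability x : t0 < T -> K t0 x -> exists2 u, prog u &
  forall s, t0 <= s -> s <= T -> exists2 y, K s y & rd (Phi t0 x u s) y <= e * (1 + (T - t0)).
Proof.
move=> tT Kx; have [_ [u0 [_ [_ _ pu _ _]]]] := step t00 tT Kx e0.
have va : valid (Node t0 x u0) by split=> //=; exact: ltW.
have [b [[_ _ _ pb] [_ _ _ h] bT]] := follows_final va.
exists (nctl b) => // s ts sT.
by have [|y Ky hy] := h s ts; [rewrite bT|exists y; rewrite // -bT].
Qed.

End abstract_viability.

(** * Square integrable random elements *)

Section sigma_algebra_operations.
Context {T : Type} (S : set (set T)).
Hypothesis hS : sigma_algebra setT S.

Lemma sigmaT : S setT. Proof. by have [h0 hC _] := hS; rewrite -(setD0 setT); exact: hC. Qed.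

Lemma sigmaC A : S A -> S (~` A). Proof. by have [_ hC _] := hS; rewrite -setTD; exact: hC. Qed.

Lemma sigma_bigcup (A : nat -> set T) : (forall k, S (A k)) -> S (\bigcup_k A k).
Proof. by have [_ _] := hS; apply. Qed.

Lemma sigma_bigcap (A : nat -> set T) : (forall k, S (A k)) -> S (\bigcap_k A k).
Proof.
move=> hA; rewrite -[X in S X]setCK setC_bigcap; apply: sigmaC.
by apply: sigma_bigcup => k; exact: sigmaC.
Qed.

Lemma sigmaU A B : S A -> S B -> S (A `|` B).
Proof. by move=> hA hB; rewrite -bigcup2E; apply: sigma_bigcup => -[|[|k]] //=; case: hS. Qed.

Lemma sigmaI A B : S A -> S B -> S (A `&` B).
Proof. by move=> hA hB; rewrite -[X in S X]setCK setCI; apply/sigmaC/sigmaU; exact: sigmaC. Qed.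

End sigma_algebra_operations.

Section mean_square.
Context {R : realType} {dO : measure_display} {Omega : measurableType dO}.
Variable P : probability Omega R.
Local Notation nrm := (nrm2 P setT).
Local Notation sq := (sqint P setT).
Let mT : measurable [set: Omega] := measurableT.
Let SI := sqint_semi_inner P mT.
Implicit Types f g : Omega -> R.

(** The minimum of the two squares is almost everywhere the first one, and everywhere
    below the second one. *)
Lemma sqr_integral_le_ae f g : measurable_fun setT f -> measurable_fun setT g ->
  {ae P, forall w, `|f w| <= `|g w|} ->
  (\int[P]_w (f w ^+ 2)%:E <= \int[P]_w (g w ^+ 2)%:E)%E.
Proof.
move=> mf mg fg.
have mf2 : measurable_fun setT (fun w => f w ^+ 2) by exact: measurable_funX.
have mg2 : measurable_fun setT (fun w => g w ^+ 2) by exact: measurable_funX.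
rewrite (ae_eq_integral (fun w => (Num.min (f w ^+ 2) (g w ^+ 2))%:E))//.
- apply: ge0_le_integral => //.
  + by move=> w _; rewrite lee_fin le_min !sqr_ge0.
  + by apply/measurable_EFinP; exact: measurable_minr.
  + by apply/measurable_EFinP.
  + by move=> w _; rewrite lee_fin ge_min lexx orbT.
- by apply/measurable_EFinP.
- by apply/measurable_EFinP; exact: measurable_minr.
- apply: filterS fg => w h _; rewrite min_l// -(real_normK (num_real (f w))).
  by rewrite -(real_normK (num_real (g w))) ler_pXn2r ?nnegrE.
Qed.

Lemma nrm_le_ae f g : sq f -> sq g -> {ae P, forall w, `|f w| <= `|g w|} -> nrm f <= nrm g.
Proof.
move=> Hf Hg fg; apply: ler_wsqrtr; rewrite -lee_fin -!sqint_ipE//.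
by apply: sqr_integral_le_ae => //; [case: Hf|case: Hg].
Qed.

Lemma sq_cst c : sq (cst c).
Proof.
split; first exact: measurable_cst.
have E := integral_cst P measurableT (c ^+ 2)%:E; rewrite /= probability_setT mule1 in E.
by rewrite [X in (X < _)%E]E ltry.
Qed.

Lemma sqZ c f : sq f -> sq (fun w => c * f w). Proof. exact: (siZ SI). Qed.

Lemma sqD f g : sq f -> sq g -> sq (fun w => f w + g w). Proof. exact: (siD SI). Qed.

Lemma nrmD f g : sq f -> sq g -> nrm (fun w => f w + g w) <= nrm f + nrm g.
Proof. exact: (si_triangle SI). Qed.

Lemma nrmZ c f : sq f -> nrm (fun w => c * f w) = `|c| * nrm f.
Proof. exact: (si_nrmZ SI). Qed.

Lemma nrm_cst c : nrm (cst c) = `|c|.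
Proof.
have E := Rintegral_cst P measurableT (c * c); rewrite /= probability_setT mulr1 in E.
by rewrite /nrm2 [X in Num.sqrt X](_ : _ = c * c)// -expr2 sqrtr_sqr.
Qed.

Lemma sq_le_ae f g : measurable_fun setT f -> sq g -> {ae P, forall w, `|f w| <= `|g w|} -> sq f.
Proof. by move=> mf [mg g2] fg; split=> //; exact: le_lt_trans (sqr_integral_le_ae mf mg fg) g2. Qed.

Lemma nrm_dominated (f : nat -> Omega -> R) g : (forall k, measurable_fun setT (f k)) -> sq g ->
  {ae P, forall w, forall k, `|f k w| <= `|g w|} ->
  {ae P, forall w, f k w @[k --> \oo] --> 0} -> nrm (f k) @[k --> \oo] --> 0.
Proof.
move=> mf Hg fg f0; rewrite -[X in _ --> X]sqrtr0; apply: continuous_cvg; first exact: sqrt_continuous.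
have Hf k : sq (f k) by apply: (sq_le_ae (mf k) Hg); apply: filterS fg => w; exact.
have [||||| _ _ h] := @dominated_convergence _ _ _ P setT mT (fun k w => (f k w ^+ 2)%:E)
  (cst 0%E) (fun w => (g w ^+ 2)%:E).
- by move=> k; apply/measurable_EFinP; exact: measurable_funX.
- exact: measurable_cst.
- apply: filterS f0 => w h _; apply: cvg_EFin; first exact: nearW.
  by rewrite -[X in _ --> X](mulr0 0); exact: (cvgM h h).
- exact: (sqint_integrable Hg).
- apply: filterS fg => w h k _; rewrite lee_fin ger0_norm ?sqr_ge0//.
  rewrite -(real_normK (num_real (f k w))) -(real_normK (num_real (g w))).
  by rewrite ler_pXn2r ?nnegrE.
rewrite integral0 in h; rewrite (_ : (fun k => _) = fine \o (fun k => \int[P]_w (f k w ^+ 2)%:E)%E).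
  exact: (fine_cvg h).
by apply/funext => k /=; rewrite sqint_ipE.
Qed.

Lemma fatou_le_ae (h : nat -> Omega -> \bar R) (l : Omega -> \bar R) (c : \bar R) :
  (forall k, measurable_fun setT (h k)) -> measurable_fun setT l ->
  (forall k w, (0 <= h k w)%E) -> (forall w, (0 <= l w)%E) ->
  {ae P, forall w, h ^~ w @ \oo --> l w} -> (forall k, (\int[P]_w h k w <= c)%E) ->
  (\int[P]_w l w <= c)%E.
Proof.
move=> mh ml h0 l0 [N [mN N0 sN]] hc.
have mD : measurable (setT `\` N) by exact: measurableD.
rewrite (@ge0_negligible_integral _ _ _ P setT N)//.
apply: (@fatou_le _ _ _ P (setT `\` N) mD h) => //.
- by move=> k; exact: measurable_funS (mh k).
- by move=> w [_ Nw]; apply: contrapT => nh; apply: Nw; exact: sN.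
- by move=> k; rewrite -(@ge0_negligible_integral _ _ _ P setT N).
Qed.

End mean_square.

Lemma cvg0_shift {R : realType} (v : nat -> R) (k : nat) :
  v j @[j --> \oo] --> 0 -> v (k + j)%N @[j --> \oo] --> 0.
Proof. by rewrite -(cvg_shiftn k v); under eq_fun do rewrite addnC. Qed.

(** The separability of [H^-1] is what makes distances measurable. *)
Lemma measurable_Hm1_norm {R : realType} {n : nat} {O : set 'rV[R]_n.+1} {dO : measure_display}
  {Omega : measurableType dO} (f : Omega -> Hm1 O) : open O -> bounded_set O ->
  (forall e, measurable_fun setT (fun w => ipH (f w) e)) ->
  measurable_fun setT (fun w => `|f w|).
Proof.
move=> oO bO mf _; have [D hD] := Hm1_norming oO bO.
apply: (measurability _ (RGenOInfty.measurableE R)) => // _ [_ [c ->] <-].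
rewrite setTI -[X in measurable X]setCK; apply: measurableC.
have [c0|c0] := ltP c 0.
  rewrite (_ : ~` _ = set0) //; apply/seteqP; split=> w //=; rewrite in_itv/= andbT.
  by apply; exact: lt_le_trans (normr_ge0 _).
rewrite (_ : ~` _ = \bigcap_k [set w | `|ipH (f w) (D k)| <= c * `|D k|]).
  apply: bigcapT_measurable => k; rewrite -[X in measurable X]setTI.
  rewrite (_ : [set w | _] = ((fun x : R => `|x|) \o (fun w => ipH (f w) (D k))) @^-1` `]-oo, c * `|D k|]).
    by apply: (measurableT_comp (@normr_measurable R setT) (mf (D k))).
  by apply/seteqP; split=> w /=; rewrite in_itv.
apply/seteqP; split=> w /=; rewrite in_itv/= andbT => h.
  move=> k _; apply: (le_trans (ipH_CS oO bO _ _)); rewrite ler_wpM2r// leNgt; exact/negP.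
by apply/negP; rewrite -leNgt; apply: hD => // k; exact: h.
Qed.

Section random_elements.
Context {R : realType} {n : nat}.
Variables (O1 O2 : set 'rV[R]_n.+1).
Hypotheses (oO1 : open O1) (bO1 : bounded_set O1) (oO2 : open O2) (bO2 : bounded_set O2).
Context {dO : measure_display} {Omega : measurableType dO}.
Variable P : probability Omega R.
Local Notation H := (Hm1 O1 * Hm1 O2)%type.
Local Notation nrm := (nrm2 P setT).
Local Notation sq := (sqint P setT).
Implicit Types X Y Z : Omega -> H.

Lemma nH_openP (V : set H) : open V <->
  forall p, V p -> exists2 e, 0 < e & forall q, nH (p - q) < e -> V q.
Proof.
split=> [oV p Vp|h].
  have /nbhs_ballP[e /= e0 he] := open_nbhs_nbhs (conj oV Vp); exists e => // q pq.
  apply: he; rewrite -ball_normE /ball_/= prod_normE gt_max; apply/andP; split.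
    exact: le_lt_trans (nH_fst _) pq.
  exact: le_lt_trans (nH_snd _) pq.
rewrite openE => p /h[e e0 he]; apply/nbhs_ballP; exists (e / 2) => /=; first by rewrite divr_gt0.
move=> q; rewrite -ball_normE /ball_/= prod_normE gt_max => /andP[h1 h2]; apply: he.
by apply: (le_lt_trans (nH_le _)); rewrite (splitr e); exact: ltrD.
Qed.

Lemma nH_dist (p q r : H) : `|nH (p - q) - nH (p - r)| <= nH (q - r).
Proof.
have t1 := nH_tri oO1 bO1 oO2 bO2 p q r; have t2 := nH_tri oO1 bO1 oO2 bO2 p r q.
move: t1 t2; rewrite (nH_B r q) ler_norml; move: (nH _) (nH _) (nH _) => x y z t1 t2.
by apply/andP; split; lra.
Qed.

Definition borel X := forall V, open V -> measurable (X @^-1` V).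

Lemma borel_lipschitz X (g : H -> R) (L : R) : (forall p q, `|g p - g q| <= L * nH (p - q)) ->
  borel X -> measurable_fun setT (g \o X).
Proof.
move=> hg bX _; apply: (measurability _ (RGenOInfty.measurableE R)) => // _ [_ [c ->] <-].
rewrite setTI; apply: (bX (g @^-1` `]c, +oo[)); apply/nH_openP => p.
rewrite /= in_itv/= andbT => cp; have L1 : 0 < `|L| + 1 by rewrite ltr_wpDl.
exists ((g p - c) / (`|L| + 1)) => [|q]; first by rewrite divr_gt0// subr_gt0.
rewrite ltr_pdivlMr// in_itv/= andbT => h.
have : g p - g q < g p - c.
  apply: le_lt_trans h; apply: (le_trans (ler_norm _)); apply: (le_trans (hg p q)).
  rewrite mulrC ler_wpM2l ?nH_ge0//; apply: (le_trans (ler_norm L)); rewrite lerDl//.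
by rewrite ltrD2l ltrN2.
Qed.

Lemma borel_dist X Y : borel X -> borel Y -> measurable_fun setT (fun w => nH (X w - Y w)).
Proof.
move=> bX bY.
have m1 : measurable_fun setT (fun w => `|(X w).1 - (Y w).1|).
  apply: (measurable_Hm1_norm oO1 bO1) => e.
  have L p q : `|ipH (p : H).1 e - ipH (q : H).1 e| <= `|e| * nH (p - q).
    rewrite -(ipHBl oO1 bO1) mulrC; apply: (le_trans (ipH_CS oO1 bO1 _ _)).
    by rewrite ler_wpM2r//; exact: (nH_fst (p - q)).
  under eq_fun do rewrite (ipHBl oO1 bO1).
  by apply: measurable_funB; [exact: (borel_lipschitz L bX)|exact: (borel_lipschitz L bY)].
have m2 : measurable_fun setT (fun w => `|(X w).2 - (Y w).2|).
  apply: (measurable_Hm1_norm oO2 bO2) => e.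
  have L p q : `|ipH (p : H).2 e - ipH (q : H).2 e| <= `|e| * nH (p - q).
    rewrite -(ipHBl oO2 bO2) mulrC; apply: (le_trans (ipH_CS oO2 bO2 _ _)).
    by rewrite ler_wpM2r//; exact: (nH_snd (p - q)).
  under eq_fun do rewrite (ipHBl oO2 bO2).
  by apply: measurable_funB; [exact: (borel_lipschitz L bX)|exact: (borel_lipschitz L bY)].
apply: (@measurableT_comp _ _ _ _ _ _ _ _ (fun w => `|(X w).1 - (Y w).1| ^+ 2 + `|(X w).2 - (Y w).2| ^+ 2)).
  by apply: continuous_measurable_fun; exact: sqrt_continuous.
by apply: measurable_funD; exact: measurable_funX.
Qed.

Definition msq X := borel X /\ sq (fun w => nH (X w)).

(** The distance of [L^2(Omega; H^-1(O1) * H^-1(O2))]. *)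
Definition rd X Y : R := nrm (fun w => nH (X w - Y w)).

Lemma borel_nH X : borel X -> measurable_fun setT (fun w => nH (X w)).
Proof.
move=> bX; apply: (@borel_lipschitz X (@nH R n O1 O2) 1 _ bX) => p q; rewrite mul1r ler_norml.
have h1 := nH_D oO1 bO1 oO2 bO2 (p - q) q; have h2 := nH_D oO1 bO1 oO2 bO2 (q - p) p.
rewrite !subrK in h1 h2; rewrite (nH_B q p) in h2; apply/andP; split; lra.
Qed.

Lemma nH_norm (p : H) : `|nH p| = nH p. Proof. by rewrite ger0_norm// nH_ge0. Qed.

Lemma msq_dist X Y : msq X -> msq Y -> sq (fun w => nH (X w - Y w)).
Proof.
move=> [bX sX] [bY sY]; apply: (sq_le_ae (borel_dist bX bY) (sqD sX sY)).
apply: aeW => w; rewrite nH_norm ger0_norm ?addr_ge0 ?nH_ge0//.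
by rewrite -(nH_N (Y w)); exact: nH_D.
Qed.

Lemma rd_ge0 X Y : 0 <= rd X Y. Proof. exact: sqrtr_ge0. Qed.

Lemma rdxx X : rd X X = 0.
Proof.
rewrite /rd (_ : (fun w => _) = cst 0) ?nrm_cst ?normr0//.
by apply/funext => w; rewrite subrr nH0.
Qed.

Lemma rdC X Y : rd X Y = rd Y X.
Proof. by congr nrm2; apply/funext => w; exact: nH_B. Qed.

Lemma rd_tri X Y Z : msq X -> msq Y -> msq Z -> rd X Z <= rd X Y + rd Y Z.
Proof.
move=> mX mY mZ; have h1 := msq_dist mX mY; have h2 := msq_dist mY mZ.
apply: le_trans (nrmD h1 h2); apply: (nrm_le_ae (msq_dist mX mZ) (sqD h1 h2)).
apply: aeW => w; rewrite nH_norm ger0_norm ?addr_ge0 ?nH_ge0//.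
exact: nH_tri.
Qed.

Lemma rd_le X Y f : msq X -> msq Y -> sq f -> {ae P, forall w, nH (X w - Y w) <= `|f w|} ->
  rd X Y <= nrm f.
Proof.
move=> mX mY Hf h; apply: (nrm_le_ae (msq_dist mX mY) Hf).
by apply: filterS h => w; rewrite nH_norm.
Qed.

Lemma rd_eq0 X Y : msq X -> msq Y -> {ae P, forall w, X w = Y w} -> rd X Y = 0.
Proof.
move=> mX mY h; apply/eqP; rewrite eq_le rd_ge0 andbT.
have <- : nrm (cst 0) = 0 by rewrite nrm_cst normr0.
apply: (rd_le mX mY (sq_cst P 0)); apply: filterS h => w ->.
by rewrite subrr nH0.
Qed.

Lemma sq_sqnorm X : borel X -> ('E_P[fun w => sqnorm (X w)] < +oo)%E -> msq X.
Proof.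
move=> bX; rewrite unlock => h; split=> //; split; first exact: borel_nH.
apply: le_lt_trans h; rewrite le_eqVlt; apply/orP; left; apply/eqP.
by apply: eq_integral => w _; rewrite nH2.
Qed.

Lemma msq_sqnorm X : msq X -> ('E_P[fun w => sqnorm (X w)] < +oo)%E.
Proof.
move=> [_ [_ h]]; rewrite unlock; apply: le_lt_trans h; rewrite le_eqVlt.
by apply/orP; left; apply/eqP; apply: eq_integral => w _; rewrite nH2.
Qed.

Lemma rd_sqnorm X Y : msq X -> msq Y ->
  ('E_P[fun w => sqnorm (X w - Y w)%R] = (rd X Y ^+ 2)%:E)%E.
Proof.
move=> mX mY; have h := msq_dist mX mY; rewrite unlock /rd /nrm2 (sqr_sqrtr _); last first.
  exact: (si_ge0 (sqint_semi_inner P measurableT) h).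
by rewrite -sqint_ipE//; apply: eq_integral => w _; rewrite nH2.
Qed.

Lemma rd_Lnorm X Y : msq X -> msq Y ->
  Lnorm P 2%:E (fun w => (Num.sqrt (sqnorm (X w - Y w)))%:E) = (rd X Y)%:E.
Proof.
move=> mX mY; have h := msq_dist mX mY.
rewrite unlock; have -> : (\int[P]_w (`|(Num.sqrt (sqnorm (X w - Y w)))%:E| `^ 2) = (rd X Y ^+ 2)%:E)%E.
  rewrite -(rd_sqnorm mX mY) unlock; apply: eq_integral => w _.
  rewrite abse_EFin poweR_EFin powR_mulrn// real_normK ?num_real//.
  by rewrite sqr_sqrtr// sqnorm_ge0.
by rewrite poweR_EFin powR12_sqrt ?sqr_ge0// sqrtr_sqr ger0_norm// rd_ge0.
Qed.

Variable F : R -> set (set Omega).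
Hypothesis hF : usual_filtration P F.

Lemma adapted_borel s X : 0 <= s -> adapted_at F s X -> borel X.
Proof. by move=> s0 aX V oV; have [_ hm _ _ _] := hF; apply: (hm s s0); exact: aX. Qed.

Lemma adapted_mono s s' X : 0 <= s -> s <= s' -> adapted_at F s X -> adapted_at F s' X.
Proof. by move=> s0 ss aX V oV; have [_ _ hm _ _] := hF; apply: (hm s s' s0 ss); exact: aX. Qed.

Lemma negligible_in s N : 0 <= s -> P.-negligible N -> F s N.
Proof. by move=> s0 nN; have [_ _ hm _ hN] := hF; apply: (hm 0 s) => //; exact: hN. Qed.

Lemma L2_msq K s X : 0 <= s -> L2Omega P F K s X -> msq X.
Proof. by move=> s0 [aX eX _]; apply: sq_sqnorm => //; exact: adapted_borel aX. Qed.

(** Chebyshev's inequality, by [fast_cauchy_ae]. *)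
Lemma rd_fast (x : nat -> Omega -> H) y : (forall k, msq (x k)) -> (forall k, msq (y k)) ->
  (forall k, rd (x k) (y k) <= 4%:R ^- k) ->
  {ae P, forall w, exists B : R, forall k, nH (x k w - y k w) <= B * 2%:R ^- k}.
Proof.
move=> mx my h; have := @fast_cauchy_ae _ _ _ P setT measurableT (fun k w => nH (x k w - y k w)) 1.
have h1 k : measurable_fun setT (fun w => nH (x k w - y k w)) by have [] := msq_dist (mx k) (my k).
move=> /(_ h1) h2; have {}h2 := h2 _; apply: filterS (h2 _).
  by move=> w /(_ Logic.I)[B hB]; exists B => k; have := hB k; rewrite nH_norm.
move=> k; rewrite (sqint_ipE _ (msq_dist (mx k) (my k)))// lee_fin mul1r.
rewrite -(si_sqr (sqint_semi_inner P measurableT) (msq_dist (mx k) (my k))).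
rewrite (_ : 16%:R ^- k = (4%:R ^- k) ^+ 2 :> R); last first.
  by rewrite (_ : 16%:R = 4%:R ^+ 2 :> R) ?exprVn -?exprM 1?mulnC// -natrX.
by rewrite ler_pXn2r ?nnegrE ?invr_ge0 ?exprn_ge0 ?sqrtr_ge0//; exact: h.
Qed.

Lemma pow4_bound (r : nat -> R) : r k @[k --> \oo] --> 0 -> forall j, exists N, forall k, (N <= k)%N -> r k <= 4%:R ^- j.
Proof.
move=> /cvgr0Pnorm_le hr j; have p0 : 0 < 4%:R ^- j :> R by rewrite invr_gt0 exprn_gt0.
have [N _ hN] := hr _ p0; exists N => k Nk; exact: le_trans (ler_norm _) (hN k Nk).
Qed.

(** A fast sequence of approximations converges almost surely, and [K] is closed. *)
Lemma L2_closed (K : set H) s Y : 0 <= s -> closed K -> L2Omega P F setT s Y ->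
  (forall e, 0 < e -> exists2 X, L2Omega P F K s X & rd Y X <= e) -> L2Omega P F K s Y.
Proof.
move=> s0 cK LY h; have [aY eY _] := LY; split=> //.
have /choice[x hx] : forall k : nat, exists X, L2Omega P F K s X /\ rd Y X <= 4%:R ^- k.
  by move=> k; have [|X] := h (4%:R ^- k); [rewrite invr_gt0 exprn_gt0|exists X].
have mx k : msq (x k) := L2_msq s0 (hx k).1.
have h1 := rd_fast (fun _ => L2_msq s0 LY) mx (fun k => (hx k).2).
have h2 : {ae P, forall w, forall k, K (x k w)}.
  by apply/ae_foralln => k; have [[]] := hx k.
apply: filterS2 h1 h2 => w [B hB] Kx; apply: contrapT => nK.
have oK : open (~` K) by exact: closed_openC.
have [e e0 he] := (nH_openP (~` K)).1 oK (Y w) nK.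
have ch : (fun k => B * 2%:R ^- k) @ \oo --> 0.
  rewrite (_ : (fun k => _) = geometric B 2%:R^-1); last by apply/funext => k; rewrite /geometric/= exprVn.
  by apply: cvg_geometric; rewrite ger0_norm ?invr_ge0// invf_lt1// ltr1n.
move/cvgr0Pnorm_lt : ch => /(_ e e0)[k _ /(_ k (leqnn k))] hk.
apply: (he (x k w)); last exact: Kx.
by apply: le_lt_trans (hB k) _; apply: le_lt_trans (ler_norm _) hk.
Qed.

(** The limit is chosen pointwise; its adaptedness comes from the completeness
    of the filtration. *)
Lemma L2_complete_random s (x : nat -> Omega -> H) (r : nat -> R) : 0 <= s ->
  (forall k, L2Omega P F setT s (x k)) ->
  (forall k l, (k <= l)%N -> rd (x k) (x l) <= r k) -> r k @[k --> \oo] --> 0 ->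
  exists2 y, L2Omega P F setT s y & forall k, rd (x k) y <= r k.
Proof.
move=> s0 Lx hx hr; have [hS _ _ _ _] := hF; have sS := hS s s0.
have mx k : msq (x k) := L2_msq s0 (Lx k).
have [N hN] := choice (pow4_bound hr).
pose f (j : nat) : nat := (\sum_(i < j.+1) (N i).+1)%N.
have fS j : (f j <= f j.+1)%N by rewrite /f [X in (_ <= X)%N]big_ord_recr/= leq_addr.
have fN j : (N j <= f j)%N by rewrite /f big_ord_recr/=; apply: leq_trans (leq_addl _ _); exact: leqnSn.
have fj j : (j <= f j)%N.
  by elim: j => // j IH; rewrite /f big_ord_recr/= -/(f j) addnS ltnS (leq_trans IH)// leq_addr.
clearbody f.
have ae1 := @rd_fast (fun j => x (f j)) (fun j => x (f j.+1)) (fun j => mx _) (fun j => mx _)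
  (fun j => le_trans (hx _ _ (fS j)) (hN j _ (fN j))).
pose good w := exists p, exists B : R, forall j, nH (p - x (f j) w) <= B * 2%:R ^- j.
have aeg : {ae P, forall w, good w}.
  apply: filterS ae1 => w [B hB].
  have B0 : 0 <= B by have := le_trans (nH_ge0 _) (hB 0%N); rewrite expr0 invr1 mulr1.
  have dist j l : (j <= l)%N -> nH (x (f j) w - x (f l) w) <= 2 * B * 2%:R ^- j - 2 * B * 2%:R ^- l.
    elim: l => [|l IH]; first by rewrite leqn0 => /eqP ->; rewrite !subrr nH0.
    rewrite leq_eqVlt => /predU1P[->|]; first by rewrite !subrr nH0.
    rewrite ltnS => /IH h; apply: (le_trans (nH_tri oO1 bO1 oO2 bO2 _ (x (f l) w) _)).
    apply: (le_trans (lerD h (hB l))); rewrite exprS invfM.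
    by move: (2%:R ^+ l)^-1 (2%:R ^+ j)^-1 => p q; lra.
  have dist2 j l : (j <= l)%N -> nH (x (f j) w - x (f l) w) <= 2 * B * 2%:R ^- j.
    move=> /dist/le_trans; apply; rewrite lerBlDr lerDl.
    by rewrite !mulr_ge0// invr_ge0 exprn_ge0.
  have cr : (fun j => 2 * B * 2%:R ^- j) @ \oo --> 0.
    rewrite (_ : (fun k => _) = geometric (2 * B) 2%:R^-1); last by apply/funext => k; rewrite /geometric/= exprVn.
    by apply: cvg_geometric; rewrite ger0_norm ?invr_ge0// invf_lt1// ltr1n.
  have [|p1 hp1] := @Hm1_complete _ _ O1 (fun j => (x (f j) w).1) _ _ cr.
    by move=> j l jl; exact: le_trans (nH_fst _) (dist2 j l jl).
  have [|p2 hp2] := @Hm1_complete _ _ O2 (fun j => (x (f j) w).2) _ _ cr.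
    by move=> j l jl; exact: le_trans (nH_snd _) (dist2 j l jl).
  exists (p1, p2), (2 * B + 2 * B) => j; apply: (le_trans (nH_le _)).
  by rewrite mulrDl; apply: lerD; [exact: hp1|exact: hp2].
pose y w : H := xget (0 : H) [set p : H | exists B : R, forall j, nH (p - x (f j) w) <= B * 2%:R ^- j].
have hy w : good w -> exists B : R, forall j, nH (y w - x (f j) w) <= B * 2%:R ^- j.
  move=> [p hp]; have := @xgetPex _ (0 : H) [set p : H | exists B : R, forall j, nH (p - x (f j) w) <= B * 2%:R ^- j].
  by apply; exists p.
have cy w : good w -> nH (y w - x (f j) w) @[j --> \oo] --> 0.
  move=> /hy[B hB]; have cr : (fun j => B * 2%:R ^- j) @ \oo --> 0.
    rewrite (_ : (fun k => _) = geometric B 2%:R^-1); last by apply/funext => k; rewrite /geometric/= exprVn.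
    by apply: cvg_geometric; rewrite ger0_norm ?invr_ge0// invf_lt1// ltr1n.
  apply: (squeeze_cvgr _ (cvg_cst 0) cr); apply: nearW => j.
  by rewrite nH_ge0 hB.
have Fbad A : A `<=` [set w | ~ good w] -> F s A.
  by move=> Ab; apply: (negligible_in s0); apply: negligibleS aeg => w /Ab.
have Fgood : F s [set w | good w].
  rewrite (_ : [set w | good w] = ~` [set w | ~ good w]); first by apply: sigmaC => //; exact: Fbad.
  by apply/seteqP; split=> w /=; [move=> g; exact|move/contrapT].
have ay : adapted_at F s y.
  move=> V oV.
  (* [Vm m] is the set of the points of [V] that are at distance more than [1 / (m + 1)]
     of its complement: the limit is in [V] when a tail is in some [Vm m]. *)
  pose Vm (m : nat) : set H := [set p | exists2 e, m.+1%:R^-1 < e & forall q, nH (p - q) < e -> V q].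
  have oVm m : open (Vm m).
    apply/nH_openP => p [e me he]; exists ((e - m.+1%:R^-1) / 2); first by rewrite divr_gt0// subr_gt0.
    move=> q pq; exists ((e + m.+1%:R^-1) / 2); first by rewrite ltr_pdivlMr// mulr_natr mulr2n ltrD2r.
    move=> q' qq; apply: he; apply: (le_lt_trans (nH_tri oO1 bO1 oO2 bO2 _ q _)).
    move: pq qq; move: (m.+1%:R^-1) (nH _) (nH _) => a c c'; lra.
  rewrite (_ : y @^-1` V = ([set w | good w] `&` \bigcup_m \bigcup_J \bigcap_j (x (f (J + j)%N) @^-1` Vm m))
      `|` ([set w | ~ good w] `&` y @^-1` V)); last first.
    apply/seteqP; split=> w.
    - move=> Vy; have [g|ng] := pselect (good w); [left|by right]; split=> //.
      have [e e0 he] := (nH_openP V).1 oV (y w) Vy.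
      have [m _ hm] := near_infty_natSinv_lt (PosNum (divr_gt0 e0 (ltr0n R 2))).
      have {}hm := hm m (leqnn m); rewrite /= in hm.
      move/cvgr0Pnorm_lt : (cy w g) => /(_ _ (divr_gt0 e0 (ltr0n R 2)))[J _ hJ].
      exists m => //; exists J => // j _; exists (e / 2) => // q xq; apply: he.
      apply: (le_lt_trans (nH_tri oO1 bO1 oO2 bO2 _ (x (f (J + j)%N) w) _)); rewrite (splitr e).
      apply: ltrD => //; have := hJ (J + j)%N (leq_addr _ _).
      by rewrite /= nH_norm.
    - move=> [[g [m _ [J _ hJ]]]|[_ //]].
      have m0 : 0 < m.+1%:R^-1 :> R by rewrite invr_gt0.
      move/cvgr0Pnorm_lt : (cy w g) => /(_ _ m0)[J' _ hJ'].
      have [e me he] := hJ J' Logic.I; apply: he; rewrite nH_B.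
      by apply: lt_trans me; have := hJ' (J + J')%N (leq_addl _ _); rewrite /= nH_norm.
  apply: sigmaU => //; last by apply: Fbad => w [].
  apply: sigmaI => //; apply: sigma_bigcup => // m; apply: sigma_bigcup => // J.
  by apply: sigma_bigcap => // j; have [ax _ _] := Lx (f (J + j)%N); exact: ax.
have bY := adapted_borel s0 ay.
have est k : (\int[P]_w ((nH (x k w - y w)) ^+ 2)%:E <= ((r k) ^+ 2)%:E)%E.
  have bk : borel (x k) by have [] := mx k.
  have r0 : 0 <= r k := le_trans (rd_ge0 _ _) (hx k k (leqnn k)).
  apply: (@fatou_le_ae _ _ _ P (fun j w => ((nH (x k w - x (f (k + j)%N) w)) ^+ 2)%:E)).
  - move=> j; apply/measurable_EFinP; apply: measurable_funX.
    by have [] := msq_dist (mx k) (mx (f (k + j)%N)).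
  - by apply/measurable_EFinP; apply: measurable_funX; exact: borel_dist.
  - by move=> j w; rewrite lee_fin sqr_ge0.
  - by move=> w; rewrite lee_fin sqr_ge0.
  - apply: filterS aeg => w g; apply: cvg_EFin; first exact: nearW.
    have c1 : nH (x k w - x (f (k + j)%N) w) @[j --> \oo] --> nH (x k w - y w).
      have c2 : nH (y w - x (f (k + j)%N) w) @[j --> \oo] --> 0.
        exact: (@cvg0_shift R (fun j => nH (y w - x (f j) w)) k (cy w g)).
      apply/cvgrPdist_le => e e0; move/cvgr0Pnorm_le : c2 => /(_ e e0); apply: filterS => j.
      by rewrite nH_norm; exact: le_trans (nH_dist _ _ _).
    by rewrite /comp /=; under eq_fun do rewrite expr2; rewrite expr2; exact: (cvgM c1 c1).
  - move=> j; rewrite (sqint_ipE _ (msq_dist (mx k) (mx _)))// lee_fin.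
    rewrite -(si_sqr (sqint_semi_inner P measurableT) (msq_dist (mx k) (mx _))).
    rewrite ler_pXn2r ?nnegrE ?sqrtr_ge0//; apply: hx.
    by apply: leq_trans (fj _); exact: leq_addr.
have sk k : sq (fun w => nH (x k w - y w)).
  split; first by apply: borel_dist => //; have [] := mx k.
  by apply: le_lt_trans (est k) _; rewrite ltry.
have my : msq y.
  split=> //; apply: (sq_le_ae (borel_nH bY) (sqD (sk 0%N) (mx 0%N).2)).
  apply: aeW => w; rewrite nH_norm ger0_norm ?addr_ge0 ?nH_ge0//.
  by rewrite -{1}[y w](subrK (x 0%N w)) (nH_B (x 0%N w)); exact: nH_D.
exists y; first by split=> //; [exact: msq_sqnorm|exact: aeW].
move=> k; have r0 : 0 <= r k := le_trans (rd_ge0 _ _) (hx k k (leqnn k)).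
rewrite -(@ler_pXn2r _ 2)// ?nnegrE ?rd_ge0//.
rewrite /rd (si_sqr (sqint_semi_inner P measurableT) (sk k)) -lee_fin -sqint_ipE//.
Qed.

End random_elements.

(** * Progressive controls *)

Section progressive_controls.
Context {R : realType} {dO : measure_display} {Omega : measurableType dO}.
Variables (P : probability Omega R) (F : R -> set (set Omega)).
Hypothesis hF : usual_filtration P F.
Context {U : topologicalType}.
Implicit Types u v : R -> Omega -> U.

(** A process that coincides with progressive ones on the members of a countable
    measurable cover of the time axis is progressive. *)
Lemma progressive_glue (A : nat -> set R) (u : nat -> R -> Omega -> U) v :
  (forall k, measurable (A k)) -> \bigcup_k A k = setT ->
  (forall k r, A k r -> v r = u k r) -> (forall k, progressive F (u k)) -> progressive F v.
Proof.
move=> mA cA vu pu t V t0 oV; set G := (X in <<s X >>).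
have hS : sigma_algebra setT <<s G >> by exact: smallest_sigma_algebra.
rewrite (_ : [set p | _] =
    \bigcup_k ((A k `&` `[0, t]) `*` setT `&` [set p | 0 <= p.1 <= t /\ V (u k p.1 p.2)])).
  apply: (sigma_bigcup hS) => k; apply: (sigmaI hS); last exact: pu.
  apply: sub_gen_smallest; exists (A k `&` `[0, t]).
    by split; [apply: measurableI => //|move=> r []].
  exists setT => //; have [h _ _ _ _] := hF; exact: (sigmaT (h t t0)).
apply/seteqP; split=> [[r w] /= [rt Vv]|[r w] [k _ [[[Ar _] _] [rt Vu]]]]; last first.
  by split=> //=; rewrite (vu k).
have [k _ Ar] : (\bigcup_k A k) r by rewrite cA.
exists k => //; split => /=; first by split => //; split => //; rewrite in_itv.
by split => //; rewrite -(vu k).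
Qed.

Lemma progressive_cat u v t : progressive F u -> progressive F v ->
  progressive F (fun r => if r < t then u r else v r).
Proof.
move=> pu pv.
apply: (@progressive_glue (fun k => if k is 0%N then `]-oo, t[%classic else `[t, +oo[%classic)
  (fun k => if k is 0%N then u else v)).
- by move=> [|k]; exact: measurable_itv.
- apply/seteqP; split=> // r _; have [rt|tr] := ltP r t.
    by exists 0%N => //=; rewrite in_itv.
  by exists 1%N => //=; rewrite in_itv/= tr.
- by move=> [|k] r; rewrite /= in_itv/= ?andbT; [move=> ->|rewrite leNgt; case: ltP].
- by move=> [|k].
Qed.

Lemma progressive_lim (u : nat -> R -> Omega -> U) (t : nat -> R) :
  (forall k, progressive F (u k)) -> (forall k, t k <= t k.+1) ->
  (forall k r, r < t k -> u k.+1 r = u k r) ->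
  exists2 v, progressive F v & forall k r, r < t k -> v r = u k r.
Proof.
move=> pu tm uu.
have step k l r : (k <= l)%N -> r < t k -> u l r = u k r.
  elim: l => [|l IH]; first by rewrite leqn0 => /eqP ->.
  rewrite leq_eqVlt => /predU1P[->//|]; rewrite ltnS => kl rk; rewrite uu ?IH//.
  apply: lt_le_trans rk _; elim: l kl {IH} => [|l IH]; first by rewrite leqn0 => /eqP ->.
  by rewrite leq_eqVlt => /predU1P[->//|]; rewrite ltnS => /IH h; exact: le_trans h (tm l).
have agree k l r : r < t k -> r < t l -> u k r = u l r.
  by case/orP: (leq_total k l) => kl rk rl; [rewrite (step k l)|rewrite -(step l k)].
have /choice[v hv] : forall r, exists vr, (forall k, r < t k -> vr = u k r) /\
    ((forall k, t k <= r) -> vr = u 0%N r).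
  move=> r; have [[k rk]|no] := pselect (exists k, r < t k).
    exists (u k r); split=> [l rl|h]; first exact: agree.
    by have := h k; rewrite leNgt rk.
  by exists (u 0%N r); split=> // k rk; case: no; exists k.
exists v; last by move=> k r; have [h _] := hv r; exact: h.
apply: (@progressive_glue (fun k => if k is k'.+1 then `]-oo, t k'[%classic else \bigcap_j `[t j, +oo[%classic)
  (fun k => u k.-1)).
- by move=> [|k]; [apply: bigcapT_measurable => k; exact: measurable_itv|exact: measurable_itv].
- apply/seteqP; split=> // r _; have [[k rk]|no] := pselect (exists k, r < t k).
    by exists k.+1 => //=; rewrite in_itv.
  exists 0%N => // k _ /=; rewrite in_itv/= andbT leNgt; apply/negP => rk.
  by apply: no; exists k.
- move=> [|k] r /= h.
    by have [_] := hv r; apply => k; have := h k Logic.I; rewrite /= in_itv/= andbT.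
  by have [hk _] := hv r; apply: hk; move: h; rewrite in_itv.
- by move=> k; exact: pu.
Qed.

End progressive_controls.

(** * The random flow *)

Lemma rational_close {R : realType} : exists q : nat -> R, forall a b : R, a < b ->
  exists k, a < q k < b.
Proof.
exists (fun k => ratr (odflt 0 (@unpickle rat k))) => a b ab.
have [c] := rat_in_itvoo ab; rewrite in_itv/= => h.
by exists (pickle c); rewrite pickleK.
Qed.

Section random_flow.
Context {R : realType} {n : nat}.
Variables (O1 O2 : set 'rV[R]_n.+1).
Hypotheses (oO1 : open O1) (bO1 : bounded_set O1) (oO2 : open O2) (bO2 : bounded_set O2).
Variables (b1 b2 : 'rV[R]_n.+1 -> 'rV[R]_n.+1).
Variables (G1 : R -> Hm1 O1 -> Hm1 O1) (G2 : R -> Hm1 O2 -> Hm1 O2).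
Hypotheses (hb1 : admissible_field O1 b1) (hb2 : admissible_field O2 b2).
Hypotheses (hG1 : is_transport_group b1 G1) (hG2 : is_transport_group b2 G2).
Context {dO : measure_display} {Omega : measurableType dO}.
Variables (P : probability Omega R) (F : R -> set (set Omega)) (W : R -> Omega -> R).
Hypotheses (hF : usual_filtration P F) (hW : brownian P F W).
Local Notation H := (Hm1 O1 * Hm1 O2)%type.
Local Notation nrm := (nrm2 P setT).
Local Notation sq := (sqint P setT).
Local Notation L := (L2Omega P F [set: H]).
Local Notation msq := (@msq R n O1 O2 dO Omega P).
Local Notation rd := (@rd R n O1 O2 dO Omega P).
Implicit Types X Y : Omega -> H.

Definition rframes (a c : R) X w : H := frames G1 G2 (W ^~ w) a c (X w).

Lemma path_ae : {ae P, forall w, cpath (W ^~ w)}.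
Proof. by have [_ h _ _ _] := hW. Qed.

Lemma W_measurable t : 0 <= t -> measurable_fun setT (W t).
Proof.
move=> t0 _ B mB; rewrite setTI; have [_ _ h _ _] := hW; have [_ hm _ _ _] := hF.
by apply: (hm t t0); exact: h.
Qed.

(** The frame is a jointly continuous function of [W c], [W a] and [X]; rational
    approximations of the first two decompose the preimage of an open set into
    countably many adapted events. *)
Lemma rframes_adapted a c s X : 0 <= a -> a <= s -> 0 <= c -> c <= s ->
  adapted_at F s X -> adapted_at F s (rframes a c X).
Proof.
move=> a0 as_ c0 cs aX V oV; have s0 := le_trans a0 as_.
have [hS _ hm _ _] := hF; have sS := hS s s0; have [_ _ hWm _ _] := hW.
have [q hq] := @rational_close R.
have [C C0 hC] := frames_bound oO1 bO1 oO2 bO2 hb1 hb2 hG1 hG2.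
pose g (e : R) (p : H) : H := (G1 e p.1, G2 e p.2).
have hg e e' p p' : nH (g e p - g e' p') <= nH (p - p') + C * `|e - e'| * nH p'.
  by have := hC id 0 e e' p p'; rewrite /frames /frame !subr0.
pose N i j m : set H := [set p | exists2 e, 0 < e & forall p', nH (p - p') < e ->
  forall e1 e2, `|e1 - q i| < m.+1%:R^-1 -> `|e2 - q j| < m.+1%:R^-1 -> V (g (e1 - e2) p')].
have oN i j m : open (N i j m).
  apply/nH_openP => p [e e0 he]; exists (e / 2); first by rewrite divr_gt0.
  move=> p' pp; exists (e / 2); first by rewrite divr_gt0.
  move=> p'' pp' e1 e2 h1 h2; apply: he => //.
  by apply: (le_lt_trans (nH_tri oO1 bO1 oO2 bO2 _ p' _)); rewrite (splitr e); exact: ltrD.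
rewrite (_ : _ @^-1` _ = \bigcup_i \bigcup_j \bigcup_m
   (W c @^-1` [set x | `|x - q i| < m.+1%:R^-1] `&`
    (W a @^-1` [set x | `|x - q j| < m.+1%:R^-1] `&` (X @^-1` N i j m)))).
  apply: (sigma_bigcup sS) => i; apply: (sigma_bigcup sS) => j; apply: (sigma_bigcup sS) => m.
  have mI k : measurable ([set x | `|x - q k| < m.+1%:R^-1] : set (measurableTypeR R)).
    rewrite (_ : [set x | _] = ball (q k) m.+1%:R^-1); first exact: measurable_ball.
    by apply/seteqP; split=> x; rewrite -ball_normE /ball_/= distrC.
  apply: (sigmaI sS); first by apply: (hm c s c0 cs); exact: (hWm c _ c0 (mI i)).
  by apply: (sigmaI sS); [apply: (hm a s a0 as_); exact: (hWm a _ a0 (mI j))|apply: aX; exact: oN].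
apply/seteqP; split=> w; last first.
  move=> [i _ [j _ [m _ [/= h1 [h2 [e e0 he]]]]]].
  by apply: (he (X w)) => //; rewrite subrr nH0.
move=> Vw; have [e e0 he] := (nH_openP V).1 oV _ Vw.
pose D := 2 * (1 + C * (nH (X w) + 1) * 4).
have D0 : 0 < D by rewrite mulr_gt0// ltr_pwDl// !mulr_ge0// addr_ge0// nH_ge0.
have eD : 0 < Num.min 1 (e / D) by rewrite lt_min ltr01 divr_gt0.
have [m _ hm'] := near_infty_natSinv_lt (PosNum eD).
have {hm'} := hm' m (leqnn m); rewrite /= lt_min => /andP[m1 m2].
have m0 : 0 < m.+1%:R^-1 :> R by rewrite invr_gt0.
have close r : exists i, `|r - q i| < m.+1%:R^-1.
  have [|i hi] := hq (r - m.+1%:R^-1) (r + m.+1%:R^-1); first by rewrite ltrD2l gtrN.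
  by exists i; rewrite distrC ltr_distl.
have [i hi] := close (W c w); have [j hj] := close (W a w).
exists i => //; exists j => //; exists m => //; split=> //; split=> //=.
exists m.+1%:R^-1 => // p' pp e1 e2 h1 h2; apply: he.
rewrite /rframes /frames /frame -/(g (W c w - W a w) (X w)).
apply: (le_lt_trans (hg _ _ _ _)).
have np : nH p' <= nH (X w) + 1.
  rewrite -[p'](subrK (X w)) addrC; apply: (le_trans (nH_D oO1 bO1 oO2 bO2 _ _)).
  by rewrite lerD2l nH_B; apply: ltW; exact: lt_trans pp m1.
have de : `|W c w - W a w - (e1 - e2)| <= 4 * m.+1%:R^-1.
  move: hi hj h1 h2; rewrite !ltr_norml; move: (m.+1%:R^-1) => y.
  by move=> /andP[? ?] /andP[? ?] /andP[? ?] /andP[? ?]; rewrite ler_norml; apply/andP; split; lra.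
apply: (@le_lt_trans _ _ (D / 2 * m.+1%:R^-1)).
  have -> : D / 2 * m.+1%:R^-1 = m.+1%:R^-1 + C * (4 * m.+1%:R^-1) * (nH (X w) + 1).
    by rewrite /D; move: (m.+1%:R^-1) => y; field.
  apply: lerD; first exact: ltW.
  by apply: ler_pM => //; [rewrite mulr_ge0|exact: nH_ge0|rewrite ler_wpM2l].
by move: m2; rewrite ltr_pdivlMr// => m2; move: m2; move: (m.+1%:R^-1) m0 => y y0; nra.
Qed.

Lemma nH_rframes a c X : (fun w => nH (rframes a c X w)) = (fun w => nH (X w)).
Proof. by apply/funext => w; rewrite /rframes (frames_nH hG1 hG2). Qed.

Lemma L2E s X : 0 <= s -> adapted_at F s X -> sq (fun w => nH (X w)) -> L s X.
Proof.
move=> s0 aX sX; split=> //; last exact: aeW.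
by apply: msq_sqnorm; split=> //; exact: (adapted_borel hF s0 aX).
Qed.

Lemma L2_mono (K : set H) s s' : 0 <= s -> s <= s' -> L2Omega P F K s `<=` L2Omega P F K s'.
Proof. by move=> s0 ss X [aX eX kX]; split=> //; exact: (adapted_mono hF s0 ss aX). Qed.

Lemma L2_sub (K : set H) s : L2Omega P F K s `<=` L s.
Proof. by move=> X [aX eX _]; split=> //; exact: aeW. Qed.

Lemma rframes_L2 a c s X : 0 <= a -> a <= s -> 0 <= c -> c <= s -> L s X -> L s (rframes a c X).
Proof.
move=> a0 as_ c0 cs LX; have [aX _ _] := LX; have s0 := le_trans a0 as_.
apply: L2E => //; first exact: rframes_adapted.
by rewrite nH_rframes; have [] := L2_msq oO1 bO1 oO2 bO2 hF s0 LX.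
Qed.

Lemma rd_rframes a c X Y : rd (rframes a c X) (rframes a c Y) = rd X Y.
Proof. by congr nrm2; apply/funext => w; rewrite /rframes -(framesB hG1 hG2) (frames_nH hG1 hG2). Qed.

Lemma rframesK a c e X : rframes c e (rframes a c X) = rframes a e X.
Proof. by apply/funext => w; exact: (framesK hG1 hG2). Qed.

Lemma rframes_id a X : rframes a a X = X.
Proof. by apply/funext => w; exact: (frames_id hG1 hG2). Qed.

(** The hypothesis says that a frame maps the [K]-valued elements onto themselves;
    being invertible, so does its inverse. *)
Lemma hatK_rframes (K : set H) (t s : R) X : hatK P F W G1 G2 K t s = L2Omega P F K s ->
  L2Omega P F K s X -> L2Omega P F K s (rframes s t X) /\ L2Omega P F K s (rframes t s X).
Proof.
move=> hK KX; split; first by rewrite -hK; exists X.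
have [Y KY <-] : hatK P F W G1 G2 K t s X by rewrite hK.
by rewrite -[X in rframes t s X]/(rframes s t Y) rframesK rframes_id.
Qed.

End random_flow.

Lemma min_cvg {R : realType} (c : R) (v : nat -> R) l : v @ \oo --> l ->
  Num.min c (v k) @[k --> \oo] --> Num.min c l.
Proof.
move=> h; under eq_fun do rewrite minr_absE; rewrite minr_absE.
apply: cvgM; last exact: cvg_cst.
apply: cvgB; first by apply: cvgD; [exact: cvg_cst|exact: h].
by apply: cvg_norm; apply: cvgB; [exact: cvg_cst|exact: h].
Qed.

Lemma within_cvg {R : realType} {V : topologicalType} (g : R -> V) (a : R) (s : nat -> R) s0 :
  (forall k, a <= s k) -> a <= s0 -> s k @[k --> \oo] --> s0 ->
  {within `[a, +oo[, continuous g} -> g (s k) @[k --> \oo] --> g s0.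
Proof.
move=> as_ as0 cs /subspace_continuousP cg.
have A0 : `[a, +oo[%classic s0 by rewrite /= in_itv/= as0.
apply: (cvg_comp s g _ (cg s0 A0)) => B hB.
have h : \forall k \near \oo, `[a, +oo[%classic (s k) -> B (s k) by exact: (cs _ hB).
by apply: filterS h => k; apply; rewrite /= in_itv/= as_.
Qed.

Section flow_properties.
Context {R : realType} {n : nat}.
Variables (O1 O2 : set 'rV[R]_n.+1).
Hypotheses (oO1 : open O1) (bO1 : bounded_set O1) (oO2 : open O2) (bO2 : bounded_set O2).
Variables (b1 b2 : 'rV[R]_n.+1 -> 'rV[R]_n.+1).
Variables (G1 : R -> Hm1 O1 -> Hm1 O1) (G2 : R -> Hm1 O2 -> Hm1 O2).
Hypotheses (hb1 : admissible_field O1 b1) (hb2 : admissible_field O2 b2).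
Hypotheses (hG1 : is_transport_group b1 G1) (hG2 : is_transport_group b2 G2).
Variables (beta1 beta2 : R -> R).
Hypotheses (hbeta1 : admissible_beta beta1) (hbeta2 : admissible_beta beta2).
Variables (U : metricType R) (f1 : Hm1 O1 -> Hm1 O2 -> U -> Hm1 O1)
  (f2 : Hm1 O1 -> Hm1 O2 -> U -> Hm1 O2).
Hypotheses (hf1 : admissible_f f1) (hf2 : admissible_f f2).
Context {dO : measure_display} {Omega : measurableType dO}.
Variables (P : probability Omega R) (F : R -> set (set Omega)) (W : R -> Omega -> R).
Hypotheses (hF : usual_filtration P F) (hW : brownian P F W).
Local Notation H := (Hm1 O1 * Hm1 O2)%type.
Local Notation nrm := (nrm2 P setT).
Local Notation sq := (sqint P setT).
Local Notation L := (L2Omega P F [set: H]).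
Local Notation rd := (@rd R n O1 O2 dO Omega P).
Local Notation prog := (@progressive R dO Omega F U).
Local Notation rfr := (rframes G1 G2 W).
Variables z zhat : R -> (Omega -> H) -> (R -> Omega -> U) -> R -> Omega -> H.
Hypothesis hz : forall t xi u, 0 <= t -> L t xi -> prog u ->
  solves_system P F W G1 G2 beta1 beta2 f1 f2 t xi u (z t xi u).
Hypothesis hzhat : forall t xi u, 0 <= t -> L t xi -> prog u ->
  solves_scheme P F W G1 G2 beta1 beta2 f1 f2 t xi u (zhat t xi u).
Implicit Types X Y xi : Omega -> H.

Let pws := pair_solution G1 G2 beta1 beta2.
Let sdrift (w : Omega) t (u : R -> Omega -> U) (y : R -> Omega -> H) :=
  system_drift G1 G2 f1 f2 (W ^~ w) t (u ^~ w) (y ^~ w).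

Let sysT T := system_apriori oO1 bO1 oO2 bO2 hb1 hb2 hG1 hG2 hbeta1 hbeta2 hf1 hf2 T.
Let lipT T := system_lipschitz oO1 bO1 oO2 bO2 hb1 hb2 hG1 hG2 hbeta1 hbeta2 hf1 hf2 T.
Let ctlT T := system_control oO1 bO1 oO2 bO2 hb1 hb2 hG1 hG2 hbeta1 hbeta2 hf1 hf2 T.
Let schE := scheme_error oO1 bO1 oO2 bO2 hb1 hb2 hG1 hG2 hbeta1 hbeta2 hf1 hf2.
Let Lmsq K s X := @L2_msq R n O1 O2 oO1 bO1 oO2 bO2 dO Omega P F hF K s X.
Let rdtri X Y Z := @rd_tri R n O1 O2 oO1 bO1 oO2 bO2 dO Omega P X Y Z.
Let rdle X Y f := @rd_le R n O1 O2 oO1 bO1 oO2 bO2 dO Omega P X Y f.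
Let Bdist X Y := @borel_dist R n O1 O2 oO1 bO1 oO2 bO2 dO Omega X Y.
Let BnH X := @borel_nH R n O1 O2 oO1 bO1 oO2 bO2 dO Omega X.

Lemma system_ae t xi u : 0 <= t -> L t xi -> prog u ->
  {ae P, forall w, cpath (W ^~ w) /\ pws (W ^~ w) t (xi w) (sdrift w t u (z t xi u)) (z t xi u ^~ w)}.
Proof.
move=> t0 Lx pu; have [_ h] := hz t0 Lx pu.
by apply: filterS2 (path_ae hW) h => w h1 h2; split.
Qed.

Lemma scheme_ae t xi u : 0 <= t -> L t xi -> prog u ->
  {ae P, forall w, pws (W ^~ w) t (xi w) (fun r => drift f1 f2 (xi w) (u r w)) (zhat t xi u ^~ w)}.
Proof.
move=> t0 Lx pu; have [_ h] := hzhat t0 Lx pu.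
by apply: filterS h => w h2.
Qed.

Lemma sq_affine c X : msq P X -> sq (fun w => c * (1 + nH (X w))).
Proof. by move=> [_ sX]; apply: sqZ; apply: sqD => //; exact: sq_cst. Qed.

Lemma z_L2 t xi u s : 0 <= t -> L t xi -> prog u -> t <= s -> L s (z t xi u s).
Proof.
move=> t0 Lx pu ts; have [az _] := hz t0 Lx pu; have s0 := le_trans t0 ts.
have [C C0 hC] := sysT s; have aZ := az s ts.
apply: (L2E hF s0 aZ).
apply: (sq_le_ae (BnH (adapted_borel hF s0 aZ)) (sq_affine C (Lmsq t0 Lx))).
apply: filterS (system_ae t0 Lx pu) => w [cW sw].
rewrite nH_norm ger0_norm ?mulr_ge0 ?addr_ge0 ?nH_ge0//.
exact: (hC _ _ _ _ _ _ cW t0 ts (lexx s) sw).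
Qed.

(** The scheme inherits the second moments of the system through the crude form of
    [scheme_error]. *)
Lemma zhat_L2 t xi u s : 0 <= t -> L t xi -> prog u -> t <= s -> L s (zhat t xi u s).
Proof.
move=> t0 Lx pu ts; have [az _] := hzhat t0 Lx pu; have s0 := le_trans t0 ts.
have [C C0 hC] := sysT s; have aZ := az s ts; have [A [M [D [A0 M0 D0 hD]]]] := schE.
apply: (L2E hF s0 aZ); have mx := Lmsq t0 Lx.
(* The displacement of the solution costs [A (C + 1)], that of the frame [2 (M + A)]. *)
pose m : R := A * (C + 1) + 2 * (M + A).
have m0 : 0 <= m by rewrite !(addr_ge0, mulr_ge0).
apply: (sq_le_ae (BnH (adapted_borel hF s0 aZ)) (sq_affine (C + 4 * m * (s - t)) mx)).
apply: filterS2 (system_ae t0 Lx pu) (scheme_ae t0 Lx pu) => w [cW sw] swh.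
have n0 := nH_ge0 (xi w); have n1 : 0 <= 1 + nH (xi w) by rewrite addr_ge0.
rewrite nH_norm ger0_norm; last by rewrite mulr_ge0// addr_ge0// mulr_ge0 ?subr_ge0// mulr_ge0.
have h1 : nH (z t xi u s w) <= C * (1 + nH (xi w)) := hC _ _ _ _ _ _ cW t0 ts (lexx s) sw.
have h2 : nH (z t xi u s w - zhat t xi u s w) <= 4 * (m * (1 + nH (xi w))) * (s - t).
  apply: (hD _ _ _ _ _ _ _ _ cW t0 ts (mulr_ge0 m0 n1) sw swh) => r.
  rewrite in_itv/= => /andP[tr rs].
  have h : nH (z t xi u r w) <= C * (1 + nH (xi w)) := hC _ _ _ _ _ _ cW t0 tr (ltW rs) sw.
  rewrite /m mulrDl; apply: lerD.
    rewrite -mulrA ler_wpM2l//; apply: (le_trans (nH_D oO1 bO1 oO2 bO2 _ _)).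
    by rewrite nH_N (frames_nH hG1 hG2) mulrDl mul1r; apply: lerD => //; rewrite lerDr.
  rewrite -mulrA; apply: ler_pM => //.
  - by rewrite le_min ler0n mulr_ge0.
  - by rewrite addr_ge0// mulr_ge0.
  - by rewrite ge_min lexx.
  - have := mulr_ge0 M0 n0; move: (nH (xi w)) => x; lra.
rewrite -[zhat t xi u s w](subrK (z t xi u s w)) addrC.
apply: (le_trans (nH_D oO1 bO1 oO2 bO2 _ _)); rewrite (nH_B (zhat _ _ _ _ _)).
by apply: (le_trans (lerD h1 h2)); rewrite [leRHS]mulrDl [X in _ <= _ + X]mulrAC -(mulrA 4 m).
Qed.

(** The flow in the moving frame: it is autonomous in the sense that restarting
    needs no change of frame. *)
Definition flow t xi u s : Omega -> H := rfr t s (z t xi u s).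

Lemma flow_L2 t xi u s : 0 <= t -> t <= s -> L t xi -> prog u -> L s (flow t xi u s).
Proof.
move=> t0 ts Lx pu.
exact: (rframes_L2 oO1 bO1 oO2 bO2 hb1 hb2 hG1 hG2 hF hW t0 ts (le_trans t0 ts) (lexx s) (z_L2 t0 Lx pu ts)).
Qed.

Lemma flow0 t xi u : 0 <= t -> L t xi -> prog u -> rd (flow t xi u t) xi = 0.
Proof.
move=> t0 Lx pu; rewrite /flow (rframes_id hG1 hG2).
apply: (rd_eq0 oO1 bO1 oO2 bO2 (Lmsq t0 (z_L2 t0 Lx pu (lexx t))) (Lmsq t0 Lx)).
apply: filterS (system_ae t0 Lx pu) => w [_ [[h1 _ _ _] [h2 _ _ _]]].
by move: h1 h2; case: (z _ _ _ _ _) (xi w) => x y [x' y'] /= -> ->.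
Qed.

(** The same constant serves all controls; two controls that agree before [s] are
    not distinguished. *)
Lemma flow_lipschitz T : exists2 C : R, 0 <= C & forall t x y u v s, 0 <= t -> t <= s -> s <= T ->
  L t x -> L t y -> prog u -> prog v -> (forall r, t <= r -> r < s -> u r = v r) ->
  rd (flow t x u s) (flow t y v s) <= C * rd x y.
Proof.
have [C C0 hC] := lipT T; exists C => // t x y u v s t0 ts sT Lx Ly pu pv uv.
have mx := Lmsq t0 Lx; have my := Lmsq t0 Ly; have s0 := le_trans t0 ts.
have mxy := msq_dist oO1 bO1 oO2 bO2 mx my.
rewrite (_ : C * rd x y = nrm (fun w => C * nH (x w - y w))); last by rewrite (nrmZ C mxy) ger0_norm.
rewrite /flow (rd_rframes hG1 hG2).
apply: (rdle (Lmsq s0 (z_L2 t0 Lx pu ts)) (Lmsq s0 (z_L2 t0 Ly pv ts)) (sqZ C mxy)).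
apply: filterS2 (system_ae t0 Lx pu) (system_ae t0 Ly pv) => w [cW s1] [_ s2].
rewrite ger0_norm ?mulr_ge0 ?nH_ge0//.
apply: (hC _ _ _ _ _ _ _ _ _ cW t0 ts sT s1 s2) => r; rewrite in_itv/= => /andP[tr rs].
by rewrite uv.
Qed.

(** Uniqueness for the restarted system. *)
Lemma flow_flow t x u s s' : 0 <= t -> t <= s -> s <= s' -> L t x -> prog u ->
  rd (flow t x u s') (flow s (flow t x u s) u s') = 0.
Proof.
move=> t0 ts ss Lx pu; have s0 := le_trans t0 ts; have ts' := le_trans ts ss; have s0' := le_trans s0 ss.
have Ls := flow_L2 t0 ts Lx pu; have [C C0 hC] := lipT s'.
apply: (rd_eq0 oO1 bO1 oO2 bO2 (Lmsq s0' (flow_L2 t0 ts' Lx pu)) (Lmsq s0' (flow_L2 s0 ss Ls pu))).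
apply: filterS2 (system_ae t0 Lx pu) (system_ae s0 Ls pu) => w [cW s1] [_ s2].
have s3 := system_restart oO1 bO1 oO2 bO2 hb1 hb2 hG1 hG2 cW t0 ts s1.
have := hC _ _ _ _ _ _ _ _ _ cW s0 ss (lexx s') s3 s2 (fun r _ => erefl).
rewrite subrr nH0 mulr0 => h.
have /nH_0/subr0_eq e : nH (frames G1 G2 (W^~ w) t s (z t x u s' w) - z s (flow t x u s) u s' w) = 0.
  by apply/eqP; rewrite eq_le nH_ge0 andbT.
have -> : flow s (flow t x u s) u s' w = frames G1 G2 (W ^~ w) s s' (z s (flow t x u s) u s' w) by [].
by rewrite -e (framesK hG1 hG2).
Qed.

Lemma flow_path t x u (s : nat -> R) s0 w : 0 <= t -> (forall k, t <= s k) -> t <= s0 ->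
  s k @[k --> \oo] --> s0 -> cpath (W ^~ w) ->
  pws (W ^~ w) t (x w) (sdrift w t u (z t x u)) (z t x u ^~ w) ->
  nH (flow t x u (s k) w - flow t x u s0 w) @[k --> \oo] --> 0.
Proof.
move=> t0 ts ts0 cs cW sw; have [D D0 hD] := frames_bound oO1 bO1 oO2 bO2 hb1 hb2 hG1 hG2.
have [[_ c1 _ _] [_ c2 _ _]] := sw.
have e1 := within_cvg ts ts0 cs c1; have e2 := within_cvg ts ts0 cs c2.
have e3 := within_cvg (fun k => le_trans t0 (ts k)) (le_trans t0 ts0) cs cW.
pose gk k := (`|(z t x u (s k) w).1 - (z t x u s0 w).1| + `|(z t x u (s k) w).2 - (z t x u s0 w).2|)
   + D * `|W (s k) w - W s0 w| * nH (z t x u s0 w).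
have cgk : gk k @[k --> \oo] --> 0.
  have zero (V : normedModType R) (g : nat -> V) l : g k @[k --> \oo] --> l -> `|g k - l| @[k --> \oo] --> 0.
    by move=> h; apply/norm_cvg0P/subr_cvg0.
  rewrite (_ : 0 = (0 + 0) + D * 0 * nH (z t x u s0 w)); last by rewrite mulr0 mul0r !addr0.
  apply: cvgD; first by apply: cvgD; apply: zero.
  by apply: cvgM; [apply: cvgM; [exact: cvg_cst|exact: zero]|exact: cvg_cst].
apply: (squeeze_cvgr _ (cvg_cst 0) cgk); apply: nearW => k; rewrite nH_ge0/=.
apply: (le_trans (hD _ _ _ _ _ _)); rewrite lerD2r; exact: nH_le.
Qed.

Lemma flow_continuous t x u (s : nat -> R) s0 T : 0 <= t -> (forall k, t <= s k) ->
  (forall k, s k <= T) -> t <= s0 -> s0 <= T -> s k @[k --> \oo] --> s0 -> L t x -> prog u ->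
  rd (flow t x u (s k)) (flow t x u s0) @[k --> \oo] --> 0.
Proof.
move=> t0 ts sT ts0 s0T cs Lx pu; have [C C0 hC] := sysT T.
have mx := Lmsq t0 Lx.
have mk k := Lmsq (le_trans t0 (ts k)) (flow_L2 t0 (ts k) Lx pu).
have m0 := Lmsq (le_trans t0 ts0) (flow_L2 t0 ts0 Lx pu).
apply: (nrm_dominated (f := fun k w => nH (flow t x u (s k) w - flow t x u s0 w))
   (g := fun w => (2 * C) * (1 + nH (x w)))).
- by move=> k; have [] := msq_dist oO1 bO1 oO2 bO2 (mk k) m0.
- exact: sq_affine.
- apply: filterS (system_ae t0 Lx pu) => w [cW sw] k; rewrite nH_norm.
  have h1 : nH (z t x u (s k) w) <= C * (1 + nH (x w)) := hC _ _ _ _ _ _ cW t0 (ts k) (sT k) sw.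
  have h2 : nH (z t x u s0 w) <= C * (1 + nH (x w)) := hC _ _ _ _ _ _ cW t0 ts0 s0T sw.
  rewrite ger0_norm; last by rewrite !mulr_ge0// addr_ge0// nH_ge0.
  apply: (le_trans (nH_D oO1 bO1 oO2 bO2 _ _)); rewrite nH_N /flow /rframes !(frames_nH hG1 hG2).
  by apply: (le_trans (lerD h1 h2)); rewrite -mulrA mulr_natl mulr2n.
- apply: filterS (system_ae t0 Lx pu) => w [cW sw].
  exact: (flow_path t0 ts ts0 cs cW sw).
Qed.

(** What the local error of the scheme costs, uniformly in the control: the bound
    for a reference control is dominated and tends to [0] along each path, and
    another control changes it by [O(h)]. *)
Lemma local_modulus (A M D : R) t xi T dl : 0 <= A -> 0 <= M -> 0 <= D ->
  0 <= t -> t < T -> L t xi -> 0 < dl ->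
  exists2 h, 0 < h /\ t + h <= T & exists2 m, [/\ sq m, forall w, 0 <= m w & nrm m <= dl] &
    forall u, prog u -> {ae P, forall w, forall r, t <= r -> r <= t + h ->
      A * nH (flow t xi u r w - xi w) + Num.min 2 (D * `|W r w - W t w|) * (M + A * nH (xi w)) <= m w}.
Proof.
move=> A0 M0 D0 t0 tT Lx dl0; have Tt : 0 < T - t by rewrite subr_gt0.
have [[u0 pu0]|no] := pselect (exists u, prog u); last first.
  exists (T - t); first by rewrite [t + _]addrC subrK lexx.
  exists (cst 0); first by split=> //; [exact: sq_cst|rewrite nrm_cst normr0 ltW].
  by move=> u pu; case: no; exists u.
have mx := Lmsq t0 Lx.
have [C C0 hC] := sysT T; have [E E0 hE] := ctlT T; have [q hq] := @rational_close R.
pose g r w := A * nH (flow t xi u0 r w - xi w) + Num.min 2 (D * `|W r w - W t w|) * (M + A * nH (xi w)).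
pose c := A * (C + 1) + 2 * (M + A).
have c0 : 0 <= c by rewrite !(addr_ge0, mulr_ge0).
pose B w := c * (1 + nH (xi w)).
have gB w r : cpath (W ^~ w) -> pws (W ^~ w) t (xi w) (sdrift w t u0 (z t xi u0)) (z t xi u0 ^~ w) ->
    t <= r -> r <= T -> g r w <= B w.
  move=> cW sw tr rT; have n0 := nH_ge0 (xi w).
  have h : nH (z t xi u0 r w) <= C * (1 + nH (xi w)) := hC _ _ _ _ _ _ cW t0 tr rT sw.
  rewrite /B /c mulrDl; apply: lerD.
    rewrite -mulrA ler_wpM2l//; apply: (le_trans (nH_D oO1 bO1 oO2 bO2 _ _)).
    by rewrite nH_N /flow /rframes (frames_nH hG1 hG2) mulrDl mul1r; apply: lerD => //; rewrite lerDr.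
  rewrite -mulrA; apply: ler_pM => //.
  - by rewrite le_min ler0n mulr_ge0.
  - by rewrite addr_ge0// mulr_ge0.
  - by rewrite ge_min lexx.
  - have := mulr_ge0 M0 n0; move: (nH (xi w)) => x; lra.
have gcvg w (s : nat -> R) s0 : cpath (W ^~ w) ->
    pws (W ^~ w) t (xi w) (sdrift w t u0 (z t xi u0)) (z t xi u0 ^~ w) ->
    (forall k, t <= s k) -> t <= s0 -> s k @[k --> \oo] --> s0 -> g (s k) w @[k --> \oo] --> g s0 w.
  move=> cW sw ts ts0 cs; have h1 := flow_path t0 ts ts0 cs cW sw.
  have h2 := within_cvg (fun k => le_trans t0 (ts k)) (le_trans t0 ts0) cs cW.
  have c1 : nH (flow t xi u0 (s k) w - xi w) @[k --> \oo] --> nH (flow t xi u0 s0 w - xi w).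
    apply/cvgrPdist_le => e e0; move/cvgr0Pnorm_le : h1 => /(_ e e0); apply: filterS => k.
    rewrite nH_norm nH_B => h; apply: le_trans h.
    by rewrite (nH_B (flow _ _ _ s0 w) (xi w)) (nH_B (flow _ _ _ (s k) w) (xi w)); exact: (nH_dist oO1 bO1 oO2 bO2).
  have c2 : Num.min 2 (D * `|W (s k) w - W t w|) @[k --> \oo] --> Num.min 2 (D * `|W s0 w - W t w|).
    apply: min_cvg.
    by apply: cvgM; [exact: cvg_cst|apply: cvg_norm; apply: cvgB => //; exact: cvg_cst].
  apply: (cvgD (cvgM (cvg_cst A) c1) (cvgM c2 (cvg_cst (M + A * nH (xi w))))).
have mg r : t <= r -> measurable_fun setT (g r).
  move=> tr; have r0 := le_trans t0 tr.
  have [bf _] := Lmsq r0 (flow_L2 t0 tr Lx pu0); have [bx _] := mx.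
  apply: measurable_funD; apply: measurable_funM.
  - exact: measurable_cst.
  - exact: Bdist.
  - apply: measurable_minr; first exact: measurable_cst.
    apply: measurable_funM; first exact: measurable_cst.
    apply: measurableT_comp; first exact: normr_measurable.
    by apply: measurable_funB; exact: (W_measurable hF hW).
  - apply: measurable_funD; first exact: measurable_cst.
    by apply: measurable_funM; [exact: measurable_cst|exact: BnH].
pose h k := (T - t) / k.+1%:R.
have h0 k : 0 < h k by rewrite divr_gt0.
have hT k : h k <= T - t by rewrite ler_pdivrMr// ler_peMr ?(ltW Tt)// ler1n.
have hm k l : (k <= l)%N -> h l <= h k.
  by move=> kl; rewrite /h ler_pM2l// lef_pV2 ?posrE// ler_nat ltnS.
have ch : h k @[k --> \oo] --> 0.
  by rewrite -[X in _ --> X](mulr0 (T - t)); apply: cvgM; [exact: cvg_cst|exact: cvg_harmonic].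
pose e := dl / 4; have e0 : 0 < e by rewrite divr_gt0.
(* On this event [g] stays below [e] until the time [t + h k], by continuity. *)
pose S k := [set w | forall j, t <= q j -> q j < t + h k -> g (q j) w <= e].
have mS k : measurable (S k).
  rewrite (_ : S k = \bigcap_j (if (t <= q j) && (q j < t + h k) then [set w | g (q j) w <= e] else setT)).
    apply: bigcapT_measurable => j; case: ifPn => // /andP[tq _].
    rewrite (_ : [set w | _] = setT `&` g (q j) @^-1` `]-oo, e]); first exact: mg.
    by rewrite setTI; apply/seteqP; split=> w /=; rewrite in_itv.
  apply/seteqP; split=> w /= hw.
    by move=> j _; case: ifPn => // /andP[] ? ?; exact: hw.
  by move=> j h1 h2; have := hw j Logic.I; rewrite h1 h2.
pose f k w := B w * \1_(~` S k) w.
have sB : sq B by exact: sq_affine.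
have f0 : nrm (f k) @[k --> \oo] --> 0.
  apply: (nrm_dominated (g := B)) => //.
  - move=> k; apply: measurable_funM; first by case: sB.
    by apply: measurable_indic; exact: measurableC.
  - apply: aeW => w k; rewrite /f normrM ler_piMr// indicE; case: (_ \in _); by rewrite ?normr1 ?normr0.
  - apply: filterS (system_ae t0 Lx pu0) => w [cW sw].
    have [N hN] : exists N, forall k, (N <= k)%N -> S k w.
      apply: contrapT => no.
      have /choice[j hj] : forall N, exists j, [/\ t <= q j, q j < t + h N & e < g (q j) w].
        move=> N; apply: contrapT => noj; apply: no; exists N => k Nk j tq qk.
        rewrite leNgt; apply/negP => eg; apply: noj; exists j; split=> //.
        by apply: (lt_le_trans qk); rewrite lerD2l hm.
      have c1 : q (j k) @[k --> \oo] --> t.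
        have c2 : t + h k @[k --> \oo] --> t.
          by rewrite -[X in _ --> X]addr0; apply: cvgD => //; exact: cvg_cst.
        apply: (squeeze_cvgr _ (cvg_cst t) c2); apply: nearW => k.
        by have [-> /ltW -> _] := hj k.
      have c2 := gcvg w _ t cW sw (fun k => let: And3 a _ _ := hj k in a) (lexx t) c1.
      have gt0 : g t w = 0.
        have [[z1 _ _ _] [z2 _ _ _]] := sw.
        have -> : g t w = A * nH (z t xi u0 t w - xi w) + Num.min 2 (D * `|W t w - W t w|) * (M + A * nH (xi w)).
          by rewrite /g /flow (rframes_id hG1 hG2).
        have -> : z t xi u0 t w = xi w by move: z1 z2; case: (z _ _ _ _ _) (xi w) => x y [x' y'] /= -> ->.
        by rewrite !subrr nH0 normr0 !mulr0 (min_r (ler0n _ _)) mul0r addr0.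
      have : e <= g t w by apply: (ler_cvg_to (cvg_cst e) c2); apply: nearW => k; have [_ _ /ltW] := hj k.
      by rewrite gt0 leNgt e0.
    apply: (@cvg_trans _ (cst (0 : R) @ \oo)); last exact: cvg_cst.
    apply: near_eq_cvg; exists N => // k /= Nk.
    by rewrite /f indicE memNset ?mulr0// => nS; apply: nS; exact: hN.
have AE0 : 0 <= A * E by exact: mulr_ge0.
pose Z w := (A * E) * (1 + nH (xi w)); have sZ : sq Z by exact: sq_affine.
have [k [fk hk]] : exists k, nrm (f k) <= e /\ h k * nrm Z <= e.
  have cz : h k * nrm Z @[k --> \oo] --> 0.
    by rewrite -[X in _ --> X](mul0r (nrm Z)); apply: cvgM => //; exact: cvg_cst.
  move/cvgr0Pnorm_le : f0 => /(_ e e0)[N1 _ h1]; move/cvgr0Pnorm_le : cz => /(_ e e0)[N2 _ h2].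
  exists (maxn N1 N2); split; first exact: le_trans (ler_norm _) (h1 _ (leq_maxl _ _)).
  exact: le_trans (ler_norm _) (h2 _ (leq_maxr _ _)).
have f_ge0 w : 0 <= f k w.
  by rewrite mulr_ge0// ?indicE// mulr_ge0// addr_ge0// nH_ge0.
have Z_ge0 w : 0 <= Z w by rewrite mulr_ge0// addr_ge0// nH_ge0.
have sf : sq (f k).
  apply: (sq_le_ae _ sB).
    apply: measurable_funM; first by case: sB.
    by apply: measurable_indic; exact: measurableC.
  apply: aeW => w; rewrite /f normrM ler_piMr// indicE; case: (_ \in _); by rewrite ?normr1 ?normr0.
exists (h k / 2); first split; first by rewrite divr_gt0.
  rewrite -lerBrDl; apply: le_trans (hT k); rewrite ler_pdivrMr// ler_peMr ?(ltW (h0 k))//.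
  by rewrite ler1n.
exists (fun w => (e + f k w) + h k * Z w).
  have s1 : sq (fun w => e + f k w) by apply: sqD => //; exact: sq_cst.
  split; first by apply: sqD => //; exact: sqZ.
    by move=> w; rewrite !addr_ge0// ?(ltW e0)// mulr_ge0// ltW.
  apply: (le_trans (nrmD s1 (sqZ _ sZ))); rewrite (nrmZ _ sZ) (ger0_norm (ltW (h0 k))).
  apply: (@le_trans _ _ ((e + e) + e)); last by rewrite /e; lra.
  apply: lerD => //; apply: (le_trans (nrmD (sq_cst P e) sf)).
  by rewrite nrm_cst (ger0_norm (ltW e0)) lerD2l.
move=> u pu; apply: filterS2 (system_ae t0 Lx pu0) (system_ae t0 Lx pu) => w [cW s0] [_ s1] r tr rh.
have rk : r < t + h k.
  by apply: (le_lt_trans rh); rewrite ltrD2l ltr_pdivrMr// ltr_pMr ?h0// ltr1n.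
have rT : r <= T by apply: (le_trans (ltW rk)); rewrite -lerBrDl.
have grk : g r w <= e + f k w.
  have [Sw|nSw] := pselect (S k w); last first.
    rewrite /f indicE mem_set// mulr1; apply: (le_trans (gB _ _ cW s0 tr rT)).
    by rewrite lerDr ltW.
  apply: (@le_trans _ _ e); last by rewrite lerDl.
  have /choice[j hj] : forall l : nat, exists j, r < q j < Num.min (r + l.+1%:R^-1) (t + h k).
    by move=> l; apply: hq; rewrite lt_min rk andbT ltrDl invr_gt0.
  have c1 : q (j l) @[l --> \oo] --> r.
    have c2 : r + l.+1%:R^-1 @[l --> \oo] --> r.
      by rewrite -[X in _ --> X]addr0; apply: cvgD; [exact: cvg_cst|exact: cvg_harmonic].
    apply: (squeeze_cvgr _ (cvg_cst r) c2); apply: nearW => l.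
    by have := hj l; rewrite lt_min => /and3P[/ltW -> /ltW -> _].
  have tq l : t <= q (j l) by have /andP[/ltW h1 _] := hj l; exact: le_trans h1.
  have c2 := gcvg w _ r cW s0 tq tr c1.
  apply: (ler_cvg_to c2 (cvg_cst e)); apply: nearW => l; apply: Sw => //.
  by have := hj l; rewrite lt_min => /and3P[].
have hd : nH (flow t xi u r w - flow t xi u0 r w) <= E * (1 + nH (xi w)) * h k.
  rewrite /flow /rframes -(framesB hG1 hG2) (frames_nH hG1 hG2).
  apply: (le_trans (hE _ _ _ _ _ _ _ _ cW t0 tr rT s1 s0)).
  rewrite ler_wpM2l ?mulr_ge0 ?addr_ge0 ?nH_ge0//.
  by rewrite lerBlDl ltW.
have -> : h k * Z w = A * (E * (1 + nH (xi w)) * h k) by rewrite /Z mulrC !mulrA.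
apply: (@le_trans _ _ (g r w + A * (E * (1 + nH (xi w)) * h k))); last by rewrite lerD2r.
rewrite /g addrAC lerD2r -mulrDr ler_wpM2l//.
by apply: (le_trans (nH_tri oO1 bO1 oO2 bO2 _ (flow t xi u0 r w) _)); rewrite addrC lerD2l.
Qed.

(** The scheme follows the system up to [o(h)], uniformly in the control, and no
    control moves the flow far in a short time. *)
Lemma scheme_local t xi T e : 0 <= t -> t < T -> L t xi -> 0 < e ->
  exists2 h0, 0 < h0 /\ t + h0 <= T & forall u, prog u ->
    (forall h, 0 < h -> h <= h0 -> rd (z t xi u (t + h)) (zhat t xi u (t + h)) <= e * h) /\
    (forall s, t <= s -> s <= t + h0 -> rd (flow t xi u s) xi <= e).
Proof.
move=> t0 tT Lx e0; have [A [M [D [A0 M0 D0 hD]]]] := schE.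
have A1 : 0 <= A + 1 by rewrite addr_ge0.
have [h0 hh [m [sm m0 me] hm]] := local_modulus A1 M0 D0 t0 tT Lx (divr_gt0 e0 (ltr0n R 4)).
exists h0 => // u pu; split=> [h hp hh0|s ts sh].
  have th : t <= t + h by rewrite lerDl ltW.
  have s0 := le_trans t0 th.
  have s4 : sq (fun w => (4 * h) * m w) by exact: sqZ.
  apply: (@le_trans _ _ (nrm (fun w => (4 * h) * m w))).
    apply: (rdle (Lmsq s0 (z_L2 t0 Lx pu th)) (Lmsq s0 (zhat_L2 t0 Lx pu th)) s4).
    have ae3 : {ae P, forall w, (cpath (W ^~ w) /\ pws (W ^~ w) t (xi w) (sdrift w t u (z t xi u)) (z t xi u ^~ w)) /\
        pws (W ^~ w) t (xi w) (fun r => drift f1 f2 (xi w) (u r w)) (zhat t xi u ^~ w)}.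
      apply: filterS2 (system_ae t0 Lx pu) (scheme_ae t0 Lx pu) => w h1 h2; exact: (conj h1 h2).
    apply: filterS2 ae3 (hm u pu) => w [[cW sw] swh] hw.
    apply: le_trans (ler_norm _); rewrite (_ : 4 * h * m w = 4 * m w * (t + h - t)); last first.
      by rewrite addrAC subrr add0r mulrAC.
    apply: (hD _ _ _ _ _ _ _ _ cW t0 th (m0 w) sw swh) => r; rewrite in_itv/= => /andP[tr rh].
    have rh0 : r <= t + h0 by apply: (le_trans (ltW rh)); rewrite lerD2l.
    apply: le_trans (hw r tr rh0); apply: lerD.
      by rewrite ler_wpM2r ?nH_ge0// lerDl.
    rewrite ler_wpM2l//; first by rewrite le_min ler0n mulr_ge0.
    by rewrite lerD2l ler_wpM2r ?nH_ge0// lerDl.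
  rewrite (nrmZ _ sm) ger0_norm ?mulr_ge0 ?(ltW hp)//.
  apply: (@le_trans _ _ (4 * h * (e / 4))); first by rewrite ler_wpM2l// mulr_ge0// ltW.
  by rewrite le_eqVlt; apply/orP; left; apply/eqP; field.
apply: (@le_trans _ _ (nrm m)); last first.
  by apply: (le_trans me); rewrite ler_pdivrMr// ler_peMr ?(ltW e0)// ler1n.
apply: (rdle (Lmsq (le_trans t0 ts) (flow_L2 t0 ts Lx pu)) (Lmsq t0 Lx) sm).
apply: filterS (hm u pu) => w hw; apply: le_trans (ler_norm _).
apply: le_trans (hw s ts sh); apply: ler_wpDr.
  by rewrite mulr_ge0// ?addr_ge0// ?mulr_ge0// ?nH_ge0// le_min ler0n mulr_ge0.
by rewrite ler_peMl ?nH_ge0// lerDr.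
Qed.

End flow_properties.

(** * Near viability and quasi-tangency *)

Section equivalence.
Context {R : realType} {n : nat}.
Variables (O1 O2 : set 'rV[R]_n.+1).
Hypotheses (oO1 : open O1) (bO1 : bounded_set O1) (oO2 : open O2) (bO2 : bounded_set O2).
Variables (b1 b2 : 'rV[R]_n.+1 -> 'rV[R]_n.+1).
Variables (G1 : R -> Hm1 O1 -> Hm1 O1) (G2 : R -> Hm1 O2 -> Hm1 O2).
Hypotheses (hb1 : admissible_field O1 b1) (hb2 : admissible_field O2 b2).
Hypotheses (hG1 : is_transport_group b1 G1) (hG2 : is_transport_group b2 G2).
Variables (beta1 beta2 : R -> R).
Hypotheses (hbeta1 : admissible_beta beta1) (hbeta2 : admissible_beta beta2).
Variables (U : metricType R) (f1 : Hm1 O1 -> Hm1 O2 -> U -> Hm1 O1)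
  (f2 : Hm1 O1 -> Hm1 O2 -> U -> Hm1 O2).
Hypotheses (hf1 : admissible_f f1) (hf2 : admissible_f f2).
Context {dO : measure_display} {Omega : measurableType dO}.
Variables (P : probability Omega R) (F : R -> set (set Omega)) (W : R -> Omega -> R).
Hypotheses (hF : usual_filtration P F) (hW : brownian P F W).
Local Notation H := (Hm1 O1 * Hm1 O2)%type.
Local Notation L := (L2Omega P F [set: H]).
Local Notation rd := (@rd R n O1 O2 dO Omega P).
Local Notation prog := (@progressive R dO Omega F U).
Local Notation rfr := (rframes G1 G2 W).
Variables z zhat : R -> (Omega -> H) -> (R -> Omega -> U) -> R -> Omega -> H.
Hypothesis hz : forall t xi u, 0 <= t -> L t xi -> prog u ->
  solves_system P F W G1 G2 beta1 beta2 f1 f2 t xi u (z t xi u).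
Hypothesis hzhat : forall t xi u, 0 <= t -> L t xi -> prog u ->
  solves_scheme P F W G1 G2 beta1 beta2 f1 f2 t xi u (zhat t xi u).
Variables (T : R) (K : set H).
Hypotheses (cK : closed K) (hK : forall t s : R, 0 <= t -> t <= s -> s <= T ->
  hatK P F W G1 G2 K t s = L2Omega P F K s).
Local Notation KK := (L2Omega P F K).
Local Notation flow := (flow G1 G2 W z).
Implicit Types xi th : Omega -> H.

Let Lmsq K' s X := @L2_msq R n O1 O2 oO1 bO1 oO2 bO2 dO Omega P F hF K' s X.
Let rdtri X Y Z := @rd_tri R n O1 O2 oO1 bO1 oO2 bO2 dO Omega P X Y Z.
Let zL t xi u s := @z_L2 _ _ _ _ oO1 bO1 oO2 bO2 _ _ _ _ hb1 hb2 hG1 hG2 _ _ hbeta1 hbeta2 _ _ _ hf1 hf2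
  _ _ _ _ _ hF hW _ hz t xi u s.
Let zhL t xi u s := @zhat_L2 _ _ _ _ oO1 bO1 oO2 bO2 _ _ _ _ hb1 hb2 hG1 hG2 _ _ hbeta1 hbeta2 _ _ _ hf1 hf2
  _ _ _ _ _ hF hW _ _ hz hzhat t xi u s.
Let local := @scheme_local _ _ _ _ oO1 bO1 oO2 bO2 _ _ _ _ hb1 hb2 hG1 hG2 _ _ hbeta1 hbeta2 _ _ _ hf1 hf2
  _ _ _ _ _ hF hW _ _ hz hzhat.

Lemma nearly_viableP : nearly_viable P F T K z <->
  forall t xi, 0 <= t -> t < T -> KK t xi -> forall e, 0 < e -> exists2 u, prog u &
    forall s, t <= s -> s <= T -> exists2 th, KK s th & rd (z t xi u s) th <= e.
Proof.
have dE t xi u s th : 0 <= t -> KK t xi -> prog u -> t <= s -> KK s th ->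
    Lnorm P 2%:E (fun w => (Num.sqrt (sqnorm (z t xi u s w - th w)))%:E) = (rd (z t xi u s) th)%:E.
  move=> t0 Kx pu ts Kth; have s0 := le_trans t0 ts.
  exact: (rd_Lnorm oO1 bO1 oO2 bO2 (Lmsq s0 (zL t0 (L2_sub Kx) pu ts)) (Lmsq s0 Kth)).
split=> h t xi t0 tT Kx.
  move=> e e0; have /ereal_inf_lt[_ [u pu <-] hu] : (ereal_inf
      [set ereal_sup [set distL2 P (z t xi u s) (KK s) | s in `[t, T]] | u in prog] < e%:E)%E.
    by rewrite (h t xi t0 tT Kx) lte_fin.
  exists u => // s ts sT.
  have : (distL2 P (z t xi u s) (KK s) < e%:E)%E.
    apply: le_lt_trans hu; apply: ereal_sup_ubound; exists s => //.
    by rewrite /= in_itv/= ts.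
  move=> /ereal_inf_lt[_ [th Kth <-]]; rewrite (dE t xi u s th)// lte_fin => /ltW he.
  by exists th.
apply/eqP; rewrite eq_le; apply/andP; split; last first.
  apply: le_ereal_inf_tmp => _ [u pu <-]; apply: le_ereal_sup_tmp.
  exists (distL2 P (z t xi u t) (KK t)); first by exists t => //; rewrite /= in_itv/= lexx ltW.
  apply: le_ereal_inf_tmp => _ [th Kth <-]; rewrite (dE t xi u t th)// lee_fin.
  exact: rd_ge0.
apply/lee_addgt0Pr => e e0; rewrite add0e; have [u pu hu] := h t xi t0 tT Kx e e0.
apply: (@le_trans _ _ (ereal_sup [set distL2 P (z t xi u s) (KK s) | s in `[t, T]])).
  by apply: ereal_inf_lbound; exists u.
apply: ge_ereal_sup => _ [s + <-]; rewrite /= in_itv/= => /andP[ts sT].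
have [th Kth hth] := hu s ts sT.
apply: (@le_trans _ _ (rd (z t xi u s) th)%:E); last by rewrite lee_fin.
by apply: ereal_inf_lbound; exists th => //; exact: dE.
Qed.

Lemma quasi_tangentP t xi : 0 <= t -> KK t xi -> quasi_tangent_at P F K zhat t xi <->
  forall e h0, 0 < e -> 0 < h0 -> exists h u th, [/\ 0 < h, h < h0, prog u, KK (t + h) th &
    rd (zhat t xi u (t + h)) th <= e * h].
Proof.
move=> t0 Kx.
have dE h u th : 0 < h -> prog u -> KK (t + h) th ->
    ('E_P[fun w => sqnorm (zhat t xi u (t + h)%R w - th w)%R] = ((rd (zhat t xi u (t + h)) th) ^+ 2)%:E)%E.
  move=> hp pu Kth; have th' : t <= t + h by rewrite lerDl ltW.
  have s0 := le_trans t0 th'.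
  exact: (rd_sqnorm oO1 bO1 oO2 bO2 (Lmsq s0 (zhL t0 (L2_sub Kx) pu th')) (Lmsq s0 Kth)).
rewrite /quasi_tangent_at limf_einfE; set Q := (fun eps : R => ereal_inf _).
have Q0 h : (0 <= Q h)%E.
  apply: le_ereal_inf_tmp => _ [u pu [th Kth <-]]; apply: mule_ge0.
    by rewrite lee_fin invr_ge0 sqr_ge0.
  by rewrite unlock; apply: integral_ge0 => w _; rewrite lee_fin sqnorm_ge0.
split=> [hQ e h0 e0 h00|h].
  have : (ereal_inf (Q @` `]0%R, h0[) < (e ^+ 2)%:E)%E.
    apply: (@le_lt_trans _ _ 0%E); last by rewrite lte_fin exprn_gt0.
    rewrite -hQ; apply: ereal_sup_ubound; exists `]0, h0[%classic => //.
    exists h0 => //= y /=; rewrite sub0r normrN => yh y0; rewrite in_itv/= y0/=.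
    exact: le_lt_trans (ler_norm _) yh.
  move=> /ereal_inf_lt[_ [h + <-]]; rewrite /= in_itv/= => /andP[hp hh].
  move=> /ereal_inf_lt[_ [u pu [th Kth <-]]]; rewrite dE// -EFinM lte_fin => hlt.
  exists h, u, th; split=> //; rewrite -(@ler_pXn2r _ 2)// ?nnegrE ?rd_ge0//; last first.
    by rewrite mulr_ge0// ltW.
  by move: hlt; rewrite exprMn ltr_pdivrMl ?exprn_gt0// mulrC => /ltW.
apply/eqP; rewrite eq_le; apply/andP; split; last first.
  apply: le_ereal_sup_tmp; exists (ereal_inf (Q @` setT)); first by exists setT => //; exact: filterT.
  by apply: le_ereal_inf_tmp => _ [h' _ <-].
apply: ge_ereal_sup => _ [A hA <-]; apply/lee_addgt0Pr => e e0; rewrite add0e.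
have [h0 /= h00 hh0] : exists2 h0 : R, 0 < h0 & forall h, 0 < h -> h < h0 -> A h.
  move: hA => [d /= d0 hd]; exists d => // h' hp hd'; apply: hd => //=.
  by rewrite sub0r normrN ger0_norm// ltW.
have se0 : 0 < Num.sqrt e by rewrite sqrtr_gt0.
have [h' [u [th [hp hh pu Kth hrd]]]] := h _ _ se0 h00.
apply: (@le_trans _ _ (Q h')); first by apply: ereal_inf_lbound; exists h' => //; exact: hh0.
apply: (@le_trans _ _ (((h' ^+ 2)^-1)%R%:E * 'E_P[fun w => sqnorm (zhat t xi u (t + h')%R w - th w)%R])%E).
  by apply: ereal_inf_lbound; exists u => //; exists th.
rewrite dE// -EFinM lee_fin ler_pdivrMl ?exprn_gt0// -[e]sqr_sqrtr ?(ltW e0)// -exprMn.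
by rewrite ler_pXn2r ?nnegrE ?rd_ge0 ?mulr_ge0 ?(ltW hp) ?(ltW se0)// mulrC.
Qed.

Let rdK t s X Y : rd (rfr t s X) Y = rd X (rfr s t Y).
Proof.
by rewrite -[in LHS](rframes_id hG1 hG2 W s Y) -[in LHS](rframesK hG1 hG2 W s t s) (rd_rframes hG1 hG2).
Qed.

(** Near viability gives controls that end up within [o(h)] of [K] at each short
    time, and the scheme is [o(h)]-close to the system. *)
Lemma quasi_tangent_of_viable : nearly_viable P F T K z ->
  forall t xi, 0 <= t -> t < T -> KK t xi -> quasi_tangent_at P F K zhat t xi.
Proof.
move=> /nearly_viableP hV t xi t0 tT Kx; apply/(quasi_tangentP t0 Kx) => e h0 e0 h00.
have Lx := L2_sub Kx; have e2 : 0 < e / 2 by rewrite divr_gt0.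
have [h1 [h10 hT] hloc] := local t0 tT Lx e2.
pose h := Num.min h0 h1 / 2; have m0 : 0 < Num.min h0 h1 by rewrite lt_min h00.
have hp : 0 < h by rewrite divr_gt0.
have hm : h < Num.min h0 h1 by rewrite ltr_pdivrMr// ltr_pMr// ltr1n.
move: (hm); rewrite lt_min => /andP[hh0 hh1].
have [u pu hu] := hV t xi t0 tT Kx (e / 2 * h) (mulr_gt0 e2 hp).
have th : t <= t + h by rewrite lerDl ltW.
have hT' : t + h <= T by apply: le_trans hT; rewrite lerD2l ltW.
have [y Ky hy] := hu (t + h) th hT'; have [hl _] := hloc u pu.
exists h, u, y; split=> //; have s0 := le_trans t0 th.
have m1 := Lmsq s0 (zL t0 Lx pu th); have m2 := Lmsq s0 (zhL t0 Lx pu th).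
have hz' : rd (zhat t xi u (t + h)) (z t xi u (t + h)) <= e / 2 * h by rewrite rdC; exact: (hl h hp (ltW hh1)).
have -> : e * h = e / 2 * h + e / 2 * h by rewrite -mulrDl -splitr.
exact: le_trans (rdtri m2 m1 (Lmsq s0 Ky)) (lerD hz' hy).
Qed.

(** Quasi-tangency and [scheme_local] give the local steps of [near_viability], for
    the flow in the moving frame; the invariance of the [K]-valued elements carries
    the conclusion back to the fixed frame. *)
Lemma viable_of_quasi_tangent :
  (forall t xi, 0 <= t -> t < T -> KK t xi -> quasi_tangent_at P F K zhat t xi) ->
  nearly_viable P F T K z.
Proof.
move=> hQ; apply/nearly_viableP => t xi t0 tT Kx e e0.
have [C C0 hC] := @flow_lipschitz _ _ _ _ oO1 bO1 oO2 bO2 _ _ _ _ hb1 hb2 hG1 hG2 _ _ hbeta1 hbeta2 _ _ _ hf1 hf2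
  _ _ _ _ _ hF hW _ hz T.
have fL := @flow_L2 _ _ _ _ oO1 bO1 oO2 bO2 _ _ _ _ hb1 hb2 hG1 hG2 _ _ hbeta1 hbeta2 _ _ _ hf1 hf2
  _ _ _ _ _ hF hW _ hz.
have f0 := @flow0 _ _ _ _ oO1 bO1 oO2 bO2 _ _ _ _ hb1 hb2 hG1 hG2 _ _ hbeta1 hbeta2 _ _ _ hf1 hf2
  _ _ _ _ _ hF hW _ hz.
have ff := @flow_flow _ _ _ _ oO1 bO1 oO2 bO2 _ _ _ _ hb1 hb2 hG1 hG2 _ _ hbeta1 hbeta2 _ _ _ hf1 hf2
  _ _ _ _ _ hF hW _ hz.
have fc := @flow_continuous _ _ _ _ oO1 bO1 oO2 bO2 _ _ _ _ hb1 hb2 hG1 hG2 _ _ hbeta1 hbeta2 _ _ _ hf1 hf2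
  _ _ _ _ _ hF hW _ hz.
have T0 : 0 < 1 + (T - t) by rewrite ltr_pwDl// subr_ge0 ltW.
have eT : 0 < e / (1 + (T - t)) by rewrite divr_gt0.
have step t1 x e1 : 0 <= t1 -> t1 < T -> KK t1 x -> 0 < e1 -> exists h v y,
     [/\ 0 < h, t1 + h <= T, prog v, KK (t1 + h) y &
         rd (flow t1 x v (t1 + h)) y <= e1 * h /\
         forall s, t1 <= s -> s <= t1 + h -> rd (flow t1 x v s) x <= e1].
  move=> t10 t1T Kx1 e10; have Lx := L2_sub Kx1; have e2 : 0 < e1 / 2 by rewrite divr_gt0.
  have [h1 [h10 hT] hloc] := local t10 t1T Lx e2.
  have [h [u [th [hp hh pu Kth hrd]]]] := (quasi_tangentP t10 Kx1).1 (hQ t1 x t10 t1T Kx1) _ _ e2 h10.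
  have [hl hm] := hloc u pu.
  have t1h : t1 <= t1 + h by rewrite lerDl ltW.
  have hT' : t1 + h <= T by apply: le_trans hT; rewrite lerD2l ltW.
  have [_ Ky] := hatK_rframes hG1 hG2 (hK t10 t1h hT') Kth.
  exists h, u, (rfr t1 (t1 + h) th); split=> //; split.
    have s0 := le_trans t10 t1h.
    rewrite /flow (rd_rframes hG1 hG2).
    have m1 := Lmsq s0 (zL t10 Lx pu t1h); have m2 := Lmsq s0 (zhL t10 Lx pu t1h).
    have -> : e1 * h = e1 / 2 * h + e1 / 2 * h by rewrite -mulrDl -splitr.
    exact: le_trans (rdtri m1 m2 (Lmsq s0 Kth)) (lerD (hl h hp (ltW hh)) hrd).
  move=> s ts sh; apply: (@le_trans _ _ (e1 / 2)).
    by apply: hm => //; apply: (le_trans sh); rewrite lerD2l ltW.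
  by rewrite ler_pdivrMr// ler_peMr ?(ltW e10)// ler1n.
have T00 : 0 <= T := le_trans t0 (ltW tT).
have tri x y y' : L T x -> L T y -> L T y' -> rd x y' <= rd x y + rd y y'.
  by move=> h1 h2 h3; exact: (rdtri (Lmsq T00 h1) (Lmsq T00 h2) (Lmsq T00 h3)).
have lmono s s' : 0 <= s -> s <= s' -> L s `<=` L s' by exact: L2_mono.
have kmono s s' : 0 <= s -> s <= s' -> KK s `<=` KK s' by exact: L2_mono.
have kl s : KK s `<=` L s by exact: L2_sub.
have p_in t1 x u s : 0 <= t1 -> t1 <= s -> s <= T -> L t1 x -> prog u -> L s (flow t1 x u s).
  by move=> t10 ts _ Lx pu; exact: fL.
have p0 t1 x u : 0 <= t1 -> t1 <= T -> L t1 x -> prog u -> rd (flow t1 x u t1) x = 0.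
  by move=> t10 _; exact: f0.
have plip t1 x y u s : 0 <= t1 -> t1 <= s -> s <= T -> L t1 x -> L t1 y -> prog u ->
     rd (flow t1 x u s) (flow t1 y u s) <= C * rd x y.
  by move=> t10 ts sT Lx Ly pu; exact: hC.
have pflow t1 x u s s' : 0 <= t1 -> t1 <= s -> s <= s' -> s' <= T -> L t1 x -> prog u ->
     rd (flow t1 x u s') (flow s (flow t1 x u s) u s') = 0.
  by move=> t10 ts ss _; exact: ff.
have pcausal t1 x u u' s : 0 <= t1 -> t1 <= s -> s <= T -> L t1 x -> prog u -> prog u' ->
     (forall r, t1 <= r -> r < s -> u r = u' r) -> rd (flow t1 x u s) (flow t1 x u' s) = 0.
  move=> t10 ts sT Lx pu pu' uu; apply/eqP; rewrite eq_le rd_ge0 andbT.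
  by apply: (le_trans (hC _ _ _ _ _ _ t10 ts sT Lx Lx pu pu' uu)); rewrite rdxx mulr0.
have kclosed s x : 0 <= s -> s <= T -> L s x ->
     (forall e, 0 < e -> exists2 y, KK s y & rd x y <= e) -> KK s x.
  by move=> s0 _; exact: L2_closed.
have compl s (x : nat -> Omega -> H) (r : nat -> R) : 0 <= s -> s <= T -> (forall k, L s (x k)) ->
     (forall k l, (k <= l)%N -> rd (x k) (x l) <= r k) -> r k @[k --> \oo] --> 0 ->
     exists2 y, L s y & forall k, rd (x k) y <= r k.
  by move=> s0 _; exact: L2_complete_random.
have pcont t1 x u (s : nat -> R) s0 : 0 <= t1 -> (forall k, t1 <= s k) -> (forall k, s k <= T) ->
     t1 <= s0 -> s0 <= T -> s k @[k --> \oo] --> s0 -> L t1 x -> prog u ->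
     rd (flow t1 x u (s k)) (flow t1 x u s0) @[k --> \oo] --> 0.
  exact: fc.
have pcat u v t1 : prog u -> prog v -> prog (fun r => if r < t1 then u r else v r).
  exact: (progressive_cat hF).
have plim (u : nat -> R -> Omega -> U) (t1 : nat -> R) : (forall k, prog (u k)) ->
     (forall k, t1 k <= t1 k.+1) -> (forall k r, r < t1 k -> u k.+1 r = u k r) ->
     exists2 v, prog v & forall k r, r < t1 k -> v r = u k r.
  exact: (progressive_lim hF).
have [u pu hu] := @near_viability R (Omega -> H) (Omega -> U) T L KK rd prog flow C
  (rdxx P) (rdC P) tri lmono kmono kl p_in p0 C0 plip pflow pcausal pcont kclosed compl
  pcat plim step t (e / (1 + (T - t))) t0 eT xi tT Kx.
exists u => // s ts sT; have [y Ky hy] := hu s ts sT.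
have [Kth _] := hatK_rframes hG1 hG2 (hK t0 ts sT) Ky.
exists (rfr s t y) => //; rewrite -rdK; apply: (le_trans hy).
by rewrite divfK// gt_eqF.
Qed.

End equivalence.

Theorem theorem3 (R : realType) (d : nat) (O1 O2 : set 'rV[R]_d)
    (b1 b2 : 'rV[R]_d -> 'rV[R]_d)
    (G1 : R -> Hm1 O1 -> Hm1 O1) (G2 : R -> Hm1 O2 -> Hm1 O2)
    (dO : measure_display) (Omega : measurableType dO)
    (P : probability Omega R) (F : R -> set (set Omega)) (W : R -> Omega -> R)
    (U : metricType R) (beta1 beta2 : R -> R)
    (f1 : Hm1 O1 -> Hm1 O2 -> U -> Hm1 O1)
    (f2 : Hm1 O1 -> Hm1 O2 -> U -> Hm1 O2)
    (z zhat : R -> (Omega -> Hm1 O1 * Hm1 O2) -> (R -> Omega -> U) ->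
              R -> Omega -> Hm1 O1 * Hm1 O2)
    (T : R) (K : set (Hm1 O1 * Hm1 O2))
    (hd : (2 <= d)%N)
    (hO1 : bounded_smooth_domain O1) (hO2 : bounded_smooth_domain O2)
    (hb1 : admissible_field O1 b1) (hb2 : admissible_field O2 b2)
    (hG1 : is_transport_group b1 G1) (hG2 : is_transport_group b2 G2)
    (hF : usual_filtration P F) (hW : brownian P F W)
    (hU : compact [set: U])
    (hbeta1 : admissible_beta beta1) (hbeta2 : admissible_beta beta2)
    (hf1 : admissible_f f1) (hf2 : admissible_f f2)
    (hz : forall (t : R) xi u, 0 <= t -> L2Omega P F [set: Hm1 O1 * Hm1 O2] t xi ->
       progressive F u ->
       solves_system P F W G1 G2 beta1 beta2 f1 f2 t xi u (z t xi u))
    (hzhat : forall (t : R) xi u, 0 <= t ->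
       L2Omega P F [set: Hm1 O1 * Hm1 O2] t xi -> progressive F u ->
       solves_scheme P F W G1 G2 beta1 beta2 f1 f2 t xi u (zhat t xi u))
    (hT : 0 < T) (hKclosed : closed K)
    (hK : forall t s : R, 0 <= t -> t <= s -> s <= T ->
       hatK P F W G1 G2 K t s = L2Omega P F K s) :
  nearly_viable P F T K z <->
  (forall (t : R) xi, 0 <= t -> t < T -> L2Omega P F K t xi ->
     quasi_tangent_at P F K zhat t xi).
Proof.
case: d O1 O2 b1 b2 G1 G2 f1 f2 z zhat K hd hO1 hO2 hb1 hb2 hG1 hG2 hf1 hf2 hz hzhat hKclosed hK
  => [|n] // O1 O2 b1 b2 G1 G2 f1 f2 z zhat K _ [oO1 _ _ bO1 _] [oO2 _ _ bO2 _] hb1 hb2 hG1 hG2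
  hf1 hf2 hz hzhat hKclosed hK.
split; first exact: (@quasi_tangent_of_viable R n O1 O2 oO1 bO1 oO2 bO2 b1 b2 G1 G2 hb1 hb2 hG1 hG2
  beta1 beta2 hbeta1 hbeta2 U f1 f2 hf1 hf2 dO Omega P F W hF hW z zhat hz hzhat T K).
exact: (@viable_of_quasi_tangent R n O1 O2 oO1 bO1 oO2 bO2 b1 b2 G1 G2 hb1 hb2 hG1 hG2
  beta1 beta2 hbeta1 hbeta2 U f1 f2 hf1 hf2 dO Omega P F W hF hW z zhat hz hzhat T K hKclosed hK).
Qed.
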